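(* Consider the single index model and the regularized M-estimator $\hat\beta$ defined in the context. Let $\delta>0$, $\kappa\ge1$, $\tau>0$ be constants independent of $n,p$. Assume: (a) $\frac{1}{2\delta}\le \frac pn\le\frac1\delta$; the rows of $X$ are iid $N(0,\Sigma)$ with $\|\Sigma\|_{op}\|\Sigma^{-1}\|_{op}\le\kappa$; $w^T\Sigma w=1$; $g$ is convex and, for every $y_0\in\mathcal Y$, $\ell_{y_0}$ is convex and continuously differentiable with $\ell_{y_0}'$ 1-Lipschitz. (b) $g(0)\le g(b)$ for all $b\in\mathbb R^p$; $(b-\tilde b)^T(d-\tilde d)\ge\tau\|\Sigma^{1/2}(b-\tilde b)\|^2$ for all $b,\tilde b\in\mathbb R^p$, $d\in\partial g(b)$, $\tilde d\in\partial g(\tilde b)$; and $\mathbb P(\ell_{y_i}'(0)=0)=0$. Define $a_*=w^T\Sigma\hat\beta$, $\sigma_*^2=\|\Sigma^{1/2}\hat\beta\|^2-a_*^2$ (with $\sigma_*\ge0$) and $\gamma_*=\mathrm{Tr}[\Sigma\hat A]$. Then $$\max_{i=1,\dots,n}\mathbb E\Bigl[\frac1{\hat r^2}\Bigl|x_i^T\hat\beta-\mathrm{prox}\bigl[\gamma_*\ell_{y_i}(\cdot)\bigr]\bigl(a_*U_i+\sigma_*Z_i\bigr)\Bigr|^2\Bigr]\le\frac{C(\delta,\tau)}n,$$ where $U_i=x_i^Tw$ and, for each $i$, $Z_i$ is a suitable random variable such that $U_i$ and $Z_i$ are independent $N(0,1)$ random variables.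
   Context: Model: $(x_i,\xi_i,y_i)_{i=1,\dots,n}$ are iid, $x_i\sim N(0,\Sigma)$ in $\mathbb R^p$, $\xi_i$ is a latent variable independent of $x_i$, and $y_i=F(x_i^Tw,\xi_i)$ for an unknown deterministic function $F:\mathbb R^2\to\mathbb R$ and an unknown nonrandom index $w\in\mathbb R^p$ with $w^T\Sigma w=1$. (In the claim, $U_i$ denotes $x_i^Tw$, not the latent variable.) $\mathcal Y\subset\mathbb R$ is a set with $\mathbb P(y_i\in\mathcal Y)=1$. $X\in\mathbb R^{n\times p}$ has rows $x_i^T$ and entries $x_{ij}$; $y=(y_1,\dots,y_n)$. Estimator: for loss functions $\ell_{y_0}:\mathbb R\to\mathbb R$ ($y_0\in\mathcal Y$) and penalty $g:\mathbb R^p\to\mathbb R$, $\hat\beta=\hat\beta(y,X)=\mathrm{argmin}_{b\in\mathbb R^p}\frac1n\sum_{i=1}^n\ell_{y_i}(x_i^Tb)+g(b)$. Derivatives $\ell_{y_0}',\ell_{y_0}''$ are in the real argument (where they exist). $\partial g(b)$ is the subdifferential. For convex $f:\mathbb R\to\mathbb R$, $\mathrm{prox}[f](u)=\mathrm{argmin}_{v\in\mathbb R}(u-v)^2/2+f(v)$. Notation: $\hat\psi\in\mathbb R^n$ has components $\hat\psi_i=-\ell_{y_i}'(x_i^T\hat\beta)$; $\hat r=(\frac1n\|\hat\psi\|^2)^{1/2}$; $D=\mathrm{diag}(\ell_{y_i}''(x_i^T\hat\beta))_{i\le n}$. Under (a)-(b), for fixed $y$ the map $X\mapsto\hat\beta(y,X)$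 is differentiable almost everywhere, and $\hat A\in\mathbb R^{p\times p}$ denotes a matrix such that $\frac{\partial}{\partial x_{ij}}\hat\beta(y,X)=\hat A(e_j\hat\psi_i-X^TDe_i\hat\beta_j)$ for all $i,j$, $\|\Sigma^{1/2}\hat A\Sigma^{1/2}\|_{op}\le(n\tau)^{-1}$, and, with $V=D-DX\hat AX^TD$, $\hat{\mathsf{df}}=\mathrm{Tr}[X\hat AX^TD]$ and $\hat c=\frac1{n\tau}\|D^{1/2}X\Sigma^{-1/2}\|_{op}^2$: if $DX\hat\beta\ne\hat\psi$, then $0\le\hat{\mathsf{df}}\le n$ and $\mathrm{Tr}[D]/(1+\hat c)\le\mathrm{Tr}[V]\le\mathrm{Tr}[D]$; if $DX\hat\beta=\hat\psi$, then $-\hat c\le\hat{\mathsf{df}}\le n+\hat c$ and $-4\hat c+\mathrm{Tr}[D]/(1+\hat c)\le\mathrm{Tr}[V]\le\mathrm{Tr}[D]+4\hat c$ (such a matrix exists). $C(\delta,\tau)$ denotes a constant depending only on $(\delta,\tau)$. *)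

(* Defs.v *)
From HB Require Import structures.
From mathcomp Require Import all_boot all_order all_algebra.
From mathcomp Require Import all_classical all_reals all_analysis.

Set Implicit Arguments.
Unset Strict Implicit.
Unset Printing Implicit Defensive.

Import Order.TTheory GRing.Theory Num.Theory.
Import numFieldNormedType.Exports.

Local Open Scope classical_set_scope.
Local Open Scope ring_scope.

(** * Euclidean linear algebra

    The canonical norm of matrices in the library is the entrywise maximum, so
    the Euclidean and spectral norms are introduced separately. *)

Section LinearAlgebra.
Context {R : realType}.

Definition dotv (k : nat) (u v : 'cV[R]_k) : R := (u^T *m v) 0 0.

Definition enorm (k : nat) (u : 'cV[R]_k) : R := Num.sqrt (dotv u u).

Definition opnorm (m k : nat) (A : 'M[R]_(m, k)) : R :=
  sup [set enorm (A *m u) | u in [set u : 'cV[R]_k | enorm u <= 1]].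

Definition psdmx (k : nat) (A : 'M[R]_k) : Prop :=
  A^T = A /\ forall u : 'cV[R]_k, 0 <= dotv u (A *m u).

(** The positive semidefinite square root [A^(1/2)] of a positive semidefinite
    matrix [A] (unspecified for other matrices). *)
Definition sqrtmx (k : nat) (A : 'M[R]_k) : 'M[R]_k :=
  get [set S : 'M[R]_k | psdmx S /\ S *m S = A].

Definition col_of_tuple (k : nat) (v : k.-tuple R) : 'cV[R]_k :=
  \col_j tnth v j.

End LinearAlgebra.

(** * Convex analysis *)

Section Convexity.
Context {R : realType}.

Definition convexf (V : lmodType R) (f : V -> R) : Prop :=
  convex_function (E := V) setT f.

(** [argmin f] is a minimizer of [f] if there is one. *)
Definition argmin (V : pointedType) (f : V -> R) : V :=
  get [set b | forall b', f b <= f b'].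

Definition subdifferential (p : nat) (g : 'cV[R]_p -> R) (b : 'cV[R]_p) :
    set 'cV[R]_p :=
  [set d | forall b', g b + dotv d (b' - b) <= g b'].

(** [prox f u] is only meaningful for convex [f]; the conventional value for
    nonconvex [f] is [u], the value of the proximal operator of [0]. *)
Definition prox (f : R -> R) (u : R) : R :=
  if `[< convexf (V := R^o) f >]
  then argmin (fun v : R => (u - v) ^+ 2 / 2 + f v)
  else u.

End Convexity.

(** * Probability *)

Section Probability.
Context {d : measure_display} {T : measurableType d} {R : realType}.
Variable P : probability T R.

Definition has_law (d' : measure_display) (T' : measurableType d')
    (X : T -> T') (mu : set T' -> \bar R) : Prop :=
  forall A, measurable A -> P (X @^-1` A) = mu A.

(** The second argument of [normal_prob] is the standard deviation, and
    [normal_prob m 0] is not the Dirac mass at [m]. *)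
Definition centered_normal (v : R) : set R -> \bar R :=
  if v == 0 then \d_(0 : R) else normal_prob 0 (Num.sqrt v).

(** [x] has law [N(0, Sigma)]: every linear form [a^T x] has law
    [N(0, a^T Sigma a)]. *)
Definition gaussian_vector (p : nat) (x : T -> p.-tuple R)
    (Sigma : 'M[R]_p) : Prop :=
  forall a : 'cV[R]_p,
    has_law (fun t => dotv a (col_of_tuple (x t)))
      (centered_normal (dotv a (Sigma *m a))).

Definition independent2 (d1 d2 : measure_display) (T1 : measurableType d1)
    (T2 : measurableType d2) (X : T -> T1) (Y : T -> T2) : Prop :=
  forall A B, measurable A -> measurable B ->
    P (X @^-1` A `&` Y @^-1` B) = (P (X @^-1` A) * P (Y @^-1` B))%E.

(** The product rule for subfamilies follows by taking some [A i] to be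
    [setT]. *)
Definition mutually_independent (I : finType) (d' : measure_display)
    (T' : measurableType d') (X : I -> T -> T') : Prop :=
  forall A : I -> set T', (forall i, measurable (A i)) ->
    P (\bigcap_i (X i @^-1` A i)) = (\prod_i P (X i @^-1` A i))%E.

Definition iid (I : finType) (d' : measure_display)
    (T' : measurableType d') (X : I -> T -> T') : Prop :=
  mutually_independent X /\
  forall i j A, measurable A -> P (X i @^-1` A) = P (X j @^-1` A).

End Probability.

(** * The single index model and the regularized M-estimator *)

Section Model.
Context {d : measure_display} {T : measurableType d} {R : realType}.
Variables (P : probability T R) (n p : nat).

Definition single_index_model (Sigma : 'M[R]_p) (w : 'cV[R]_p)
    (F : R * R -> R) (x : 'I_n -> {RV P >-> p.-tuple R})
    (xi : 'I_n -> {RV P >-> R}) (y : 'I_n -> T -> R) : Prop :=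
  [/\ iid P (fun i t => (x i t, xi i t, y i t)),
      forall i, gaussian_vector P (x i) Sigma,
      forall i, independent2 P (x i) (xi i),
      measurable_fun setT F &
      forall i t, y i t = F (dotv (col_of_tuple (x i t)) w, xi i t)].

Definition design (x : 'I_n -> {RV P >-> p.-tuple R}) (t : T) : 'M[R]_(n, p) :=
  \matrix_(i, j) tnth (x i t) j.

End Model.

Section Estimator.
Context {R : realType} {n p : nat}.

(** [loss y0] is the loss function attached to the response [y0]. *)
Variables (loss : R -> R -> R) (g : 'cV[R]_p -> R).

Definition objective (y : 'I_n -> R) (X : 'M[R]_(n, p)) (b : 'cV[R]_p) : R :=
  n%:R^-1 * \sum_(i < n) loss (y i) ((X *m b) i 0) + g b.

Definition bhat (y : 'I_n -> R) (X : 'M[R]_(n, p)) : 'cV[R]_p :=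
  argmin (objective y X).

Definition psihat (y : 'I_n -> R) (X : 'M[R]_(n, p)) : 'cV[R]_n :=
  \col_i - derive1 (loss (y i)) ((X *m bhat y X) i 0).

Definition rhat (y : 'I_n -> R) (X : 'M[R]_(n, p)) : R :=
  Num.sqrt (n%:R^-1 * enorm (psihat y X) ^+ 2).

(** [derive1] is total: a diagonal entry where the second derivative of the
    loss does not exist takes the default value of the library. *)
Definition Dmx (y : 'I_n -> R) (X : 'M[R]_(n, p)) : 'M[R]_n :=
  diag_mx (\row_i derive1 (derive1 (loss (y i))) ((X *m bhat y X) i 0)).

Definition chat (Sigma : 'M[R]_p) (tau : R) (y : 'I_n -> R)
    (X : 'M[R]_(n, p)) : R :=
  (n%:R * tau)^-1
  * opnorm (sqrtmx (Dmx y X) *m X *m invmx (sqrtmx Sigma)) ^+ 2.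

Definition dfhat (y : 'I_n -> R) (X : 'M[R]_(n, p)) (A : 'M[R]_p) : R :=
  \tr (X *m A *m X^T *m Dmx y X).

Definition Vmx (y : 'I_n -> R) (X : 'M[R]_(n, p)) (A : 'M[R]_p) : 'M[R]_n :=
  Dmx y X - Dmx y X *m X *m A *m X^T *m Dmx y X.

(** The properties characterizing the matrices [A] that may be taken as
    [Ahat] at [(y, X)]. *)
Definition is_Ahat (Sigma : 'M[R]_p) (tau : R) (y : 'I_n -> R)
    (X : 'M[R]_(n, p)) (A : 'M[R]_p) : Prop :=
  let b := bhat y X in
  let psi := psihat y X in
  let D := Dmx y X in
  let c := chat Sigma tau y X in
  [/\ differentiable (bhat y) X,
      forall (i : 'I_n) (j : 'I_p),
        'D_(delta_mx i j) (bhat y) X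
        = A *m (psi i 0 *: delta_mx j 0 - b j 0 *: (X^T *m D *m delta_mx i 0)),
      opnorm (sqrtmx Sigma *m A *m sqrtmx Sigma) <= (n%:R * tau)^-1,
      D *m X *m b <> psi ->
        0 <= dfhat y X A <= n%:R /\
        \tr D / (1 + c) <= \tr (Vmx y X A) <= \tr D &
      D *m X *m b = psi ->
        - c <= dfhat y X A <= n%:R + c /\
        - 4 * c + \tr D / (1 + c) <= \tr (Vmx y X A) <= \tr D + 4 * c].

End Estimator.

(** * Assumptions on the loss and on the penalty *)

Section Assumptions.
Context {R : realType}.

(** The last clause is the measurability in [y0] without which the estimator is
    not a random vector. *)
Definition regular_loss (Y : set R) (loss : R -> R -> R) : Prop :=
  (forall y0, Y y0 ->
    [/\ convexf (V := R^o) (loss y0),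
        forall u, derivable (loss y0) u 1,
        continuous (derive1 (loss y0)) &
        forall u v, `|derive1 (loss y0) u - derive1 (loss y0) v| <= `|u - v| ]) /\
  forall u, measurable_fun Y (fun y0 => loss y0 u).

Definition strongly_monotone_subdifferential (p : nat) (Sigma : 'M[R]_p)
    (tau : R) (g : 'cV[R]_p -> R) : Prop :=
  forall b b' dd dd', subdifferential g b dd -> subdifferential g b' dd' ->
    tau * enorm (sqrtmx Sigma *m (b - b')) ^+ 2 <= dotv (b - b') (dd - dd').

End Assumptions.

(* Main.v *)
(** Whitening makes the rows of the design independent standard Gaussian vectors
    whose first coordinate is the index. For a fixed row, let [z] be its other
    coordinates, [B] the whitened estimator, [B0] the estimator computed with [z]
    erased, and [tail] the projection forgetting the first coordinate. Then
    [z . B0 = |tail B0| Z] with [Z] standard Gaussian and independent of the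
    index (when [tail B0] vanishes, an extra Gaussian variable is used). The
    second order Stein formula for the vector field
    [rho (1 + |z|^2 / n) (B - B0)], where [rho] is a function of the erased
    design that stands for [1 / r], shows that [z . (B - B0)] is close to the
    divergence of [B], which is [gamma psi_i] up to negligible terms. Hence
    [x_i^T beta - gamma psi_i] is close to [a U_i + sigma Z_i], and the proximal
    operator is nonexpansive.

    Stein's formula is used in a discrete form, in which difference quotients
    along coordinate shifts replace the derivatives and the Cameron-Martin
    formula replaces integration by parts; so only a monotonicity inequality
    comparing the estimators of two designs is needed, and differentiability
    enters through Fatou's lemma alone. Ratios such as [psi_i^2 / r^2] are
    bounded in expectation by exchangeability of the rows, even when multiplied
    by moments of the operator norm: these are dominated by a weight, symmetric
    in the rows, which is a sum over lattice points of exponentials of bilinear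
    forms. *)

Require Import Defs.
From HB Require Import structures.
From mathcomp Require Import all_boot all_order all_algebra.
From mathcomp Require Import all_classical all_reals all_analysis.
From mathcomp Require Import measurable_realfun ring lra zify perm.

Set Implicit Arguments.
Unset Strict Implicit.
Unset Printing Implicit Defensive.

Import Order.TTheory GRing.Theory Num.Theory.
Import numFieldNormedType.Exports.

Local Open Scope classical_set_scope.
Local Open Scope ring_scope.

(** * Euclidean and spectral norms *)

Section Euclid.
Context {R : realType}.
Implicit Types k m : nat.

(** The obstacle is the factor [1 / r ^ 2], whose moments are not controlled: every quantity has to
    be compared with the residual vector before expectations are taken. Since [rho] ignores the
    erased entries, Stein's formula never differentiates the normalization; the price is the factor
    [1 + |z|^2 / n], up to powers of which the residual norms of the two designs are comparable.
    Subtracting [B0] makes the field of order [n^(-1/2)], whence the rate. All errors are dominated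
    by a weight that depends on the erased design, times powers of [1 + |z|^2 / n] and of [1 + Z^2].
    Exchangeability only speaks of the full design. The weight is at most [(1 + |z|^2 / n)^8] times
    ratios of the full design, and it is independent of [z], so a bound on the weight divided by
    that power is a bound on the weight. The other two factors both depend on [z]; Young's
    inequality separates them. The trace [gamma] can be negative, but not below [- 1 / (n tau)], so
    the conventional value of [prox] costs an error of order [1 / n]. *)

Lemma dotvE k (u v : 'cV[R]_k) : dotv u v = \sum_i u i 0 * v i 0.
Proof. by rewrite /dotv mxE; apply: eq_bigr => i _; rewrite mxE. Qed.

Lemma dotvC k (u v : 'cV[R]_k) : dotv u v = dotv v u.
Proof. by rewrite !dotvE; apply: eq_bigr => i _; rewrite mulrC. Qed.

Lemma dotvDr k (u v w : 'cV[R]_k) : dotv u (v + w) = dotv u v + dotv u w.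
Proof. by rewrite /dotv mulmxDr mxE. Qed.

Lemma dotvDl k (u v w : 'cV[R]_k) : dotv (v + w) u = dotv v u + dotv w u.
Proof. by rewrite dotvC dotvDr !(dotvC u). Qed.

Lemma dotvNr k (u v : 'cV[R]_k) : dotv u (- v) = - dotv u v.
Proof. by rewrite /dotv mulmxN mxE. Qed.

Lemma dotvNl k (u v : 'cV[R]_k) : dotv (- u) v = - dotv u v.
Proof. by rewrite dotvC dotvNr dotvC. Qed.

Lemma dotvBr k (u v w : 'cV[R]_k) : dotv u (v - w) = dotv u v - dotv u w.
Proof. by rewrite dotvDr dotvNr. Qed.

Lemma dotvBl k (u v w : 'cV[R]_k) : dotv (v - w) u = dotv v u - dotv w u.
Proof. by rewrite dotvDl dotvNl. Qed.

Lemma dotvZr k (a : R) (u v : 'cV[R]_k) : dotv u (a *: v) = a * dotv u v.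
Proof. by rewrite /dotv -scalemxAr mxE. Qed.

Lemma dotvZl k (a : R) (u v : 'cV[R]_k) : dotv (a *: u) v = a * dotv u v.
Proof. by rewrite dotvC dotvZr dotvC. Qed.

Lemma dotv0r k (u : 'cV[R]_k) : dotv u 0 = 0.
Proof. by rewrite /dotv mulmx0 mxE. Qed.

Lemma dotv0l k (u : 'cV[R]_k) : dotv 0 u = 0.
Proof. by rewrite dotvC dotv0r. Qed.

Lemma dotv_mulmx m k (A : 'M[R]_(m, k)) u v :
  dotv u (A *m v) = dotv (A^T *m u) v.
Proof. by rewrite /dotv trmx_mul trmxK mulmxA. Qed.

Lemma dotv_mulmxl m k (A : 'M[R]_(m, k)) u v :
  dotv (A *m v) u = dotv v (A^T *m u).
Proof. by rewrite dotvC dotv_mulmx dotvC. Qed.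

Lemma dotv_ge0 k (u : 'cV[R]_k) : 0 <= dotv u u.
Proof. by rewrite dotvE sumr_ge0// => i _; rewrite -expr2 sqr_ge0. Qed.

Lemma dotv_sq k (u : 'cV[R]_k) : dotv u u = \sum_i u i 0 ^+ 2.
Proof. by rewrite dotvE; apply: eq_bigr => i _; rewrite expr2. Qed.

Lemma dotv_eq0 k (u : 'cV[R]_k) : (dotv u u == 0) = (u == 0).
Proof.
apply/eqP/eqP => [|->]; last by rewrite dotv0l.
rewrite dotv_sq => /eqP; rewrite psumr_eq0; last by move=> i _; exact: sqr_ge0.
move=> /allP h; apply/matrixP => i j; rewrite mxE ord1.
by have := h i; rewrite mem_index_enum sqrf_eq0 => /(_ erefl)/eqP.
Qed.

Lemma dotv_gt0 k (u : 'cV[R]_k) : (0 < dotv u u) = (u != 0).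
Proof. by rewrite lt_def dotv_ge0 andbT dotv_eq0. Qed.

Lemma dotv_delta k (u : 'cV[R]_k) i : dotv (delta_mx i 0) u = u i 0.
Proof.
rewrite dotvE (bigD1 i)//= big1 ?addr0 => [|j ji]; rewrite mxE.
  by rewrite !eqxx mul1r.
by rewrite (negbTE ji) mul0r.
Qed.

Lemma dotv_CS2 k (u v : 'cV[R]_k) : dotv u v ^+ 2 <= dotv u u * dotv v v.
Proof.
have [->|v0] := eqVneq v 0; first by rewrite !dotv0r expr0n mulr0.
have v1 : 0 < dotv v v by rewrite dotv_gt0.
have := dotv_ge0 (dotv v v *: u - dotv u v *: v).
rewrite dotvBl !dotvBr !dotvZl !dotvZr (dotvC v u).
rewrite [X in 0 <= X -> _](_ : _ =
   dotv v v * (dotv u u * dotv v v - dotv u v ^+ 2)); last by ring.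
by rewrite pmulr_rge0// subr_ge0.
Qed.

Lemma enorm_ge0 k (u : 'cV[R]_k) : 0 <= enorm u.
Proof. exact: sqrtr_ge0. Qed.

Lemma enorm_sq k (u : 'cV[R]_k) : enorm u ^+ 2 = dotv u u.
Proof. by rewrite sqr_sqrtr// dotv_ge0. Qed.

Lemma dotv_CS k (u v : 'cV[R]_k) : `|dotv u v| <= enorm u * enorm v.
Proof.
rewrite -(@ler_pXn2r _ 2)// ?nnegrE ?mulr_ge0 ?enorm_ge0//.
by rewrite real_normK ?num_real// exprMn !enorm_sq dotv_CS2.
Qed.

Lemma enormZ k (a : R) (u : 'cV[R]_k) : enorm (a *: u) = `|a| * enorm u.
Proof.
by rewrite /enorm dotvZl dotvZr mulrA -expr2 sqrtrM ?sqr_ge0// sqrtr_sqr.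
Qed.

Lemma enormN k (u : 'cV[R]_k) : enorm (- u) = enorm u.
Proof. by rewrite /enorm dotvNl dotvNr opprK. Qed.

Lemma enorm0 k : enorm (0 : 'cV[R]_k) = 0.
Proof. by rewrite /enorm dotv0l sqrtr0. Qed.

Lemma enorm_eq0 k (u : 'cV[R]_k) : (enorm u == 0) = (u == 0).
Proof. by rewrite -dotv_eq0 -enorm_sq sqrf_eq0. Qed.

Lemma enormD k (u v : 'cV[R]_k) : enorm (u + v) <= enorm u + enorm v.
Proof.
rewrite -(@ler_pXn2r _ 2)// ?nnegrE ?addr_ge0 ?enorm_ge0//.
rewrite enorm_sq sqrrD !enorm_sq dotvDl !dotvDr (dotvC v u).
have := dotv_CS u v; have := ler_norm (dotv u v); lra.
Qed.

Lemma enorm_delta k (i : 'I_k) : enorm (delta_mx i 0 : 'cV[R]_k) = 1.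
Proof. by rewrite /enorm dotv_delta mxE !eqxx sqrtr1. Qed.

Lemma ler_enorm k (u : 'cV[R]_k) (c : R) : 0 <= c ->
  dotv u u <= c ^+ 2 -> enorm u <= c.
Proof.
move=> c0 h; rewrite -(@ler_pXn2r _ 2)// ?nnegrE ?enorm_ge0//.
by rewrite enorm_sq.
Qed.

Lemma abs_coord_enorm k (u : 'cV[R]_k) i : `|u i 0| <= enorm u.
Proof.
by rewrite -dotv_delta (le_trans (dotv_CS _ _))// enorm_delta mul1r.
Qed.

(** The Hilbert-Schmidt norm makes the supremum defining [opnorm] finite. *)
Lemma mulmx_HS_bound m k (A : 'M[R]_(m, k)) u :
  dotv (A *m u) (A *m u) <= (\sum_i \sum_j A i j ^+ 2) * dotv u u.
Proof.
rewrite dotv_sq mulr_suml; apply: ler_sum => i _.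
have -> : (A *m u) i 0 = dotv (row i A)^T u.
  by rewrite dotvE mxE; apply: eq_bigr => j _; rewrite !mxE.
apply: le_trans (dotv_CS2 _ _) _; rewrite dotv_sq ler_wpM2r ?dotv_ge0//.
by apply: ler_sum => j _; rewrite !mxE.
Qed.

Lemma opnorm_has_sup m k (A : 'M[R]_(m, k)) :
  has_sup [set enorm (A *m u) | u in [set u : 'cV[R]_k | enorm u <= 1]].
Proof.
split; first by exists (enorm (A *m 0)), 0 => //=; rewrite enorm0.
exists (Num.sqrt (\sum_i \sum_j A i j ^+ 2)) => _ [u /= u1 <-].
rewrite ler_wsqrtr// (le_trans (mulmx_HS_bound _ _))// ler_piMr//.
  by rewrite sumr_ge0// => i _; rewrite sumr_ge0// => j _; exact: sqr_ge0.
by rewrite -enorm_sq expr_le1// enorm_ge0.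
Qed.

Lemma opnormP m k (A : 'M[R]_(m, k)) u : enorm (A *m u) <= opnorm A * enorm u.
Proof.
have [->|u0] := eqVneq u 0; first by rewrite mulmx0 !enorm0 mulr0.
have nu : 0 < enorm u by rewrite lt_def enorm_ge0 enorm_eq0 u0.
rewrite -ler_pdivrMr//.
have -> : enorm (A *m u) / enorm u = enorm (A *m ((enorm u)^-1 *: u)).
  by rewrite -scalemxAr enormZ ger0_norm ?invr_ge0 ?enorm_ge0// mulrC.
apply: (ub_le_sup (proj2 (opnorm_has_sup A))); exists ((enorm u)^-1 *: u) => //=.
by rewrite enormZ ger0_norm ?invr_ge0 ?enorm_ge0// mulVf ?gt_eqF.
Qed.

Lemma opnorm_ge0 m k (A : 'M[R]_(m, k)) : 0 <= opnorm A.
Proof.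
apply: (ub_le_sup (proj2 (opnorm_has_sup A))); exists 0 => /=.
  by rewrite enorm0.
by rewrite mulmx0 enorm0.
Qed.

Lemma opnorm_le m k (A : 'M[R]_(m, k)) c :
  (forall u, enorm u <= 1 -> enorm (A *m u) <= c) -> opnorm A <= c.
Proof.
move=> h; apply: ge_sup; first exact: (proj1 (opnorm_has_sup A)).
by move=> _ [u /= u1 <-]; exact: h.
Qed.

End Euclid.

(** * Convex functions *)

Section Convex.
Context {R : realType}.

Lemma convexfP (V : lmodType R) (f : V -> R) : convexf f <->
  forall (t : R) x y, 0 <= t <= 1 ->
    f (t *: x + (1 - t) *: y) <= t * f x + (1 - t) * f y.
Proof.
split=> [h t x y /andP[t0 t1]|h t x y _ _].
  by have := h (Itv01 t0 t1) x y (mem_set I) (mem_set I).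
apply: h; apply/andP; split; exact: ge0 || exact: le1.
Qed.

Lemma convexf_mean (V : lmodType R) (f : V -> R) m (x : nat -> V) : convexf f ->
  f (m.+1%:R^-1 *: \sum_(i < m.+1) x i) <= m.+1%:R^-1 * \sum_(i < m.+1) f (x i).
Proof.
move=> /convexfP cf; elim: m => [|m ih].
  by rewrite !big_ord1 invr1 scale1r mul1r.
rewrite !(big_ord_recr m.+1) /=.
have h1 : (1 - m.+2%:R^-1) * m.+1%:R^-1 = m.+2%:R^-1 :> R.
  have a1 : m.+1%:R != 0 :> R by rewrite pnatr_eq0.
  have : m.+2%:R != 0 :> R by rewrite pnatr_eq0.
  rewrite -[m.+2]addn1 natrD; move: (m.+1%:R : R) a1 => a a1 a2.
  by field; rewrite a1 a2.
have h01 : 0 <= (m.+2%:R^-1 : R) <= 1.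
  by rewrite invr_ge0 ler0n/= invf_le1 ?ltr0n// ler1n.
have := cf _ (x m.+1) (m.+1%:R^-1 *: \sum_(i < m.+1) x i) h01.
rewrite scalerA h1 -scalerDr addrC => /le_trans; apply.
rewrite mulrDr addrC lerD2r.
apply: le_trans (ler_wpM2l _ ih) _; last by rewrite mulrA h1.
by rewrite subr_ge0; case/andP: h01.
Qed.

Lemma coord_mxnorm m k (A : 'M[R]_(m, k)) i j : `|A i j| <= `|A|.
Proof.
rewrite [leRHS]/Num.Def.normr /= mx_normrE.
by apply/bigmax_geP; right => /=; exists (i, j).
Qed.

Lemma mxnorm_le m k (A : 'M[R]_(m, k)) c : 0 <= c ->
  (forall i j, `|A i j| <= c) -> `|A| <= c.
Proof.
move=> c0 h; rewrite [leLHS]/Num.Def.normr /= mx_normrE.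
by apply/bigmax_leP; split => // -[i j] _; exact: h.
Qed.

(** [b + u] is the mean of the points [b + u_i e_i], where [e_i] is the unit vector scaled by the
    dimension, and each of them lies on the segment from [b - e_i] to [b + e_i]. So finitely many
    values of [g] bound it near [b]. *)
Lemma convexf_locally_bounded p (g : 'cV[R]_p.+1 -> R) b : convexf g ->
  exists M : R, forall u : 'cV[R]_p.+1, (forall i, `|u i 0| <= 1) -> g (b + u) <= M.
Proof.
move=> cg; have cg' := (convexfP g).1 cg.
pose e (i : 'I_p.+1) : 'cV[R]_p.+1 := p.+1%:R *: delta_mx i 0.
exists (p.+1%:R^-1 * \sum_(i < p.+1) (`|g (b + e i)| + `|g (b - e i)|)) => u hu.
have -> : b + u = p.+1%:R^-1 *: \sum_(i < p.+1) (b + u i 0 *: e i).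
  rewrite big_split/= sumr_const card_ord scalerDr.
  rewrite -[b *+ _]scaler_nat scalerA mulVf ?pnatr_eq0// scale1r; congr (_ + _).
  apply/matrixP => i j; rewrite ord1 !mxE summxE (bigD1 i)//= big1.
    by rewrite !mxE !eqxx addr0 mulr1 mulrCA mulVf ?pnatr_eq0// mulr1.
  by move=> k ki; rewrite !mxE eq_sym (negbTE ki) !mulr0.
have := convexf_mean p (fun i => b + u (inord i) 0 *: e (inord i)) cg.
under eq_bigr do rewrite inord_val.
move=> /le_trans; apply; rewrite ler_wpM2l ?invr_ge0//.
apply: ler_sum => i _; rewrite inord_val.
have := hu i; rewrite ler_norml => /andP[h1 h2].
have h01 : 0 <= (1 + u i 0) / 2 <= 1 by apply/andP; split; lra.
have := cg' _ (b + e i) (b - e i) h01.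
have -> : (1 + u i 0) / 2 *: (b + e i) + (1 - (1 + u i 0) / 2) *: (b - e i) =
  b + u i 0 *: e i.
  by apply/matrixP => k l; rewrite !mxE; field.
move=> /le_trans; apply; apply: lerD.
  apply: le_trans (ler_norm _) _; rewrite normrM ger0_norm; last lra.
  by rewrite ler_piMl//; lra.
apply: le_trans (ler_norm _) _; rewrite normrM ger0_norm; last lra.
by rewrite ler_piMl//; lra.
Qed.

(** For [|u| <= t], convexity between [b] and [b + u / t] bounds [g (b + u)] from above, and writing
    [b] as a mean of [b + u] and [b - u / t] bounds it from below. *)
Lemma convexf_continuous p (g : 'cV[R]_p.+1 -> R) : convexf g -> continuous g.
Proof.
move=> cg b; have [M hM] := convexf_locally_bounded b cg.
have {}cg := (convexfP g).1 cg.
pose N := `|M - g b| + 1.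
have N0 : 0 < N by rewrite ltr_wpDl.
have MN : M - g b <= N by rewrite (le_trans (ler_norm _))// lerDl.
apply/(@cvgrPdist_le _ _ _ (nbhs (b : 'cV[R]_p.+1)) (nbhs_filter b)) => /= e e0.
pose t := Num.min 1 (e / N).
have t0 : 0 < t by rewrite lt_min ltr01 divr_gt0.
have t1 : t <= 1 by rewrite ge_min lexx.
have tN : t * N <= e by rewrite -ler_pdivlMr// ge_min lexx orbT.
near=> b'.
have : `|b - b'| <= t by near: b'; apply: cvgr_dist_le.
move=> hb; pose u := b' - b.
have -> : b' = b + u by rewrite addrC subrK.
have hu i : `|u i 0| <= t.
  by apply: le_trans (coord_mxnorm u i 0) _; rewrite distrC.
have hv i : `|(t^-1 *: u) i 0| <= 1.
  rewrite mxE normrM (ger0_norm (ltW _)) ?invr_gt0// ler_pdivrMl// mulr1.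
  exact: hu.
have hv' i : `|(- (t^-1 *: u)) i 0| <= 1 by rewrite mxE normrN.
have /hM gM := hv.
have /hM gM' := hv'.
have h1 : g (b + u) <= t * M + (1 - t) * g b.
  have := cg t (b + t^-1 *: u) b; rewrite (ltW t0) t1 => /(_ erefl).
  have -> : t *: (b + t^-1 *: u) + (1 - t) *: b = b + u.
    by apply/matrixP => k l; rewrite !mxE; field; rewrite gt_eqF.
  by move=> /le_trans; apply; rewrite lerD2r ler_wpM2l// ltW.
have h2 : (1 + t) * g b <= g (b + u) + t * M.
  have t10 : 0 < 1 + t by rewrite addr_gt0.
  have := cg (1 + t)^-1 (b + u) (b - t^-1 *: u).
  rewrite invr_ge0 (ltW t10) invf_le1// lerDl (ltW t0) => /(_ erefl).
  have -> : (1 + t)^-1 *: (b + u) + (1 - (1 + t)^-1) *: (b - t^-1 *: u) = b.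
    by apply/matrixP => k l; rewrite !mxE; field; rewrite !gt_eqF.
  move=> /(ler_wpM2l (ltW t10)) /le_trans; apply.
  rewrite mulrDr !mulrA mulfV ?gt_eqF// mul1r lerD2l.
  have -> : (1 + t) * (1 - (1 + t)^-1) = t by field; rewrite gt_eqF.
  by rewrite ler_wpM2l// ltW.
have tMN : t * (M - g b) <= e.
  by rewrite (le_trans _ tN)// ler_wpM2l// ltW.
rewrite ler_norml; nra.
Unshelve. all: by end_near. Qed.

Lemma trmx_continuous m k : continuous (@trmx R m k).
Proof.
move=> A; apply/(@cvgrPdist_le _ _ _ (nbhs (A : 'M[R]_(m, k))) (nbhs_filter A)) => /= e e0; near=> B.
have : `|A - B| <= e by near: B; apply: cvgr_dist_le.
move=> h; apply: mxnorm_le => [|i j]; first exact: ltW.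
by rewrite (le_trans _ h)// !mxE -[leLHS]/(`|A j i - B j i|) (le_trans _ (coord_mxnorm _ j i))// !mxE.
Unshelve. all: by end_near. Qed.

(** A minimum over the cube of half side [c] is global, because outside the ball of radius [c] the
    value at [0] is at least as good. The cube is taken among row vectors, for which boxes are known
    to be compact. *)
Lemma coercive_argmin p (f : 'cV[R]_p -> R) (c : R) : continuous f -> 0 <= c ->
  (forall b, c < enorm b -> f 0 <= f b) ->
  exists b, forall b', f b <= f b'.
Proof.
move=> cf c0 hc.
pose A : set 'rV[R]_p := [set v | forall i, v 0 i \in `[-c, c]].
have cA : compact A.
  apply: (@rV_compact _  _ (fun=> `[- c, c]%classic)).
  by move=> _; apply: segment_compact.
have A0 : A 0 by move=> i; rewrite mxE in_itv/= oppr_le0 c0.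
have cft : continuous (fun v : 'rV[R]_p => f v^T).
  move=> v; apply: continuous_comp; first exact: trmx_continuous.
  exact: cf.
have [v vA hv] := @compact_EVT_min _ _ _ A (ex_intro _ _ A0) cA
  (continuous_subspaceT cft).
exists v^T => b'.
have [h|h] := leP (enorm b') c; last first.
  apply: le_trans (hc _ h); have := hv 0; rewrite trmx0; apply.
  exact: mem_set.
have := hv b'^T; rewrite trmxK; apply; apply: mem_set => i.
by rewrite mxE in_itv/= -ler_norml (le_trans (abs_coord_enorm _ _)).
Qed.

Lemma argminP (V : pointedType) (f : V -> R) :
  (exists b, forall b', f b <= f b') -> forall b', f (argmin f) <= f b'.
Proof. by move=> h; exact: (getPex h). Qed.

(** Fermat's rule for a sum in which [L] only has a quadratic upper bound along lines: compare [b]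
    with [b + t (b' - b)], divide by [t] and let [t] tend to [0]. *)
Lemma min_subdifferential p (L g : 'cV[R]_p -> R) b v : convexf g ->
  (forall d, exists C, forall t, 0 <= t <= 1 ->
      L (b + t *: d) <= L b + t * dotv v d + t ^+ 2 * C) ->
  (forall b', L b + g b <= L b' + g b') ->
  subdifferential g b (- v).
Proof.
move=> /convexfP cg hL hb b' /=.
have [C hC] := hL (b' - b).
suff h t : 0 < t <= 1 -> g b + dotv (- v) (b' - b) <= g b' + t * `|C|.
  apply/ler_addgt0Pr => e e0.
  pose t := Num.min 1 (e / (`|C| + 1)).
  have C0 : 0 < `|C| + 1 by rewrite ltr_wpDl.
  have t0 : 0 < t by rewrite lt_min ltr01 divr_gt0.
  have t1 : t <= 1 by rewrite ge_min lexx.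
  apply: le_trans (h t _) _; first by rewrite t0 t1.
  rewrite lerD2l (@le_trans _ _ (t * (`|C| + 1)))//.
    by rewrite ler_wpM2l ?ltW// ltrDl.
  by rewrite -ler_pdivlMr// ge_min lexx orbT.
move=> /andP[t0 t1]; have t01 : 0 <= t <= 1 by rewrite ltW.
have := hb (b + t *: (b' - b)).
have := cg t b' b t01.
have -> : t *: b' + (1 - t) *: b = b + t *: (b' - b).
  by apply/matrixP => i j; rewrite !mxE; ring.
have := hC t t01; rewrite dotvNl => h1 h2 h3.
have hC' : t ^+ 2 * C <= t ^+ 2 * `|C| by rewrite ler_wpM2l ?sqr_ge0// ler_norm.
rewrite -(@ler_pM2l _ t)//; nra.
Qed.

End Convex.

(** * Convex differentiable functions of one variable *)

Section Loss.
Context {R : realType}.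
Variable l : R -> R.
Hypothesis cl : convexf (V := R^o) l.
Hypothesis dl : forall u, derivable l u 1.
Let l' := derive1 l.

Lemma convexf_tangent u v : l u + l' u * (v - u) <= l v.
Proof.
have cl' := (convexfP (l : R^o -> R)).1 cl.
have [->|uv] := eqVneq v u; first by rewrite subrr mulr0 addr0.
have hd : h^-1 *: (l (h *: 1 + u) - l u) @[h --> 0^'] --> l' u.
  by rewrite /l' derive1E; exact: (@dl u).
apply/ler_addgt0Pr => e e0.
pose a := `|v - u|.
have a0 : 0 < a by rewrite normr_gt0 subr_eq0.
have /cvgrPdist_le /(_ (e / a)) := hd.
rewrite divr_gt0// => /(_ erefl).
rewrite near_withinE => /nbhs_ballP[/= r r0 hr].
pose t := Num.min 1 (r / 2 / a).
have t0 : 0 < t by rewrite lt_min ltr01 !divr_gt0.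
have t1 : t <= 1 by rewrite ge_min lexx.
have ta : t * a <= r / 2 by rewrite -ler_pdivlMr// ge_min lexx orbT.
pose h := t * (v - u).
have h0 : h != 0 by apply: mulf_neq0; [exact: lt0r_neq0|rewrite subr_eq0].
have hh : `|h| = t * a by rewrite normrM gtr0_norm.
have := hr h; rewrite /ball/= sub0r normrN hh => /(_ _ h0).
rewrite (le_lt_trans ta) ?ltr_pdivrMr ?mulr2n ?mulrDr ?mulr1 ?ltrDl// => /(_ erefl).
rewrite -[_ *: 1]/(h * 1) mulr1 -[_ *: _]/(h^-1 * (l (h + u) - l u)) => hk.
have : `|h * (l' u - h^-1 * (l (h + u) - l u))| <= t * e.
  rewrite normrM hh -mulrA; apply: ler_wpM2l; first exact: ltW.
  by rewrite -ler_pdivlMl// [leRHS]mulrC.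
rewrite mulrBr mulrA mulfV// mul1r => /(le_trans (ler_norm _)).
have := cl' t v u; rewrite ltW// t1 => /(_ erefl).
have -> : t *: v + (1 - t) *: u = h + u.
  by rewrite -[_ *: v]/(t * v) -[_ *: u]/((1 - t) * u) /h; ring.
move=> h1 h2; rewrite -(@ler_pM2l _ t)//; move: h2; rewrite /h; nra.
Qed.

Lemma derive1_convex_mono u v : 0 <= (u - v) * (l' u - l' v).
Proof. have := convexf_tangent u v; have := convexf_tangent v u; nra. Qed.

Hypothesis lipl : forall u v, `|l' u - l' v| <= `|u - v|.

(** On the line [l' u - l' v] and [u - v] have the same sign, so cocoercivity is the Lipschitz bound
    multiplied by [|l' u - l' v|]. *)
Lemma derive1_convex_cocoercive u v : (l' u - l' v) ^+ 2 <= (u - v) * (l' u - l' v).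
Proof.
have := derive1_convex_mono u v; have := lipl u v.
move: (l' u - l' v) (u - v) => x y h hm.
rewrite -(ger0_norm hm) normrM -real_normK ?num_real// expr2 ler_wpM2r//.
Qed.

(** The tangent at [u + v] and the Lipschitz bound on its slope give the coefficient [1] instead of
    the optimal [1 / 2], and require no integration. *)
Lemma convexf_quad_upper u v : l (u + v) <= l u + l' u * v + v ^+ 2.
Proof.
have := convexf_tangent (u + v) u.
have := lipl (u + v) u; have -> : u + v - u = v by ring.
move: (l' (u + v)) => a h1 h2.
have : (a - l' u) * v <= v ^+ 2.
  apply: le_trans (ler_norm _) _; rewrite normrM -real_normK ?num_real// expr2.
  by rewrite ler_wpM2r.
nra.
Qed.

Lemma loss_continuous : continuous l.
Proof.
move=> u; apply: differentiable_continuous; apply/derivable1_diffP; exact: (@dl u).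
Qed.

End Loss.

Section ContinuityRules.
Context {R : realType} {T : topologicalType}.
Implicit Types f g : T -> R.

Lemma contD f g : continuous f -> continuous g -> continuous (fun x => f x + g x).
Proof. by move=> cf cg x; apply: cvgD; [exact: cf|exact: cg]. Qed.

Lemma contB f g : continuous f -> continuous g -> continuous (fun x => f x - g x).
Proof. by move=> cf cg x; apply: cvgB; [exact: cf|exact: cg]. Qed.

Lemma contM f g : continuous f -> continuous g -> continuous (fun x => f x * g x).
Proof. by move=> cf cg x; apply: cvgM; [exact: cf|exact: cg]. Qed.

Lemma cont_cst (a : R) : continuous (fun _ : T => a).
Proof. by move=> x; exact: cvg_cst. Qed.

Lemma cont_sum (I : Type) (s : seq I) (f : I -> T -> R) :
  (forall i, continuous (f i)) -> continuous (fun x => \sum_(i <- s) f i x).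
Proof.
move=> cf; elim: s => [|i s ih].
  rewrite (_ : (fun _ => _) = (fun _ => 0)); first exact: cont_cst.
  by apply/funext => x; rewrite big_nil.
rewrite (_ : (fun _ => _) = (fun x => f i x + \sum_(j <- s) f j x)).
  by apply: contD.
by apply/funext => x; rewrite big_cons.
Qed.

End ContinuityRules.

Lemma mulmx_coord_continuous {R : realType} m k (X : 'M[R]_(m, k)) i :
  continuous (fun b : 'cV[R]_k => (X *m b) i 0).
Proof.
rewrite (_ : (fun b => _) =
    (fun b : 'cV[R]_k => \sum_j X i j * b j 0)); last first.
  by apply/funext => c; rewrite mxE.
apply: cont_sum => j; apply: contM; first exact: cont_cst.
by move=> c; exact: coord_continuous.
Qed.

Lemma dotv_mulmx_continuous {R : realType} m k (X : 'M[R]_(m, k)) :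
  continuous (fun b : 'cV[R]_k => dotv (X *m b) (X *m b)).
Proof.
rewrite (_ : (fun b => _) =
    (fun b : 'cV[R]_k => \sum_j (X *m b) j 0 * (X *m b) j 0)); last first.
  by apply/funext => c; rewrite dotvE.
by apply: cont_sum => j; apply: contM; exact: mulmx_coord_continuous.
Qed.

Lemma near_dist_mx {R : realType} m k (b : 'M[R]_(m, k)) (P : set 'M[R]_(m, k)) :
  (\forall c \near b, P c) -> exists2 e, 0 < e & forall c, `|c - b| < e -> P c.
Proof.
move=> /nbhs_normP[e e0 h]; exists e => // c hc; apply: h.
by rewrite /ball_/= distrC.
Qed.

(** * The estimator *)

Section Growth.
Context {R : realType}.
Variables (p : nat) (Sigma : 'M[R]_p.+1) (tau : R).
Let H := sqrtmx Sigma.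

Section Fun.
Variable f : 'cV[R]_p.+1 -> R.
Hypothesis cf : convexf f.
Hypothesis f0 : forall b, f 0 <= f b.
Hypothesis mf : strongly_monotone_subdifferential Sigma tau f.

Lemma subdifferential_min0 : subdifferential f 0 0.
Proof. by move=> b /=; rewrite dotv0l addr0. Qed.

(** Subgradients are obtained at the proximal points of [f], which accumulate
    at every point. *)
Lemma near_subdifferential b e : 0 < e ->
  exists m d, dotv (m - b) (m - b) <= e /\ subdifferential f m d.
Proof.
move=> e0.
(* Comparing the minimizer [m] of [L + f] with [b] gives [lam / 2 |m - b|^2 <= f b - f 0], which
   this [lam] turns into [|m - b|^2 <= e]. The [+ 1] keeps [lam] positive. *)
pose lam := 2 * (f b - f 0 + 1) / e.
have fb : 0 < f b - f 0 + 1 by have := f0 b; lra.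
have lam0 : 0 < lam by rewrite divr_gt0// mulr_gt0.
pose L (c : 'cV[R]_p.+1) := lam / 2 * dotv (c - b) (c - b).
have L0 c : 0 <= L c by rewrite mulr_ge0 ?dotv_ge0// divr_ge0 ?ltW.
have cL : continuous L.
  apply: contM; first exact: cont_cst.
  rewrite (_ : (fun c => _) = (fun c : 'cV[R]_p.+1 =>
     dotv (1%:M *m c) (1%:M *m c) - 2 * (b^T *m c) 0 0 + dotv b b)).
    apply: contD; last exact: cont_cst.
    apply: contB; first exact: dotv_mulmx_continuous.
    by apply: contM; [exact: cont_cst|exact: mulmx_coord_continuous].
  apply/funext => c; rewrite mul1mx -/(dotv b c) dotvBl !dotvBr (dotvC c b); lra.
have [m hm] : exists m, forall c, (L m + f m) <= L c + f c.
  apply: (@coercive_argmin _ _ (fun c => L c + f c) (2 * enorm b)).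
  - by apply: contD => //; exact: convexf_continuous.
  - by rewrite mulr_ge0// enorm_ge0.
  - move=> c hc; apply: lerD; last exact: f0.
    rewrite /L; apply: ler_wpM2l; first by apply: divr_ge0 => //; exact: ltW.
    rewrite sub0r dotvNl dotvNr opprK.
    have h1 : enorm b <= enorm (c - b).
      by have := enormD (c - b) b; rewrite subrK; lra.
    rewrite -!enorm_sq; have := enorm_ge0 b; nra.
exists m, (- (lam *: (m - b))); split.
  have := hm b; rewrite {2}/L subrr dotv0l mulr0 add0r /L.
  have := f0 m => h1 h2.
  have h3 : lam / 2 * dotv (m - b) (m - b) <= f b - f 0 + 1 by lra.
  have : e * (lam / 2 * dotv (m - b) (m - b)) <= e * (f b - f 0 + 1).
    by rewrite ler_pM2l.
  rewrite mulrA (_ : e * (lam / 2) = f b - f 0 + 1); last first.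
    by rewrite /lam; field; rewrite gt_eqF.
  by rewrite mulrC ler_pM2r.
apply: (@min_subdifferential R _ L) => // d.
exists (lam / 2 * dotv d d) => t _.
rewrite /L (_ : m + t *: d - b = (m - b) + t *: d); last by rewrite addrAC.
move: (m - b) => u; rewrite dotvDl !dotvDr !dotvZl !dotvZr (dotvC d u).
by rewrite le_eqVlt; apply/orP; left; apply/eqP; field.
Qed.

(** At a point [m] near [b] with a subgradient [d], strong monotonicity against the subgradient [0]
    at [0] gives [tau |H m|^2 <= d . m], and [d . m] bounds [f (m + m) - f m] from below. Evaluating
    at the doubled point replaces an integration of subgradients along a segment; continuity then
    moves [m] to [b]. *)
Lemma strong_growth b : f 0 + tau * enorm (H *m b) ^+ 2 <= f (b + b).
Proof.
pose F (c : 'cV[R]_p.+1) := f (c + c) - tau * dotv (H *m c) (H *m c).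
have cF : continuous F.
  apply: contB; last first.
    by apply: contM; [exact: cont_cst|exact: dotv_mulmx_continuous].
  move=> c; apply: (@continuous_comp _ _ _ (fun x : 'cV[R]_p.+1 => x + x)).
    exact: (@cvgD _ _ _ (nbhs c) (nbhs_filter c) id id c c cvg_id cvg_id).
  exact: convexf_continuous.
suff : f 0 <= F b by rewrite /F -enorm_sq; lra.
apply/ler_addgt0Pr => e e0.
have /cvgrPdist_le /(_ e e0) /near_dist_mx[r r0 hr] := cF b.
have r20 : 0 < (r / 2) ^+ 2 by rewrite exprn_gt0// divr_gt0.
have [m [d [hm hd]]] := near_subdifferential b r20.
have : `|m - b| < r.
  apply: (@le_lt_trans _ _ (r / 2)); last by lra.
  apply: mxnorm_le => [|i j]; first by rewrite divr_ge0// ltW.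
  rewrite ord1 (le_trans (abs_coord_enorm _ _))// ler_enorm// divr_ge0// ltW//.
move=> /hr; rewrite ler_norml => /andP[h1 _].
have := mf hd subdifferential_min0; rewrite !subr0 dotvC => h2.
have := hd (m + m); rewrite addrK.
have := f0 m; move: h1 h2; rewrite /F enorm_sq -/H; lra.
Qed.

End Fun.
End Growth.

Section Estimator.
Context {R : realType}.
Variables (n p : nat) (Sigma : 'M[R]_p.+1) (tau : R).
Variables (loss : R -> R -> R) (g : 'cV[R]_p.+1 -> R).
Let H := sqrtmx Sigma.
Hypotheses (tau0 : 0 < tau) (n0 : (0 < n)%N) (uH : H \in unitmx).
Hypothesis cg : convexf g.
Hypothesis g0 : forall b, g 0 <= g b.
Hypothesis mg : strongly_monotone_subdifferential Sigma tau g.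

Definition good_loss (l : R -> R) := [/\ convexf (V := R^o) l,
  forall u, derivable l u 1 &
  forall u v, `|derive1 l u - derive1 l v| <= `|u - v| ].

Definition avg_loss (y : 'I_n -> R) (X : 'M[R]_(n, p.+1)) (b : 'cV[R]_p.+1) : R :=
  n%:R^-1 * \sum_(i < n) loss (y i) ((X *m b) i 0).

(** Residuals at an arbitrary coefficient vector, with the sign of [psihat]: the gradient of
    [avg_loss] is [- X^T resid / n]. *)
Definition resid (y : 'I_n -> R) (X : 'M[R]_(n, p.+1)) (b : 'cV[R]_p.+1) :
  'cV[R]_n := \col_i - derive1 (loss (y i)) ((X *m b) i 0).

Section Fixed.
Variables (y : 'I_n -> R).
Hypothesis gl : forall i, good_loss (loss (y i)).

Lemma sqrt_unit_bound b : enorm b <= opnorm (invmx H) * enorm (H *m b).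
Proof. by rewrite -{1}(mulKmx uH b) opnormP. Qed.

Lemma avg_loss_continuous X : continuous (avg_loss y X).
Proof.
apply: contM; first exact: cont_cst.
apply: cont_sum => i c.
apply: (@continuous_comp _ _ _ (fun b : 'cV[R]_p.+1 => (X *m b) i 0)).
  exact: mulmx_coord_continuous.
by have [_ d _] := gl i; exact: loss_continuous.
Qed.

Lemma objective_continuous X : continuous (objective loss g y X).
Proof.
apply: contD; first exact: avg_loss_continuous.
exact: convexf_continuous.
Qed.

Lemma avg_loss_tangent X b c :
  avg_loss y X b - n%:R^-1 * dotv (resid y X b) (X *m (c - b)) <= avg_loss y X c.
Proof.
rewrite /avg_loss -mulrBr ler_wpM2l// dotvE -sumrB ler_sum// => i _.
have [c1 c2 _] := gl i.
have := convexf_tangent c1 c2 ((X *m b) i 0) ((X *m c) i 0).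
rewrite mulmxBr [resid _ _ _ _ _]mxE [(_ - _ : 'cV_n) i 0]mxE.
by rewrite [(- _ : 'cV_n) i 0]mxE mulNr opprK.
Qed.

Lemma avg_loss_upper X b d : exists C, forall t, 0 <= t <= 1 ->
  avg_loss y X (b + t *: d) <= avg_loss y X b
    + t * dotv (- (n%:R^-1 *: (X^T *m resid y X b))) d + t ^+ 2 * C.
Proof.
exists (n%:R^-1 * dotv (X *m d) (X *m d)) => t _.
rewrite dotvNl dotvZl -dotv_mulmx.
rewrite (_ : _ + _ + _ = n%:R^-1 * (\sum_(i < n) loss (y i) ((X *m b) i 0)
  + t * - dotv (resid y X b) (X *m d) + t ^+ 2 * dotv (X *m d) (X *m d))); last first.
  by rewrite /avg_loss; ring.
rewrite ler_wpM2l// !dotvE -sumrN !mulr_sumr -!big_split/= ler_sum// => i _.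
have [c1 c2 c3] := gl i.
have := convexf_quad_upper c1 c2 c3 ((X *m b) i 0) (t * (X *m d) i 0).
rewrite mulmxDr -scalemxAr [(_ + _ : 'cV_n) i 0]mxE [(_ *: _ : 'cV_n) i 0]mxE.
rewrite [resid _ _ _ _ _]mxE => /le_trans; apply.
rewrite mulNr opprK expr2; nra.
Qed.

(** The tilt [d] makes the stationarity condition serve twice: at the estimator with [d = 0], and at
    arbitrary points where [d] is a subgradient of the whole objective. *)
Lemma min_resid X b (d : 'cV[R]_p.+1) :
  (forall b', objective loss g y X b + dotv d (b' - b) <= objective loss g y X b') ->
  subdifferential g b (d + n%:R^-1 *: (X^T *m resid y X b)).
Proof.
move=> hb.
have : subdifferential (fun c => g c - dotv d c) b
    (- - (n%:R^-1 *: (X^T *m resid y X b))).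
  apply: (@min_subdifferential R _ (avg_loss y X)).
  - apply/convexfP => t u v t01; have := (convexfP g).1 cg t u v t01.
    by rewrite dotvDr !dotvZr; lra.
  - exact: avg_loss_upper.
  - by move=> b'; have := hb b'; rewrite /objective -!/(avg_loss _ _ _) dotvBr; lra.
move=> hs b'; have := hs b'; rewrite opprK /= dotvDl (dotvBr d); lra.
Qed.

Lemma resid_mono X b c :
  dotv (resid y X b - resid y X c) (resid y X b - resid y X c) <=
  - dotv (X *m (b - c)) (resid y X b - resid y X c).
Proof.
rewrite !dotvE -sumrN ler_sum// => i _.
have [c1 c2 c3] := gl i.
have := derive1_convex_cocoercive c1 c2 c3 ((X *m b) i 0) ((X *m c) i 0).
rewrite mulmxBr !mxE; nra.
Qed.

(** The objective translated by its minimizer has a strongly monotone subdifferential, since the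
    residuals contribute a term of the right sign, so [strong_growth] applies. This is uniqueness of
    the minimizer in quantitative form; it serves for measurability. *)
Lemma objective_min_growth X b c :
  (forall b', objective loss g y X b <= objective loss g y X b') ->
  objective loss g y X b + tau * enorm (H *m c) ^+ 2 <=
  objective loss g y X (b + (c + c)).
Proof.
move=> hb.
have := @strong_growth R p Sigma tau (fun c => objective loss g y X (b + c)).
rewrite addr0; apply.
- apply/convexfP => t u v t01; rewrite /objective -!/(avg_loss _ _ _).
  have -> : b + (t *: u + (1 - t) *: v) = t *: (b + u) + (1 - t) *: (b + v).
    by apply/matrixP => i j; rewrite !mxE; ring.
  have := (convexfP g).1 cg t (b + u) (b + v) t01.
  suff : avg_loss y X (t *: (b + u) + (1 - t) *: (b + v)) <=
    t * avg_loss y X (b + u) + (1 - t) * avg_loss y X (b + v) by lra.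
  rewrite /avg_loss !mulrA ![t * _]mulrC ![(1 - t) * _]mulrC -!mulrA -mulrDr.
  rewrite ler_wpM2l// !mulr_sumr -big_split/= ler_sum// => i _.
  have [c1 _ _] := gl i.
  have := (convexfP (loss (y i) : R^o -> R)).1 c1 t ((X *m (b + u)) i 0)
     ((X *m (b + v)) i 0) t01.
  rewrite (mulmxDr X (t *: (b + u))) -!scalemxAr [(_ + _ : 'cV_n) i 0]mxE.
  by rewrite ![(_ *: _ : 'cV_n) i 0]mxE.
- exact: (fun c' => hb (b + c')).
- move=> u v du dv hu hv.
  have {}hu : subdifferential g (b + u) (du + n%:R^-1 *: (X^T *m resid y X (b + u))).
    apply: min_resid => b'; have := hu (b' - b); rewrite /= addrCA subrr addr0.
    by rewrite opprD addrA.
  have {}hv : subdifferential g (b + v) (dv + n%:R^-1 *: (X^T *m resid y X (b + v))).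
    apply: min_resid => b'; have := hv (b' - b); rewrite /= addrCA subrr addr0.
    by rewrite opprD addrA.
  have := mg hu hv; rewrite opprD addrACA subrr add0r => /le_trans; apply.
  rewrite opprD addrACA -scalerBr -mulmxBr (dotvDr (u - v) (du - dv)) gerDl dotvZr
    dotv_mulmx trmxK.
  rewrite mulr_ge0_le0//.
  have := resid_mono X (b + u) (b + v); rewrite opprD addrACA subrr add0r.
  have := dotv_ge0 (resid y X (b + u) - resid y X (b + v)); lra.
Qed.

Lemma objective_argmin X : exists b, forall b', objective loss g y X b <= objective loss g y X b'.
Proof.
pose v := n%:R^-1 *: (X^T *m resid y X 0).
pose c := opnorm (invmx H).
have c0 : 0 <= c by exact: opnorm_ge0.
(* Beyond this radius the growth [tau / 4 |H b|^2] of the penalty dominates [|v| |b|], the largest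
   decrease of the linearized loss. *)
apply: (@coercive_argmin _ _ _ (4 * (c ^+ 2 * enorm v / tau))).
- exact: objective_continuous.
- apply: mulr_ge0 => //; apply: divr_ge0; last exact: ltW.
  by apply: mulr_ge0; [exact: sqr_ge0|exact: enorm_ge0].
move=> b hb.
have := avg_loss_tangent X 0 b; rewrite subr0 dotv_mulmx -dotvZl -/v.
have := strong_growth cg g0 mg (2^-1 *: b).
rewrite -scalemxAr enormZ exprMn ger0_norm ?invr_ge0// -scalerDl.
have -> : 2^-1 + 2^-1 = 1 :> R by lra.
rewrite scale1r /objective -!/(avg_loss _ _ _) => h1 h2.
have h3 : dotv v b <= enorm v * enorm b by rewrite (le_trans (ler_norm _))// dotv_CS.
suff : enorm v * enorm b <= tau * (2^-1 ^+ 2 * enorm (H *m b) ^+ 2) by lra.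
have h4 := sqrt_unit_bound b.
have b0 := enorm_ge0 b; have v0 := enorm_ge0 v; have Hb0 := enorm_ge0 (H *m b).
have h5 : enorm b ^+ 2 <= c ^+ 2 * enorm (H *m b) ^+ 2.
  by rewrite -exprMn ler_pXn2r// nnegrE// mulr_ge0.
have h6 : 4 * (c ^+ 2 * enorm v) <= tau * enorm b.
  by have := ltW hb; rewrite mulrA ler_pdivrMr// [leRHS]mulrC.
have [cE|c1] := eqVneq c 0.
  move: h5; rewrite cE expr0n mul0r => h5.
  have -> : enorm b = 0 by apply/eqP; rewrite -sqrf_eq0 eq_le h5 sqr_ge0.
  by rewrite mulr0; apply: mulr_ge0; [exact: ltW|rewrite mulr_ge0 ?sqr_ge0].
have c2 : 0 < c ^+ 2 by rewrite exprn_even_gt0.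
rewrite -(@ler_pM2l _ (c ^+ 2))//.
have h7 : 4 * (c ^+ 2 * enorm v) * enorm b <= tau * enorm b * enorm b by rewrite ler_wpM2r.
have h8 : tau * enorm b ^+ 2 <= tau * (c ^+ 2 * enorm (H *m b) ^+ 2).
  by rewrite ler_wpM2l// ltW.
nra.
Qed.

Lemma bhatP X b' : objective loss g y X (bhat loss g y X) <= objective loss g y X b'.
Proof. exact: (argminP (objective_argmin X)). Qed.

Lemma bhat_kkt X :
  subdifferential g (bhat loss g y X) (n%:R^-1 *: (X^T *m psihat loss g y X)).
Proof.
rewrite -[_ *: _]add0r; apply: min_resid => b'.
by rewrite dotv0l addr0 bhatP.
Qed.

(** Strong monotonicity between the subgradient at the estimator and the subgradient [0] at [0]. *)
Lemma bhat_kkt_ge0 X : n%:R * tau * enorm (H *m bhat loss g y X) ^+ 2 <=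
  dotv (X *m bhat loss g y X) (psihat loss g y X).
Proof.
have := mg (bhat_kkt X) (subdifferential_min0 g0).
rewrite !subr0 dotvZr -(ler_pM2l (_ : 0 < n%:R)) ?ltr0n// !mulrA mulfV ?mul1r.
  by rewrite dotv_mulmx trmxK.
by rewrite pnatr_eq0 -lt0n.
Qed.

(** The designs may be far apart: this replaces bounds on derivatives, and the
    Poincare inequality. *)
Lemma kkt_perturbation (X X' : 'M[R]_(n, p.+1)) b b' (u u' : 'cV[R]_n) :
  (forall i, u i 0 = - derive1 (loss (y i)) ((X *m b) i 0)) ->
  (forall i, u' i 0 = - derive1 (loss (y i)) ((X' *m b') i 0)) ->
  subdifferential g b (n%:R^-1 *: (X^T *m u)) ->
  subdifferential g b' (n%:R^-1 *: (X'^T *m u')) ->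
  n%:R * tau * enorm (H *m (b - b')) ^+ 2 + dotv (u - u') (u - u') <=
  dotv (b - b') ((X - X')^T *m u') - dotv (u - u') ((X - X') *m b').
Proof.
move=> uE uE' hb hb'; have := mg hb hb'.
have nn : 0 < n%:R :> R by rewrite ltr0n.
rewrite -scalerBr dotvZr -(ler_pM2l nn) mulrA [leRHS]mulrA mulfV ?gt_eqF// mul1r.
rewrite -/H => h1.
have h2 : dotv (u - u') (u - u') <= - dotv (X *m b - X' *m b') (u - u').
  rewrite !dotvE -sumrN; apply: ler_sum => i _.
  have [c1 c2 c3] := gl i.
  have := derive1_convex_cocoercive c1 c2 c3 ((X *m b) i 0) ((X' *m b') i 0).
  rewrite [(u - u') i 0]mxE [(- u') i 0]mxE uE uE'.
  rewrite [(X *m b - _) i 0]mxE [(- (X' *m b')) i 0]mxE.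
  have e (z1 z2 : R) : z1 ^+ 2 <= z2 * z1 -> (- z1) * (- z1) <= - (z2 * (- z1)).
    by rewrite mulrNN mulrN opprK expr2.
  by rewrite -opprD; exact: e.
have h3 : X *m b - X' *m b' = X *m (b - b') + (X - X') *m b'.
  by rewrite mulmxBr mulmxBl addrA subrK.
have h4 : X^T *m u - X'^T *m u' = X^T *m (u - u') + (X - X')^T *m u'.
  by rewrite mulmxBr linearB/= mulmxBl addrA subrK.
move: h1 h2; rewrite h3 h4; move: (b - b') (u - u') (X - X') => db du dX.
rewrite dotvDr dotvDl (dotv_mulmx X^T) trmxK (dotvC (dX *m b')).
move: (enorm _ ^+ 2) (dotv du du) (dotv (X *m db) du) (dotv du _)
  (dotv db _) => x1 x2 x3 x4 x5; lra.
Qed.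

Lemma bhat_perturbation X X' :
  let b := bhat loss g y X in let b' := bhat loss g y X' in
  let u := psihat loss g y X in let u' := psihat loss g y X' in
  n%:R * tau * enorm (H *m (b - b')) ^+ 2 + dotv (u - u') (u - u') <=
  dotv (b - b') ((X - X')^T *m u') - dotv (u - u') ((X - X') *m b').
Proof.
by apply: kkt_perturbation; [move=> i; rewrite mxE|move=> i; rewrite mxE|
  exact: bhat_kkt|exact: bhat_kkt].
Qed.

(** If all residuals vanish, [bhat_kkt_ge0] forces the estimator to be [0], where the residuals are
    [- l' 0]. This makes division by [r] legitimate. *)
Lemma psihat_neq0 X (i : 'I_n) : (forall k, derive1 (loss (y k)) 0 <> 0) ->
  exists k : 'I_n, psihat loss g y X k 0 != 0.
Proof.
move=> l0; apply: contrapT => /forallNP h.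
have u0 : psihat loss g y X = 0.
  by apply/matrixP => k j; rewrite ord1 [RHS]mxE; apply/eqP/negPn/negP; exact: h.
have := bhat_kkt_ge0 X; rewrite u0 dotv0r => h1.
have b0 : bhat loss g y X = 0.
  apply/eqP; rewrite -enorm_eq0 eq_le enorm_ge0 andbT.
  apply: le_trans (sqrt_unit_bound _) _.
  suff -> : enorm (H *m bhat loss g y X) = 0 by rewrite mulr0.
  have nt : 0 < n%:R * tau by rewrite mulr_gt0// ltr0n.
  by apply/eqP; rewrite -sqrf_eq0 eq_le sqr_ge0 andbT -(pmulr_rle0 _ nt).
apply: (l0 i); have := congr1 (fun v : 'cV[R]_n => v i 0) u0.
by rewrite !mxE b0 big1 => [/eqP|j _]; [rewrite oppr_eq0 => /eqP|rewrite mxE mulr0].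
Qed.

End Fixed.
End Estimator.

Lemma cvg_harmonic_bound {R : realType} (u : nat -> R) l C :
  (forall m, `|l - u m| <= C * m.+1%:R^-1) -> u m @[m --> \oo] --> l.
Proof.
move=> h; apply/cvgrPdist_le => e e0.
have C0 : 0 < `|C| + 1 by rewrite ltr_wpDl.
have /cvgrPdist_le /(_ (e / (`|C| + 1))) := @cvg_harmonic R.
rewrite divr_gt0// => /(_ erefl) hh; near=> m.
apply: le_trans (h m) _.
have : `|0 - harmonic m| <= e / (`|C| + 1) by near: m.
rewrite sub0r normrN ger0_norm ?harmonic_ge0// /harmonic ler_pdivlMr// => hm.
apply: le_trans hm; rewrite mulrC ler_wpM2l ?invr_ge0//.
by rewrite (le_trans (ler_norm _))// lerDl.
Unshelve. all: by end_near. Qed.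

(** * Measurability of the estimator *)

Section Caratheodory.
Context {d : measure_display} {T : measurableType d} {R : realType}.

(** [th] is the limit of its roundings to multiples of [1 / (m + 1)], which take countably many
    values; continuity of [G t] passes to the limit. *)
Lemma measurable_caratheodory (G : T -> R -> R) (th : T -> R) :
  (forall u, measurable_fun setT (G ^~ u)) -> (forall t, continuous (G t)) ->
  measurable_fun setT th -> measurable_fun setT (fun t => G t (th t)).
Proof.
move=> mG cG mth.
pose f (m : nat) t : R := (Num.floor (m.+1%:R * th t))%:~R / m.+1%:R.
apply: (@measurable_fun_cvg _ _ _ _ (fun m t => G t (f m t))) => [m|t _]; last first.
  apply: (cvg_comp (f^~ t) (G t)); last exact: cG.
  apply: (@cvg_harmonic_bound _ _ _ 1) => m; rewrite mul1r /f.
  have m0 : 0 < m.+1%:R :> R by rewrite ltr0n.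
  have -> : th t - (Num.floor (m.+1%:R * th t))%:~R / m.+1%:R =
      (m.+1%:R * th t - (Num.floor (m.+1%:R * th t))%:~R) / m.+1%:R.
    by rewrite mulrBl mulrAC mulfV ?gt_eqF// mul1r.
  have /andP[h1 h2] := floor_itv (m.+1%:R * th t).
  rewrite normrM [X in _ * X]ger0_norm ?invr_ge0// ler_piMl ?invr_ge0//.
  by rewrite ger0_norm ?subr_ge0// lerBlDl ltW// -[X in _ + X]/(1%:~R) -intrD.
move=> _ B mB; rewrite setTI.
rewrite (_ : _ @^-1` B = \bigcup_(z : int)
  ([set t | Num.floor (m.+1%:R * th t) = z] `&` ((G^~ (z%:~R / m.+1%:R)) @^-1` B))).
  apply: countable_bigcupT_measurable => [|z]; first exact: countableP.
  apply: measurableI; last by rewrite -[X in measurable X]setTI; exact: mG.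
  rewrite (_ : [set t | _] = (fun t => m.+1%:R * th t) @^-1` `[z%:~R, (z + 1)%:~R[).
    rewrite -[X in measurable X]setTI.
    have : measurable_fun setT (fun t => m.+1%:R * th t) by exact: measurable_funM.
    by apply => //; exact: measurable_itv.
  apply/seteqP; split => t /=.
    by move=> <-; rewrite in_itv/=; exact: floor_itv.
  by rewrite in_itv/= => h; exact: floor_def.
apply/seteqP; split => t /=.
  by move=> h; exists (Num.floor (m.+1%:R * th t)).
by move=> [z _ [<-]].
Qed.

Section Argmin.
Variables (p : nat) (Phi : T -> 'cV[R]_p -> R) (b : T -> 'cV[R]_p) (M : R).
Hypothesis mPhi : forall q, measurable_fun setT (Phi ^~ q).
Hypothesis cPhi : forall t, continuous (Phi t).
Hypothesis M0 : 0 < M.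
Hypothesis growth : forall t (c : 'cV[R]_p) j,
  (c j 0 - b t j 0) ^+ 2 <= M * (Phi t c - Phi t (b t)).

(** An enumeration of the rational vectors; numbers that encode no vector are sent to [0]. *)
Let q (m : nat) : 'cV[R]_p := map_mx ratr (odflt 0 (unpickle m : option 'cV[rat]_p)).

Let q_dense (c : 'cV[R]_p) e : 0 < e -> exists m, `|q m - c| < e.
Proof.
move=> e0.
have h i : exists r : rat, ratr r \in `]c i 0 - e / 2, c i 0 + e / 2[.
  by apply: rat_in_itvoo; lra.
have {}h (i : 'I_p) := cid (h i).
exists (pickle (\col_i sval (h i))).
rewrite /q pickleK /=; apply: (@le_lt_trans _ _ (e / 2)); last lra.
apply: mxnorm_le => [|i j]; first lra.
rewrite ord1 !mxE; have := svalP (h i); rewrite in_itv/= => /andP[h1 h2].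
by rewrite ler_norml; apply/andP; split; lra.
Qed.

Let Fixpoint best N t : 'cV[R]_p := if N is N'.+1 then
  (if Phi t (q N) < Phi t (best N' t) then q N else best N' t) else q 0.

Let best_le N t m : (m <= N)%N -> Phi t (best N t) <= Phi t (q m).
Proof.
elim: N m => [|N ih] m; first by rewrite leqn0 => /eqP ->.
rewrite leq_eqVlt => /orP[/eqP->|]; rewrite /=; case: ltP => // h; last exact: ih.
by move=> /ih; exact: le_trans (ltW h).
Qed.

Let measurable_best N : measurable_fun setT (fun t => Phi t (best N t)) /\
  forall j, measurable_fun setT (fun t => best N t j 0).
Proof.
elim: N => [|N [ih1 ih2]]; first by split=> [|j] //=.
have mlt : measurable_fun setT (fun t => Phi t (q N.+1) < Phi t (best N t)).
  exact: measurable_fun_ltr.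
split => [|j]; last first.
  rewrite (_ : (fun t => _) = (fun t =>
    if Phi t (q N.+1) < Phi t (best N t) then q N.+1 j 0 else best N t j 0)).
    exact: measurable_fun_ifT.
  by apply/funext => t /=; case: ifP.
rewrite (_ : (fun t => _) = (fun t =>
  if Phi t (q N.+1) < Phi t (best N t) then Phi t (q N.+1) else Phi t (best N t))).
  exact: measurable_fun_ifT.
by apply/funext => t /=; case: ifP.
Qed.

(** [best N] is selected among the first [N + 1] rational points by comparing measurable functions.
    Its value tends to the minimum by density and continuity, and the growth hypothesis turns
    convergence of values into convergence of points. *)
Lemma measurable_argmin j : measurable_fun setT (fun t => b t j 0).
Proof.
apply: (@measurable_fun_cvg _ _ _ _ (fun N t => best N t j 0)) => [N|t _].
  exact: (measurable_best N).2.
apply/cvgrPdist_le => e e0.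
have e1 : 0 < e ^+ 2 / M by rewrite divr_gt0// exprn_gt0.
have /cvgrPdist_le /(_ _ e1) /near_dist_mx[r r0 hr] := @cPhi t (b t).
have [m /hr hm] := q_dense (b t) r0.
near=> N.
have mN : (m <= N)%N by near: N; exact: nbhs_infty_ge.
rewrite -(@ler_pXn2r _ 2)// ?nnegrE ?normr_ge0// ?(ltW e0)//.
rewrite real_normK ?num_real// -sqrrN opprB.
apply: le_trans (growth _ _ _) _; rewrite mulrC -ler_pdivlMr//.
apply: le_trans hm; rewrite distrC; apply: le_trans (ler_norm _); rewrite lerD2r.
exact: best_le.
Unshelve. all: by end_near. Qed.

End Argmin.
End Caratheodory.

Section MeasurableEstimator.
Context {d : measure_display} {T : measurableType d} {R : realType}.
Variables (n p : nat) (Sigma : 'M[R]_p.+1) (tau : R).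
Variables (loss : R -> R -> R) (g : 'cV[R]_p.+1 -> R).
Hypotheses (tau0 : 0 < tau) (n0 : (0 < n)%N) (uH : sqrtmx Sigma \in unitmx).
Hypothesis cg : convexf g.
Hypothesis g0 : forall b, g 0 <= g b.
Hypothesis mg : strongly_monotone_subdifferential Sigma tau g.
Variables (y : T -> 'I_n -> R) (X : T -> 'M[R]_(n, p.+1)).
Hypothesis gl : forall t i, good_loss (loss (y t i)).
Hypothesis ml : forall i u, measurable_fun setT (fun t => loss (y t i) u).
Hypothesis mX : forall i j, measurable_fun setT (fun t => X t i j).

Let mXv (v : T -> 'cV[R]_p.+1) : (forall j, measurable_fun setT (fun t => v t j 0)) ->
  forall i, measurable_fun setT (fun t => (X t *m v t) i 0).
Proof.
move=> mv i; rewrite (_ : (fun t => _) = (fun t => \sum_j X t i j * v t j 0)).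
  by apply: measurable_sum => j; exact: measurable_funM.
by apply/funext => t; rewrite mxE.
Qed.

Lemma measurable_bhat j : measurable_fun setT (fun t => bhat loss g (y t) (X t) j 0).
Proof.
pose c := opnorm (invmx (sqrtmx Sigma)).
(* The [4] comes from halving the displacement in [objective_min_growth]; the [+ 1] makes the
   constant positive without a lower bound on [c]. *)
apply: (@measurable_argmin _ _ _ _ (fun t => objective loss g (y t) (X t)) _
  (4 * (c ^+ 2 + 1) / tau)).
- move=> q; apply: measurable_funD => //; apply: measurable_funM => //.
  apply: measurable_sum => i.
  apply: (@measurable_caratheodory _ _ _ (fun t => loss (y t i))) => //.
    by move=> t; have [_ h _] := gl t i; exact: loss_continuous.
  exact: mXv.
- by move=> t; exact: objective_continuous.
- by apply: divr_gt0 => //; apply: mulr_gt0 => //; apply: ltr_wpDl => //; exact: sqr_ge0.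
move=> t b j'; set b0 := bhat _ _ _ _.
have := @objective_min_growth _ _ _ _ _ _ _ cg mg _ (gl t) (X t) b0 (2^-1 *: (b - b0))
  (bhatP tau0 uH cg g0 mg (gl t) (X t)).
rewrite -scalerDl (_ : 2^-1 + 2^-1 = 1 :> R); last lra.
rewrite scale1r (addrC b0) subrK -scalemxAr enormZ exprMn ger0_norm ?invr_ge0// => h.
have h1 := sqrt_unit_bound uH (b - b0).
have h2 : (b j' 0 - b0 j' 0) ^+ 2 <= enorm (b - b0) ^+ 2.
  rewrite -[leLHS]real_normK ?num_real// ler_pXn2r// ?nnegrE ?enorm_ge0//.
  by have := abs_coord_enorm (b - b0) j'; rewrite !mxE.
apply: (le_trans h2).
have h3 : enorm (b - b0) ^+ 2 <= c ^+ 2 * enorm (sqrtmx Sigma *m (b - b0)) ^+ 2.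
  by rewrite -exprMn ler_pXn2r// nnegrE ?mulr_ge0 ?enorm_ge0 ?opnorm_ge0.
apply: (le_trans h3); rewrite [leRHS]mulrAC ler_pdivlMr//.
have := sqr_ge0 (enorm (sqrtmx Sigma *m (b - b0))); have := sqr_ge0 c.
move: (enorm _ ^+ 2) (c ^+ 2) (objective _ _ _ _ b) (objective _ _ _ _ b0) h
  => x z o1 o2 h z0 x0.
have : 0 <= tau * x by rewrite mulr_ge0// ltW.
nra.
Qed.

(** The derivative of the loss at the fitted value is the limit of forward quotients of step
    [1 / (m + 1)]; the tangent and the quadratic upper bound place each quotient within one step of
    it. *)
Lemma measurable_psihat i :
  measurable_fun setT (fun t => psihat loss g (y t) (X t) i 0).
Proof.
rewrite (_ : (fun t => _) = (fun t =>
    - derive1 (loss (y t i)) ((X t *m bhat loss g (y t) (X t)) i 0))); last first.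
  by apply/funext => t; rewrite mxE.
apply: measurableT_comp => //.
set th := fun t => (X t *m bhat loss g (y t) (X t)) i 0.
have mth : measurable_fun setT th by apply: mXv; exact: measurable_bhat.
have ml' (f : T -> R) : measurable_fun setT f ->
    measurable_fun setT (fun t => loss (y t i) (f t)).
  apply: (@measurable_caratheodory _ _ _ (fun t => loss (y t i))) => //.
  by move=> t; have [_ h _] := gl t i; exact: loss_continuous.
apply: (@measurable_fun_cvg _ _ _ _ (fun m t =>
  m.+1%:R * (loss (y t i) (th t + m.+1%:R^-1) - loss (y t i) (th t)))) => [m|t _].
  apply: measurable_funM => //; apply: measurable_funB; apply: ml' => //.
  exact: measurable_funD.
apply: (@cvg_harmonic_bound _ _ _ 1) => m; rewrite mul1r.
have [c1 c2 c3] := gl t i.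
have m0 : 0 < m.+1%:R :> R by rewrite ltr0n.
have := convexf_quad_upper c1 c2 c3 (th t) m.+1%:R^-1.
have := convexf_tangent c1 c2 (th t) (th t + m.+1%:R^-1).
rewrite addrAC subrr add0r.
move: (loss _ _) (loss _ _) => l1 l2; rewrite -/(th t).
have [D ->] : exists D : R, derive1 (loss (y t i)) (th t) = D by eexists.
move: (m.+1%:R : R) m0 => k k0 h1 h2.
have kV : 0 < k^-1 by rewrite invr_gt0.
have DE : D = k * (D / k) by rewrite mulrCA mulfV ?mulr1// gt_eqF.
have kE : k^-1 = k * k^-1 ^+ 2 by rewrite expr2 mulrA mulfV ?mul1r// gt_eqF.
have h1' : D <= k * (l1 - l2) by rewrite DE ler_pM2l//; lra.
have h2' : k * (l1 - l2) <= D + k^-1.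
  suff : k * (l1 - l2) <= k * (D / k) + k * k^-1 ^+ 2 by rewrite -DE -kE.
  by rewrite -mulrDr ler_pM2l//; lra.
by rewrite ler_norml; apply/andP; split; lra.
Qed.

End MeasurableEstimator.

(** * Square roots and whitening *)

Section Spectral.
Context {R : realType}.

Lemma enorm_delta_mx k (i : 'I_k) : dotv (delta_mx i 0 : 'cV[R]_k) (delta_mx i 0) = 1.
Proof. by rewrite -enorm_sq enorm_delta expr1n. Qed.

(** The reflection that exchanges [v] and the first basis vector, replaced by the identity when the
    two coincide. *)
Lemma householder k (v : 'cV[R]_k.+1) : dotv v v = 1 ->
  exists Q : 'M[R]_k.+1, Q^T *m Q = 1%:M /\ Q *m delta_mx 0 0 = v.
Proof.
move=> v1; set e : 'cV[R]_k.+1 := delta_mx 0 0.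
have [->|ve] := eqVneq v e; first by exists 1%:M; rewrite trmx1 !mul1mx.
set u := v - e.
have u0 : 0 < dotv u u by rewrite dotv_gt0 subr_eq0.
have ue : dotv e u = v 0 0 - 1 by rewrite dotvBr /e enorm_delta_mx dotv_delta.
have uu : dotv u u = 2 - 2 * v 0 0.
  by rewrite dotvBl !dotvBr v1 (dotvC v) /e enorm_delta_mx dotv_delta; ring.
pose Q : 'M[R]_k.+1 := 1%:M - (2 / dotv u u) *: (u *m u^T).
have OT : Q^T = Q by rewrite /Q linearB/= linearZ/= trmx1 trmx_mul trmxK.
have uuT w : u *m u^T *m w = dotv u w *: u.
  by rewrite -mulmxA (mx11_scalar (u^T *m w)) mul_mx_scalar.
have OE w : Q *m w = w - (2 * dotv u w / dotv u u) *: u.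
  by rewrite mulmxBl mul1mx -scalemxAl uuT scalerA mulrAC.
exists Q; split.
  rewrite OT {1}/Q mulmxBl mul1mx -scalemxAl -mulmxA.
  have -> : u^T *m Q = - u^T.
    rewrite -[Q]trmxK OT -trmx_mul OE mulfK ?gt_eqF//.
    by rewrite scaler_nat mulr2n opprD addrA subrr add0r linearN.
  by rewrite mulmxN scalerN opprK /Q subrK.
rewrite OE dotvC ue uu.
have h : 2 * (v 0 0 - 1) / (2 - 2 * v 0 0) = -1.
  by field; rewrite -uu gt_eqF.
by rewrite h scaleN1r opprK /u addrC subrK.
Qed.

(** If [u = A v] were nonzero, the form at [v - t u] would be [- 2 t |u|^2 + t^2 a], which is
    negative for small [t]. *)
Lemma psdmx_null k (A : 'M[R]_k) v : psdmx A -> dotv v (A *m v) = 0 -> A *m v = 0.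
Proof.
move=> [AT A0] v0; apply/eqP; rewrite -dotv_eq0; apply/eqP.
set u := A *m v; have uv : dotv v (A *m u) = dotv u u by rewrite dotv_mulmx AT.
apply/eqP/negPn/negP => uu.
have uu0 : 0 < dotv u u by rewrite lt_def uu dotv_ge0.
pose a := dotv u (A *m u).
have a0 : 0 <= a by exact: A0.
pose t := dotv u u / (a + 1).
have a1 : 0 < a + 1 by lra.
have t0 : 0 < t by rewrite divr_gt0.
have := A0 (v - t *: u).
rewrite mulmxBr -scalemxAr -/u dotvBl !dotvBr !dotvZl !dotvZr -/a uv v0.
have -> : dotv u u = t * (a + 1) by rewrite mulfVK// gt_eqF.
nra.
Qed.

(** [v] maximizes the Rayleigh quotient on the unit sphere. With [l] the maximum, [l - A] is
    positive semidefinite and its form vanishes at [v], so [psdmx_null] applies. *)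
Lemma psdmx_eigen k (A : 'M[R]_k.+1) : psdmx A ->
  exists v l, [/\ dotv v v = 1, 0 <= l & A *m v = l *: v].
Proof.
move=> [AT A0].
pose q (v : 'cV[R]_k.+1) := dotv v (A *m v).
pose nn (v : 'cV[R]_k.+1) := dotv v v.
have cq : continuous q.
  rewrite (_ : q = fun v => \sum_j (1%:M *m v) j 0 * (A *m v) j 0); last first.
    by apply/funext => v; rewrite /q dotvE mul1mx.
  by apply: cont_sum => j; apply: contM; exact: mulmx_coord_continuous.
have cn : continuous nn.
  rewrite (_ : nn = fun v => dotv (1%:M *m v) (1%:M *m v)).
    exact: dotv_mulmx_continuous.
  by apply/funext => v; rewrite mul1mx.
pose S : set 'rV[R]_k.+1 := [set v | nn v^T = 1].
have cS : compact S.
  pose c : R := 1.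
  have cC : compact [set v : 'rV[R]_k.+1 | forall i, v 0 i \in `[- c, c]].
    apply: (@rV_compact _  _ (fun=> `[- c, c]%classic)).
    by move=> _; apply: segment_compact.
  apply: (subclosed_compact _ cC) => [|v /= Sv i].
    apply: (@closed_comp _ _ (fun v : 'rV[R]_k.+1 => nn v^T) [set 1]).
      move=> v _; apply: (continuous_comp (@trmx_continuous _ _ _ v)).
      exact: cn.
    exact: closed_eq.
  rewrite in_itv/= -ler_norml.
  have := abs_coord_enorm v^T i; rewrite mxE => /le_trans; apply.
  by apply: ler_enorm => //; rewrite -/(nn _) Sv expr1n.
have S0 : S !=set0.
  by exists (delta_mx 0 0 : 'cV[R]_k.+1)^T; rewrite /S/= trmxK /nn enorm_delta_mx.
have [v vS hv] := @compact_EVT_max _ _ (fun v => q v^T) S S0 cS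
  (continuous_subspaceT (fun v => continuous_comp (@trmx_continuous _ _ _ v) (@cq _))).
exists v^T, (q v^T); have {}vS : dotv v^T v^T = 1 by move: vS; rewrite inE.
split=> //; first exact: A0.
have hB u : q u <= q v^T * nn u.
  have [->|u0] := eqVneq u 0; first by rewrite /q /nn !dotv0l mulr0.
  have uu : 0 < enorm u by rewrite lt_def enorm_ge0 enorm_eq0 u0.
  have := hv ((enorm u)^-1 *: u)^T.
  rewrite trmxK inE /S/= trmxK /nn /q -scalemxAr !dotvZl !dotvZr !mulrA -expr2.
  rewrite exprVn enorm_sq mulVf; last by rewrite dotv_eq0.
  move=> /(_ erefl); rewrite mulrC ler_pdivrMr ?dotv_gt0//.
have : (q v^T *: 1%:M - A) *m v^T = 0.
  apply: psdmx_null.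
    split=> [|u]; first by rewrite linearB/= linearZ/= trmx1 AT.
    rewrite mulmxBl -scalemxAl mul1mx dotvBr dotvZr subr_ge0; exact: hB.
  by rewrite mulmxBl -scalemxAl mul1mx dotvBr dotvZr vS mulr1 subrr.
by rewrite mulmxBl -scalemxAl mul1mx => /eqP; rewrite subr_eq0 => /eqP.
Qed.

(** Induction on the dimension: an orthogonal [Q] that moves the first basis vector to an
    eigenvector makes [Q^T A Q] block diagonal, and the smaller block has a root by induction. *)
Lemma psdmx_sqrt_exists k (A : 'M[R]_k) : psdmx A ->
  exists S : 'M[R]_k, psdmx S /\ S *m S = A.
Proof.
elim: k A => [|k ih] A hA; first by exists A; split => //; apply/matrixP => -[].
have [v [l [v1 l0 Av]]] := psdmx_eigen hA.
have [Q [OO Oe]] := householder v1.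
have OO' : Q *m Q^T = 1%:M by exact: mulmx1C.
pose C : 'M[R]_(1 + k) := Q^T *m A *m Q.
have CT : C^T = C by rewrite /C !trmx_mul trmxK hA.1 mulmxA.
have Ce : Q^T *m A *m Q *m (delta_mx 0 0 : 'cV[R]_k.+1) = l *: delta_mx 0 0.
  by rewrite -mulmxA Oe -mulmxA Av -scalemxAr -Oe mulmxA OO mul1mx.
have Ce' : C *m (col_mx 1%:M 0 : 'cV[R]_(1 + k)) = l *: col_mx 1%:M 0.
  have <- // : (delta_mx 0 0 : 'cV[R]_(1 + k)) = col_mx 1%:M 0.
  apply/matrixP => i j; rewrite !mxE ord1 eqxx andbT.
  case: splitP => i' hi; rewrite !mxE.
    by rewrite -!val_eqE /= hi.
  by rewrite -val_eqE /= hi.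
have CE : C = block_mx l%:M 0 0 (drsubmx C).
  have h : ulsubmx C = l%:M /\ dlsubmx C = 0.
    move: Ce'; rewrite -{1}[C]submxK mul_block_col !mulmx1 !mulmx0 !addr0.
    by rewrite scale_col_mx scaler0 scalemx1 => /eq_col_mx[-> ->].
  rewrite -{1}[C]submxK h.1 h.2; congr block_mx.
  by rewrite -[ursubmx C]trmxK -[X in (ursubmx X)^T]CT trmx_ursub trmxK h.2 trmx0.
have pC u : 0 <= dotv u (C *m u).
  by rewrite /C -!mulmxA dotv_mulmx trmxK; exact: hA.2.
have pC' : psdmx (drsubmx C).
  split; first by rewrite trmx_drsub CT.
  move=> u; have := pC (col_mx 0 u).
  rewrite CE mul_block_col !mulmx0 mul0mx !add0r /dotv tr_col_mx mul_row_col.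
  by rewrite mulmx0 add0r block_mxKdr.
have [S' [pS' SS']] := ih _ pC'.
pose D : 'M[R]_(1 + k) := block_mx (Num.sqrt l)%:M 0 0 S'.
have DT : D^T = D by rewrite /D tr_block_mx !trmx0 tr_scalar_mx pS'.1.
have pD (x : 'cV[R]_(1 + k)) : 0 <= dotv x (D *m x).
  rewrite -[x]vsubmxK /D mul_block_col !mul0mx addr0 add0r.
  rewrite /dotv tr_col_mx mul_row_col mxE addr_ge0//; last exact: pS'.2.
  rewrite mul_scalar_mx -/(dotv _ _) dotvZr mulr_ge0 ?sqrtr_ge0//.
  exact: dotv_ge0.
have DD : D *m D = C.
  rewrite CE mulmx_block !mulmx0 !mul0mx !addr0 !add0r SS'.
  by rewrite -scalar_mxM -expr2 sqr_sqrtr.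
exists (Q *m D *m Q^T); split.
  split.
    rewrite !trmx_mul trmxK mulmxA; congr (_ *m _ *m _).
    exact: DT.
  by move=> u; rewrite -!mulmxA dotv_mulmx; exact: pD.
rewrite -!mulmxA [Q^T *m _]mulmxA OO mul1mx [D *m (D *m _)]mulmxA DD /C.
by rewrite !mulmxA OO' mul1mx -mulmxA OO' mulmx1.
Qed.

Lemma sqrtmxP k (A : 'M[R]_k) : psdmx A ->
  psdmx (sqrtmx A) /\ sqrtmx A *m sqrtmx A = A.
Proof. by move=> /psdmx_sqrt_exists h; exact: (getPex h). Qed.

Lemma sqrtmx_unit k (A : 'M[R]_k) : psdmx A -> A \in unitmx -> sqrtmx A \in unitmx.
Proof.
by move=> /sqrtmxP[_ h]; rewrite -[in X in X -> _]h unitmx_mul => /andP[].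
Qed.

(** The coordinates [S^-1 x] of a [N(0, Sigma)] vector [x] are
    standard, and the first one is the index [x^T w]. *)
Lemma whitening k (Sigma : 'M[R]_k.+1) (w : 'cV[R]_k.+1) : psdmx Sigma ->
  Sigma \in unitmx -> dotv w (Sigma *m w) = 1 ->
  exists S : 'M[R]_k.+1, [/\ S \in unitmx, S *m S^T = Sigma,
    S^T *m w = delta_mx 0 0,
    (forall b, enorm (S^T *m b) = enorm (sqrtmx Sigma *m b)) &
    (forall (A : 'M[R]_k.+1) u, enorm (S^T *m A *m S *m u) <=
       opnorm (sqrtmx Sigma *m A *m sqrtmx Sigma) * enorm u)].
Proof.
move=> pS uS w1; have [[HT _] HH] := sqrtmxP pS.
set H := sqrtmx Sigma in HT HH *.
have Hw : dotv (H *m w) (H *m w) = 1 by rewrite dotv_mulmx HT mulmxA HH dotvC.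
have [Q [OO Oe]] := householder Hw.
have OO' : Q *m Q^T = 1%:M by exact: mulmx1C.
have On u : enorm (Q *m u) = enorm u by rewrite /enorm dotv_mulmx mulmxA OO mul1mx.
have OTn u : enorm (Q^T *m u) = enorm u.
  by rewrite /enorm dotv_mulmx trmxK mulmxA OO' mul1mx.
have uO : Q \in unitmx by case/mulmx1_unit: OO.
(* Any [S] with [S S^T = Sigma] whitens the rows; the orthogonal [Q], which moves the first basis
   vector to the unit vector [H w], puts the index in first position. *)
exists (H *m Q); split.
- by rewrite unitmx_mul uO sqrtmx_unit.
- by rewrite trmx_mul HT mulmxA -(mulmxA H) OO' mulmx1.
- by rewrite trmx_mul HT -mulmxA -Oe mulmxA OO mul1mx.
- by move=> b; rewrite trmx_mul HT -mulmxA OTn.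
- move=> A u; rewrite trmx_mul HT -!mulmxA OTn !mulmxA.
  by rewrite -[X in _ <= _ * X]On -!mulmxA !(mulmxA H) !mulmxA -(mulmxA _ Q) opnormP.
Qed.

(** In an orthonormal basis whose first vector is parallel to [b], only the first diagonal entry can
    be negative, and it is at least [- c]. *)
Lemma trace_ge_compl k (A : 'M[R]_k.+1) (b : 'cV[R]_k.+1) c :
  (forall u, enorm (A *m u) <= c * enorm u) ->
  (forall u, dotv u b = 0 -> 0 <= dotv u (A *m u)) -> - c <= \tr A.
Proof.
move=> hc hb.
have [Q [OO hO]] : exists Q : 'M[R]_k.+1, Q^T *m Q = 1%:M /\
    exists a, b = a *: (Q *m delta_mx 0 0).
  have [b0|b0] := eqVneq b 0.
    by exists 1%:M; rewrite trmx1 mul1mx; split => //; exists 0; rewrite scale0r.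
  have nb : enorm b != 0 by rewrite enorm_eq0.
  have [|Q [OO Oe]] := @householder _ ((enorm b)^-1 *: b).
    by rewrite dotvZl dotvZr mulrA -expr2 exprVn enorm_sq mulVf// dotv_eq0.
  by exists Q; split => //; exists (enorm b); rewrite Oe scalerA mulfV// scale1r.
have OO' : Q *m Q^T = 1%:M by exact: mulmx1C.
have On u : enorm (Q *m u) = enorm u by rewrite /enorm dotv_mulmx mulmxA OO mul1mx.
have -> : \tr A = \tr (Q^T *m A *m Q).
  by rewrite mxtrace_mulC mulmxA OO' mul1mx.
have cE i : (Q^T *m A *m Q) i i = dotv (Q *m delta_mx i 0) (A *m (Q *m delta_mx i 0)).
  by rewrite dotv_mulmxl !mulmxA dotv_delta -colE [RHS]mxE.
rewrite /mxtrace (bigD1 0)//= -[leLHS]addr0; apply: lerD.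
  rewrite cE; set v := Q *m _.
  have v1 : enorm v = 1 by rewrite On enorm_delta.
  rewrite lerNl; have := dotv_CS v (A *m v); rewrite v1 mul1r.
  have := hc v; rewrite v1 mulr1 => h1 h2.
  by rewrite (le_trans _ h1)// (le_trans _ h2)// -normrN ler_norm.
apply: sumr_ge0 => i i0; rewrite cE; apply: hb.
have [a ->] := hO; rewrite dotvZr dotv_mulmx mulmxA OO mul1mx dotvC dotv_delta.
by rewrite mxE eq_sym (negbTE i0) mulr0.
Qed.

End Spectral.

(** * The normal law *)

Lemma ge0_integral_law d1 d2 (T1 : measurableType d1) (T2 : measurableType d2)
    (R : realType) (mu : {measure set T1 -> \bar R}) (nu : {measure set T2 -> \bar R})
    (f : T1 -> T2) (F : T2 -> \bar R) :
  measurable_fun setT f ->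
  (forall A, measurable A -> mu (f @^-1` A) = nu A) ->
  measurable_fun setT F -> (forall y, (0 <= F y)%E) ->
  (\int[nu]_y F y = \int[mu]_x F (f x))%E.
Proof.
move=> mf h mF F0.
have e := @ge0_integral_pushforward _ _ _ _ R f mf mu setT F measurableT mF
  (fun y _ => F0 y).
rewrite preimage_setT in e; rewrite [RHS](_ : _ = (\int[mu]_x (F \o f) x)%E)// -e.
by apply: eq_measure_integral => A mA _; rewrite -h.
Qed.

Section Normal.
Context {R : realType}.
Local Open Scope ereal_scope.
Notation mu := (@lebesgue_measure R).
Notation N := (normal_prob (0 : R) 1).

Lemma lebesgue_measure_shift (h : R) (A : set R) : measurable A ->
  pushforward mu ((fun x => x + h)%R : _ -> measurableTypeR R) A = mu A.
Proof.
move=> mA.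
have ms : measurable_fun setT ((fun x => x + h)%R : R -> measurableTypeR R).
  by apply: measurable_funD.
apply/esym/lebesgue_measure_unique => //= _ [[a b]] _ <-.
rewrite /pushforward /=.
have -> : (fun x : R => (x + h)%R) @^-1` `]a, b] = `](a - h)%R, (b - h)%R]%classic.
  by apply/seteqP; split => x /=; rewrite !in_itv/= ltrBlDr lerBrDr.
rewrite !lebesgue_measure_itv/= !lte_fin ltrD2r.
by case: ifP => // _; rewrite -!EFinD opprB addrA subrK.
Qed.

Lemma ge0_integral_shift (h : R) (f : R -> \bar R) : measurable_fun setT f ->
  (forall x, 0 <= f x) -> \int[mu]_x f (x + h)%R = \int[mu]_x f x.
Proof.
move=> mf f0; apply/esym.
apply: (@ge0_integral_law _ _ _ _ _ mu mu (fun x : R => (x + h)%R)) => //.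
  by apply: measurable_funD.
by move=> A mA; exact: lebesgue_measure_shift.
Qed.

Lemma ge0_integral_normal (f : R -> \bar R) : measurable_fun setT f ->
  (forall x, 0 <= f x) ->
  \int[N]_x f x = \int[mu]_x (f x * (normal_pdf 0 1 x)%:E).
Proof.
move=> mf f0; have dom := @normal_prob_dominates R 0 1.
have e := @Radon_Nikodym_SigmaFinite.change_of_variables _ _ _ _ _ dom f setT
  f0 measurableT mf.
move: e; set RN := Radon_Nikodym_SigmaFinite.f _ _ => e.
have e' : \int[N]_x f x = \int[mu]_x (f x * RN x) by exact: (esym e).
rewrite e'.
have If := Radon_Nikodym_SigmaFinite.f_integrable dom.
have mRN := measurable_int _ If.
have mpdf : measurable_fun setT (fun x : R => (normal_pdf 0 1 x)%:E).
  by apply/measurable_EFinP; exact: measurable_normal_pdf.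
apply: ge0_ae_eq_integral => //.
- exact: emeasurable_funM.
- exact: emeasurable_funM.
- by move=> x _; rewrite mule_ge0// Radon_Nikodym_SigmaFinite.f_ge0.
- by move=> x _; rewrite mule_ge0// lee_fin normal_pdf_ge0.
- apply: ae_eqe_mul2l; apply: integral_ae_eq => //.
  by move=> E _ mE; rewrite -Radon_Nikodym_SigmaFinite.f_integral.
Qed.

Lemma normal_pdf01 (x : R) : normal_pdf 0 1 x = (normal_peak 1 * expR (- x ^+ 2 / 2))%R.
Proof. by rewrite normal_pdfE ?oner_neq0// /normal_fun subr0 expr1n. Qed.

(** The Cameron-Martin formula in dimension one, by completing the square in the density. *)
Lemma normal_translate (h : R) (f : R -> \bar R) : measurable_fun setT f ->
  (forall x, 0 <= f x) ->
  \int[N]_x (f (x - h)%R * (expR (h * x - h ^+ 2 / 2))%:E) = \int[N]_x f x.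
Proof.
move=> mf f0; rewrite !ge0_integral_normal//; last first.
- by move=> x; rewrite mule_ge0// lee_fin expR_ge0.
- apply: emeasurable_funM; first by apply: (measurableT_comp mf); exact: measurable_funB.
  apply/measurable_EFinP; apply: measurableT_comp => //.
  by apply: measurable_funB => //; exact: measurable_funM.
rewrite -[RHS](ge0_integral_shift (- h)); last first.
- by move=> x; rewrite mule_ge0// lee_fin normal_pdf_ge0.
- apply: emeasurable_funM => //; apply/measurable_EFinP; exact: measurable_normal_pdf.
apply: eq_integral => x _; rewrite -muleA -EFinM; congr (_ * _%:E).
rewrite !normal_pdf01 mulrCA -expRD; congr (_ * expR _)%R; by field.
Qed.

Lemma normal_mgf (h : R) : \int[N]_x (expR (h * x))%:E = (expR (h ^+ 2 / 2))%:E.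
Proof.
have h1 := @normal_translate h (fun=> 1) (measurable_cst _) (fun x => lee01).
have {}h1 : \int[N]_x (1 * (expR (h * x - h ^+ 2 / 2))%:E) = 1.
  by rewrite h1 (integral_cst N measurableT 1) mul1e; exact: probability_setT.
transitivity (\int[N]_x ((expR (h ^+ 2 / 2))%:E * (1 * (expR (h * x - h ^+ 2 / 2))%:E))).
  by apply: eq_integral => x _; rewrite mul1e -EFinM -expRD addrC subrK.
rewrite ge0_integralZl_EFin ?h1 ?mule1 ?expR_ge0//.
- under eq_fun do rewrite mul1e.
  apply/measurable_EFinP; apply: measurableT_comp => //.
  by apply: measurable_funB => //; exact: measurable_funM.
Qed.

Lemma ge0_integral_normalN (f : R -> \bar R) : measurable_fun setT f ->
  (forall x, 0 <= f x) -> \int[N]_x f (- x)%R = \int[N]_x f x.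
Proof.
move=> mf f0.
have mfN : measurable_fun setT (fun x : R => f (- x)%R).
  apply: (measurableT_comp mf); apply: continuous_measurable_fun.
  exact: opp_continuous.
have mpdf : measurable_fun setT (fun x : R => (normal_pdf 0 1 x)%:E).
  by apply/measurable_EFinP; exact: measurable_normal_pdf.
rewrite !ge0_integral_normal//.
have mF : measurable_fun setT (fun x : R => f x * (normal_pdf 0 1 x)%:E).
  exact: emeasurable_funM.
have mN : measurable_fun setT (fun x : R => (- x)%R).
  by apply: continuous_measurable_fun; exact: opp_continuous.
have F0 (x : R) : 0 <= f x * (normal_pdf 0 1 x)%:E.
  by rewrite mule_ge0// lee_fin normal_pdf_ge0.
have e := @ge0_integral_law _ _ _ _ _ mu mu (fun x : R => - x)%R _ mN
  (@lebesgue_measureN R) mF F0.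
rewrite e; apply: eq_integral => x _; congr (_ * _%:E).
by rewrite !normal_pdf01 sqrrN.
Qed.

Lemma measurable_cos : measurable_fun setT (@cos R).
Proof. by apply: continuous_measurable_fun; exact: continuous_cos. Qed.

Lemma measurable_sin : measurable_fun setT (@sin R).
Proof. by apply: continuous_measurable_fun; exact: continuous_sin. Qed.

End Normal.

Section Bounded.
Context d (T : measurableType d) (R : realType) (P : probability T R).

Lemma bounded_integrable (f : T -> R) (M : R) : measurable_fun setT f ->
  (forall x, `|f x| <= M) -> P.-integrable setT (EFin \o f).
Proof.
move=> mf hf; apply: (@le_integrable _ _ _ P setT measurableT _ (EFin \o cst M)).
- exact/measurable_EFinP.
- by move=> x _ /=; rewrite lee_fin (le_trans (hf x))// ler_norm.
- exact: finite_measure_integrable_cst.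
Qed.

Lemma expR_lin_integrable (X : T -> R) (h : R) : measurable_fun setT X ->
  (forall A, measurable A -> P (X @^-1` A) = normal_prob 0 1 A) ->
  P.-integrable setT (fun x => (expR (h * X x))%:E).
Proof.
move=> mX hX.
have mF : measurable_fun setT (fun x : R => (expR (h * x))%:E).
  apply/measurable_EFinP; apply: measurableT_comp => //; exact: measurable_funM.
apply/integrableP; split; first exact: (measurableT_comp mF).
under eq_integral do rewrite gee0_abs ?lee_fin ?expR_ge0//.
rewrite -(@ge0_integral_law _ _ _ _ R P (normal_prob 0 1) X (fun x => (expR (h * x))%:E))//.
  by rewrite normal_mgf ltry.
Qed.

End Bounded.

(** * The characteristic function of the normal law *)

Section CharFun.
Context d (T : measurableType d) (R : realType) (P : probability T R).
Variable X : T -> R.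
Hypothesis mX : measurable_fun setT X.
Hypothesis lX : forall A, measurable A -> P (X @^-1` A) = normal_prob 0 1 A.
Implicit Types f : R -> R.

Let ge0_law (F : R -> \bar R) : measurable_fun setT F -> (forall y, (0 <= F y)%E) ->
  (\int[normal_prob (0:R) 1]_y F y = \int[P]_x F (X x))%E.
Proof. exact: (@ge0_integral_law _ _ _ _ R P (normal_prob 0 1) X F). Qed.

Let mexp (h c : R) : measurable_fun setT (fun x : R => expR (h * x - c)).
Proof.
by apply: measurableT_comp => //; apply: measurable_funB => //; exact: measurable_funM.
Qed.

Lemma law_translate (h : R) (f : R -> \bar R) : measurable_fun setT f ->
  (forall x, 0 <= f x)%E ->
  (\int[P]_t (f (X t - h)%R * (expR (h * X t - h ^+ 2 / 2))%:E) = \int[P]_t f (X t))%E.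
Proof.
move=> mf f0.
have mF : measurable_fun setT (fun x : R => (f (x - h)%R * (expR (h * x - h ^+ 2 / 2))%:E)%E).
  apply: emeasurable_funM; last by apply/measurable_EFinP.
  by apply: (measurableT_comp mf); exact: measurable_funB.
have e1 := ge0_law mF; rewrite -e1; last first.
  by move=> y; rewrite mule_ge0// lee_fin expR_ge0.
by rewrite normal_translate// ge0_law.
Qed.

Let Xint (h : R) : P.-integrable setT (fun t => (expR (h * X t))%:E).
Proof. exact: expR_lin_integrable. Qed.

Lemma normal_abs_integrable (h : R) :
  P.-integrable setT (fun t => (`|X t| * expR (h * X t))%:E).
Proof.
apply: (@le_integrable _ _ _ P setT measurableT _
   ((fun t => (expR ((h + 1) * X t))%:E) \+ (fun t => (expR ((h - 1) * X t))%:E))%E).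
- apply/measurable_EFinP; apply: measurable_funM.
    by apply: (measurableT_comp _ mX); apply: continuous_measurable_fun; exact: norm_continuous.
  by apply: measurableT_comp => //; exact: measurable_funM.
- move=> t _ /=; rewrite lee_fin !mulrDl !expRD mul1r mulN1r -mulrDr.
  rewrite normrM normr_id [leRHS]normrM mulrC ler_wpM2l//.
  apply: le_trans (ler_norm _).
  have := expR_ge1Dx (X t); have := expR_ge1Dx (- X t).
  have := expR_gt0 (X t); have := expR_gt0 (- X t).
  by rewrite ler_norml => *; apply/andP; split; lra.
- by apply: integrableD => //; exact: Xint.
Qed.

Let bint f : measurable_fun setT f -> (forall x, `|f x| <= 1) ->
  P.-integrable setT (fun t => (f (X t))%:E).
Proof.
move=> mf hf; apply: (@bounded_integrable _ _ _ P (f \o X) 1) => // [|t].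
  exact: measurableT_comp.
exact: hf.
Qed.

Let cint (c : R) : P.-integrable setT (fun t => c%:E).
Proof. by apply: (@bounded_integrable _ _ _ P (fun=> c) `|c|). Qed.

Let mcos (s : R) : measurable_fun setT (fun x : R => cos (s * x)).
Proof. by apply: (measurableT_comp (@measurable_cos R)); exact: measurable_funM. Qed.

Let msin (s : R) : measurable_fun setT (fun x : R => sin (s * x)).
Proof. by apply: (measurableT_comp (@measurable_sin R)); exact: measurable_funM. Qed.

(** Both [f + 1] and [1] are nonnegative, and the formula for [f] is the difference of those two
    cases. *)
Lemma law_translate_bounded (h : R) f : measurable_fun setT f ->
  (forall x, `|f x| <= 1) ->
  \int[P]_t (f (X t - h) * expR (h * X t - h ^+ 2 / 2)) = \int[P]_t f (X t).
Proof.
move=> mf hf.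
have hfM x : 0 <= f x + 1 by have := hf x; rewrite ler_norml => /andP[]; lra.
have mfh : measurable_fun setT (fun x : R => f (x - h)).
  by apply: (measurableT_comp mf); exact: measurable_funB.
have iE : P.-integrable setT (fun t => (expR (h * X t - h ^+ 2 / 2))%:E).
  rewrite (_ : (fun x => _) = (fun t => (expR (- (h ^+ 2 / 2)))%:E * (expR (h * X t))%:E)%E).
    by apply: integrableZl => //; exact: Xint.
  by apply/funext => x; rewrite -EFinM -expRD addrC.
have ifE : P.-integrable setT (fun t => (f (X t - h) * expR (h * X t - h ^+ 2 / 2))%:E).
  apply: (le_integrable _ _ _ iE) => //.
    apply/measurable_EFinP; apply: measurable_funM.
      exact: (measurableT_comp mfh mX).
    exact: (measurableT_comp (mexp _ _) mX).
  move=> t _ /=; rewrite lee_fin normrM ler_piMl ?normr_ge0//.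
have h1 (g : R -> R) : measurable_fun setT g -> (forall x, 0 <= g x) ->
   \int[P]_t (g (X t - h) * expR (h * X t - h ^+ 2 / 2)) = \int[P]_t g (X t).
  move=> mg g0; rewrite /Rintegral; congr fine.
  have mg' : measurable_fun setT (EFin \o g) by apply/measurable_EFinP.
  by rewrite -[RHS](@law_translate h (EFin \o g)).
have := h1 (fun x => f x + 1) (measurable_funD mf (measurable_cst _)) hfM.
have := h1 (fun x => 1) (measurable_cst _) (fun=> ler01).
rewrite RintegralD//; last 2 first.
- exact: bint.
- exact: cint.
move=> hM; under eq_Rintegral do rewrite mulrDl.
rewrite RintegralD//; first by rewrite hM => /addIr.
by under eq_fun do rewrite mul1r.
Qed.

Let phi (s : R) := \int[P]_t cos (s * X t).

Lemma normal_sin (s : R) : \int[P]_t sin (s * X t) = 0.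
Proof.
have m1 : measurable_fun setT (fun x : R => (sin (s * x) + 1)%:E).
  by apply/measurable_EFinP; exact: measurable_funD.
have p1 (x : R) : (0 <= (sin (s * x) + 1)%:E)%E.
  by rewrite lee_fin; have := sin_geN1 (s * x); lra.
have mN : measurable_fun setT (fun x : R => - x).
  by apply: continuous_measurable_fun; exact: opp_continuous.
have h1 : \int[P]_t (sin (s * X t) + 1) = \int[P]_t (sin (s * (- X t)) + 1).
  rewrite /Rintegral; congr fine.
  have e2 := ge0_integral_normalN m1 p1; rewrite -(ge0_law m1 p1) -e2.
  by apply: (ge0_law (measurableT_comp m1 mN)) => y; exact: p1.
have is1 : P.-integrable setT (fun t => (sin (s * X t))%:E).
  by apply: (bint (msin s)) => // x; exact: sin_max.
move: h1; under [X in _ = X]eq_Rintegral do rewrite mulrN sinN.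
have is2 : P.-integrable setT (fun t => (- sin (s * X t))%:E).
  by under eq_fun do rewrite EFinN; exact: integrableN.
have i1 := cint 1.
rewrite !RintegralD//.
have -> : \int[P]_t (- sin (s * X t)) = - \int[P]_t sin (s * X t).
  under eq_Rintegral do rewrite -mulN1r.
  by rewrite RintegralZl// mulN1r.
lra.
Qed.

(** The shift by [h] absorbs the exponential; in [sin (s (X + h))] the term with [sin (s X)]
    integrates to [0] by symmetry. *)
Lemma normal_sin_mgf (s h : R) :
  \int[P]_t (sin (s * X t) * expR (h * X t)) = expR (h ^+ 2 / 2) * sin (s * h) * phi s.
Proof.
have ms : measurable_fun setT (fun x : R => sin (s * (x + h))).
  by apply: (measurableT_comp (msin s)); exact: measurable_funD.
have e := @law_translate_bounded h (fun x => sin (s * (x + h))) ms (fun=> sin_max _).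
have i1 : P.-integrable setT (fun t => (sin (s * X t))%:E).
  by apply: (bint (msin s)) => // x; exact: sin_max.
have i2 : P.-integrable setT (fun t => (cos (s * X t))%:E).
  by apply: (bint (mcos s)) => // x; exact: cos_max.
have eR : \int[P]_t sin (s * (X t + h)) = sin (s * h) * phi s.
  under eq_Rintegral do rewrite mulrDr sinD.
  rewrite RintegralD//.
  - by rewrite !RintegralZr// normal_sin mul0r add0r mulrC.
  - exact: (integrableZr _ _ i1).
  - exact: (integrableZr _ _ i2).
rewrite -mulrA -eR -e -RintegralZl//.
  apply: eq_Rintegral => t _.
  by rewrite subrK mulrCA -expRD addrC subrK.
have := Xint h; have mss := measurableT_comp (msin s) mX.
move=> iX; apply: (le_integrable _ _ _ (integrableZl measurableT (expR (- (h ^+ 2 / 2))) iX)) => //.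
  apply/measurable_EFinP; apply: measurable_funM.
    by apply: (measurableT_comp (msin s)); apply: measurable_funD => //; exact: measurable_funB.
  exact: (measurableT_comp (mexp _ _) mX).
move=> t _ /=; rewrite lee_fin subrK normrM -expRD addrC ler_piMl ?normr_ge0//.
exact: sin_max.
Qed.

Lemma is_derive_lin (a x : R) : is_derive a 1 (fun b : R => b * x) x.
Proof.
have := is_deriveZ x (is_derive_id a (1 : R)).
rewrite (_ : x \*: id = (fun b : R => b * x)); last by apply/funext => b; rewrite /= mulrC.
by move=> h; apply: is_derive_eq; rewrite -[_ *: _]/(x * 1) mulr1.
Qed.

Let is_derive_phi (s : R) : is_derive s 1 phi (- \int[P]_t (X t * sin (s * X t))).
Proof.
pose f (a : R) t := cos (a * X t).
have df (a : R) t : is_derive a 1 (f^~ t) (- (X t * sin (a * X t))).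
  have h1 := @is_derive1_comp R cos (fun b => b * X t) a _ _ (is_derive_cos _)
    (is_derive_lin a (X t)).
  by apply: is_derive_eq; rewrite mulNr mulrC.
have aI : (s \in `]s - 1, s + 1[) by rewrite in_itv/=; apply/andP; split; lra.
have fI x : `]s - 1, s + 1[%classic x -> P.-integrable setT (EFin \o f x).
  by move=> _; apply: (bint (mcos x)) => // y; exact: cos_max.
have fd x t : `]s - 1, s + 1[%classic x -> [set: T] t -> derivable (f ^~ t) x 1.
  by move=> _ _; have [] := df x t.
have fE x t : partial1of2 f x t = - (X t * sin (x * X t)).
  by rewrite partial1of2E; exact: derive_val.
have iG : P.-integrable setT (EFin \o (fun t => `|X t|)).
  have := normal_abs_integrable 0.
  by under eq_fun do rewrite mul0r expR0 mulr1.
have Gub x t : `]s - 1, s + 1[%classic x -> [set: T] t -> `|partial1of2 f x t| <= `|X t|.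
  move=> _ _; rewrite fE normrN normrM ler_piMr//; exact: sin_max.
have h := cvg_differentiation_under_integral measurableT aI fI fd
  (fun t => normr_ge0 (X t)) iG Gub.
have ed : derive1 phi s = - \int[P]_t (X t * sin (s * X t)).
  rewrite (differentiation_under_integral measurableT aI fI fd
    (fun t => normr_ge0 (X t)) iG Gub).
  under eq_Rintegral do rewrite fE -mulN1r.
  rewrite RintegralZl ?mulN1r//.
  apply: (le_integrable _ _ _ iG) => //.
    by apply/measurable_EFinP; apply: measurable_funM => //; exact: (measurableT_comp (msin s)).
  move=> t _ /=; rewrite lee_fin normr_id normrM ler_piMr//; exact: sin_max.
rewrite -ed derive1E; apply: derivableP.
exact: (derivable_under_integral measurableT aI fI fd
    (fun t => normr_ge0 (X t)) iG Gub).
Qed.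

(** Differentiating both sides of [normal_sin_mgf] at [h = 0] yields this Stein identity without
    integration by parts. *)
Lemma normal_stein_sin (s : R) : \int[P]_t (X t * sin (s * X t)) = s * phi s.
Proof.
pose f (h : R) t := sin (s * X t) * expR (h * X t).
have df (a : R) t : is_derive a 1 (f^~ t) (X t * (sin (s * X t) * expR (a * X t))).
  have h1 := @is_derive1_comp R expR (fun b => b * X t) a _ _ (is_derive_expR _)
    (is_derive_lin a (X t)).
  have h2 := is_deriveZ (sin (s * X t)) h1.
  apply: (@is_derive_eq _ _ _ _ _ _ _ _ h2).
  by rewrite -[_ *: _]/(sin (s * X t) * (expR (a * X t) * X t)) mulrA mulrC.
have aI : (0 \in `](-1 : R), 1[) by rewrite in_itv/=; apply/andP; split; lra.
pose G t := `|X t| * expR (1 * X t) + `|X t| * expR (-1 * X t).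
have iG : P.-integrable setT (EFin \o G).
  exact: (integrableD measurableT (normal_abs_integrable 1) (normal_abs_integrable (-1))).
have G0 t : 0 <= G t by rewrite addr_ge0// mulr_ge0// expR_ge0.
have hX (x : R) t : `](-1 : R), 1[%classic x -> expR (x * X t) <= expR (1 * X t) + expR (-1 * X t).
  rewrite /= in_itv/= => /andP[x1 x2].
  have [X0|X0] := leP 0 (X t).
    apply: ler_wpDr; first exact: expR_ge0.
    by rewrite ler_expR ler_wpM2r// ltW.
  apply: ler_wpDl; first exact: expR_ge0.
  by rewrite ler_expR ler_wnM2r// ltW.
have mexp0 (x : R) : measurable_fun setT (fun t => expR (x * X t)).
  by apply: measurableT_comp => //; exact: measurable_funM.
have mf (x : R) : measurable_fun setT (f x).
  by apply: measurable_funM => //; exact: (measurableT_comp (msin s)).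
have fI x : `](-1 : R), 1[%classic x -> P.-integrable setT (EFin \o f x).
  move=> _; apply: (le_integrable _ _ _ (Xint x)) => //; first exact/measurable_EFinP.
  by move=> t _ /=; rewrite lee_fin normrM ler_piMl// sin_max.
have fd x t : `](-1 : R), 1[%classic x -> [set: T] t -> derivable (f ^~ t) x 1.
  by move=> _ _; have [] := df x t.
have fE x t : partial1of2 f x t = X t * (sin (s * X t) * expR (x * X t)).
  by rewrite partial1of2E; exact: derive_val.
have Gub x t : `](-1 : R), 1[%classic x -> [set: T] t -> `|partial1of2 f x t| <= G t.
  move=> hx _; rewrite fE /G -mulrDr normrM ler_wpM2l// normrM.
  rewrite (ger0_norm (expR_ge0 _)) (le_trans _ (hX x t hx))//.
  by rewrite ler_piMl ?expR_ge0// sin_max.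
have e1 := differentiation_under_integral measurableT aI fI fd G0 iG Gub.
have e2 : (fun x' => \int[P]_y f x' y) =
    (fun h => expR (h ^+ 2 / 2) * (sin (h * s) * phi s)).
  by apply/funext => h; rewrite normal_sin_mgf -mulrA (mulrC s).
have h1 : is_derive (0 : R) (1 : R) (fun h : R => h ^+ 2 / 2) 0.
  have := is_deriveZ (2^-1 : R) (is_deriveM (is_derive_id (0 : R) 1) (is_derive_id (0 : R) 1)).
  rewrite (_ : _ \*: _ = (fun h : R => h ^+ 2 / 2)); last first.
    by apply/funext => h; exact: mulrC.
  by move=> h; apply: is_derive_eq; rewrite !scale0r addr0 scaler0.
have h2 := @is_derive1_comp R expR (fun h => h ^+ 2 / 2) 0 _ _ (is_derive_expR _) h1.
have h3 := @is_derive1_comp R sin (fun h => h * s) 0 _ _ (is_derive_sin _) (is_derive_lin 0 s).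
have h4 := is_deriveM h2 (is_deriveZ (phi s) h3).
have e3 : derive1 (fun x' => \int[P]_y f x' y) 0 = s * phi s.
  rewrite e2 derive1E.
  have e4 : (fun h => expR (h ^+ 2 / 2) * (sin (h * s) * phi s)) =
      (expR \o (fun h => h ^+ 2 / 2)) \* (phi s \*: (sin \o (fun h => h * s))).
    by apply/funext => h; rewrite /= (mulrC (sin _)).
  rewrite e4 (@derive_val _ _ _ _ _ _ _ h4) /= expr0n !mul0r expR0 cos0.
  rewrite mulr0 scaler0 addr0 mul1r scale1r.
  by rewrite -[_ *: _]/(phi s * s) mulrC.
rewrite -e3 e1; apply: eq_Rintegral => t _.
by rewrite fE mul0r expR0 mulr1.
Qed.

(** By the Stein identity [phi' = - s phi], so the product of [phi s] with [exp (s^2 / 2)] has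
    derivative zero. *)
Lemma normal_cos (s : R) : \int[P]_t cos (s * X t) = expR (- s ^+ 2 / 2).
Proof.
pose F (s : R) := phi s * expR (s ^+ 2 / 2).
have dF (a : R) : is_derive a 1 F 0.
  have h1 : is_derive a (1 : R) (fun h : R => h ^+ 2 / 2) a.
    have := is_deriveZ (2^-1 : R) (is_deriveM (is_derive_id (a : R) 1) (is_derive_id (a : R) 1)).
    rewrite (_ : _ \*: _ = (fun h : R => h ^+ 2 / 2)); last first.
      by apply/funext => h; exact: mulrC.
    move=> h; apply: is_derive_eq.
    rewrite -![_ *: _]/(_ * _) mulr1; lra.
  have h2 := @is_derive1_comp R expR (fun h => h ^+ 2 / 2) a _ _ (is_derive_expR _) h1.
  have h3 := is_derive_phi a; rewrite normal_stein_sin in h3.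
  apply: (@is_derive_eq _ _ _ _ _ _ _ _ (is_deriveM h3 h2)).
  rewrite /= -![_ *: _]/(_ * _); ring.
have := is_derive_0_is_cst s 0 dF; rewrite /F expr0n mul0r expR0 mulr1 => h.
have phi0 : phi 0 = 1.
  rewrite /phi; under eq_Rintegral do rewrite mul0r cos0.
  rewrite Rintegral_cst// mul1r -[RHS]/(fine 1%E); congr fine.
  exact: probability_setT.
rewrite phi0 in h.
have e0 : expR (s ^+ 2 / 2) != 0 by rewrite gt_eqF// expR_gt0.
by rewrite -/(phi s) mulNr expRN; apply: (mulIf e0); rewrite h mulVf.
Qed.

End CharFun.

(** * Independence of Gaussian coordinates *)

Section BoundedExpectation.
Context d (T : measurableType d) (R : realType) (P : probability T R).

Implicit Types f g : T -> R.

Definition bmfun f : Prop := measurable_fun setT f /\ exists M, forall t, `|f t| <= M.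

Lemma bmfunI f : bmfun f -> P.-integrable setT (EFin \o f).
Proof. by move=> [mf [M hM]]; exact: bounded_integrable mf hM. Qed.

Lemma bmfunD f g : bmfun f -> bmfun g -> bmfun (fun t => f t + g t).
Proof.
move=> [mf [M hM]] [mg [N hN]]; split; first exact: measurable_funD.
by exists (M + N) => t; rewrite (le_trans (ler_normD _ _))// lerD.
Qed.

Lemma bmfunM f g : bmfun f -> bmfun g -> bmfun (fun t => f t * g t).
Proof.
move=> [mf [M hM]] [mg [N hN]]; split; first exact: measurable_funM.
by exists (M * N) => t; rewrite normrM ler_pM.
Qed.

Lemma bmfun_cst c : bmfun (fun _ => c).
Proof. by split; [exact: measurable_cst|exists `|c|]. Qed.

Lemma bmfunZ c f : bmfun f -> bmfun (fun t => c * f t).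
Proof. by apply: bmfunM; exact: bmfun_cst. Qed.

Lemma bmfun_cos X : measurable_fun setT X -> bmfun (fun t => cos (X t)).
Proof.
move=> mX; split; first exact: (measurableT_comp (@measurable_cos R)).
by exists 1 => t; exact: cos_max.
Qed.

Lemma bmfun_sin X : measurable_fun setT X -> bmfun (fun t => sin (X t)).
Proof.
move=> mX; split; first exact: (measurableT_comp (@measurable_sin R)).
by exists 1 => t; exact: sin_max.
Qed.

Lemma bmfun_indic (A : set T) : measurable A -> bmfun (\1_A).
Proof.
move=> mA; split; first exact: measurable_indic.
by exists 1 => t; rewrite indicE; case: (_ \in _); rewrite ?normr1 ?normr0.
Qed.

Lemma REbD f g : bmfun f -> bmfun g ->
  \int[P]_t (f t + g t) = \int[P]_t f t + \int[P]_t g t.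
Proof. by move=> bf bg; rewrite RintegralD//; exact: bmfunI. Qed.

Lemma REbZ c f : bmfun f -> \int[P]_t (c * f t) = c * \int[P]_t f t.
Proof. by move=> bf; rewrite RintegralZl//; exact: bmfunI. Qed.

Lemma REb_cst (c : R) : \int[P]_t c = c.
Proof.
rewrite Rintegral_cst// -[RHS]mulr1; congr (_ * _).
by rewrite -[RHS]/(fine 1%E); congr fine; exact: probability_setT.
Qed.

Lemma REb_indic (A : set T) : measurable A -> (\int[P]_t \1_A t)%:E = P A.
Proof.
move=> mA; rewrite /Rintegral fineK.
  by rewrite integral_indic// setIT.
by rewrite integral_indic// setIT fin_num_measure.
Qed.

Lemma cvg_EFinT (u : nat -> R) (l : R) : u n @[n --> \oo] --> l ->
  (u n)%:E @[n --> \oo] --> l%:E.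
Proof. by move=> h; apply: cvg_EFin => //; exact: nearW. Qed.

Lemma REb_cvg (f_ : nat -> T -> R) (f : T -> R) (M : R) : (forall n, measurable_fun setT (f_ n)) ->
  (forall n t, `|f_ n t| <= M) -> (forall t, f_ n t @[n --> \oo] --> f t) ->
  bmfun f /\ \int[P]_t f_ n t @[n --> \oo] --> \int[P]_t f t.
Proof.
move=> mf hM cf.
have mlim : measurable_fun setT f.
  by apply: (measurable_fun_cvg mf) => t _; exact: cf.
have bf : forall t, `|f t| <= M.
  move=> t; have h : `|f_ n t| @[n --> \oo] --> `|f t| by apply: cvg_norm; exact: cf.
  rewrite -(cvg_lim _ h)//; apply: limr_le; first by apply/cvg_ex; exists `|f t|.
  by apply: nearW => n; exact: hM.
have B : bmfun f by split => //; exists M.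
have B_ n : bmfun (f_ n) by split => //; exists M.
split => //.
have [_ _ h] := @dominated_convergence _ _ _ P setT measurableT
  (fun n t => (f_ n t)%:E) (fun t => (f t)%:E) (fun=> M%:E)
  (fun n => (measurable_EFinP _ _).2 (mf n))
  ((measurable_EFinP _ _).2 mlim)
  (aeW _ (fun t _ => cvg_EFinT (cf t)))
  (finite_measure_integrable_cst P M measurableT)
  (aeW _ (fun t n _ => hM n t)).
have e (g : T -> R) : bmfun g -> (\int[P]_t (g t)%:E = (\int[P]_t g t)%:E)%E.
  by move=> bg; rewrite /Rintegral fineK//; apply: integrable_fin_num => //; exact: bmfunI.
rewrite e// in h; have [_ {}h] := (fine_cvgP _ _).1 h.
exact: h.
Qed.

End BoundedExpectation.
Arguments bmfun {d T R} f.

(** * Orthogonality to all cosines implies orthogonality to all indicators *)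

Section TrigDeterminacy.
Context {R : realType}.

(** The phase [b] puts the sines in the class and makes it stable under products, by [cosM_half]. *)
Inductive trigpoly : (R -> R) -> Prop :=
| Trig_cos s b : trigpoly (fun x => cos (s * x + b))
| Trig_add f g : trigpoly f -> trigpoly g -> trigpoly (fun x => f x + g x)
| Trig_scale c f : trigpoly f -> trigpoly (fun x => c * f x).

Lemma cosM_half (a b : R) : cos a * cos b = 2^-1 * (cos (a + b) + cos (a - b)).
Proof. by rewrite cosD cosB; field. Qed.

Lemma trigpolyM f g : trigpoly f -> trigpoly g -> trigpoly (fun x => f x * g x).
Proof.
move=> + hg; elim => [s b|f1 f2 _ h1 _ h2|c f1 _ h1].
- elim: hg => [s' b'|f1 f2 _ h1 _ h2|c f1 _ h1].
  + rewrite (_ : (fun x => _) = fun x => 2^-1 *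
      (cos ((s + s') * x + (b + b')) + cos ((s - s') * x + (b - b')))).
      by apply: Trig_scale; apply: Trig_add; exact: Trig_cos.
    by apply/funext => x; rewrite cosM_half; congr (_ * (cos _ + cos _)); ring.
  + rewrite (_ : (fun x => _) = fun x => cos (s * x + b) * f1 x + cos (s * x + b) * f2 x).
      exact: Trig_add.
    by apply/funext => x; rewrite mulrDr.
  + rewrite (_ : (fun x => _) = fun x => c * (cos (s * x + b) * f1 x)).
      exact: Trig_scale.
    by apply/funext => x; rewrite mulrCA.
- rewrite (_ : (fun x => _) = fun x => f1 x * g x + f2 x * g x).
    exact: Trig_add.
  by apply/funext => x; rewrite mulrDl.
- rewrite (_ : (fun x => _) = fun x => c * (f1 x * g x)).
    exact: Trig_scale.
  by apply/funext => x; rewrite mulrA.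
Qed.

Lemma trigpoly_cont f : trigpoly f -> continuous f.
Proof.
elim => [s b|f1 f2 _ h1 _ h2|c f1 _ h1] x.
- apply: (@continuous_comp _ _ _ (fun x => s * x + b) cos); last exact: continuous_cos.
  by apply: cvgD; [apply: cvgM; [exact: cvg_cst|exact: cvg_id]|exact: cvg_cst].
- by apply: cvgD; [exact: h1|exact: h2].
- by apply: cvgM; [exact: cvg_cst|exact: h1].
Qed.

(** The iterates of [u |-> (3 u - u ^ 3) / 2] converge to the sign of [u] on
    [[-1, 1]]. *)
Fixpoint signit (N : nat) (u : R) : R :=
  if N is N'.+1 then let v := signit N' u in (3 * v - v ^+ 3) / 2 else u.

Lemma signitN N u : signit N (- u) = - signit N u.
Proof. by elim: N => [//|N /= ->]; field. Qed.

(** If [v] is the current iterate, the next defect is [(1 - v)^2 (2 + v) / 2], and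
    [(1 - v) (2 + v) / 2 <= 1 - u / 2] because [v >= u]. *)
Lemma signit_pos u : 0 < u <= 1 -> forall N,
  u <= signit N u <= 1 /\ 1 - signit N u <= (1 - u / 2) ^+ N.
Proof.
move=> /andP[u0 u1]; elim => [|N [/andP[h1 h2] h3]] /=.
  by rewrite expr0; split; [apply/andP; split|]; lra.
set v := signit N u in h1 h2 h3 *.
have e : 1 - (3 * v - v ^+ 3) / 2 = (1 - v) * ((1 - v) * (2 + v) / 2) by field.
have b1 : (1 - v) * (2 + v) / 2 <= 1 - u / 2 by nra.
have b0 : 0 <= (1 - v) * (2 + v) / 2 by nra.
split; last by rewrite e exprSr ler_pM//; lra.
apply/andP; split; last by rewrite -subr_ge0 e mulr_ge0//; lra.
have -> : (3 * v - v ^+ 3) / 2 = v + v * ((1 - v) * (1 + v) / 2) by field.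
by nra.
Qed.

Lemma signit_cvg u : `|u| <= 1 -> signit N u @[N --> \oo] --> Num.sg u.
Proof.
have pos v : 0 < v <= 1 -> signit N v @[N --> \oo] --> (1 : R).
  move=> hv; have [v0 v1] := andP hv.
  apply/cvgrPdist_lt => e e0.
  have h : (1 - v / 2) ^+ N @[N --> \oo] --> (0 : R).
    by apply: cvg_expr; rewrite ger0_norm; lra.
  move/cvgrPdist_lt: h => /(_ _ e0); apply: filter_app; near=> N => hN.
  have [/andP[_ h1] h2] := signit_pos hv N.
  rewrite sub0r normrN ger0_norm in hN; last by rewrite exprn_ge0//; lra.
  by rewrite ger0_norm; lra.
rewrite ler_norml => /andP[um u1]; case: (sgrP u) => [->|u0|u0].
- rewrite (_ : (fun N => _) = fun=> 0); first exact: cvg_cst.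
  by apply/funext; elim => [//|N /= ->]; rewrite expr0n/= mulr0 subr0 mul0r.
- by apply: pos; rewrite u0.
- rewrite (_ : (fun N => _) = fun N => - signit N (- u)); last first.
    by apply/funext => N; rewrite signitN opprK.
  by apply: cvgN; apply: pos; lra.
Unshelve. all: by end_near.
Qed.

Lemma signit_le1 u : `|u| <= 1 -> forall N, `|signit N u| <= 1.
Proof.
move=> h N; have pos v : 0 < v <= 1 -> `|signit N v| <= 1.
  move=> hv; have [/andP[h1 h2] _] := signit_pos hv N.
  by have [? _] := andP hv; rewrite ger0_norm//; lra.
have [u0|u0|<-] := ltgtP 0 u.
- by apply: pos; rewrite u0 (le_trans (ler_norm u)).
- rewrite -(opprK u) signitN normrN; apply: pos; rewrite oppr_gt0 u0 -normrN in h *.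
  by rewrite (le_trans (ler_norm _)).
- suff -> : signit N 0 = 0 by rewrite normr0.
  by elim: (N) => [//|k /= ->]; rewrite expr0n/= mulr0 subr0 mul0r.
Qed.

Context d (T : measurableType d) (P : probability T R).
Variables (Y u : T -> R).
Hypotheses (mY : measurable_fun setT Y) (bu : bmfun u).
Hypothesis ortho : forall s b, \int[P]_t (cos (s * Y t + b) * u t) = 0.

Let bcont (f : R -> R) (M : R) : continuous f -> (forall x, `|f x| <= M) -> bmfun (fun t => f (Y t)).
Proof.
move=> cf hM; split; last by exists M => t; exact: hM.
by apply: (measurableT_comp _ mY); exact: continuous_measurable_fun.
Qed.

Let trig_bounded f : trigpoly f -> exists M : R, forall x, `|f x| <= M.
Proof.
elim => [s b|f1 f2 _ [M h1] _ [M' h2]|c f1 _ [M h1]].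
- by exists 1 => x; exact: cos_max.
- by exists (M + M') => x; rewrite (le_trans (ler_normD _ _))// lerD.
- by exists (`|c| * M) => x; rewrite normrM ler_wpM2l.
Qed.

Let trig_bm f : trigpoly f -> bmfun (fun t => f (Y t)).
Proof. by move=> hf; have [M] := trig_bounded hf; apply: bcont; exact: trigpoly_cont. Qed.

Let trig0 f : trigpoly f -> \int[P]_t (f (Y t) * u t) = 0.
Proof.
elim => [s b|f1 f2 t1 h1 t2 h2|c f1 t1 h1].
- exact: ortho.
- under eq_Rintegral do rewrite mulrDl.
  by rewrite REbD ?h1 ?h2 ?addr0//; apply: bmfunM => //; exact: trig_bm.
- under eq_Rintegral do rewrite -mulrA.
  by rewrite REbZ ?h1 ?mulr0//; apply: bmfunM => //; exact: trig_bm.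
Qed.

Let lim0 (f_ : nat -> R -> R) (f : R -> R) : (forall n, bmfun (fun t => f_ n (Y t))) ->
  (forall n x, `|f_ n x| <= 1) -> (forall x, f_ n x @[n --> \oo] --> f x) ->
  (forall n, \int[P]_t (f_ n (Y t) * u t) = 0) ->
  bmfun (fun t => f (Y t)) /\ \int[P]_t (f (Y t) * u t) = 0.
Proof.
move=> mf hM cf h0; split.
  by have [] := @REb_cvg _ T R P (fun n t => f_ n (Y t)) (fun t => f (Y t)) 1
   (fun n => (mf n).1) (fun n t => hM n _) (fun t => cf _).
have [mu [N hN]] := bu.
have [|n t|t|] := @REb_cvg _ T R P (fun n t => f_ n (Y t) * u t) (fun t => f (Y t) * u t) N.
- by move=> n; have [] := bmfunM (mf n) bu.
- by rewrite normrM -[N]mul1r ler_pM.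
- by apply: cvgM; [exact: cf|exact: cvg_cst].
move=> _ h; rewrite -(cvg_lim _ h)//; under eq_fun do rewrite h0.
by apply: cvg_lim => //; exact: cvg_cst.
Qed.

Let sgpos (v : R) := (Num.sg v + Num.sg v ^+ 2) / 2.

Let sgposE (v : R) : sgpos v = (0 < v)%R%:R.
Proof.
rewrite /sgpos; have [v0|v0|<-] := ltgtP 0 v.
- by rewrite gtr0_sg// expr1n -[(true : nat)%:R]/(1 : R); lra.
- by rewrite ltr0_sg// expr2 mulrNN mulr1 -[(false : nat)%:R]/(0 : R); lra.
- by rewrite sgr0 -[(false : nat)%:R]/(0 : R); lra.
Qed.

Let sin_pos (c : R) (m : nat) :
  let f (x : R) : R := (0 < sin ((x - c) / m.+1%:R))%R%:R in
  bmfun (fun t => f (Y t)) /\ \int[P]_t (f (Y t) * u t) = 0.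
Proof.
pose p N x := signit N (sin ((x - c) / m.+1%:R)).
have tp N : trigpoly (p N).
  elim: N => [|N ih]; rewrite /p/=.
    rewrite (_ : (fun x => _) = (fun x => cos (m.+1%:R^-1 * x + (- c / m.+1%:R - pi / 2)))).
      exact: Trig_cos.
    by apply/funext => x; rewrite addrA cosBpihalf; congr sin; rewrite mulrBl mulNr mulrC.
  rewrite (_ : (fun x => _) = fun x => 3 / 2 * p N x + - 2^-1 * (p N x * (p N x * p N x))).
    apply: Trig_add; first exact: Trig_scale.
    by apply: Trig_scale; do 2 apply: trigpolyM => //.
  by apply/funext => x; rewrite /p; field.
pose r N x := 2^-1 * (p N x + p N x * p N x).
have tr N : trigpoly (r N).
  by apply: Trig_scale; apply: Trig_add => //; exact: trigpolyM.
apply: (@lim0 r).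
- by move=> N; exact: trig_bm.
- move=> N x; have := @signit_le1 _ (sin_max ((x - c) / m.+1%:R)) N.
  rewrite -/(p N x) /r => h; have := h; rewrite ler_norml => /andP[h1 h2].
  by rewrite ler_norml; apply/andP; split; nra.
- move=> x; rewrite -sgposE /sgpos /r expr2.
  have h := @signit_cvg _ (sin_max ((x - c) / m.+1%:R)).
  rewrite mulrC; apply: cvgM; first exact: cvg_cst.
  by apply: cvgD; [exact: h|apply: cvgM; exact: h].
- by move=> N; exact: trig0.
Qed.

(** Once the period is large enough, the sine of [(x - c) / (m + 1)] has the sign of [x - c]. *)
Let ray (c : R) : let f (x : R) : R := (c < x)%R%:R in
  bmfun (fun t => f (Y t)) /\ \int[P]_t (f (Y t) * u t) = 0.
Proof.
apply: (@lim0 (fun m (x : R) => (0 < sin ((x - c) / m.+1%:R))%R%:R)).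
- by move=> m; exact: (sin_pos c m).1.
- by move=> m x; case: (0 < _); rewrite ?normr1 ?normr0.
- move=> x; apply: cvg_near_cst.
  have h : (x - c) / m.+1%:R @[m --> \oo] --> (0 : R).
    rewrite -(mulr0 (x - c)); apply: cvgM; first exact: cvg_cst.
    exact: cvg_harmonic.
  have p0 : 0 < (pi : R) by exact: pi_gt0.
  move/cvgrPdist_lt: h => /(_ _ p0); apply: filter_app; near=> m => hm.
  rewrite sub0r normrN in hm.
  have m0 : 0 < (m.+1%:R : R)^-1 by rewrite invr_gt0.
  congr (_%:R); congr (nat_of_bool _).
  have [cx|xc|->] := ltgtP c x.
  + apply: sin_gt0_pi; rewrite mulr_gt0 ?subr_gt0//=.
    by rewrite (le_lt_trans (ler_norm _)).
  + apply/negbTE; rewrite -leNgt -oppr_ge0 -sinN ltW// sin_gt0_pi//.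
    rewrite oppr_gt0 pmulr_llt0// subr_lt0 xc/=.
    by rewrite -normrN in hm; rewrite (le_lt_trans (ler_norm _)).
  + by rewrite subrr mul0r sin0 ltxx.
- by move=> m; exact: (sin_pos c m).2.
Unshelve. all: by end_near.
Qed.

(** Half-lines generate the Borel sets and are stable under intersection, and the sets whose
    indicator is orthogonal to [u] form a Dynkin system. *)
Lemma trig_determinacy (A : set R) : measurable A ->
  \int[P]_t (\1_A (Y t) * u t) = 0.
Proof.
move=> mA; have [mu [N hN]] := bu.
have bI B : measurable B -> bmfun (fun t => \1_B (Y t) : R).
  move=> mB; split; first by apply: (measurableT_comp _ mY); exact: measurable_indic.
  by exists 1 => t; rewrite indicE; case: (_ \in _); rewrite ?normr1 ?normr0.
pose Q (A : set R) := \int[P]_t (\1_A (Y t) * u t) = 0.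
suff: Q A by [].
have mE : @measurable _ R = <<s @RGenOInfty.G R >>.
  by have := @RGenOInfty.measurableE R; exact: id.
apply: (@dynkin_induction _ R (@RGenOInfty.G R) Q mE) => //.
- move=> _ _ [a ->] [b ->]; exists (Num.max a b).
  by apply/seteqP; split => x /=; rewrite !in_itv/= !andbT gt_max => /andP.
- rewrite /Q; under eq_Rintegral do rewrite indicT mul1r.
  have := ortho 0 0; under eq_Rintegral do rewrite mul0r addr0 cos0 mul1r.
  by [].
- move=> _ [c ->]; rewrite /Q; have [_] := ray c.
  congr (_ = _); apply: eq_Rintegral => t _; congr (_ * _).
  rewrite indicE; congr (_%:R); congr nat_of_bool.
  by apply/idP/idP; rewrite inE/= in_itv/= andbT.
- move=> S mS hS; rewrite /Q.
  have h1 : \int[P]_t u t = 0.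
    by have := ortho 0 0; under eq_Rintegral do rewrite mul0r addr0 cos0 mul1r.
  transitivity (\int[P]_t (u t + -1 * (\1_S (Y t) * u t))).
    apply: eq_Rintegral => t _; rewrite indicC/= indicE.
    by case: (_ \in _); rewrite -?[(~~ true : nat)%:R]/(0 : R) -?[(~~ false : nat)%:R]/(1 : R) -?[(true : nat)%:R]/(1 : R) -?[(false : nat)%:R]/(0 : R); ring.
  rewrite REbD//; last by apply: bmfunZ; apply: bmfunM => //; exact: bI.
  rewrite REbZ ?h1 ?hS ?mulr0 ?addr0//.
  by apply: bmfunM => //; exact: bI.
- move=> F mF tF hF; rewrite /Q.
  pose G n := \big[setU/set0]_(i < n) F i.
  have mG n : measurable (G n) by apply: bigsetU_measurable.
  apply: (@lim0 (fun n => \1_(G n)) (\1_(\bigcup_i F i)) _ _ _ _).2.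
  + by move=> n; exact: bI.
  + by move=> n x; rewrite indicE; case: (_ \in _); rewrite ?normr1 ?normr0.
  + move=> x; apply: cvg_near_cst.
    have [[i _ Fi]|nF] := pselect ((\bigcup_i F i) x).
      near=> n; rewrite !indicE !mem_set//; first by exists i.
      rewrite /G -bigcup_mkord; exists i => //=.
      by near: n; exists i.+1.
    apply: nearW => n; rewrite !indicE !memNset// => h; apply: nF.
    by move: h; rewrite /G -bigcup_mkord => -[i _ Fi]; exists i.
  + elim => [|n ih].
      rewrite /G; under eq_Rintegral do rewrite big_ord0 indic0 mul0r.
      exact: REb_cst.
    transitivity (\int[P]_t (\1_(G n) (Y t) * u t + \1_(F n) (Y t) * u t)).
      apply: eq_Rintegral => t _; rewrite -mulrDl /G big_ord_recr/=; congr (_ * _).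
      rewrite !indicE in_setU; case: (boolP (Y t \in F n)) => h; last by rewrite orbF addr0.
      rewrite orbT; case: (boolP (Y t \in _)) => h'; last by rewrite add0r.
      move: h h'; rewrite !inE -bigcup_mkord => h [i /= ni h'].
      by have := tF i n Logic.I Logic.I (ex_intro _ (Y t) (conj h' h)) => e; rewrite e ltnn in ni.
    rewrite REbD ?ih ?hF ?addr0//; apply: bmfunM => //; exact: bI.
- by rewrite -mE.
Unshelve. all: by end_near.
Qed.

End TrigDeterminacy.

(** * Independence deduced from the laws of linear forms *)

Section CramerWold.
Context d (T : measurableType d) (R : realType) (P : probability T R).
Variables (I : finType) (X : I -> T -> R).
Hypothesis mX : forall i, measurable_fun setT (X i).

Let lin (a : I -> R) t := \sum_i a i * X i t.

Hypothesis lX : forall a : I -> R, \sum_i a i ^+ 2 = 1 ->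
  forall A, measurable A -> P (lin a @^-1` A) = normal_prob 0 1 A.

Let mlin a : measurable_fun setT (lin a).
Proof. by apply: measurable_sum => i; exact: measurable_funM. Qed.

Let bcos a c : bmfun (fun t => cos (lin a t + c)).
Proof. by apply: bmfun_cos; exact: measurable_funD. Qed.

Let E_cos a c : \int[P]_t cos (lin a t + c) = cos c * expR (- (\sum_i a i ^+ 2) / 2).
Proof.
have [a0|a0] := eqVneq (\sum_i a i ^+ 2) 0.
  have l0 t : lin a t = 0.
    apply: big1 => i _; have /eqP := psumr_eq0P (fun i _ => sqr_ge0 (a i)) a0 (i := i) isT.
    by rewrite sqrf_eq0 => /eqP ->; rewrite mul0r.
  under eq_Rintegral do rewrite l0 add0r.
  by rewrite REb_cst a0 oppr0 mul0r expR0 mulr1.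
have p0 : 0 < \sum_i a i ^+ 2 by rewrite lt_def a0 sumr_ge0// => i _; exact: sqr_ge0.
pose s := Num.sqrt (\sum_i a i ^+ 2).
have s0 : s != 0 by rewrite gt_eqF ?sqrtr_gt0.
have s2 : s ^+ 2 = \sum_i a i ^+ 2 by rewrite sqr_sqrtr// ltW.
pose a' i := s^-1 * a i.
have a'1 : \sum_i a' i ^+ 2 = 1.
  under eq_bigr do rewrite exprMn.
  by rewrite -mulr_sumr -s2 -exprMn mulVf// expr1n.
have la t : lin a t = s * lin a' t.
  by rewrite /lin mulr_sumr; apply: eq_bigr => i _; rewrite !mulrA mulfV// mul1r.
have bs : bmfun (fun t => sin (s * lin a' t)) by apply: bmfun_sin; exact: measurable_funM.
have bc : bmfun (fun t => cos (s * lin a' t)) by apply: bmfun_cos; exact: measurable_funM.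
transitivity (\int[P]_t (cos c * cos (s * lin a' t) + - sin c * sin (s * lin a' t))).
  by apply: eq_Rintegral => t _; rewrite la cosD; ring.
rewrite REbD ?REbZ//; try by apply: bmfunZ.
by rewrite (normal_cos (mlin a') (lX a'1)) (normal_sin (mlin a') (lX a'1)) mulr0 addr0 s2.
Qed.

Let shift (a : I -> R) (m : I) (s : R) : I -> R := fun i => a i + (i == m)%:R * s.

Let lin_shift a m s t : lin (shift a m s) t = lin a t + s * X m t.
Proof.
rewrite /lin; under eq_bigr do rewrite mulrDl.
rewrite big_split/=; congr (_ + _); rewrite (bigD1 m)//= eqxx mul1r big1 ?addr0//.
by move=> i /negbTE ->; rewrite !mul0r.
Qed.

Let sq_shift a m s : a m = 0 ->
  \sum_i (shift a m s) i ^+ 2 = \sum_i a i ^+ 2 + s ^+ 2.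
Proof.
move=> am; rewrite (bigD1 m)//= [in RHS](bigD1 m)//= /shift am eqxx add0r mul1r expr0n add0r.
rewrite addrC; congr (_ + _); apply: eq_bigr => i /negbTE ->.
by rewrite mul0r addr0.
Qed.

(** Induction over the coordinates. A cosine with a frequency vector [a] that vanishes on the
    coordinates carrying an indicator is carried along, because multiplying it by [cos (e X_m + b)]
    only changes [a] at the new coordinate [m]. Hence the centered function [u] is orthogonal to all
    these cosines, and [trig_determinacy] replaces them by the indicator in [X m]. *)
Let factor (A : I -> set R) (s : seq I) : (forall i, measurable (A i)) -> uniq s ->
  forall a c, (forall i, i \in s -> a i = 0) ->
  \int[P]_t (\prod_(i <- s) \1_(A i) (X i t) * cos (lin a t + c)) =
  \prod_(i <- s) fine (P (X i @^-1` A i)) * \int[P]_t cos (lin a t + c).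
Proof.
move=> mA; have mpre i : measurable (X i @^-1` A i).
  by rewrite -[X in measurable X]setTI; exact: mX.
have bI i : bmfun (fun t => \1_(A i) (X i t) : R) by exact: (bmfun_indic R (mpre i)).
have bp r : bmfun (fun t => \prod_(i <- r) \1_(A i) (X i t) : R).
  elim: r => [|i r ih]; first by under eq_fun do rewrite big_nil; exact: bmfun_cst.
  by under eq_fun do rewrite big_cons; exact: bmfunM.
elim: s => [_ a c _|m s ih /= /andP[ms us] a c a0].
  by rewrite big_nil mul1r; apply: eq_Rintegral => t _; rewrite big_nil mul1r.
have {}ih := ih us.
have a0s i : i \in s -> a i = 0 by move=> h; apply: a0; rewrite inE h orbT.
have am : a m = 0 by apply: a0; rewrite inE eqxx.
pose W t : R := \prod_(i <- s) \1_(A i) (X i t).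
pose p := \prod_(i <- s) fine (P (X i @^-1` A i)).
pose K := p * \int[P]_t cos (lin a t + c).
pose u t := W t * cos (lin a t + c) + - K.
have bW : bmfun W by exact: bp.
have bv : bmfun (fun t => W t * cos (lin a t + c)) by exact: bmfunM.
have bu : bmfun u by apply: bmfunD => //; exact: bmfun_cst.
have ort e b : \int[P]_t (cos (e * X m t + b) * u t) = 0.
  have a1 e' i : i \in s -> shift a m e' i = 0.
    move=> si; rewrite /shift a0s// add0r; case: eqP => [im|_]; last by rewrite mul0r.
    by move: ms; rewrite -im si.
  transitivity (\int[P]_t (2^-1 * (W t * cos (lin (shift a m e) t + (c + b)) +
     W t * cos (lin (shift a m (- e)) t + (c - b))) + - K * cos (lin (shift (fun=> 0) m e) t + b))).
    apply: eq_Rintegral => t _; rewrite !lin_shift /u mulrDr; congr (_ + _).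
      rewrite mulrCA cosM_half -mulrDr mulrCA; congr (_ * (_ * (_ + _))).
        by congr cos; ring.
      by rewrite -cosN; congr cos; ring.
    by rewrite mulrC; congr (_ * cos _); rewrite /lin big1 ?add0r// => i _; rewrite mul0r.
  rewrite REbD; last 2 first.
  - by apply: bmfunZ; apply: bmfunD; exact: bmfunM.
  - exact: bmfunZ.
  rewrite REbZ; last by apply: bmfunD; exact: bmfunM.
  rewrite REbD; [|exact: bmfunM|exact: bmfunM].
  rewrite [X in _ + X]REbZ// !ih; [|exact: a1|exact: a1].
  have z0 : \sum_(i : I) (0 : R) ^+ 2 = 0 by apply: big1 => i _; rewrite expr0n.
  rewrite /K -/p !E_cos !sq_shift// z0.
  rewrite sqrrN add0r cosD cosB !mulNr !mulrDl opprD expRD; by field.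
have := trig_determinacy (mX m) bu ort (mA m).
under eq_Rintegral do rewrite /u mulrDr.
rewrite REbD; [|exact: bmfunM|by apply: bmfunM => //; exact: bmfun_cst].
under [X in _ + X = _]eq_Rintegral do rewrite mulrC.
rewrite REbZ// mulNr => /eqP; rewrite subr_eq0 => /eqP h.
rewrite big_cons -mulrA -/p -/K mulrC.
have <- : \int[P]_t \1_(A m) (X m t) = fine (P (X m @^-1` A m)).
  by rewrite -(REb_indic P (mpre m)).
rewrite -h; apply: eq_Rintegral => t _; by rewrite big_cons -mulrA.
Qed.

(** [cos (s * X i + c)] factors out of the expectation of trigonometric
    functions of the other coordinates, and indicators of half-lines are limits
    of trigonometric polynomials. *)
Lemma gaussian_forms_independent (A : I -> set R) : (forall i, measurable (A i)) ->
  P (\bigcap_i (X i @^-1` A i)) = (\prod_i P (X i @^-1` A i))%E.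
Proof.
move=> mA; have mpre i : measurable (X i @^-1` A i).
  by rewrite -[X in measurable X]setTI; exact: mX.
have := factor mA (index_enum_uniq I) (a := fun=> 0) 0 (fun _ _ => erefl).
have c1 t : cos (lin (fun=> 0) t + 0) = 1.
  by rewrite /lin big1 ?addr0 ?cos0// => i _; rewrite mul0r.
under [X in _ = _ * X -> _]eq_Rintegral do rewrite c1.
rewrite REb_cst mulr1; under eq_Rintegral do rewrite c1 mulr1.
have mcap : measurable (\bigcap_i (X i @^-1` A i)).
  by apply: fin_bigcap_measurable => //; exact: finite_finset.
move=> h; rewrite -(REb_indic P mcap).
transitivity ((\prod_i fine (P (X i @^-1` A i)))%:E); last first.
  rewrite (big_morph (@EFin R) (@EFinM R) erefl); apply: eq_bigr => i _; rewrite fineK//.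
  exact: fin_num_measure.
congr EFin; rewrite -h; apply: eq_Rintegral => t _.
rewrite indicE; case: (boolP (t \in _)) => ht.
  rewrite big1// => i _; rewrite indicE mem_set//.
  by move: ht; rewrite inE => /(_ i Logic.I).
apply/esym/eqP; rewrite prodf_seq_eq0.
move/negP: ht => ht; apply/negPn/negP => /hasPn hn; apply: ht.
rewrite inE => i _; have := hn i (mem_index_enum i).
by rewrite indicE /=; case: (boolP (_ \in _)); rewrite ?inE// eqxx.
Qed.

End CramerWold.

(** * Independent data *)

Section Data.
Context {R : realType} {J : finType}.

(** Families of reals indexed by the finite type [J], encoded as tuples so as to carry the product
    sigma-algebra. *)
Definition data : Type := #|J|.-tuple R.

HB.instance Definition _ := Measurable.on data.

Definition crd (j : J) (d : data) : R := tnth d (enum_rank j).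

Definition mkd (f : J -> R) : data := [tuple f (enum_val i) | i < #|J|].

Lemma crd_mkd f j : crd j (mkd f) = f j.
Proof. by rewrite /crd tnth_mktuple enum_rankK. Qed.

Lemma eq_data d d' : (forall j, crd j d = crd j d') -> d = d'.
Proof. by move=> h; apply: eq_from_tnth => i; have := h (enum_val i); rewrite /crd enum_valK. Qed.

Lemma measurable_crd j : measurable_fun setT (crd j).
Proof. exact: measurable_tnth. Qed.

Lemma measurable_mkd dT (T : measurableType dT) (f : T -> J -> R) :
  (forall j, measurable_fun setT (f^~ j)) -> measurable_fun setT (fun t => mkd (f t)).
Proof.
move=> mf; apply/measurable_fun_tnthP => i.
rewrite (_ : _ \o _ = f^~ (enum_val i)); first exact: mf.
by apply/funext => t /=; rewrite tnth_mktuple.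
Qed.

Definition box (A : J -> set R) : set data := [set d | forall j, A j (crd j d)].

Lemma measurable_box A : (forall j, measurable (A j)) -> measurable (box A).
Proof.
move=> mA; rewrite (_ : box A = \bigcap_j (crd j @^-1` A j)).
  apply: fin_bigcap_measurable => [|j _]; first exact: finite_finset.
  by rewrite -[X in measurable X]setTI; exact: measurable_crd.
by apply/seteqP; split => d h j; [move=> _; exact: h|exact: h].
Qed.

(** Boxes are stable under intersection and generate the sigma-algebra of tuples. *)
Lemma data_measure_unique (m1 m2 : {measure set data -> \bar R}) :
  (m1 setT < +oo)%E ->
  (forall A : J -> set R, (forall j, measurable (A j)) -> m1 (box A) = m2 (box A)) ->
  forall B, measurable B -> m1 B = m2 B.
Proof.
move=> fin h B mB.
pose G : set (set data) := [set C | exists2 A : J -> set R, (forall j, measurable (A j)) & C = box A].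
have GT : G setT.
  by exists (fun=> setT) => //; apply/seteqP; split.
apply: (measure_unique G (fun=> setT)) => //.
- apply/seteqP; split.
    apply: smallest_sub; first exact: smallest_sigma_algebra.
    apply: (big_ind (fun Y => Y `<=` <<s G >>)) => [//|X Y hX hY|i _ C [A mA <-]]; first by rewrite subUset; split.
    apply: sub_sigma_algebra; exists (fun j => if enum_rank j == i then A else setT).
      by move=> j; case: ifP.
    apply/seteqP; split => d /=.
      by move=> [_ h'] j; case: eqP => // ij; rewrite /crd ij.
    move=> h'; split => //; have := h' (enum_val i).
    by rewrite enum_valK eqxx /crd enum_valK.
  apply: smallest_sub; first exact: sigma_algebra_measurable.
  by move=> C [A mA ->]; exact: measurable_box.
- move=> _ _ [A mA ->] [A' mA' ->]; exists (fun j => A j `&` A' j).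
    by move=> j; exact: measurableI.
  apply/seteqP; split => d /=; first by move=> [h1 h2] j; split; [exact: h1|exact: h2].
  by move=> h'; split => j; have [] := h' j.
- by rewrite bigcup_const.
- by move=> _ [A mA ->]; exact: h.
Qed.

Definition mix (Q : pred J) (d d' : data) : data :=
  mkd (fun j => if Q j then crd j d' else crd j d).

Definition shiftd (j : J) (h : R) (d : data) : data :=
  mkd (fun k => if k == j then crd k d + h else crd k d).

Lemma measurable_shiftd j h : measurable_fun setT (shiftd j h).
Proof.
apply: measurable_mkd => k; case: (k == j); last exact: measurable_crd.
by apply: measurable_funD => //; exact: measurable_crd.
Qed.

End Data.
Arguments data R J : clear implicits.

Lemma measurable_sum_cond dT (T : measurableType dT) (R : realType) (I : finType) (Q : pred I)
    (f : I -> T -> R) : (forall i, measurable_fun setT (f i)) ->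
  measurable_fun setT (fun t => \sum_(i | Q i) f i t).
Proof.
move=> mf; under eq_fun do rewrite big_mkcond.
apply: measurable_sum => i; case: (Q i) => //; exact: measurable_cst.
Qed.

Section IndependentData.
Context dT (T : measurableType dT) (R : realType) (P : probability T R) (J : finType).
Variable D : T -> data R J.
Hypothesis mD : measurable_fun setT D.
Hypothesis iD : forall A : J -> set R, (forall j, measurable (A j)) ->
  P (D @^-1` box A) = (\prod_j P ((fun t => crd j (D t)) @^-1` A j))%E.
Implicit Types f : data R J -> \bar R.

Let mDj j : measurable_fun setT (fun t => crd j (D t)).
Proof. exact: (measurableT_comp (measurable_crd j)). Qed.

Lemma eq_law_integral d' (T' : measurableType d') (P' : probability T' R) (D' : T' -> data R J) f :
  measurable_fun setT D' ->
  (forall A : J -> set R, (forall j, measurable (A j)) ->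
    P (D @^-1` box A) = P' (D' @^-1` box A)) ->
  measurable_fun setT f -> (forall d, 0 <= f d)%E ->
  (\int[P]_t f (D t) = \int[P']_t f (D' t))%E.
Proof.
move=> mD' h mf f0.
have u := @data_measure_unique R J (pushforward P D) (pushforward P' D') _ _.
rewrite -(@ge0_integral_law _ _ _ _ R P (pushforward P D) D f)//.
apply: ge0_integral_law => // B mB; apply/esym/u => //.
have : (P (D @^-1` setT) < +oo)%E by rewrite preimage_setT probability_setT ltry.
exact.
Qed.

Let mmix Q : measurable_fun setT (fun tt : T * T => mix Q (D tt.1) (D tt.2)).
Proof.
apply: measurable_mkd => j; case: (Q j).
  exact: (measurableT_comp (mDj j) measurable_snd).
exact: (measurableT_comp (mDj j) measurable_fst).
Qed.

(** For independent coordinates, a block may be replaced by an independent copy without changing the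
    law. This plays the role of conditioning on the coordinates outside [Q], with product measures
    only. *)
Lemma resample (Q : pred J) f : measurable_fun setT f -> (forall d, 0 <= f d)%E ->
  (\int[P]_t f (D t) = \int[P]_t \int[P]_t' f (mix Q (D t) (D t')))%E.
Proof.
move=> mf f0.
rewrite (@eq_law_integral _ _ (P \x P)%E (fun tt => mix Q (D tt.1) (D tt.2)) f)//.
  rewrite (@fubini_tonelli1 _ _ _ _ R P P (fun tt => f (mix Q (D tt.1) (D tt.2))))//.
  exact: (measurableT_comp mf).
move=> A mA; rewrite iD//.
pose A1 j := if Q j then setT else A j; pose A2 j := if Q j then A j else setT.
have mA1 j : measurable (A1 j) by rewrite /A1; case: (Q j).
have mA2 j : measurable (A2 j) by rewrite /A2; case: (Q j).
rewrite (_ : _ @^-1` _ = (D @^-1` box A1) `*` (D @^-1` box A2)).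
  have mb A' : (forall j, measurable (A' j)) -> measurable (D @^-1` box A').
    by move=> ?; rewrite -[X in measurable X]setTI; apply: mD => //; exact: measurable_box.
  transitivity (P (D @^-1` box A1) * P (D @^-1` box A2))%E; last first.
    by apply/esym/product_measure1E; exact: mb.
  rewrite !iD// -big_split/=; apply: eq_bigr => j _; rewrite /A1 /A2.
  by case: (Q j); rewrite preimage_setT; rewrite probability_setT ?mul1e ?mule1.
apply/seteqP; split => -[t t'] /=.
  move=> h; split => j; have := h j; rewrite /mix crd_mkd /A1 /A2; by case: (Q j).
move=> [h1 h2] j; have := h1 j; have := h2 j; rewrite /mix crd_mkd /A1 /A2; by case: (Q j).
Qed.

Lemma law_involution (s : J -> J) f : involutive s ->
  (forall j A, measurable A ->
    P ((fun t => crd (s j) (D t)) @^-1` A) = P ((fun t => crd j (D t)) @^-1` A)) ->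
  measurable_fun setT f -> (forall d, 0 <= f d)%E ->
  (\int[P]_t f (D t) = \int[P]_t f (mkd (fun j => crd (s j) (D t))))%E.
Proof.
move=> sK hs mf f0; apply: eq_law_integral => //; first exact: measurable_mkd.
move=> A mA; rewrite iD//.
rewrite (_ : (fun t => mkd _) @^-1` _ = D @^-1` box (A \o s)).
  rewrite iD => [|j]; last exact: mA.
  rewrite [RHS](reindex_inj (inv_inj sK))/=; apply: eq_bigr => j _.
  by rewrite hs// sK.
apply/seteqP; split => t /= h j; have := h (s j); rewrite crd_mkd /= ?sK//.
Qed.

(** [resample] freezes all coordinates but [j], which leaves the formula in dimension one. *)
Lemma data_translate (j : J) (h : R) f :
  (forall A, measurable A -> P ((fun t => crd j (D t)) @^-1` A) = normal_prob 0 1 A) ->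
  measurable_fun setT f -> (forall d, 0 <= f d)%E ->
  (\int[P]_t (f (shiftd j (- h) (D t)) * (expR (h * crd j (D t) - h ^+ 2 / 2))%:E) =
   \int[P]_t f (D t))%E.
Proof.
move=> lj mf f0.
pose F d : \bar R := (f (shiftd j (- h) d) * (expR (h * crd j d - h ^+ 2 / 2))%:E)%E.
have mF : measurable_fun setT F.
  apply: emeasurable_funM; first by apply: (measurableT_comp mf); exact: measurable_shiftd.
  apply/measurable_EFinP; apply: measurableT_comp => //.
  by apply: measurable_funB => //; apply: measurable_funM => //; exact: measurable_crd.
have F0 d : (0 <= F d)%E by rewrite mule_ge0// lee_fin expR_ge0.
rewrite -[LHS]/(\int[P]_t F (D t))%E (resample (pred1 j) mF F0) (resample (pred1 j) mf f0).
apply: eq_integral => t _.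
pose g (x : R) := f (mkd (fun k => if k == j then x else crd k (D t))).
have mg : measurable_fun setT g.
  by apply: (measurableT_comp mf); apply: measurable_mkd => k; case: (k == j).
have e := @law_translate _ T R P _ (mDj j) lj h g mg (fun=> f0 _).
transitivity (\int[P]_t' (g (crd j (D t') - h)%R * (expR (h * crd j (D t') - h ^+ 2 / 2))%:E))%E; last rewrite e.
all: apply: eq_integral => t' _; rewrite /g /F.
- rewrite {2}/mix crd_mkd/= eqxx; congr (f _ * _)%E.
  by apply: eq_data => k; rewrite !crd_mkd/=; case: eqP => [->|].
- by congr f; apply: eq_data => k; rewrite !crd_mkd/=; case: eqP => [->|].
Qed.

(** Given the coordinates outside the block, the weights [m] are constants, so the form is one
    standard Gaussian variable unless they all vanish. In that case the mean [c] stands in for the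
    value of [phi]: it is what an extra independent Gaussian variable contributes. *)
Lemma block_gaussian (Q : pred J) (m : data R J -> J -> R) (W : data R J -> \bar R)
    (phi : R -> \bar R) :
  (forall a : J -> R, \sum_(j | Q j) a j ^+ 2 = 1 -> forall A, measurable A ->
    P ((fun t => \sum_(j | Q j) a j * crd j (D t)) @^-1` A) = normal_prob 0 1 A) ->
  (forall d d', m (mix Q d d') = m d) -> (forall d d', W (mix Q d d') = W d) ->
  (forall j, measurable_fun setT (m^~ j)) -> measurable_fun setT W ->
  measurable_fun setT phi -> (forall d, 0 <= W d)%E -> (forall x, 0 <= phi x)%E ->
  (forall d, \sum_(j | Q j) m d j ^+ 2 = 0 \/ \sum_(j | Q j) m d j ^+ 2 = 1) ->
  let c := (\int[normal_prob (0 : R) 1]_x phi x)%E in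
  (\int[P]_t (W (D t) * (if (\sum_(j | Q j) m (D t) j ^+ 2 == 0)%R then c
     else phi (\sum_(j | Q j) m (D t) j * crd j (D t))%R))
   = \int[P]_t W (D t) * c)%E.
Proof.
move=> lQ mm mW Mm MW Mphi W0 phi0 m01 c.
have c0 : (0 <= c)%E by exact: integral_ge0.
pose S d := \sum_(j | Q j) m d j ^+ 2.
pose L d := \sum_(j | Q j) m d j * crd j d.
have MS : measurable_fun setT S by apply: measurable_sum_cond => j; exact: measurable_funX.
have ML : measurable_fun setT L.
  by apply: measurable_sum_cond => j; apply: measurable_funM => //; exact: measurable_crd.
pose f d := (W d * (if S d == 0%R then c else phi (L d)))%E.
have Mf : measurable_fun setT f.
  apply: emeasurable_funM => //; apply: measurable_fun_ifT => //.
    exact: measurable_fun_eqr.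
  exact: (measurableT_comp Mphi).
have f0 d : (0 <= f d)%E by rewrite mule_ge0//; case: ifP.
rewrite -[LHS]/(\int[P]_t f (D t))%E (resample Q Mf f0).
transitivity (\int[P]_t (W (D t) * c))%E; last first.
  rewrite ge0_integralZr//; exact: (measurableT_comp MW).
apply: eq_integral => t _; rewrite /f.
have Sm d d' : S (mix Q d d') = S d by rewrite /S mm.
have [S0|S0] := eqVneq (S (D t)) 0.
  under eq_integral do rewrite mW Sm S0 eqxx.
  rewrite integral_cst// -[RHS]mule1; congr (_ * _)%E; exact: probability_setT.
have S1 : S (D t) = 1 by have [h|//] := m01 (D t); rewrite /S h eqxx in S0.
under eq_integral do rewrite mW Sm S1 oner_eq0 /L mm.
rewrite ge0_integralZl//; last first.
  apply: (measurableT_comp Mphi); apply: measurable_sum_cond => j.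
  apply: measurable_funM => //; apply: (measurableT_comp (measurable_crd j)).
  exact: (measurableT_comp (mmix Q) (pair1_measurable t)).
congr (_ * _)%E; rewrite /c.
rewrite (@ge0_integral_law _ _ _ _ R P (normal_prob 0 1) (fun t' => \sum_(j | Q j) m (D t) j * crd j (D t')))//.
- by apply: eq_integral => t' _; congr phi; apply: eq_bigr => j Qj; rewrite crd_mkd Qj.
- by apply: measurable_sum_cond => j; exact: measurable_funM.
- exact: lQ.
Qed.

End IndependentData.

(** * The operator norm of a Gaussian matrix *)

Section Lattice.
Context {R : realType}.

Definition lat (k : nat) : finType := {ffun 'I_k -> bool * 'I_(4 * k + 1)}.

(** The points of [[-1, 1]^k] with coordinates in [Z / (4 sqrt k)]. *)
Definition latv k (f : lat k) : 'cV[R]_k :=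
  \col_i ((-1) ^+ (f i).1 * ((f i).2%:R / (4 * Num.sqrt k%:R))).

(** Subprobability weights in product form, geometric in the size of each coordinate; they replace a
    count of the lattice points of the unit ball. *)
Definition latw k (f : lat k) : R := \prod_i (4^-1 * 2^-1 ^+ (f i).2).

Lemma latw_gt0 k (f : lat k) : 0 < latw f.
Proof. by apply: prodr_gt0 => i _; rewrite mulr_gt0// exprn_gt0. Qed.

Lemma latw_sum k : \sum_(f : lat k) latw f <= 1.
Proof.
have -> : \sum_(f : lat k) latw f =
    \prod_(i < k) \sum_(x : bool * 'I_(4 * k + 1)) (4^-1 * 2^-1 ^+ x.2).
  by rewrite bigA_distr_bigA.
have geo m : \sum_(i < m) (2^-1 : R) ^+ i <= 2.
  suff -> : \sum_(i < m) (2^-1 : R) ^+ i = 2 - 2 * 2^-1 ^+ m.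
    by rewrite gerBl mulr_ge0// exprn_ge0.
  elim: m => [|m ih]; first by rewrite big_ord0 expr0 mulr1 subrr.
  by rewrite big_ord_recr/= ih exprS; field.
apply: (@le_trans _ _ (\prod_(i < k) (1 : R))); last by rewrite big1.
apply: ler_prod => i _; apply/andP; split.
  by apply: sumr_ge0 => x _; rewrite mulr_ge0// exprn_ge0.
rewrite -(pair_bigA _ (fun (b : bool) (x : 'I_(4 * k + 1)) => 4^-1 * 2^-1 ^+ x))/=.
rewrite big_bool/= -!mulr_sumr; have := geo (4 * k + 1)%N; lra.
Qed.

(** Integers satisfy [m <= m^2], so the sizes of the scaled coordinates sum to at most [16 k |v|^2];
    the factor [1 / 4] per coordinate raises the exponent to [18]. *)
Lemma latw_ge k (f : lat k) : (0 < k)%N -> enorm (latv f) <= 1 ->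
  ((2 : R) ^+ 18) ^- k <= latw f.
Proof.
move=> k0 f1; have k0' : 0 < (k%:R : R) by rewrite ltr0n.
have s1 : \sum_i (f i).2%:R <= 16 * (k%:R : R).
  have e : \sum_i ((f i).2%:R : R) ^+ 2 = 16 * k%:R * dotv (latv f) (latv f).
    rewrite dotv_sq mulr_sumr; apply: eq_bigr => i _; rewrite mxE !exprMn.
    rewrite sqrr_sign mul1r exprVn exprMn sqr_sqrtr ?ler0n//.
    by field; rewrite gt_eqF.
  have h2 : dotv (latv f) (latv f) <= 1.
    by rewrite -enorm_sq expr_le1// enorm_ge0.
  apply: (@le_trans _ _ (\sum_i ((f i).2%:R : R) ^+ 2)).
    apply: ler_sum => i _; rewrite -natrX ler_nat; case: (nat_of_ord _) => // m.
    by rewrite expnS expn1 leq_pmulr.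
  by rewrite e ler_piMr// mulr_ge0.
have s2 : (\sum_i (f i).2 <= 16 * k)%N by rewrite -(ler_nat R) natr_sum natrM.
have -> : latw f = (4^-1) ^+ k * 2^-1 ^+ (\sum_i (f i).2).
  rewrite /latw big_split/= prodr_const card_ord; congr (_ * _).
  by rewrite (big_morph (GRing.exp 2^-1) (exprD _) (expr0 _)).
have -> : (2 ^+ 18) ^- k = (4^-1 : R) ^+ k * 2^-1 ^+ (16 * k).
  rewrite -exprVn -(exprVn 2) (_ : 4 = 2 ^+ 2); last by ring.
  by rewrite -exprVn -!exprM -exprD; congr (_ ^+ _); lia.
rewrite ler_pM2l ?exprn_gt0// ?invr_gt0//.
by apply: ler_wiXn2l => //; lra.
Qed.

(** Rounding each coordinate towards zero does not increase the norm and costs at most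
    [1 / (4 sqrt k)] per coordinate. *)
Lemma lat_round k (u : 'cV[R]_k) : (0 < k)%N -> enorm u <= 1 ->
  exists f, enorm (latv f) <= 1 /\ enorm (u - latv f) <= 1 / 4.
Proof.
move=> k0 u1; have k0' : 0 < (k%:R : R) by rewrite ltr0n.
have k1 : 1 <= (k%:R : R) by rewrite ler1n.
pose s := 4 * Num.sqrt (k%:R : R).
have s0 : 0 < s by rewrite mulr_gt0// sqrtr_gt0.
have s2 : s ^+ 2 = 16 * k%:R by rewrite exprMn sqr_sqrtr ?ler0n//; ring.
pose N i := Num.truncn (s * `|u i 0|).
have N1 i : (N i)%:R <= s * `|u i 0| by rewrite truncn_le mulr_ge0// ltW.
have N2 i : s * `|u i 0| < (N i).+1%:R by exact: truncnS_gt.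
have N3 i : (N i < 4 * k + 1)%N.
  rewrite addn1 ltnS -(ler_nat R) natrM (le_trans (N1 i))//.
  have : `|u i 0| <= 1 by rewrite (le_trans (abs_coord_enorm _ _)).
  have sk : s <= 4 * k%:R.
    have s0' := ltW s0; have k4 : 0 <= 4 * (k%:R : R) by rewrite mulr_ge0.
    rewrite -ler_sqr ?nnegrE// s2 exprMn.
    by move: (k%:R : R) k1 => kr kr1; nra.
  by have := normr_ge0 (u i 0); nra.
pose f : lat k := [ffun i => (u i 0 < 0, Ordinal (N3 i))].
have fE i : latv f i 0 = (-1) ^+ (u i 0 < 0)%R * ((N i)%:R / s) by rewrite mxE ffunE.
have uE i : u i 0 = (-1) ^+ (u i 0 < 0)%R * `|u i 0|.
  by rewrite {1}(realEsign (num_real (u i 0))).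
exists f; split.
  apply: le_trans u1; rewrite ler_wsqrtr// !dotv_sq; apply: ler_sum => i _.
  rewrite fE [leRHS]expr2 {2 3}uE -expr2 !exprMn !sqrr_sign !mul1r -exprMn.
  by rewrite ler_sqr ?nnegrE ?divr_ge0 ?(ltW s0)// ler_pdivrMr// mulrC.
have -> : 1 / 4 = Num.sqrt ((1 / 4) ^+ 2 : R) by rewrite sqrtr_sqr ger0_norm//; lra.
rewrite ler_wsqrtr// dotv_sq.
apply: (@le_trans _ _ (\sum_(i < k) s ^- 2)).
  apply: ler_sum => i _; rewrite mxE [(- latv f) i 0]mxE fE {1}uE -mulrBr exprMn sqrr_sign mul1r.
  have -> : `|u i 0| - (N i)%:R / s = (s * `|u i 0| - (N i)%:R) / s by field; rewrite gt_eqF.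
  rewrite exprMn -exprVn ler_piMl ?exprn_ge0 ?invr_ge0 ?(ltW s0)//.
  have := N1 i; have := N2 i; rewrite -natr1 => h1 h2.
  by rewrite expr_le1//; lra.
rewrite sumr_const card_ord s2 -[_ *+ k]mulr_natr.
have -> : (16 * k%:R)^-1 * k%:R = (1 / 4) ^+ 2 :> R by field; rewrite gt_eqF.
by [].
Qed.

(** With [K = opnorm G], rounding the two unit vectors costs [K / 4] each, so [K <= L + K / 2]. *)
Lemma opnorm_lattice n p (G : 'M[R]_(n, p)) (L : R) : (0 < n)%N -> (0 < p)%N ->
  (forall (f : lat n) (g : lat p), enorm (latv f : 'cV[R]_n) <= 1 -> enorm (latv g : 'cV[R]_p) <= 1 ->
    dotv (latv f) (G *m latv g) <= L) ->
  opnorm G <= 2 * L.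
Proof.
move=> n0 p0 h.
set K := opnorm G; have K0 : 0 <= K := opnorm_ge0 _.
suff : K <= L + K / 2 by lra.
apply: opnorm_le => v v1.
have [u [u1 uv]] : exists u, enorm u <= 1 /\ dotv u (G *m v) = enorm (G *m v).
  have [Gv|Gv] := eqVneq (G *m v) 0.
    by exists 0; rewrite enorm0 ler01 dotv0l Gv enorm0.
  exists ((enorm (G *m v))^-1 *: (G *m v)).
  have e0 : enorm (G *m v) != 0 by rewrite enorm_eq0.
  split; last by rewrite dotvZl -enorm_sq expr2 mulKf.
  by rewrite enormZ ger0_norm ?invr_ge0 ?enorm_ge0// mulVf.
have [f [f1 f2]] := lat_round n0 u1; have [g [g1 g2]] := lat_round p0 v1.
have -> : enorm (G *m v) = dotv (latv f) (G *m latv g) +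
    dotv (u - latv f) (G *m v) + dotv (latv f) (G *m (v - latv g)).
  by rewrite mulmxBr dotvBl dotvBr uv; ring.
have b1 : dotv (u - latv f) (G *m v) <= K / 4.
  apply: le_trans (ler_norm _) _; apply: le_trans (dotv_CS _ _) _.
  have := opnormP G v; rewrite -/K.
  have := enorm_ge0 (G *m v); have := enorm_ge0 (u - latv f); nra.
have b2 : dotv (latv f) (G *m (v - latv g)) <= K / 4.
  apply: le_trans (ler_norm _) _; apply: le_trans (dotv_CS _ _) _.
  have := opnormP G (v - latv g); rewrite -/K.
  have := enorm_ge0 (G *m (v - latv g)); have := enorm_ge0 (latv f).
  have := enorm_ge0 (v - latv g); nra.
by have := h f g f1 g1; lra.
Qed.

(** A weight that is symmetric in the rows of [G], has expectation at most [1]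
    for a Gaussian matrix, and dominates the moments of its operator norm. *)
Definition lam n p (G : 'M[R]_(n, p)) : R := expR (- n%:R / 2) *
  \sum_(f : lat n | enorm (latv f) <= 1) \sum_(g : lat p | enorm (latv g) <= 1)
    latw f * latw g * expR (Num.sqrt n%:R * dotv (latv f) (G *m latv g)).

Lemma lam_ge0 n p (G : 'M[R]_(n, p)) : 0 <= lam G.
Proof.
rewrite mulr_ge0 ?expR_ge0// sumr_ge0// => f _; rewrite sumr_ge0// => g _.
by rewrite mulr_ge0 ?expR_ge0// mulr_ge0// ltW ?latw_gt0.
Qed.

Lemma enorm0_le1 k : enorm (0 : 'cV[R]_k) <= 1.
Proof. by rewrite enorm0. Qed.

(** [lam G] dominates each of its terms, whose weights are bounded below by [latw_ge]; the largest
    exponent controls the norm within a factor two. *)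
Lemma lam_opnorm n p (G : 'M[R]_(n, p)) : (0 < n)%N -> (0 < p)%N ->
  expR (Num.sqrt n%:R * opnorm G / 2) <= lam G * (expR (n%:R / 2) * (2 ^+ 18) ^+ (n + p)).
Proof.
move=> n0 p0; set E := expR (n%:R / 2) * _.
have sn : 0 < Num.sqrt (n%:R : R) by rewrite sqrtr_gt0 ltr0n.
have E0 : 0 < E by rewrite mulr_gt0 ?expR_gt0// !exprn_gt0.
have h f g : enorm (latv f) <= 1 -> enorm (latv g) <= 1 ->
    expR (Num.sqrt n%:R * dotv (latv f) (G *m latv g)) <= lam G * E.
  move=> f1 g1; set t := expR _.
  have t0 : 0 < t by exact: expR_gt0.
  have w1 := latw_ge n0 f1; have w2 := latw_ge p0 g1.
  have w : (2 ^+ 18) ^- (n + p) <= latw f * latw g.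
    by rewrite exprD invfM ler_pM// invr_ge0 ?exprn_ge0.
  have l1 : expR (- n%:R / 2) * (latw f * latw g * t) <= lam G.
    rewrite /lam ler_wpM2l ?expR_ge0// (bigD1 f)//= (bigD1 g)//= -addrA lerDl.
    rewrite addr_ge0//.
      by apply: sumr_ge0 => g' _; rewrite mulr_ge0 ?expR_ge0// mulr_ge0// ltW ?latw_gt0.
    apply: sumr_ge0 => f' _; apply: sumr_ge0 => g' _.
    by rewrite mulr_ge0 ?expR_ge0// mulr_ge0// ltW ?latw_gt0.
  apply: le_trans (ler_wpM2r (ltW E0) l1).
  rewrite /E mulNr expRN; set e := expR (n%:R / 2).
  have e0 : 0 < e by exact: expR_gt0.
  have -> : e^-1 * (latw f * latw g * t) * (e * (2 ^+ 18) ^+ (n + p)) =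
     t * (latw f * latw g * (2 ^+ 18) ^+ (n + p)) by field; rewrite gt_eqF.
  rewrite ler_peMr ?(ltW t0)//.
  by rewrite -ler_pdivrMr ?exprn_gt0// ?exprn_gt0// mul1r.
have lE : 0 < lam G * E.
  have [f [f1 _]] := lat_round n0 (u := 0) (enorm0_le1 _).
  have [g [g1 _]] := lat_round p0 (u := 0) (enorm0_le1 _).
  exact: lt_le_trans (expR_gt0 _) (h f g f1 g1).
rewrite -(lnK lE) ler_expR -mulrA mulrC -ler_pdivlMr//.
set L := ln _ / _.
have {}h f g : enorm (latv f) <= 1 -> enorm (latv g) <= 1 ->
    dotv (latv f) (G *m latv g) <= L.
  by move=> f1 g1; rewrite ler_pdivlMr// mulrC -ler_expR (lnK lE) h.
by have := opnorm_lattice n0 p0 h; lra.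
Qed.

Lemma opnorm_moment (delta : R) (M : nat) : 0 < delta ->
  exists2 C, 0 <= C & forall n p (G : 'M[R]_(n, p)), (0 < n)%N -> (0 < p)%N ->
    p%:R <= n%:R / delta ->
    (1 + opnorm G / Num.sqrt n%:R) ^+ M <= C * (1 + lam G).
Proof.
(* [n c] bounds the logarithm of the factor lost in [lam_opnorm], by [2 <= e]. Where [K / 2 <= c]
   the moment is bounded outright; elsewhere [expR (n (K / 2 - c)) <= lam G] beats any power of [K],
   uniformly in [n]. *)
move=> d0; pose c : R := 1 / 2 + 18 * (1 + delta^-1).
pose a : R := (2 * M.+1%:R + 1) ^+ M.
have c0 : 0 <= c by have := invr_gt0 delta; rewrite d0 /c; lra.
have a0 : 0 <= a by rewrite exprn_ge0// addr_ge0// mulr_ge0.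
exists ((1 + 2 * c) ^+ M + a * expR c); first by rewrite addr_ge0 ?mulr_ge0 ?expR_ge0// exprn_ge0//; lra.
move=> n p G n0 p0 pn; have n0' : 0 < (n%:R : R) by rewrite ltr0n.
have n1 : 1 <= (n%:R : R) by rewrite ler1n.
have sn : 0 < Num.sqrt (n%:R : R) by rewrite sqrtr_gt0.
set K := opnorm G / _; have K0 : 0 <= K by rewrite divr_ge0 ?opnorm_ge0 ?ltW.
have L0 := lam_ge0 G.
have nK : Num.sqrt n%:R * opnorm G / 2 = n%:R * (K / 2).
  rewrite -[X in _ = X * _](@sqr_sqrtr _ n%:R) ?ler0n// /K; field; rewrite gt_eqF//.
have := lam_opnorm G n0 p0; rewrite nK => h.
have h2 : expR (n%:R * (K / 2 - c)) <= lam G.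
  rewrite mulrBr expRD expRN ler_pdivrMr ?expR_gt0//.
  apply: le_trans h _; rewrite ler_wpM2l//.
  have e2 : (2 : R) <= expR 1 by have := expR_ge1Dx (1 : R); lra.
  have -> : n%:R * c = n%:R / 2 + (18 * (n%:R + n%:R / delta)) by rewrite /c; field; rewrite gt_eqF.
  rewrite expRD ler_wpM2l ?expR_ge0// -exprM.
  apply: (@le_trans _ _ (expR 1 ^+ (18 * (n + p)))).
    by apply: lerXn2r; rewrite ?nnegrE ?expR_ge0.
  by rewrite -expRM_natl mulr1 ler_expR natrM natrD; lra.
have [Kc|cK] := leP (K / 2) c.
  have : (1 + K) ^+ M <= (1 + 2 * c) ^+ M by apply: lerXn2r; rewrite ?nnegrE; lra.
  move=> /le_trans; apply.
  have X0 : 0 <= (1 + 2 * c) ^+ M by rewrite exprn_ge0//; lra.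
  have Y0 : 0 <= a * expR c by rewrite mulr_ge0 ?expR_ge0.
  nra.
have e : (1 + K) ^+ M <= a * expR (K / 2).
  have M0 : 0 < (M.+1%:R : R) by rewrite ltr0n.
  have l1 : 1 + K <= (2 * M.+1%:R + 1) * expR (K / (2 * M.+1%:R)).
    have := expR_ge1Dx (K / (2 * M.+1%:R)).
    set b := K / _; have b0 : 0 <= b by rewrite divr_ge0// mulr_ge0// ltW.
    have -> : K = 2 * M.+1%:R * b by rewrite /b; field; rewrite gt_eqF.
    have M1 : 1 <= (M.+1%:R : R) by rewrite ler1n.
    move: M.+1%:R M1 => m m1; nra.
  apply: (@le_trans _ _ (((2 * M.+1%:R + 1) * expR (K / (2 * M.+1%:R))) ^+ M)).
    apply: lerXn2r => //; rewrite nnegrE; first by rewrite addr_ge0.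
    by rewrite mulr_ge0 ?expR_ge0// addr_ge0// mulr_ge0.
  rewrite exprMn -/a ler_wpM2l// -expRM_natl ler_expR.
  rewrite mulrC mulrAC -mulrA ler_wpM2l//.
  rewrite -natr1 invfM mulrA ler_pdivrMr ?ltr_wpDl// ?natr1//.
  by rewrite mulrC ler_pM2l ?invr_gt0// -natr1; lra.
apply: le_trans e _.
have h3 : expR (K / 2 - c) <= lam G.
  apply: le_trans h2; rewrite ler_expR; nra.
have -> : expR (K / 2) = expR c * expR (K / 2 - c) by rewrite -expRD addrC subrK.
have X0 : 0 <= (1 + 2 * c) ^+ M by rewrite exprn_ge0//; lra.
have Y0 : 0 <= a * expR c by rewrite mulr_ge0 ?expR_ge0.
rewrite mulrA; nra.
Qed.

(** Permuting the coordinates of the left lattice vectors in the same way preserves their norms and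
    their weights. *)
Lemma lam_row_involution n p (s : 'I_n -> 'I_n) (G : 'M[R]_(n, p)) : involutive s ->
  lam (\matrix_(i, j) G (s i) j) = lam G.
Proof.
move=> sK; rewrite /lam; congr (_ * _).
pose t (f : lat n) : lat n := [ffun i => f (s i)].
have tK : involutive t by move=> f; apply/ffunP => i; rewrite !ffunE sK.
have lt f i : latv (t f) i 0 = latv f (s i) 0 by rewrite !mxE ffunE.
rewrite (reindex_inj (inv_inj tK))/=; apply: eq_big => [f|f _].
  congr (Num.sqrt _ <= _); rewrite !dotv_sq (reindex_inj (inv_inj sK))/=.
  by apply: eq_bigr => i _; rewrite lt sK.
apply: eq_bigr => g _; congr (_ * _ * expR (_ * _)).
  rewrite /latw (reindex_inj (inv_inj sK))/=; apply: eq_bigr => i _.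
  by rewrite ffunE sK.
rewrite !dotvE (reindex_inj (inv_inj sK))/=; apply: eq_bigr => i _.
rewrite lt sK; congr (_ * _); rewrite !mxE; apply: eq_bigr => j _.
by rewrite mxE sK.
Qed.

End Lattice.

Lemma ge0_Eint_sum dT (T : measurableType dT) (R : realType) (mu : {measure set T -> \bar R})
    (I : finType) (Q : pred I) (f : I -> T -> R) :
  (forall i, measurable_fun setT (f i)) -> (forall i t, 0 <= f i t) ->
  (\int[mu]_t (\sum_(i | Q i) f i t)%:E = \sum_(i | Q i) \int[mu]_t (f i t)%:E)%E.
Proof.
move=> mf f0; rewrite [RHS]big_mkcond.
under eq_integral do rewrite big_mkcond -sumEFin.
rewrite ge0_integral_sum//; last 2 first.
- by move=> i; apply/measurable_EFinP; case: (Q i).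
- by move=> i t _; rewrite lee_fin; case: (Q i).
by apply: eq_bigr => i _; case: (Q i) => //; exact: integral0.
Qed.

Section GaussianMatrix.
Context dT (T : measurableType dT) (R : realType) (P : probability T R) (J : finType).
Variable D : T -> data R J.
Hypothesis mD : measurable_fun setT D.
Hypothesis iD : forall A : J -> set R, (forall j, measurable (A j)) ->
  P (D @^-1` box A) = (\prod_j P ((fun t => crd j (D t)) @^-1` A j))%E.
Variables (K : finType) (c : K -> J).
Hypothesis inj_c : injective c.
Hypothesis lD : forall k A, measurable A ->
  P ((fun t => crd (c k) (D t)) @^-1` A) = normal_prob 0 1 A.

Let mDc k : measurable_fun setT (fun t => crd (c k) (D t)).
Proof. exact: (measurableT_comp (measurable_crd (c k))). Qed.

(** The coordinates are integrated out one at a time by the Cameron-Martin shift, which leaves the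
    remaining factors untouched. *)
Lemma exp_linear_form (h : K -> R) :
  (\int[P]_t (expR (\sum_k h k * crd (c k) (D t)))%:E = (expR (\sum_k h k ^+ 2 / 2))%:E)%E.
Proof.
pose F (s : seq K) (d : data R J) := expR (\sum_(k <- s) (h k * crd (c k) d - h k ^+ 2 / 2)).
have mF s : measurable_fun setT (F s).
  apply: measurableT_comp => //; elim: s => [|k s ih].
    by under eq_fun do rewrite big_nil; exact: measurable_cst.
  under eq_fun do rewrite big_cons; apply: measurable_funD => //.
  by apply: measurable_funB => //; apply: measurable_funM => //; exact: measurable_crd.
have main s : uniq s -> (\int[P]_t (F s (D t))%:E = 1)%E.
  elim: s => [_|k s ih /= /andP[ks us]].
    rewrite (eq_integral (cst 1%E)); last by move=> t _; rewrite /F big_nil expR0.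
    by rewrite (integral_cst P measurableT 1%E) mul1e; exact: probability_setT.
  rewrite -(ih us) -(data_translate mD iD (h k) (lD k) (f := fun d => (F s d)%:E)).
  - apply: eq_integral => t _; rewrite -EFinM {1}/F big_cons expRD mulrC; congr (_ * _)%:E.
    apply: congr1; apply: eq_big_seq => j js; rewrite /shiftd crd_mkd.
    by case: eqP => // /inj_c jk; rewrite -jk js in ks.
  - exact/measurable_EFinP.
  - by move=> d; rewrite lee_fin expR_ge0.
have := main _ (index_enum_uniq K).
under eq_integral do rewrite /F big_split/= sumrN expRD expRN mulrC EFinM.
rewrite ge0_integralZl_EFin//; last first.
  apply/measurable_EFinP; apply: measurableT_comp => //; apply: measurable_sum => k.
  exact: measurable_funM.
set X := integral _ _ _; set e := expR _ => h1.
have e0 : 0 < e by exact: expR_gt0.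
by rewrite -[LHS]mul1e -(mulfV (lt0r_neq0 e0)) EFinM -muleA h1 mule1.
Qed.

End GaussianMatrix.

Section LamExpectation.
Context dT (T : measurableType dT) (R : realType) (P : probability T R) (J : finType).
Variable D : T -> data R J.
Hypothesis mD : measurable_fun setT D.
Hypothesis iD : forall A : J -> set R, (forall j, measurable (A j)) ->
  P (D @^-1` box A) = (\prod_j P ((fun t => crd j (D t)) @^-1` A j))%E.
Variables (n p : nat) (c : 'I_n -> 'I_p -> J).
Hypothesis inj_c : forall i j i' j', c i j = c i' j' -> (i, j) = (i', j').
Hypothesis lD : forall i j A, measurable A ->
  P ((fun t => crd (c i j) (D t)) @^-1` A) = normal_prob 0 1 A.

Definition mxd (d : data R J) : 'M[R]_(n, p) := \matrix_(i, j) crd (c i j) d.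

Let bilE (d : data R J) f g : dotv (latv f) (mxd d *m latv g) =
  \sum_(x : 'I_n * 'I_p) latv f x.1 0 * latv g x.2 0 * crd (c x.1 x.2) d.
Proof.
rewrite -(pair_bigA _ (fun i j => latv f i 0 * latv g j 0 * crd (c i j) d))/= dotvE.
apply: eq_bigr => i _; rewrite [X in _ * X]mxE mulr_sumr; apply: eq_bigr => j _.
by rewrite [mxd d i j]mxE -mulrA; congr (_ * _); rewrite mulrC.
Qed.

Let mbil f g : measurable_fun setT (fun d : data R J => dotv (latv f) (mxd d *m latv g)).
Proof.
under eq_fun do rewrite bilE.
by apply: measurable_sum => x; apply: measurable_funM => //; exact: measurable_crd.
Qed.

Let mterm (f : lat n) (g : lat p) : measurable_fun setT (fun d : data R J =>
  latw f * latw g * expR (Num.sqrt n%:R * dotv (latv f) (mxd d *m latv g))).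
Proof.
by apply: measurable_funM => //; apply: measurableT_comp => //; exact: measurable_funM.
Qed.

Lemma measurable_lam : measurable_fun setT (fun d : data R J => lam (mxd d)).
Proof.
apply: measurable_funM => //; apply: measurable_sum_cond => f.
by apply: measurable_sum_cond => g; exact: mterm.
Qed.

(** For vectors in the unit balls the bilinear form has variance at most [1], so each exponential
    has mean at most [exp (n / 2)], which the prefactor of [lam] cancels. *)
Lemma lam_expectation : (\int[P]_t (lam (mxd (D t)))%:E <= 1)%E.
Proof.
pose w (f : lat n) (g : lat p) : R := latw f * latw g.
pose X (f : lat n) (g : lat p) t : R :=
  w f g * expR (Num.sqrt n%:R * dotv (latv f) (mxd (D t) *m latv g)).
have X0 f g t : 0 <= X f g t.
  by rewrite mulr_ge0 ?expR_ge0// mulr_ge0// ltW ?latw_gt0.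
have mX f g : measurable_fun setT (X f g) by exact: (measurableT_comp (mterm f g)).
have IX f g : enorm (latv f : 'cV[R]_n) <= 1 -> enorm (latv g : 'cV[R]_p) <= 1 ->
    (\int[P]_t (X f g t)%:E <= (w f g * expR (n%:R / 2))%:E)%E.
  move=> f1 g1; under eq_integral do rewrite /X EFinM.
  rewrite ge0_integralZl_EFin//; last 2 first.
  - apply/measurable_EFinP; apply: measurableT_comp => //; apply: measurable_funM => //.
    exact: (measurableT_comp (mbil f g)).
  - by rewrite mulr_ge0// ltW ?latw_gt0.
  rewrite [leRHS]EFinM; apply: lee_wpmul2l; first by rewrite lee_fin mulr_ge0// ltW ?latw_gt0.
  under eq_integral do rewrite bilE mulr_sumr.
  pose h (x : 'I_n * 'I_p) : R := Num.sqrt n%:R * (latv f x.1 0 * latv g x.2 0).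
  have -> : (\int[P]_t (expR (\sum_x Num.sqrt n%:R * (latv f x.1 0 * latv g x.2 0 * crd (c x.1 x.2) (D t))))%:E
     = (expR (\sum_x h x ^+ 2 / 2))%:E)%E.
    rewrite -(exp_linear_form mD iD (c := fun x => c x.1 x.2)).
    - by apply: eq_integral => t _; congr (expR _)%:E; apply: eq_bigr => x _; rewrite mulrA.
    - by move=> [i j] [i' j'] /= /inj_c.
    - by move=> x A; exact: lD.
  rewrite lee_fin ler_expR -mulr_suml ler_wpM2r//.
  have -> : \sum_x h x ^+ 2 = n%:R * (dotv (latv f) (latv f) * dotv (latv g) (latv g)).
    rewrite !dotv_sq big_distrlr/= pair_bigA mulr_sumr; apply: eq_bigr => x _.
    by rewrite !exprMn sqr_sqrtr.
  rewrite ler_piMr// -!enorm_sq -exprMn expr_le1// ?mulr_ge0 ?enorm_ge0//.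
  by rewrite mulr_ile1 ?enorm_ge0.
rewrite /lam; under eq_integral do rewrite EFinM.
have m2 f : measurable_fun setT (fun t => \sum_(g : lat p | enorm (latv g : 'cV[R]_p) <= 1) X f g t).
  by apply: measurable_sum_cond => g.
have p2 f t : 0 <= \sum_(g : lat p | enorm (latv g : 'cV[R]_p) <= 1) X f g t.
  by apply: sumr_ge0.
rewrite ge0_integralZl_EFin ?expR_ge0//; last 2 first.
- by move=> t _; rewrite lee_fin; apply: sumr_ge0 => f _; exact: p2.
- by apply/measurable_EFinP; apply: measurable_sum_cond => f; exact: m2.
rewrite (ge0_Eint_sum P _ m2 p2).
apply: (@le_trans _ _ ((expR (- n%:R / 2))%:E * (\sum_(f : lat n | enorm (latv f : 'cV[R]_n) <= 1)
    \sum_(g : lat p | enorm (latv g : 'cV[R]_p) <= 1) (w f g * expR (n%:R / 2)))%:E)%E).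
  rewrite lee_wpmul2l ?lee_fin ?expR_ge0// -sumEFin lee_sum// => f f1.
  by rewrite (ge0_Eint_sum P _ (mX f) (X0 f)) -sumEFin lee_sum// => g g1; exact: IX.
rewrite lee_fin.
under eq_bigr do rewrite -mulr_suml -mulr_sumr.
rewrite -[X in _ * X]mulr_suml mulrCA -expRD mulNr addNr expR0 mulr1 -mulr_suml.
have s0 k : 0 <= \sum_(f : lat k | enorm (latv f : 'cV[R]_k) <= 1) (latw f : R) <= 1.
  apply/andP; split; first by apply: sumr_ge0 => f _; rewrite ltW ?latw_gt0.
  apply: le_trans (latw_sum k); rewrite [leRHS](bigID (fun f => enorm (latv f : 'cV[R]_k) <= 1))/=.
  by rewrite lerDl; apply: sumr_ge0 => f _; rewrite ltW ?latw_gt0.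
by have /andP[? ?] := s0 n; have /andP[? ?] := s0 p; rewrite mulr_ile1.
Qed.

End LamExpectation.

(** * The second order Stein formula *)

Section SecondOrderStein.
Context dT (T : measurableType dT) (R : realType) (P : probability T R) (J : finType).
Variable D : T -> data R J.
Hypothesis mD : measurable_fun setT D.
Hypothesis iD : forall A : J -> set R, (forall j, measurable (A j)) ->
  P (D @^-1` box A) = (\prod_j P ((fun t => crd j (D t)) @^-1` A j))%E.
Variables (K : finType) (c : K -> J).
Hypothesis inj_c : injective c.
Hypothesis lD : forall k A, measurable A ->
  P ((fun t => crd (c k) (D t)) @^-1` A) = normal_prob 0 1 A.
Implicit Types (a b u v x y : data R J -> R) (d : data R J).

Let I (a : data R J -> R) : \bar R := (\int[P]_t (a (D t))%:E)%E.
Let E a : R := fine (I a).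
Let L2 a := measurable_fun setT a /\ (I (fun d => (a d ^+ 2)%R) < +oo)%E.

Let I_ge0 a : (forall d, 0 <= a d) -> (0 <= I a)%E.
Proof. by move=> h; apply: integral_ge0 => t _; rewrite lee_fin. Qed.

Let mDc a : measurable_fun setT a -> measurable_fun setT (fun t => a (D t)).
Proof. by move=> ma; exact: (measurableT_comp ma). Qed.

Let L2M a b : L2 a -> L2 b -> P.-integrable setT (fun t => (a (D t) * b (D t))%:E).
Proof.
move=> [ma Ia] [mb Ib].
apply: (@le_integrable _ _ _ P setT measurableT _
   ((fun t => (a (D t) ^+ 2)%:E) \+ (fun t => (b (D t) ^+ 2)%:E))%E).
- by apply/measurable_EFinP; apply: measurable_funM; exact: mDc.
- move=> t _ /=; rewrite lee_fin; apply: le_trans (ler_norm _).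
  rewrite normrM -(real_normK (num_real (a (D t)))) -(real_normK (num_real (b (D t)))).
  by have := sqr_ge0 (`|a (D t)| - `|b (D t)|); have := normr_ge0 (a (D t)); have := normr_ge0 (b (D t)); nra.
- apply: integrableD => //; apply/integrableP; split.
  + by apply/measurable_EFinP; apply: measurable_funX; exact: mDc.
  + by under eq_integral do rewrite gee0_abs ?lee_fin ?sqr_ge0//.
  + by apply/measurable_EFinP; apply: measurable_funX; exact: mDc.
  + by under eq_integral do rewrite gee0_abs ?lee_fin ?sqr_ge0//.
Qed.

Let I_sqB a b : measurable_fun setT a -> measurable_fun setT b ->
  (I (fun d => ((a d - b d) ^+ 2)%R) <= 2%:E * I (fun d => (a d ^+ 2)%R) + 2%:E * I (fun d => (b d ^+ 2)%R))%E.
Proof.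
move=> ma mb.
have m2 (g : data R J -> R) : measurable_fun setT g -> measurable_fun setT (fun t => (g (D t) ^+ 2)%:E).
  by move=> mg; apply/measurable_EFinP; apply: measurable_funX; exact: mDc.
have p2 (g : data R J -> R) t : (0 <= (g (D t) ^+ 2)%:E)%E by rewrite lee_fin sqr_ge0.
have m3 (g : data R J -> R) : measurable_fun setT g -> measurable_fun setT (fun t => 2%:E * (g (D t) ^+ 2)%:E)%E.
  by move=> mg; apply: emeasurable_funM => //; exact: m2.
rewrite /I -!ge0_integralZl_EFin//; try exact: m2.
rewrite -ge0_integralD//; try exact: m3; last 2 first.
- by move=> t _; rewrite mule_ge0.
- by move=> t _; rewrite mule_ge0.
apply: ge0_le_integral => //.
- by move=> t _; rewrite lee_fin sqr_ge0.
- by apply: (m2 (fun d => a d - b d)); exact: measurable_funB.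
- by apply: emeasurable_funD; exact: m3.
- move=> t _; rewrite -!EFinM -EFinD lee_fin; have := sqr_ge0 (a (D t) + b (D t)); nra.
Qed.

Let L2B a b : L2 a -> L2 b -> L2 (fun d => a d - b d).
Proof.
move=> [ma Ia] [mb Ib]; split; first exact: measurable_funB.
apply: le_lt_trans (I_sqB ma mb) _.
by rewrite lte_add_pinfty// lte_mul_pinfty.
Qed.

Let expand u v x y : L2 u -> L2 v -> L2 x -> L2 y ->
  E (fun d => (u d - v d) * (x d - y d)) =
  E (fun d => u d * x d) - E (fun d => u d * y d) - E (fun d => v d * x d) +
  E (fun d => v d * y d).
Proof.
move=> hu hv hx hy.
have iux := L2M hu hx; have iuy := L2M hu hy; have ivx := L2M hv hx; have ivy := L2M hv hy.
transitivity (\int[P]_t ((u (D t) * x (D t) - u (D t) * y (D t)) -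
     (v (D t) * x (D t) - v (D t) * y (D t)))).
  by rewrite /E /I /Rintegral; congr fine; apply: eq_integral => t _; congr EFin; ring.
have ix : P.-integrable setT (fun t => (u (D t) * x (D t) - u (D t) * y (D t))%:E).
  by under eq_fun do rewrite EFinB; exact: integrableB.
have iy : P.-integrable setT (fun t => (v (D t) * x (D t) - v (D t) * y (D t))%:E).
  by under eq_fun do rewrite EFinB; exact: integrableB.
rewrite RintegralB// RintegralB// RintegralB// /E /I /Rintegral; ring.
Qed.

Let EL2 a : L2 a -> I (fun d => a d * a d) = (E (fun d => a d * a d))%:E.
Proof.
by move=> ha; rewrite /E fineK//; apply: integrable_fin_num => //; exact: L2M.
Qed.

Let E_AMGM u x : L2 u -> L2 x ->
  E (fun d => u d * x d) <= (E (fun d => u d * u d) + E (fun d => x d * x d)) / 2.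
Proof.
move=> hu hx; have /(_ hu hx hu hx) e := @expand u x u x.
have p : 0 <= E (fun d => (u d - x d) * (u d - x d)).
  by rewrite fine_ge0// I_ge0// => d; rewrite -expr2 sqr_ge0.
have c1 : E (fun d => x d * u d) = E (fun d => u d * x d).
  by congr (fine (integral _ _ _)); apply/funext => t; rewrite mulrC.
rewrite e c1 in p; lra.
Qed.

Section FixedStep.
Variable h : R.

Let m (k : K) d : R := expR (h * crd (c k) d - h ^+ 2 / 2).
(** The adjoint of the shift [Up k] under the law of the data. Thus [(Tr k a - a) / h] is the
    discrete form of [z_k a - d_k a]. *)
Let Tr (k : K) a d : R := a (shiftd (c k) (- h) d) * m k d.
Let Up (k : K) a d : R := a (shiftd (c k) h d).

Let mm k : measurable_fun setT (m k).
Proof.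
apply: measurableT_comp => //; apply: measurable_funB => //; apply: measurable_funM => //.
exact: measurable_crd.
Qed.

Let mTr k a : measurable_fun setT a -> measurable_fun setT (Tr k a).
Proof.
move=> ma; apply: measurable_funM => //; apply: (measurableT_comp ma).
exact: measurable_shiftd.
Qed.

Let mUp k a : measurable_fun setT a -> measurable_fun setT (Up k a).
Proof. by move=> ma; apply: (measurableT_comp ma); exact: measurable_shiftd. Qed.

Let I_Tr1 k g : measurable_fun setT g -> I (Tr k g) = I g.
Proof.
have nn (g' : data R J -> R) : measurable_fun setT g' -> (forall d, 0 <= g' d) -> I (Tr k g') = I g'.
  move=> mg g0; rewrite /I -(data_translate mD iD h (lD k) (f := fun d => (g' d)%:E)).
  - by apply: eq_integral => t _; rewrite -EFinM.
  - exact/measurable_EFinP.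
  - by move=> d; rewrite lee_fin.
move=> mg; rewrite /I integralE [RHS]integralE; congr (_ - _)%E.
- transitivity (I (fun d => Num.max (g d) 0)); last first.
    by apply: eq_integral => t _; rewrite funeposE EFin_max.
  rewrite -nn; last 2 first.
  + by apply: measurable_maxr.
  + by move=> d; rewrite le_max lexx orbT.
  apply: eq_integral => t _; rewrite funeposE -EFin_max /Tr; congr EFin.
  by rewrite maxr_pMl ?expR_ge0// mul0r.
- transitivity (I (fun d => Num.max (- g d) 0)); last first.
    by apply: eq_integral => t _; rewrite funenegE EFin_max.
  rewrite -nn; last 2 first.
  + by apply: measurable_maxr => //; exact: measurable_funN.
  + by move=> d; rewrite le_max lexx orbT.
  apply: eq_integral => t _; rewrite funenegE -EFinN -EFin_max /Tr; congr EFin.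
  by rewrite maxr_pMl ?expR_ge0// mul0r mulNr.
Qed.

Let shiftK k d : shiftd (c k) h (shiftd (c k) (- h) d) = d.
Proof.
by apply: eq_data => j; rewrite !crd_mkd; case: eqP => // ->; rewrite subrK.
Qed.

Let I_Tr k a b : measurable_fun setT a -> measurable_fun setT b ->
  I (fun d => Tr k a d * b d) = I (fun d => a d * Up k b d).
Proof.
move=> ma mb; rewrite -(I_Tr1 k (g := fun d => a d * Up k b d)); last first.
  by apply: measurable_funM => //; exact: mUp.
by apply: eq_integral => t _; rewrite /Tr /Up shiftK; congr EFin; ring.
Qed.

Let UpTr j k a : j != k -> Up j (Tr k a) = Tr k (Up j a).
Proof.
move=> jk; apply/funext => d; rewrite /Up /Tr /m; congr (a _ * expR (_ * _ - _)).
  apply: eq_data => i; rewrite !crd_mkd; do 2 case: eqP => //.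
  by move=> -> /inj_c kj; rewrite kj eqxx in jk.
by rewrite crd_mkd; case: eqP => // /inj_c kj; rewrite kj eqxx in jk.
Qed.

Let shiftK' k d : shiftd (c k) (- h) (shiftd (c k) h d) = d.
Proof.
by apply: eq_data => j; rewrite !crd_mkd; case: eqP => // ->; rewrite addrK.
Qed.

Let UpTr_eq k a d : Up k (Tr k a) d = a d * expR (h * crd (c k) d + h ^+ 2 / 2).
Proof.
by rewrite /Up /Tr /m shiftK' crd_mkd eqxx; congr (_ * expR _); field.
Qed.

Let eqI a b : (forall d, a d = b d) -> I a = I b.
Proof. by move=> e; apply: eq_integral => t _; rewrite e. Qed.

Let I_TrTr j k a b : j != k -> measurable_fun setT a -> measurable_fun setT b ->
  I (fun d => Tr j a d * Tr k b d) = I (fun d => Up k a d * Up j b d).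
Proof.
move=> jk ma mb; rewrite I_Tr//; last exact: mTr.
rewrite UpTr// (eqI (b := fun d => Tr k (Up j b) d * a d)); last by move=> d; rewrite mulrC.
by rewrite I_Tr//; [apply: eqI => d; rewrite mulrC|exact: mUp].
Qed.

Let sqe k a : \bar R := I (fun d => (a d ^+ 2 * expR (h * crd (c k) d))%R).

Let I_TrTr_eq k a : measurable_fun setT a ->
  I (fun d => Tr k a d * Tr k a d) = ((expR (h ^+ 2 / 2))%:E * sqe k a)%E.
Proof.
move=> ma; rewrite I_Tr//; last exact: mTr.
rewrite -ge0_integralZl_EFin ?expR_ge0//.
- by apply: eq_integral => t _; rewrite UpTr_eq -EFinM expRD; congr EFin; ring.
- by move=> t _; rewrite lee_fin mulr_ge0 ?expR_ge0// sqr_ge0.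
- apply/measurable_EFinP; apply: measurable_funM; first by apply: measurable_funX; exact: mDc.
  apply: measurableT_comp => //; apply: measurable_funM => //; apply: mDc.
  exact: measurable_crd.
Qed.

Let I_UpUp_eq k a : measurable_fun setT a ->
  I (fun d => Up k a d * Up k a d) = ((expR (- (h ^+ 2 / 2)))%:E * sqe k a)%E.
Proof.
move=> ma; rewrite (eqI (b := fun d => 1 * Up k (fun d => a d ^+ 2) d)); last first.
  by move=> d; rewrite mul1r /Up expr2.
rewrite -I_Tr//; last exact: measurable_funX.
rewrite -ge0_integralZl_EFin ?expR_ge0//.
- by apply: eq_integral => t _; rewrite /Tr /m -EFinM expRD; congr EFin; ring.
- by move=> t _; rewrite lee_fin mulr_ge0 ?expR_ge0// sqr_ge0.
- apply/measurable_EFinP; apply: measurable_funM; first by apply: measurable_funX; exact: mDc.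
  apply: measurableT_comp => //; apply: measurable_funM => //; apply: mDc.
  exact: measurable_crd.
Qed.

Let L2Tr k a : measurable_fun setT a -> (sqe k a < +oo)%E -> L2 (Tr k a).
Proof.
move=> ma sa; split; first exact: mTr.
rewrite (eqI (b := fun d => Tr k a d * Tr k a d)); last by move=> d; rewrite expr2.
by rewrite I_TrTr_eq// lte_mul_pinfty// ?lee_fin ?expR_ge0.
Qed.

Let L2Up k a : measurable_fun setT a -> (sqe k a < +oo)%E -> L2 (Up k a).
Proof.
move=> ma sa; split; first exact: mUp.
rewrite (eqI (b := fun d => Up k a d * Up k a d)); last by move=> d; rewrite expr2.
by rewrite I_UpUp_eq// lte_mul_pinfty// ?lee_fin ?expR_ge0.
Qed.

(** Along distinct coordinates a shift commutes with the adjoint of the other, so the two operators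
    may change places. This is the discrete form of the terms [E (d_k f_j) (d_j f_k)] in the second
    order formula. *)
Let cross j k a b : j != k -> L2 a -> L2 b -> (forall k, sqe k a < +oo)%E ->
  (forall k, sqe k b < +oo)%E ->
  E (fun d => (Tr j a d - a d) * (Tr k b d - b d)) =
  E (fun d => (Up k a d - a d) * (Up j b d - b d)).
Proof.
move=> jk ha hb sa sb; have [ma _] := ha; have [mb _] := hb.
have Ta := L2Tr ma (sa j); have Tb := L2Tr mb (sb k).
have Ua := L2Up ma (sa k); have Ub := L2Up mb (sb j).
rewrite (expand Ta ha Tb hb) (expand Ua ha Ub hb) /E.
rewrite I_TrTr// I_Tr// (eqI (a := fun d => a d * Tr k b d) (b := fun d => Tr k b d * a d)).
  rewrite I_Tr// (eqI (a := fun d => b d * Up k a d) (b := fun d => Up k a d * b d)).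
    ring.
  by move=> d; rewrite mulrC.
by move=> d; rewrite mulrC.
Qed.

(** Along one coordinate [Tr] and [Up] do not commute: their square norms differ by the factor
    [exp (h^2)], at most [1 + 2 h^2] for [h <= 1 / 2]. This produces the term of order zero of the
    formula. *)
Let diag k a : 0 <= h <= 1 / 2 -> L2 a -> (forall k, sqe k a < +oo)%E ->
  E (fun d => (Tr k a d - a d) * (Tr k a d - a d)) <=
  5 * E (fun d => (Up k a d - a d) * (Up k a d - a d)) + 4 * h ^+ 2 * E (fun d => a d * a d).
Proof.
move=> /andP[h0 h1] ha sa; have [ma _] := ha.
have Ta := L2Tr ma (sa k); have Ua := L2Up ma (sa k).
have e1 := expand Ta ha Ta ha; have e2 := expand Ua ha Ua ha.
have eTa : E (fun d => Tr k a d * a d) = E (fun d => a d * Up k a d) by rewrite /E I_Tr.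
have eaT : E (fun d => a d * Tr k a d) = E (fun d => a d * Up k a d).
  by rewrite -eTa /E; congr fine; apply: eqI => d; rewrite mulrC.
have eUa : E (fun d => Up k a d * a d) = E (fun d => a d * Up k a d).
  by rewrite /E; congr fine; apply: eqI => d; rewrite mulrC.
have s0 : (0 <= sqe k a)%E by apply: I_ge0 => d; rewrite mulr_ge0 ?expR_ge0// sqr_ge0.
have fs : sqe k a \is a fin_num by rewrite ge0_fin_numE.
have TT : E (fun d => Tr k a d * Tr k a d) = expR (h ^+ 2 / 2) * fine (sqe k a).
  by rewrite /E I_TrTr_eq// fineM.
have UU : E (fun d => Up k a d * Up k a d) = expR (- (h ^+ 2 / 2)) * fine (sqe k a).
  by rewrite /E I_UpUp_eq// fineM.
have TU : E (fun d => Tr k a d * Tr k a d) = expR (h ^+ 2) * E (fun d => Up k a d * Up k a d).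
  by rewrite TT UU mulrA -expRD; congr (expR _ * _); field.
have U0 : 0 <= E (fun d => Up k a d * Up k a d).
  by rewrite fine_ge0// I_ge0// => d; rewrite -expr2 sqr_ge0.
have eh : expR (h ^+ 2) - 1 <= 2 * h ^+ 2.
  have := expR_ge1Dx (- h ^+ 2); rewrite expRN; set e := expR _ => he.
  have e0 : 0 < e by exact: expR_gt0.
  have h2 : 0 <= h ^+ 2 <= 1 / 4 by rewrite sqr_ge0/=; nra.
  have {}he : (1 - h ^+ 2) * e <= 1.
    by rewrite -ler_pdivlMr// div1r.
  by move: (h ^+ 2) h2 he => x /andP[x0 x1] he; nra.
have A0 : 0 <= E (fun d => a d * a d).
  by rewrite fine_ge0// I_ge0// => d; rewrite -expr2 sqr_ge0.
have Ub : E (fun d => Up k a d * Up k a d) <=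
   2 * E (fun d => (Up k a d - a d) * (Up k a d - a d)) + 2 * E (fun d => a d * a d).
  rewrite -lee_fin EFinD !EFinM -!EL2//; last exact: L2B.
  have := I_sqB (measurable_funB (mUp k ma) ma) (measurable_funN ma).
  by congr (_ <= _ * _ + _ * _)%E; apply: eqI => d /=; rewrite -?expr2 ?sqrrN//; ring.
rewrite TU eTa eaT in e1; rewrite eUa in e2; rewrite e1.
move: TU eh U0 Ub e2 A0; set q := E (fun d => (Up k a d - a d) * _); set uu := E (fun d => Up k a d * _).
set x := E (fun d => a d * Up k a d); set al := E (fun d => a d * _).
set e := expR _ => _ eh U0 Ub e2 A0.
have -> : e * uu - x - x + al = q + (e - 1) * uu by rewrite e2; ring.
have h2 : 0 <= h ^+ 2 <= 1 / 4 by rewrite sqr_ge0/=; nra.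
have q0 : 0 <= q by rewrite fine_ge0// I_ge0// => d; rewrite -expr2 sqr_ge0.
apply: (@le_trans _ _ (q + 2 * h ^+ 2 * (2 * q + 2 * al))).
  by rewrite lerD2l ler_pM//; rewrite subr_ge0 -expR0 ler_expR sqr_ge0.
by move: (h ^+ 2) h2 => X /andP[X0 X1]; nra.
Qed.

Let Esum (I' : finType) (g : I' -> data R J -> R) :
  (forall i, P.-integrable setT (fun t => (g i (D t))%:E)) ->
  E (fun d => \sum_i g i d) = \sum_i E (g i).
Proof.
move=> ig; elim: (index_enum I') => [|i s ih].
  by rewrite big_nil /E /I; under eq_integral do rewrite big_nil; rewrite integral0.
rewrite big_cons -ih /E /I -!/(Rintegral _ _ _).
have is_ : P.-integrable setT (fun t => (\sum_(j <- s) g j (D t))%:E).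
  by under eq_fun do rewrite -sumEFin; apply: integrable_sum => // j _; exact: ig.
rewrite -[RHS](@RintegralD _ _ _ P setT (fun t => g i (D t)) (fun t => \sum_(j <- s) g j (D t)))//.
  by apply: eq_Rintegral => t _; rewrite big_cons.
exact: ig.
Qed.

Let L2sum (g : K -> data R J -> R) : (forall k, L2 (g k)) ->
  I (fun d => (\sum_k g k d) ^+ 2) = (\sum_j \sum_k E (fun d => g j d * g k d))%:E.
Proof.
move=> hg.
have ig (x : K * K) : P.-integrable setT (fun t => (g x.1 (D t) * g x.2 (D t))%:E) by exact: L2M.
have eS t : (\sum_k g k (D t)) ^+ 2 = \sum_(x : K * K) g x.1 (D t) * g x.2 (D t).
  by rewrite expr2 big_distrlr/= pair_bigA.
rewrite pair_bigA/= -(Esum (g := fun (x : K * K) d => g x.1 d * g x.2 d) ig) /E fineK.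
  by apply: eq_integral => t _; rewrite eS.
apply: integrable_fin_num => //.
by rewrite /I; under eq_fun do rewrite -sumEFin; apply: integrable_sum => // x _; exact: ig.
Qed.

Lemma stein_step (f : K -> data R J -> R) (A al : R) : 0 <= h <= 1 / 2 ->
  (forall k, measurable_fun setT (f k)) ->
  (forall k, (\int[P]_t (f k (D t) ^+ 2)%:E < +oo)%E) ->
  (forall j k, (\int[P]_t (f j (D t) ^+ 2 * expR (h * crd (c k) (D t)))%:E < +oo)%E) ->
  (\int[P]_t (\sum_j \sum_k (f j (shiftd (c k) h (D t)) - f j (D t)) ^+ 2)%:E <= A%:E)%E ->
  (\int[P]_t (\sum_j f j (D t) ^+ 2)%:E <= al%:E)%E ->
  (\int[P]_t ((\sum_j (f j (shiftd (c j) (- h) (D t)) *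
       expR (h * crd (c j) (D t) - h ^+ 2 / 2) - f j (D t))) ^+ 2)%:E <=
    (5 * A + 4 * h ^+ 2 * al)%:E)%E.
Proof.
move=> h01 mf f2 sf hA hal.
have Lf k : L2 (f k) by split; [exact: mf|exact: f2].
have LT k : L2 (fun d => Tr k (f k) d - f k d) by exact: L2B (L2Tr (mf k) (sf k k)) (Lf k).
have LU j k : L2 (fun d => Up k (f j) d - f j d) by exact: L2B (L2Up (mf j) (sf j k)) (Lf j).
rewrite -[leLHS]/(I (fun d => (\sum_j (Tr j (f j) d - f j d)) ^+ 2)) L2sum// lee_fin.
pose Q j k := E (fun d => (Up k (f j) d - f j d) * (Up k (f j) d - f j d)).
pose al_ j := E (fun d => f j d * f j d).
have al0 j : 0 <= al_ j.
  by rewrite fine_ge0// I_ge0// => d; rewrite -expr2 sqr_ge0.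
have Q0 j k : 0 <= Q j k.
  by rewrite fine_ge0// I_ge0// => d; rewrite -expr2 sqr_ge0.
have eA : \sum_j \sum_k Q j k <= A.
  rewrite -lee_fin; apply: le_trans hA.
  rewrite (ge0_Eint_sum P xpredT (f := fun j t => \sum_k (f j (shiftd (c k) h (D t)) - f j (D t)) ^+ 2)); last 2 first.
  - move=> j; apply: (@measurable_sum _ _ _ _ _ _ (fun k t => (f j (shiftd (c k) h (D t)) - f j (D t)) ^+ 2)) => k.
    by apply: measurable_funX; apply: mDc (LU j k).1.
  - by move=> j t; apply: sumr_ge0 => k _; exact: sqr_ge0.
  rewrite -sumEFin; apply: lee_sum => j _.
  rewrite (ge0_Eint_sum P xpredT (f := fun k t => (f j (shiftd (c k) h (D t)) - f j (D t)) ^+ 2)); last 2 first.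
  - by move=> k; apply: measurable_funX; apply: mDc (LU j k).1.
  - by move=> k t; exact: sqr_ge0.
  rewrite -sumEFin; apply: lee_sum => k _.
  by rewrite -EL2.
have eal : \sum_j al_ j <= al.
  rewrite -lee_fin; apply: le_trans hal.
  rewrite (ge0_Eint_sum P xpredT (f := fun j t => f j (D t) ^+ 2)); last 2 first.
  - by move=> j; apply: measurable_funX; exact: mDc.
  - by move=> j t; exact: sqr_ge0.
  rewrite -sumEFin; apply: lee_sum => j _.
  by rewrite -EL2.
(* A symmetric majorant covers both the diagonal, where the coefficient is [5], and the terms off
   it, which are at most [(Q j k + Q k j) / 2]. *)
apply: (@le_trans _ _ (\sum_j \sum_k (5 / 2 * (Q j k + Q k j) + (j == k)%:R * (4 * h ^+ 2 * al_ j)))).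
  apply: ler_sum => j _; apply: ler_sum => k _; case: eqVneq => [<-|jk].
    rewrite mul1r; have := @diag j (f j) h01 (Lf j) (sf j); rewrite -/(Q j j) -/(al_ j); lra.
  rewrite mul0r addr0 cross//; [|exact: sf..].
  have := E_AMGM (LU j k) (LU k j); rewrite -/(Q j k) -/(Q k j).
  by have := Q0 j k; have := Q0 k j; lra.
have -> : \sum_j \sum_k (5 / 2 * (Q j k + Q k j) + (j == k)%:R * (4 * h ^+ 2 * al_ j)) =
    5 * (\sum_j \sum_k Q j k) + 4 * h ^+ 2 * \sum_j al_ j.
  under eq_bigr do rewrite big_split/=; rewrite big_split/=; congr (_ + _).
    under eq_bigr do rewrite -mulr_sumr big_split/=.
    rewrite -mulr_sumr big_split/= [X in _ * (_ + X)]exchange_big/=; by field.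
  rewrite mulr_sumr; apply: eq_bigr => j _; rewrite (bigD1 j)//= eqxx mul1r big1 ?addr0//.
  by move=> k kj; rewrite eq_sym (negbTE kj) mul0r.
by have := sqr_ge0 h; nra.
Qed.

End FixedStep.

(** [E (z . f - div f)^2 <= 5 E |D f|^2 + 4 E |f|^2], where the derivatives are
    replaced by difference quotients, the only limit being that of the
    integrand on the left. *)
Lemma stein_fatou (f : K -> data R J -> R) (Y : T -> R) (A al : R) :
  (forall k, measurable_fun setT (f k)) ->
  (forall h j k, 0 <= h <= 1 / 2 ->
     (\int[P]_t (f j (D t) ^+ 2 * expR (h * crd (c k) (D t)))%:E < +oo)%E) ->
  (forall h, 0 < h <= 1 / 2 ->
     (\int[P]_t (\sum_j \sum_k (f j (shiftd (c k) h (D t)) - f j (D t)) ^+ 2)%:E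
      <= (h ^+ 2 * A)%:E)%E) ->
  (\int[P]_t (\sum_j f j (D t) ^+ 2)%:E <= al%:E)%E ->
  measurable_fun setT Y ->
  {ae P, forall t, \sum_j (f j (shiftd (c j) (- m.+2%:R^-1) (D t)) *
       expR (m.+2%:R^-1 * crd (c j) (D t) - m.+2%:R^-1 ^+ 2 / 2) - f j (D t)) / m.+2%:R^-1
     @[m --> \oo] --> Y t} ->
  (\int[P]_t (Y t ^+ 2)%:E <= (5 * A + 4 * al)%:E)%E.
Proof.
move=> mf sf hA hal mY hY.
pose h (m : nat) : R := m.+2%:R^-1.
pose g m t := \sum_j (f j (shiftd (c j) (- h m) (D t)) *
       expR (h m * crd (c j) (D t) - h m ^+ 2 / 2) - f j (D t)).
have h0 m : 0 < h m by rewrite invr_gt0 ltr0n.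
have h1 m : h m <= 1 / 2 by rewrite div1r lef_pV2 ?posrE ?ltr0n// ler_nat.
have mg m : measurable_fun setT (g m).
  apply: measurable_sum => j; apply: measurable_funB; last exact: mDc.
  apply: measurable_funM.
    exact: (measurableT_comp (mf j) (measurableT_comp (measurable_shiftd _ _) mD)).
  apply: measurableT_comp => //; apply: measurable_funB => //; apply: measurable_funM => //.
  exact: (measurableT_comp (measurable_crd (c j))).
pose G m t : \bar R := ((g m t / h m) ^+ 2)%:E.
have mG m : measurable_fun setT (G m).
  by apply/measurable_EFinP; apply: measurable_funX; apply: measurable_funM.
have G0 m t : setT t -> (0 <= G m t)%E by move=> _; rewrite lee_fin sqr_ge0.
have IG m : (\int[P]_t G m t <= (5 * A + 4 * al)%:E)%E.
  have h01 : 0 <= h m <= 1 / 2 by rewrite ltW//=.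
  have := @stein_step (h m) f (h m ^+ 2 * A) al h01 mf _ _ _ hal.
  rewrite (_ : (5 * (h m ^+ 2 * A) + 4 * h m ^+ 2 * al) = h m ^+ 2 * (5 * A + 4 * al)); last by ring.
  move=> H; have {}H : (\int[P]_t (g m t ^+ 2)%:E <= (h m ^+ 2 * (5 * A + 4 * al))%:E)%E.
    apply: H.
    - move=> k; have := sf 0 k k; rewrite lexx/= => /(_ ltac:(lra)).
      by under eq_integral do rewrite mul0r expR0 mulr1.
    - by move=> j k; exact: sf.
    - by apply: hA; rewrite h0 h1.
  have -> : (\int[P]_t G m t = ((h m ^+ 2)^-1)%:E * \int[P]_t (g m t ^+ 2)%:E)%E.
    rewrite -ge0_integralZl_EFin ?invr_ge0 ?sqr_ge0//.
    - by apply: eq_integral => t _; rewrite -EFinM /G exprMn exprVn mulrC.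
    - by move=> t _; rewrite lee_fin sqr_ge0.
    - by apply/measurable_EFinP; exact: measurable_funX.
  rewrite lee_pdivrMl ?exprn_gt0//.
have F := fatou P measurableT mG G0.
have le1 : (limn_einf (fun m => \int[P]_t G m t) <= (5 * A + 4 * al)%:E)%E.
  rewrite limn_einf_lim; apply: lime_le; first exact: is_cvg_einfs.
  apply: nearW => m; apply: le_trans (IG m).
  by apply: ereal_inf_lbound; exists m => /=.
apply: le_trans le1; apply: le_trans F.
rewrite (@ae_eq_integral _ _ _ P setT (fun t => (Y t ^+ 2)%:E) (fun t => limn_einf (G^~ t)))//.
- rewrite (_ : (fun t => _) = fun t => (- limn_esup (fun m => - G m t))%E).
    apply: measurableT_comp => //; apply: measurable_fun_limn_esup => m.
    exact: measurableT_comp.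
  apply/funext => t; rewrite -limn_einfN; congr limn_einf.
  by apply/funext => m; rewrite /comp oppeK.
- by apply/measurable_EFinP; exact: measurable_funX.
- apply: filterS hY => t ht _.
  have cv : G m t @[m --> \oo] --> ((Y t) ^+ 2)%:E.
    apply: cvg_EFinT; rewrite expr2; under eq_fun do rewrite expr2.
    have e m : g m t / h m = \sum_j (f j (shiftd (c j) (- m.+2%:R^-1) (D t)) *
       expR (m.+2%:R^-1 * crd (c j) (D t) - m.+2%:R^-1 ^+ 2 / 2) - f j (D t)) / m.+2%:R^-1.
      by rewrite mulr_suml.
    by apply: cvgM; under eq_fun do rewrite e.
  by have [] := cvg_limn_einf_sup cv.
Qed.

End SecondOrderStein.

Lemma sq_le2 {R : realType} k (u v : 'cV[R]_k) :
  dotv v v <= 2 * dotv u u + 2 * dotv (u - v) (u - v).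
Proof.
have := dotv_ge0 (u + (u - v)).
rewrite !(dotvDl, dotvDr, dotvNl, dotvNr) (dotvC v u); lra.
Qed.

(** * Perturbation of the design *)

Section Deterministic.
Context {R : realType}.
Variables (n q : nat) (tau : R).
Variables (B : 'M[R]_(n, q.+1) -> 'cV[R]_q.+1) (psi : 'M[R]_(n, q.+1) -> 'cV[R]_n).
Hypotheses (tau0 : 0 < tau) (n0 : (0 < n)%N).
Hypothesis perturb : forall G G', n%:R * tau * dotv (B G - B G') (B G - B G') +
    dotv (psi G - psi G') (psi G - psi G') <=
  dotv (B G - B G') ((G - G')^T *m psi G') - dotv (psi G - psi G') ((G - G') *m B G').
Hypothesis fit_ge0 : forall G, n%:R * tau * dotv (B G) (B G) <= dotv (G *m B G) (psi G).
Notation N := (n%:R : R).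
Notation sq u := (dotv u u).

Let N0 : 0 < N. Proof. by rewrite ltr0n. Qed.

Let Nt0 : 0 < N * tau. Proof. exact: mulr_gt0. Qed.

Lemma rank1_mul k l (i : 'I_k) (v x : 'cV[R]_l) :
  ((delta_mx i 0 : 'cV[R]_k) *m v^T) *m x = dotv v x *: delta_mx i 0.
Proof. by rewrite -mulmxA [v^T *m x]mx11_scalar mul_mx_scalar. Qed.

Lemma coord_le_sq k (u : 'cV[R]_k) i : u i 0 ^+ 2 <= sq u.
Proof.
rewrite dotv_sq (bigD1 i)//= lerDl; apply: sumr_ge0 => j _; exact: sqr_ge0.
Qed.

Lemma rank1_perturb0 G G' i v : G - G' = delta_mx i 0 *m v^T ->
  N * tau * sq (B G - B G') + sq (psi G - psi G') <=
  dotv v (B G - B G') * psi G' i 0 - (psi G - psi G') i 0 * dotv v (B G').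
Proof.
move=> e; have := perturb G G'; rewrite e dotv_mulmx trmxK !rank1_mul dotvZl dotvZr dotv_delta.
by rewrite (dotvC (psi G - psi G') (delta_mx i 0)) dotv_delta; lra.
Qed.

(** By Young's inequality, the first cross term of [rank1_perturb0] is absorbed in the term in [B]
    and the second in the term in [psi], half of each. What remains only involves the estimator of
    one design. *)
Lemma rank1_perturb G G' i v : G - G' = delta_mx i 0 *m v^T ->
  N * tau * sq (B G - B G') + sq (psi G - psi G') <=
  sq v * psi G' i 0 ^+ 2 / (N * tau) + dotv v (B G') ^+ 2.
Proof.
move=> e; have := rank1_perturb0 e.
set b := sq _; set s := sq (psi G - psi G'); set x := dotv v _; set y := dotv v _.
set p := psi G' i 0; set t := (psi G - psi G') i 0.
have ts : t ^+ 2 <= s by exact: coord_le_sq.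
have := dotv_ge0 ((N * tau) *: (B G - B G') - p *: v).
rewrite dotvBl !dotvBr !dotvZl !dotvZr -/b [dotv _ v]dotvC -/x => h1.
have {}h1 : 2 * (p * x) <= N * tau * b + sq v * p ^+ 2 / (N * tau).
  rewrite -(ler_pM2l Nt0) mulrDr.
  have -> : N * tau * (sq v * p ^+ 2 / (N * tau)) = sq v * p ^+ 2 by field; rewrite ?gt_eqF.
  by move: (N * tau) h1 => T h1; nra.
have := sqr_ge0 (t + y); nra.
Qed.

Lemma rank1_perturb_sym G G' i v : G - G' = delta_mx i 0 *m v^T ->
  N * tau * sq (B G - B G') + sq (psi G - psi G') <=
  sq v * psi G i 0 ^+ 2 / (N * tau) + dotv v (B G) ^+ 2.
Proof.
move=> e; have e' : G' - G = delta_mx i 0 *m (- v)^T.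
  by rewrite linearN/= mulmxN -e opprB.
have := rank1_perturb e'; rewrite -(opprB (B G)) -(opprB (psi G)).
by rewrite !dotvNl !dotvNr !opprK sqrrN.
Qed.

Lemma B_le_psi G : (N * tau) ^+ 2 * sq (B G) <= opnorm G ^+ 2 * sq (psi G).
Proof.
have h := fit_ge0 G; have := dotv_CS2 (G *m B G) (psi G).
have : sq (G *m B G) <= opnorm G ^+ 2 * sq (B G).
  rewrite -!enorm_sq -exprMn ler_sqr ?nnegrE ?enorm_ge0 ?mulr_ge0 ?opnorm_ge0 ?enorm_ge0//.
  exact: opnormP.
have b0 := dotv_ge0 (B G); have p0 := dotv_ge0 (psi G).
have k0 : 0 <= opnorm G ^+ 2 by exact: sqr_ge0.
have T0 := Nt0.
move: (sq (B G)) (sq (psi G)) (sq (G *m B G)) (dotv (G *m B G) (psi G)) (opnorm G ^+ 2) (N * tau) b0 p0 k0 T0 h.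
move=> b p s c k t b0 p0 k0 t0 h h1 h2.
have [->|bn] := eqVneq b 0; first by rewrite mulr0 mulr_ge0.
have {bn}b0 : 0 < b by rewrite lt_def bn.
rewrite -(ler_pM2r b0).
have : (t * b) ^+ 2 <= c ^+ 2 by rewrite ler_sqr ?nnegrE//; [|apply: le_trans h]; rewrite mulr_ge0// ltW.
have : s * p <= k * b * p by rewrite ler_wpM2r.
nra.
Qed.

Lemma opnorm_rank1 k l (i : 'I_k) (G G' : 'M[R]_(k, l)) v : G - G' = delta_mx i 0 *m v^T ->
  opnorm G <= opnorm G' + enorm v.
Proof.
move=> e; apply: opnorm_le => u u1.
have -> : G *m u = G' *m u + (dotv v u) *: delta_mx i 0.
  by rewrite -rank1_mul -e mulmxBl addrC subrK.
apply: le_trans (enormD _ _) _; apply: lerD.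
  apply: le_trans (opnormP _ _) _; rewrite ler_piMr ?opnorm_ge0//.
rewrite enormZ enorm_delta mulr1; apply: le_trans (dotv_CS _ _) _.
by rewrite ler_piMr ?enorm_ge0.
Qed.

Definition c2 : R := 2 + 2 / tau + 8 / tau ^+ 2.

Lemma c2_ge1 : 1 <= c2.
Proof.
have h1 : 0 < tau^-1 by rewrite invr_gt0.
rewrite /c2 -exprVn; nra.
Qed.

(** By [rank1_perturb_sym] the residuals move by at most [|v|^2] times quantities that [B_le_psi]
    controls by the residuals themselves. This comparison is what allows a function of the erased
    design to stand for [1 / r]. *)
Lemma psi_compare G G' i v : G - G' = delta_mx i 0 *m v^T ->
  sq (psi G') <= c2 * (1 + opnorm G' / Num.sqrt N) ^+ 2 * (1 + sq v / N) ^+ 2 * sq (psi G).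
Proof.
move=> e; have h1 := rank1_perturb_sym e.
have sN : 0 < Num.sqrt N by rewrite sqrtr_gt0.
set k' := opnorm G' / _; set s2 := sq v / N; set p := sq (psi G).
have p0 : 0 <= p by exact: dotv_ge0.
have s20 : 0 <= s2 by rewrite divr_ge0 ?dotv_ge0// ltW.
have k0 : 0 <= k' by rewrite divr_ge0 ?opnorm_ge0// ltW.
pose k2 := opnorm G ^+ 2 / N.
have hk : k2 <= 2 * k' ^+ 2 + 2 * s2.
  have ov := opnorm_rank1 e.
  have : opnorm G ^+ 2 <= (opnorm G' + enorm v) ^+ 2.
    by rewrite ler_sqr ?nnegrE ?addr_ge0 ?opnorm_ge0 ?enorm_ge0.
  have -> : k' ^+ 2 = opnorm G' ^+ 2 / N by rewrite /k' exprMn exprVn sqr_sqrtr// ltW.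
  rewrite /k2 /s2 -enorm_sq !mulrA -mulrDl ler_pM2r ?invr_gt0//.
  by have := sqr_ge0 (opnorm G' - enorm v); nra.
have hB : sq (B G) * N <= k2 * p / tau ^+ 2.
  have := B_le_psi G; rewrite -/p => h.
  rewrite ler_pdivlMr ?exprn_gt0// /k2 -(ler_pM2r N0).
  have -> : opnorm G ^+ 2 / N * p * N = opnorm G ^+ 2 * p by field; rewrite gt_eqF.
  by apply: le_trans h; rewrite exprMn; lra.
have h2 : sq (psi G - psi G') <= s2 * p / tau + s2 * (k2 * p / tau ^+ 2).
  have b0 := dotv_ge0 (B G - B G').
  have a1 : sq v * psi G i 0 ^+ 2 / (N * tau) <= s2 * p / tau.
    have -> : sq v * psi G i 0 ^+ 2 / (N * tau) = s2 * psi G i 0 ^+ 2 / tau.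
      by rewrite /s2; field; rewrite ?gt_eqF.
    by rewrite ler_pM2r ?invr_gt0// ler_wpM2l// coord_le_sq.
  have a2 : dotv v (B G) ^+ 2 <= s2 * (k2 * p / tau ^+ 2).
    apply: le_trans (dotv_CS2 _ _) _.
    have -> : sq v * sq (B G) = s2 * (sq (B G) * N) by rewrite /s2; field; rewrite gt_eqF.
    by rewrite ler_wpM2l.
  have : 0 <= N * tau * sq (B G - B G') by rewrite mulr_ge0// ltW.
  lra.
have h3 : sq (psi G') <= 2 * p + 2 * sq (psi G - psi G') by exact: sq_le2.
apply: le_trans h3 _.
apply: (@le_trans _ _ (p * (2 + 2 * s2 / tau + 2 * (s2 * (2 * k' ^+ 2 + 2 * s2) / tau ^+ 2)))).
  have t2 : 0 < (tau ^+ 2)^-1 by rewrite invr_gt0 exprn_gt0.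
  have : s2 * (k2 * p / tau ^+ 2) <= s2 * ((2 * k' ^+ 2 + 2 * s2) * p / tau ^+ 2).
    by rewrite ler_wpM2l// ler_wpM2r ?(ltW t2)// ler_wpM2r.
  lra.
rewrite [leRHS]mulrC ler_wpM2l// /c2.
have t1 : 0 < tau^-1 by rewrite invr_gt0.
rewrite -!exprVn; move: (tau^-1) t1 => t t1.
have e1 : 1 <= (1 + k') ^+ 2 * (1 + s2) ^+ 2.
  by rewrite -exprMn expr_ge1//; nra.
have e2 : s2 <= (1 + k') ^+ 2 * (1 + s2) ^+ 2.
  have : 1 <= (1 + k') ^+ 2 by rewrite expr_ge1//; nra.
  have : s2 <= (1 + s2) ^+ 2 by nra.
  nra.
have e3 : s2 * (2 * k' ^+ 2 + 2 * s2) <= 4 * ((1 + k') ^+ 2 * (1 + s2) ^+ 2).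
  have a1 : s2 <= (1 + s2) ^+ 2 by nra.
  have a2 : s2 ^+ 2 <= (1 + s2) ^+ 2 by nra.
  have a3 : k' ^+ 2 <= (1 + k') ^+ 2 by nra.
  have a4 : 1 <= (1 + k') ^+ 2 by nra.
  have a5 : s2 * k' ^+ 2 <= (1 + s2) ^+ 2 * (1 + k') ^+ 2 by rewrite ler_pM// sqr_ge0.
  have a6 : s2 ^+ 2 * 1 <= (1 + s2) ^+ 2 * (1 + k') ^+ 2 by rewrite ler_pM// sqr_ge0.
  nra.
rewrite -[leRHS]mulrA; move: ((1 + k') ^+ 2 * (1 + s2) ^+ 2) e1 e2 e3 => M e1 e2 e3.
have : s2 * t <= M * t by rewrite ler_wpM2r// ltW.
have : s2 * (2 * k' ^+ 2 + 2 * s2) * t ^+ 2 <= 4 * M * t ^+ 2 by rewrite ler_wpM2r// sqr_ge0.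
lra.
Qed.

Section Row.
Variable i : 'I_n.

(** The part of row [i] orthogonal to the index, and the design in which this
    part is erased. *)
Definition zrow (G : 'M[R]_(n, q.+1)) : 'cV[R]_q.+1 :=
  \col_j (if j == 0 then 0 else G i j).

Definition erase (G : 'M[R]_(n, q.+1)) : 'M[R]_(n, q.+1) :=
  \matrix_(k, j) (if (k == i) && (j != 0) then 0 else G k j).

Lemma eraseE G : G - erase G = delta_mx i 0 *m (zrow G)^T.
Proof.
apply/matrixP => k j; rewrite !mxE big_ord1 !mxE andbT.
have [->|ki] := eqVneq k i; last by rewrite subrr mul0r.
by rewrite mul1r/=; case: (eqVneq j 0) => /= _; rewrite ?subrr ?subr0.
Qed.

Definition kap G : R := 1 + sq (zrow G) / N.

Lemma kap_ge1 G : 1 <= kap G.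
Proof. by rewrite /kap lerDl divr_ge0 ?dotv_ge0// ltW. Qed.

(** [w G] only depends on [erase G]. *)
Definition wrow G : R := psi (erase G) i 0 ^+ 2 + sq (B (erase G)).

Lemma wrow_ge0 G : 0 <= wrow G.
Proof. by rewrite addr_ge0 ?sqr_ge0 ?dotv_ge0. Qed.

Lemma zrow_lift G k : zrow G (lift ord0 k) 0 = G i (lift ord0 k).
Proof. by rewrite mxE eq_sym (negbTE (neq_lift _ _)). Qed.

Definition c5 : R := 64 * c2 / tau ^+ 2 + 16 * c2 ^+ 2 * (2 + 2 / tau + 4 / tau ^+ 2).

(** The weight of the erased design is passed back to the full one, where exchangeability applies.
    After [psi_compare] and [rank1_perturb_sym] there remain the shares of row [i] in the square
    norms of [psi], of [G B] and of the index column; the last one arises from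
    [z . B = (G B)_i - G_i0 B_0]. *)
Lemma wrow_full (G : 'M[R]_(n, q.+1)) (rho2 : R) :
  0 < sq (psi G) -> 0 < sq (psi (erase G)) -> 0 <= rho2 ->
  rho2 <= 4 * c2 * (1 + opnorm (erase G) / Num.sqrt N) ^+ 2 * (N / sq (psi (erase G))) ->
  rho2 * wrow G <= c5 * (kap G ^+ 8 * (1 + opnorm G / Num.sqrt N) ^+ 8) *
    (1 + N * psi G i 0 ^+ 2 / sq (psi G) + N * (G *m B G) i 0 ^+ 2 / sq (G *m B G)
     + N * G i 0 ^+ 2 / sq (col 0 G)).
Proof.
move=> p0 pt0 r0 hr; have k1 := kap_ge1 G.
have sN : 0 < Num.sqrt N by rewrite sqrtr_gt0.
have N1 : 1 <= N by rewrite ler1n.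
have eN : opnorm G ^+ 2 = N * (opnorm G / Num.sqrt N) ^+ 2.
  by rewrite exprMn exprVn sqr_sqrtr ?(ltW N0)// mulrCA mulfV ?gt_eqF// mulr1.
set K := opnorm G / _ in eN *; set x := 1 + K; set k := kap G in k1 *.
have K0 : 0 <= K by rewrite divr_ge0 ?opnorm_ge0// ltW.
have x1 : 1 <= x by rewrite lerDl.
have t0 : 0 < tau^-1 by rewrite invr_gt0.
have c21 := c2_ge1.
have x00 : 0 <= x by rewrite (le_trans ler01).
have k00 : 0 <= k by rewrite (le_trans ler01).
have kE : sq (zrow G) = N * (k - 1) by rewrite /k /kap; field; rewrite gt_eqF.
have eer : erase G - G = delta_mx i 0 *m (- zrow G)^T.
  by rewrite linearN/= mulmxN -eraseE opprB.
have aK : 1 + opnorm (erase G) / Num.sqrt N <= 2 * (k * x).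
  have s1 : enorm (zrow G) / Num.sqrt N <= k.
    rewrite ler_pdivrMr// -ler_sqr ?nnegrE ?enorm_ge0 ?mulr_ge0 ?sqrtr_ge0//.
    rewrite enorm_sq kE exprMn sqr_sqrtr ?(ltW N0)// mulrC; apply: ler_wpM2r; [exact: ltW|nra].
  have := opnorm_rank1 eer; rewrite enormN => h.
  have : opnorm (erase G) / Num.sqrt N <= K + enorm (zrow G) / Num.sqrt N.
    by rewrite -mulrDl ler_pM2r ?invr_gt0.
  rewrite /x; nra.
have at0 : 0 <= opnorm (erase G) / Num.sqrt N by rewrite divr_ge0 ?opnorm_ge0// ltW.
have eNt : opnorm (erase G) ^+ 2 = N * (opnorm (erase G) / Num.sqrt N) ^+ 2.
  by rewrite exprMn exprVn sqr_sqrtr ?(ltW N0)// mulrCA mulfV ?gt_eqF// mulr1.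
set Kt := opnorm (erase G) / _ in aK at0 eNt hr.
set pt := sq (psi (erase G)) in hr pt0; set p := sq (psi G) in p0 *.
have kx1 : 1 <= k * x by rewrite mulr_ege1.
have aK2 : (1 + Kt) ^+ 2 <= 4 * (k * x) ^+ 2.
  have -> : 4 * (k * x) ^+ 2 = (2 * (k * x)) ^+ 2 by ring.
  by rewrite ler_sqr ?nnegrE//; lra.
have hB : N * sq (B (erase G)) / pt <= Kt ^+ 2 / tau ^+ 2.
  rewrite ler_pdivrMr// mulrAC ler_pdivlMr ?exprn_gt0// -(ler_pM2l N0).
  have := B_le_psi (erase G); rewrite eNt -/pt exprMn; lra.
(* The coefficient part of [wrow] is controlled by the norm of the erased residuals and needs no
   share of row [i]. *)
have part1 : rho2 * sq (B (erase G)) <= 64 * c2 / tau ^+ 2 * (k * x) ^+ 4.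
  apply: (@le_trans _ _ (4 * c2 * (1 + Kt) ^+ 2 * (N * sq (B (erase G)) / pt))).
    have := ler_wpM2r (dotv_ge0 (B (erase G))) hr; lra.
  have KK : Kt ^+ 2 <= (1 + Kt) ^+ 2 by rewrite ler_sqr ?nnegrE//; lra.
  have a1 : N * sq (B (erase G)) / pt <= 4 * (k * x) ^+ 2 / tau ^+ 2.
    apply: le_trans hB _; rewrite ler_pM2r ?invr_gt0 ?exprn_gt0//; lra.
  apply: (@le_trans _ _ (4 * c2 * (4 * (k * x) ^+ 2) * (4 * (k * x) ^+ 2 / tau ^+ 2))).
    apply: ler_pM => //.
    - by rewrite mulr_ge0 ?sqr_ge0// mulr_ge0//; lra.
    - by rewrite divr_ge0 ?(ltW pt0)// mulr_ge0 ?dotv_ge0// ltW.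
    - by apply: ler_wpM2l => //; lra.
  have -> : 4 * c2 * (4 * (k * x) ^+ 2) * (4 * (k * x) ^+ 2 / tau ^+ 2) =
     64 * c2 / tau ^+ 2 * (k * x) ^+ 4 by field; rewrite gt_eqF.
  by [].
have hpt : N / pt <= c2 * (x * k) ^+ 2 * (N / p).
  have := psi_compare eer; rewrite -/p -/pt dotvNl dotvNr opprK -/K -/x -/(kap G) -/k => h.
  rewrite ler_pdivrMr// mulrA mulrAC ler_pdivlMr// -[leRHS]mulrA [leRHS]mulrC -mulrA.
  by apply: ler_wpM2l; [exact: ltW|move: h; rewrite exprMn; lra].
set b := sq (B G).
have hb : N * b / p <= K ^+ 2 / tau ^+ 2.
  rewrite ler_pdivrMr// mulrAC ler_pdivlMr ?exprn_gt0// -(ler_pM2l N0).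
  have := B_le_psi G; rewrite eN -/p -/b exprMn; lra.
have b0 : 0 <= b by exact: dotv_ge0.
have Kx : K ^+ 2 <= x ^+ 2 by rewrite ler_sqr ?nnegrE /x//; lra.
have x40 : 0 <= x ^+ 4 by rewrite exprn_ge0//; lra.
set T1 := N * psi G i 0 ^+ 2 / p; set T2 := N * (G *m B G) i 0 ^+ 2 / _; set T3 := N * G i 0 ^+ 2 / _.
have T10 : 0 <= T1 by rewrite divr_ge0 ?(ltW p0)// mulr_ge0 ?sqr_ge0// ltW.
have T20 : 0 <= T2 by rewrite divr_ge0 ?dotv_ge0// mulr_ge0 ?sqr_ge0// ltW.
have T30 : 0 <= T3 by rewrite divr_ge0 ?dotv_ge0// mulr_ge0 ?sqr_ge0// ltW.
have e2 : N * (G *m B G) i 0 ^+ 2 / p <= x ^+ 4 / tau ^+ 2 * T2.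
  have gb : sq (G *m B G) <= N * K ^+ 2 * b.
    rewrite -eN /b -!enorm_sq -exprMn ler_sqr ?nnegrE ?enorm_ge0 ?mulr_ge0 ?opnorm_ge0 ?enorm_ge0//.
    exact: opnormP.
  have [g0|g0] := eqVneq (sq (G *m B G)) 0.
    have -> : (G *m B G) i 0 = 0.
      by move/eqP: g0; rewrite dotv_eq0 => /eqP ->; rewrite mxE.
    by rewrite expr0n mulr0 mul0r mulr_ge0// divr_ge0// sqr_ge0.
  have gp : 0 < sq (G *m B G) by rewrite lt_def g0 dotv_ge0.
  have -> : N * (G *m B G) i 0 ^+ 2 / p = sq (G *m B G) / p * T2.
    by rewrite /T2; field; rewrite ?gt_eqF.
  apply: ler_wpM2r => //.
  apply: (@le_trans _ _ (K ^+ 2 * (N * b / p))).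
    rewrite ler_pdivrMr//; apply: le_trans gb _.
    by rewrite (_ : K ^+ 2 * (N * b / p) * p = N * K ^+ 2 * b)//; field; rewrite gt_eqF.
  apply: (@le_trans _ _ (x ^+ 2 * (x ^+ 2 / tau ^+ 2))).
    apply: ler_pM => //; rewrite ?sqr_ge0//.
      by rewrite divr_ge0 ?(ltW p0)// mulr_ge0// ltW.
    by apply: le_trans hb _; rewrite ler_pM2r ?invr_gt0 ?exprn_gt0.
  by rewrite mulrA -exprD.
have e3 : N * (G i 0 ^+ 2 * b) / p <= x ^+ 4 / tau ^+ 2 * T3.
  have uE : col 0 G = G *m delta_mx 0 0 by rewrite colE.
  have uN : sq (col 0 G) <= N * K ^+ 2.
    rewrite -eN -enorm_sq uE ler_sqr ?nnegrE ?enorm_ge0 ?opnorm_ge0//.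
    by apply: le_trans (opnormP _ _) _; rewrite enorm_delta mulr1.
  have [g0|g0] := eqVneq (sq (col 0 G)) 0.
    have -> : G i 0 = 0.
      move/eqP: g0; rewrite dotv_eq0 => /eqP e; have := congr1 (fun M : 'cV[R]_n => M i 0) e.
      by rewrite !mxE.
    by rewrite expr0n mul0r mulr0 mul0r mulr_ge0// divr_ge0// sqr_ge0.
  have gp : 0 < sq (col 0 G) by rewrite lt_def g0 dotv_ge0.
  have -> : N * (G i 0 ^+ 2 * b) / p = (sq (col 0 G) / N) * (N * b / p) * T3.
    by rewrite /T3; field; rewrite ?gt_eqF.
  apply: ler_wpM2r => //.
  apply: (@le_trans _ _ (x ^+ 2 * (x ^+ 2 / tau ^+ 2))).
    apply: ler_pM.
    - by rewrite divr_ge0 ?dotv_ge0// ltW.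
    - by rewrite divr_ge0 ?(ltW p0)// mulr_ge0// ltW.
    - by rewrite ler_pdivrMr//; apply: le_trans uN _; rewrite mulrC ler_pM2r.
    - by apply: le_trans hb _; rewrite ler_pM2r ?invr_gt0 ?exprn_gt0.
  by rewrite mulrA -exprD.
have hpsi : psi (erase G) i 0 ^+ 2 <= (2 + 2 / tau) * k * psi G i 0 ^+ 2 +
    4 * (G *m B G) i 0 ^+ 2 + 4 * (G i 0 ^+ 2 * b).
  have h := rank1_perturb_sym (eraseE G).
  have d0 : 0 <= N * tau * sq (B G - B (erase G)) by rewrite mulr_ge0 ?dotv_ge0// ltW.
  have c0 := coord_le_sq (psi G - psi (erase G)) i.
  have zB : dotv (zrow G) (B G) = (G *m B G) i 0 - G i 0 * B G 0 0.
    rewrite dotvE mxE !big_ord_recl/= mxE eqxx mul0r add0r addrAC subrr add0r.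
    by apply: eq_bigr => j _; rewrite zrow_lift.
  have zB2 : dotv (zrow G) (B G) ^+ 2 <= 2 * (G *m B G) i 0 ^+ 2 + 2 * (G i 0 ^+ 2 * b).
    rewrite zB; have : B G 0 0 ^+ 2 <= b by exact: coord_le_sq.
    set g := (G *m B G) i 0; set u := G i 0; set b0' := B G 0 0 => hb0.
    have : u ^+ 2 * b0' ^+ 2 <= u ^+ 2 * b by rewrite ler_wpM2l// sqr_ge0.
    have := sqr_ge0 (g + u * b0'); nra.
  have e4 : sq (zrow G) * psi G i 0 ^+ 2 / (N * tau) = (k - 1) * psi G i 0 ^+ 2 / tau.
    by rewrite kE; field; rewrite ?gt_eqF.
  rewrite e4 in h; rewrite ![in X in X <= _]mxE in c0.
  set a := psi (erase G) i 0 in c0 *; set a' := psi G i 0 in h c0 *.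
  have := sqr_ge0 (a - 2 * a'); have := sqr_ge0 a'; have ta : 0 <= a' ^+ 2 / tau by rewrite divr_ge0 ?sqr_ge0// ltW.
  nra.
have part2 : rho2 * psi (erase G) i 0 ^+ 2 <=
    16 * c2 ^+ 2 * (2 + 2 / tau + 4 / tau ^+ 2) * (k ^+ 5 * x ^+ 8) * (T1 + T2 + T3).
  set P := psi (erase G) i 0 ^+ 2 in hpsi *; have P0 : 0 <= P by exact: sqr_ge0.
  apply: (@le_trans _ _ (4 * c2 * (4 * (k * x) ^+ 2) * (c2 * (x * k) ^+ 2 * (N / p)) * P)).
    apply: ler_wpM2r => //; apply: le_trans hr _; apply: ler_pM => //.
    - by rewrite mulr_ge0 ?sqr_ge0// mulr_ge0//; lra.
    - by rewrite divr_ge0// ltW.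
    - by apply: ler_wpM2l => //; lra.
  have NP : N / p * P <= (2 + 2 / tau) * k * T1 + 4 * (x ^+ 4 / tau ^+ 2 * T2) + 4 * (x ^+ 4 / tau ^+ 2 * T3).
    have := ler_wpM2l (ltW (divr_gt0 N0 p0)) hpsi.
    have -> : N / p * ((2 + 2 / tau) * k * psi G i 0 ^+ 2 + 4 * (G *m B G) i 0 ^+ 2 + 4 * (G i 0 ^+ 2 * b)) =
      (2 + 2 / tau) * k * T1 + 4 * (N * (G *m B G) i 0 ^+ 2 / p) + 4 * (N * (G i 0 ^+ 2 * b) / p).
      by rewrite /T1; field; rewrite ?gt_eqF.
    lra.
  have x4 : 1 <= x ^+ 4 by rewrite expr_ge1//; lra.
  have NP2 : N / p * P <= (2 + 2 / tau + 4 / tau ^+ 2) * (k * x ^+ 4) * (T1 + T2 + T3).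
    apply: le_trans NP _; rewrite -exprVn; move: (tau^-1) t0 => t t0.
    have kx4 : k <= k * x ^+ 4 by rewrite ler_peMr//; lra.
    have xk4 : x ^+ 4 <= k * x ^+ 4 by rewrite ler_peMl.
    move: x4 kx4 xk4; set v := x ^+ 4 => h3; move: (k * v) => V h1 h2.
    have q1 : (2 + 2 * t) * k * T1 <= (2 + 2 * t + 4 * t ^+ 2) * V * T1.
      apply: ler_wpM2r => //; apply: ler_pM => //; [lra|have := sqr_ge0 t; lra].
    have q2 T : 0 <= T -> 4 * (v * t ^+ 2 * T) <= (2 + 2 * t + 4 * t ^+ 2) * V * T.
      move=> T0; have -> : 4 * (v * t ^+ 2 * T) = 4 * (t ^+ 2 * v) * T by ring.
      apply: ler_wpM2r => //; have := sqr_ge0 t => tt.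
      have : t ^+ 2 * v <= t ^+ 2 * V by rewrite ler_wpM2l.
      have : 0 <= (2 + 2 * t) * V by rewrite mulr_ge0//; lra.
      lra.
    have := q2 T2 T20; have := q2 T3 T30; lra.
  have -> : 4 * c2 * (4 * (k * x) ^+ 2) * (c2 * (x * k) ^+ 2 * (N / p)) * P =
    16 * c2 ^+ 2 * (k ^+ 4 * x ^+ 4) * (N / p * P) by ring.
  have -> : 16 * c2 ^+ 2 * (2 + 2 / tau + 4 / tau ^+ 2) * (k ^+ 5 * x ^+ 8) * (T1 + T2 + T3) =
    16 * c2 ^+ 2 * (k ^+ 4 * x ^+ 4) * ((2 + 2 / tau + 4 / tau ^+ 2) * (k * x ^+ 4) * (T1 + T2 + T3)) by ring.
  apply: ler_wpM2l NP2; apply: mulr_ge0; last by apply: mulr_ge0; exact: exprn_ge0.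
  by apply: mulr_ge0 => //; exact: sqr_ge0.
rewrite /wrow mulrDr.
have m1 : (k * x) ^+ 4 <= k ^+ 8 * x ^+ 8 by rewrite -exprMn ler_weXn2l.
have m2 : k ^+ 5 * x ^+ 8 <= k ^+ 8 * x ^+ 8.
  by apply: ler_wpM2r; [exact: exprn_ge0|rewrite ler_weXn2l].
have C1 : 0 <= 64 * c2 / tau ^+ 2 by rewrite divr_ge0 ?sqr_ge0// mulr_ge0//; lra.
have C2 : 0 <= 16 * c2 ^+ 2 * (2 + 2 / tau + 4 / tau ^+ 2).
  by rewrite -exprVn mulr_ge0 ?mulr_ge0 ?sqr_ge0//; have := sqr_ge0 (tau^-1); lra.
rewrite /c5; move: (k ^+ 8 * x ^+ 8) m1 m2 => V m1 m2.
have V0 : 0 <= V by apply: le_trans m1; apply: exprn_ge0; exact: mulr_ge0.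
have TS : 0 <= T1 + T2 + T3 := addr_ge0 (addr_ge0 T10 T20) T30.
have r1 := ler_wpM2l C1 m1.
have r2 : 16 * c2 ^+ 2 * (2 + 2 / tau + 4 / tau ^+ 2) * (k ^+ 5 * x ^+ 8) * (T1 + T2 + T3) <=
   16 * c2 ^+ 2 * (2 + 2 / tau + 4 / tau ^+ 2) * V * (T1 + T2 + T3).
  by apply: ler_wpM2r; [exact: TS|exact: ler_wpM2l].
have r3 : 0 <= 64 * c2 / tau ^+ 2 * V * (T1 + T2 + T3).
  exact: mulr_ge0 (mulr_ge0 C1 V0) TS.
have r4 : 0 <= 16 * c2 ^+ 2 * (2 + 2 / tau + 4 / tau ^+ 2) * V by exact: mulr_ge0.
lra.
Qed.

Section Zscore.
Variables (G : 'M[R]_(n, q.+1)) (Z : R).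
Hypothesis hZ : dotv (zrow G) (B (erase G)) ^+ 2 <= sq (B (erase G)) * Z ^+ 2.
Let bt : R := 1 + 1 / tau.

Let bt1 : 1 <= bt. Proof. by rewrite /bt lerDl div1r invr_ge0 ltW. Qed.

Let N1 : 1 <= N. Proof. by rewrite ler1n. Qed.

(** The form [z . B0] of [rank1_perturb] is bounded by [|B0| |Z|] and not by [|z| |B0|], which would
    lose a factor of order [sqrt n]. *)
Lemma erase_close : N * tau * sq (B G - B (erase G)) + sq (psi G - psi (erase G)) <=
  bt * (wrow G * (kap G * (1 + Z ^+ 2))).
Proof.
apply: le_trans (rank1_perturb (eraseE G)) _.
have k1 := kap_ge1 G; have w0 := wrow_ge0 G.
have -> : sq (zrow G) * psi (erase G) i 0 ^+ 2 / (N * tau) =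
   (kap G - 1) * psi (erase G) i 0 ^+ 2 / tau by rewrite /kap; field; rewrite ?gt_eqF.
have p0 := sqr_ge0 (psi (erase G) i 0); have b0 := dotv_ge0 (B (erase G)).
have h1 : (kap G - 1) * psi (erase G) i 0 ^+ 2 <= wrow G * kap G.
  rewrite /wrow; nra.
have h2 : dotv (zrow G) (B (erase G)) ^+ 2 <= wrow G * Z ^+ 2.
  apply: le_trans hZ _; rewrite ler_wpM2r ?sqr_ge0// /wrow; lra.
have t1 : 0 < tau^-1 by rewrite invr_gt0.
have z0 := sqr_ge0 Z; have wz : 0 <= wrow G * Z ^+ 2 by exact: mulr_ge0.
have wk : 0 <= wrow G * kap G by rewrite mulr_ge0//; lra.
have h3 : (kap G - 1) * psi (erase G) i 0 ^+ 2 / tau <= wrow G * kap G / tau.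
  by rewrite ler_pM2r.
have e : bt * (wrow G * (kap G * (1 + Z ^+ 2))) = wrow G * kap G / tau + wrow G * kap G +
   wrow G * kap G * Z ^+ 2 * bt by rewrite /bt; field; rewrite gt_eqF.
have h4 : wrow G * Z ^+ 2 <= wrow G * kap G * Z ^+ 2 * bt.
  have : wrow G * Z ^+ 2 <= wrow G * kap G * Z ^+ 2.
    by rewrite ler_wpM2r// ler_peMr.
  have : 0 <= wrow G * kap G * Z ^+ 2 by rewrite mulr_ge0.
  nra.
rewrite e; lra.
Qed.

Lemma dB_erase : N * sq (B G - B (erase G)) <= bt / tau * (wrow G * (kap G * (1 + Z ^+ 2))).
Proof.
have := erase_close; set X := wrow G * _ => h.
have p0 := dotv_ge0 (psi G - psi (erase G)).
rewrite -(ler_pM2r tau0).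
have -> : bt / tau * X * tau = bt * X by field; rewrite gt_eqF.
lra.
Qed.

Definition c3 : R := 4 * (1 + 1 / tau) ^+ 2.

Lemma wfull : psi G i 0 ^+ 2 + sq (B G) <= c3 * (wrow G * (kap G * (1 + Z ^+ 2))).
Proof.
have h1 := erase_close; have h2 := dB_erase.
have k1 := kap_ge1 G; have w0 := wrow_ge0 G; have z0 := sqr_ge0 Z.
set X := wrow G * (kap G * (1 + Z ^+ 2)) in h1 h2 *.
have X0 : wrow G <= X.
  rewrite /X ler_peMr//; nra.
have b0 := dotv_ge0 (B G - B (erase G)).
have e1 := sq_le2 (B (erase G)) (B G).
have e2 : psi G i 0 ^+ 2 <= 2 * psi (erase G) i 0 ^+ 2 + 2 * sq (psi G - psi (erase G)).
  have := coord_le_sq (psi G - psi (erase G)) i; rewrite !mxE.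
  have := sqr_ge0 (psi G i 0 - 2 * psi (erase G) i 0); nra.
have e3 : sq (B (erase G) - B G) = sq (B G - B (erase G)).
  by rewrite -opprB dotvNl dotvNr opprK.
have e4 : sq (B G - B (erase G)) <= bt / tau * X.
  apply: le_trans h2; rewrite ler_peMl//.
have p0 := dotv_ge0 (psi G - psi (erase G)).
have d0 : 0 <= N * tau * sq (B G - B (erase G)) by rewrite mulr_ge0// ltW.
have wE : psi (erase G) i 0 ^+ 2 + sq (B (erase G)) = wrow G by [].
have -> : c3 * X = 4 * X * bt + 4 * (bt / tau * X) by rewrite /c3 /bt; field; rewrite gt_eqF.
have XX : 0 <= X by lra.
have tX : 0 <= bt / tau * X by lra.
have : X <= X * bt by rewrite ler_peMr.
rewrite e3 in e1; lra.
Qed.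

End Zscore.

Section Normalized.
Variables (G : 'M[R]_(n, q.+1)) (rho2 : R).
Hypothesis hrho : N / sq (psi G) <= rho2 * kap G ^+ 2.
Hypothesis rho0 : 0 <= rho2.
Variable Z : R.
Hypothesis hZ : dotv (zrow G) (B (erase G)) ^+ 2 <= sq (B (erase G)) * Z ^+ 2.

(** Common majorant of the normalized errors; its exponents leave room for every power of [kap] and
    of [1 + Z^2] met below. *)
Definition Xrow : R := rho2 * wrow G * (kap G ^+ 4 * (1 + Z ^+ 2) ^+ 2).

Lemma Xrow_ge a b : (a <= 4)%N -> (b <= 2)%N ->
  rho2 * wrow G * (kap G ^+ a * (1 + Z ^+ 2) ^+ b) <= Xrow.
Proof.
move=> a4 b2; have k1 := kap_ge1 G; have w0 := wrow_ge0 G; have z0 := sqr_ge0 Z.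
have z1 : 1 <= 1 + Z ^+ 2 by lra.
rewrite /Xrow ler_wpM2l//; first by rewrite mulr_ge0.
by rewrite ler_pM ?exprn_ge0 ?ler_weXn2l//; lra.
Qed.

Lemma dB_normalized : N / sq (psi G) * sq (B G - B (erase G)) * (1 + Z ^+ 2) <=
  (1 + 1 / tau) / tau * Xrow / N.
Proof.
have h := dB_erase hZ; have k1 := kap_ge1 G; have w0 := wrow_ge0 G; have z0 := sqr_ge0 Z.
have z1 : 0 <= 1 + Z ^+ 2 by lra.
have b0 := dotv_ge0 (B G - B (erase G)).
have bt0 : 0 <= (1 + 1 / tau) / tau by rewrite divr_ge0 ?ltW// addr_gt0// divr_gt0.
rewrite ler_pdivlMr//.
apply: (@le_trans _ _ (rho2 * kap G ^+ 2 * (1 + Z ^+ 2) * (N * sq (B G - B (erase G))))).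
  have : N / sq (psi G) * ((1 + Z ^+ 2) * (N * sq (B G - B (erase G)))) <= rho2 * kap G ^+ 2 * ((1 + Z ^+ 2) * (N * sq (B G - B (erase G)))).
    by rewrite ler_wpM2r// mulr_ge0// mulr_ge0// ltW.
  lra.
apply: (@le_trans _ _ (rho2 * kap G ^+ 2 * (1 + Z ^+ 2) * ((1 + 1 / tau) / tau * (wrow G * (kap G * (1 + Z ^+ 2)))))).
  by rewrite ler_wpM2l// mulr_ge0// mulr_ge0// sqr_ge0.
have -> : rho2 * kap G ^+ 2 * (1 + Z ^+ 2) * ((1 + 1 / tau) / tau * (wrow G * (kap G * (1 + Z ^+ 2)))) =
  (1 + 1 / tau) / tau * (rho2 * wrow G * (kap G ^+ 3 * (1 + Z ^+ 2) ^+ 2)) by ring.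
by rewrite ler_wpM2l// Xrow_ge.
Qed.

Lemma wfull_normalized : N / sq (psi G) * (psi G i 0 ^+ 2 + sq (B G)) <= c3 * Xrow.
Proof.
have h := wfull hZ; have k1 := kap_ge1 G; have w0 := wrow_ge0 G; have z0 := sqr_ge0 Z.
have z1 : 0 <= 1 + Z ^+ 2 by lra.
have c30 : 0 <= c3 by rewrite mulr_ge0// sqr_ge0.
apply: (@le_trans _ _ (rho2 * kap G ^+ 2 * (c3 * (wrow G * (kap G * (1 + Z ^+ 2)))))).
  rewrite ler_pM//; last by rewrite addr_ge0 ?sqr_ge0 ?dotv_ge0.
  by rewrite divr_ge0 ?dotv_ge0// ltW.
have -> : rho2 * kap G ^+ 2 * (c3 * (wrow G * (kap G * (1 + Z ^+ 2)))) =
  c3 * (rho2 * wrow G * (kap G ^+ 3 * (1 + Z ^+ 2) ^+ 1)) by ring.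
by rewrite ler_wpM2l// Xrow_ge.
Qed.

End Normalized.
Section Field.
Variable rho : 'M[R]_(n, q.+1) -> R.
Hypothesis rhoE : forall G G', erase G = erase G' -> rho G = rho G'.

Definition fld (j : 'I_q) (G : 'M[R]_(n, q.+1)) : R :=
  rho G * kap G * (B G - B (erase G)) (lift ord0 j) 0.

Definition shiftG (k : 'I_q) (h : R) (G : 'M[R]_(n, q.+1)) : 'M[R]_(n, q.+1) :=
  G + h *: delta_mx i (lift ord0 k).

Lemma shiftG_rank1 k h G :
  shiftG k h G - G = delta_mx i 0 *m (h *: delta_mx (lift ord0 k) 0 : 'cV[R]_q.+1)^T.
Proof.
rewrite /shiftG addrC addKr linearZ/= -scalemxAr; congr (_ *: _).
by rewrite trmx_delta mul_delta_mx.
Qed.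

Lemma erase_shiftG k h G : erase (shiftG k h G) = erase G.
Proof.
apply/matrixP => l j; rewrite !mxE.
have [->|li] := eqVneq l i; last by rewrite mulr0 addr0.
rewrite /=; case: (eqVneq j 0) => [->|] //=.
by rewrite mulr0 addr0.
Qed.

Lemma zrow_shiftG k h G : zrow (shiftG k h G) = zrow G + h *: delta_mx (lift ord0 k) 0.
Proof.
apply/matrixP => j l; rewrite !ord1 !mxE eqxx andbT.
by case: ifPn => [/eqP->|_] //; rewrite (negbTE (neq_lift _ _)) mulr0 addr0.
Qed.

Lemma kap_shiftG k h G : kap (shiftG k h G) - kap G = (2 * h * G i (lift ord0 k) + h ^+ 2) / N.
Proof.
rewrite /kap zrow_shiftG !dotvDl !dotvDr !dotvZl !dotvZr (dotvC (zrow G) (delta_mx _ _)).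
rewrite !dotv_delta zrow_lift [delta_mx _ _ _ _]mxE !eqxx /=.
by field; rewrite gt_eqF.
Qed.

Lemma sq_lift (u : 'cV[R]_q.+1) : \sum_(j < q) u (lift ord0 j) 0 ^+ 2 <= sq u.
Proof. by rewrite dotv_sq big_ord_recl lerDr sqr_ge0. Qed.

Section Bounds.
Variables (G : 'M[R]_(n, q.+1)) (Z : R).
Hypothesis hrho : N / sq (psi G) <= rho G ^+ 2 * kap G ^+ 2.
Hypothesis hZ : dotv (zrow G) (B (erase G)) ^+ 2 <= sq (B (erase G)) * Z ^+ 2.
Notation X := (Xrow G (rho G ^+ 2) Z).

Lemma Xrow_ge0 : 0 <= X.
Proof.
have k1 := kap_ge1 G; have z0 := sqr_ge0 Z.
rewrite /Xrow mulr_ge0//; first by rewrite mulr_ge0 ?sqr_ge0 ?wrow_ge0.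
by rewrite mulr_ge0 ?exprn_ge0//; lra.
Qed.

Lemma fld_sq : \sum_j fld j G ^+ 2 <= (1 + 1 / tau) / tau * X / N.
Proof.
have h := dB_erase hZ; have k1 := kap_ge1 G; have w0 := wrow_ge0 G; have z0 := sqr_ge0 Z.
under eq_bigr do rewrite exprMn; rewrite -mulr_sumr.
have e := sq_lift (B G - B (erase G)).
have bt0 : 0 <= (1 + 1 / tau) / tau by rewrite divr_ge0 ?ltW// addr_gt0// divr_gt0.
rewrite ler_pdivlMr//.
apply: (@le_trans _ _ ((rho G * kap G) ^+ 2 * (N * sq (B G - B (erase G))))).
  by rewrite -mulrA ler_wpM2l ?sqr_ge0// mulrC ler_wpM2l// ltW.
apply: (@le_trans _ _ ((rho G * kap G) ^+ 2 * ((1 + 1 / tau) / tau * (wrow G * (kap G * (1 + Z ^+ 2)))))).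
  by rewrite ler_wpM2l ?sqr_ge0.
have -> : (rho G * kap G) ^+ 2 * ((1 + 1 / tau) / tau * (wrow G * (kap G * (1 + Z ^+ 2)))) =
  (1 + 1 / tau) / tau * (rho G ^+ 2 * wrow G * (kap G ^+ 3 * (1 + Z ^+ 2) ^+ 1)) by ring.
by rewrite ler_wpM2l// Xrow_ge// sqr_ge0.
Qed.

Variable delta : R.
Hypotheses (delta0 : 0 < delta) (qN : q%:R <= N / delta).

Definition c4 : R := 8 * (1 + 1 / (delta * tau)) / tau * c3 +
  2 * (8 + 1 / delta) * ((1 + 1 / tau) / tau).

(** The product rule splits an increment into that of [B] and that of [kap], while [rho] does not
    move. Over all shifts of row [i], the squared moves of [B] sum to at most [h^2 / (N tau)] times
    [q psi_i^2 / (N tau) + |B|^2], and [q <= N / delta] keeps the last factor bounded by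
    [psi_i^2 + |B|^2], up to constants. *)
Lemma fld_increment h : 0 <= h <= 1 / 2 ->
  \sum_j \sum_k (fld j (shiftG k h G) - fld j G) ^+ 2 <= h ^+ 2 * (c4 * X / N).
Proof.
move=> /andP[h0 h1]; have k1 := kap_ge1 G; have w0 := wrow_ge0 G; have z0 := sqr_ge0 Z.
have N1 : 1 <= N by rewrite ler1n.
set p2 := psi G i 0 ^+ 2; set b := sq (B G - B (erase G)).
have p20 : 0 <= p2 by exact: sqr_ge0.
have b0 : 0 <= b by exact: dotv_ge0.
have Nz : sq (zrow G) = N * (kap G - 1) by rewrite /kap; field; rewrite gt_eqF.
pose zk k := G i (lift ord0 k).
have zsum : \sum_k zk k ^+ 2 <= N * (kap G - 1).
  by rewrite -Nz; apply: le_trans (sq_lift _); apply: ler_sum => k _; rewrite zrow_lift.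
have kp k : kap (shiftG k h G) ^+ 2 <= 4 * kap G ^+ 2.
  have a1 : kap (shiftG k h G) <= 2 * kap G.
    have e := kap_shiftG k h G.
    have : (2 * h * zk k + h ^+ 2) / N <= (N * (kap G - 1) + 1) / N.
      rewrite ler_pM2r ?invr_gt0//.
      have a2 : zk k ^+ 2 <= N * (kap G - 1).
        by apply: le_trans zsum; rewrite (bigD1 k)//= lerDl sumr_ge0// => l _; exact: sqr_ge0.
      have := sqr_ge0 (h - zk k); nra.
    have -> : (N * (kap G - 1) + 1) / N = kap G - 1 + N^-1 by field; rewrite gt_eqF.
    have : N^-1 <= 1 by rewrite invf_le1.
    rewrite -e; lra.
  have -> : 4 * kap G ^+ 2 = (2 * kap G) ^+ 2 by ring.
  by rewrite ler_sqr ?nnegrE//; have := kap_ge1 (shiftG k h G); lra.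
have dBk k : N * tau * sq (B (shiftG k h G) - B G) <= h ^+ 2 * (p2 / (N * tau) + B G (lift ord0 k) 0 ^+ 2).
  have := rank1_perturb (shiftG_rank1 k h G).
  rewrite dotvZl dotvZr dotv_delta mxE !eqxx /= mulr1 dotvZl dotv_delta exprMn -/p2 => a.
  have := dotv_ge0 (psi (shiftG k h G) - psi G).
  have -> : h ^+ 2 * (p2 / (N * tau) + B G (lift ord0 k) 0 ^+ 2) =
    h * h * p2 / (N * tau) + h ^+ 2 * B G (lift ord0 k) 0 ^+ 2 by ring.
  by lra.
pose S1 := \sum_k sq (B (shiftG k h G) - B G).
have hS1 : N * S1 <= h ^+ 2 * ((1 + 1 / (delta * tau)) / tau * (p2 + sq (B G))).
  have a1 : N * tau * S1 <= h ^+ 2 * (q%:R * p2 / (N * tau) + sq (B G)).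
    rewrite /S1 mulr_sumr.
    apply: (@le_trans _ _ (\sum_(k < q) (h ^+ 2 * (p2 / (N * tau) + B G (lift ord0 k) 0 ^+ 2)))).
      exact: ler_sum.
    rewrite -mulr_sumr ler_wpM2l ?sqr_ge0// big_split/= sumr_const card_ord -[_ *+ q]mulr_natl.
    by rewrite mulrA lerD2l sq_lift.
  have a2 : q%:R * p2 / (N * tau) <= p2 / (delta * tau).
    rewrite ler_pdivrMr// (_ : p2 / (delta * tau) * (N * tau) = N / delta * p2); last by field; rewrite ?gt_eqF.
    by rewrite ler_wpM2r.
  rewrite -(ler_pM2r tau0).
  have -> : h ^+ 2 * ((1 + 1 / (delta * tau)) / tau * (p2 + sq (B G))) * tau =
    h ^+ 2 * (p2 + sq (B G) + (p2 / (delta * tau) + sq (B G) / (delta * tau))).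
    by field; rewrite ?gt_eqF.
  have -> : N * S1 * tau = N * tau * S1 by ring.
  apply: le_trans a1 _; rewrite ler_wpM2l ?sqr_ge0//.
  have : 0 <= sq (B G) / (delta * tau) by rewrite divr_ge0 ?dotv_ge0// mulr_ge0 ?ltW.
  lra.
pose S2 := \sum_k (kap (shiftG k h G) - kap G) ^+ 2.
have hS2 : N * S2 <= h ^+ 2 * ((8 + 1 / delta) * kap G).
  have a1 : N ^+ 2 * S2 <= h ^+ 2 * (8 * (N * (kap G - 1)) + N / delta).
    rewrite /S2 mulr_sumr.
    apply: (@le_trans _ _ (\sum_(k < q) (h ^+ 2 * (8 * zk k ^+ 2 + 1)))).
      apply: ler_sum => k _; rewrite kap_shiftG -/(zk k) exprMn mulrCA exprVn mulfV ?gt_eqF ?exprn_gt0// mulr1.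
      have -> : (2 * h * zk k + h ^+ 2) ^+ 2 = h ^+ 2 * (2 * zk k + h) ^+ 2 by ring.
      rewrite ler_wpM2l ?sqr_ge0//.
      have := sqr_ge0 (2 * zk k - h); nra.
    rewrite -mulr_sumr ler_wpM2l ?sqr_ge0// big_split/= sumr_const card_ord -mulr_sumr.
    by rewrite lerD// ler_wpM2l.
  rewrite -(ler_pM2l N0).
  apply: (@le_trans _ _ (N ^+ 2 * S2)); first by rewrite mulrA -expr2.
  apply: le_trans a1 _; rewrite [leRHS]mulrCA ler_wpM2l ?sqr_ge0//.
  have d0 : 0 <= delta^-1 by rewrite invr_ge0 ltW.
  have : N / delta <= N / delta * kap G by rewrite ler_peMr// divr_ge0 ?ltW.
  lra.
apply: (@le_trans _ _ (rho G ^+ 2 * (8 * kap G ^+ 2 * S1 + 2 * S2 * b))).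
  rewrite exchange_big/=.
  have -> : rho G ^+ 2 * (8 * kap G ^+ 2 * S1 + 2 * S2 * b) =
     \sum_(k < q) (rho G ^+ 2 * (8 * kap G ^+ 2 * sq (B (shiftG k h G) - B G) +
        2 * (kap (shiftG k h G) - kap G) ^+ 2 * b)).
    by rewrite -mulr_sumr big_split/= -mulr_sumr -mulr_suml -mulr_sumr.
  apply: ler_sum => k _.
  apply: (@le_trans _ _ (\sum_(j < q) (rho G ^+ 2 *
      (2 * kap (shiftG k h G) ^+ 2 * (B (shiftG k h G) - B G) (lift ord0 j) 0 ^+ 2 +
       2 * (kap (shiftG k h G) - kap G) ^+ 2 * (B G - B (erase G)) (lift ord0 j) 0 ^+ 2)))).
    apply: ler_sum => j _; rewrite /fld erase_shiftG (rhoE (erase_shiftG k h G)).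
    set k' := kap _; set k0 := kap G.
    have -> : (B (shiftG k h G) - B (erase G)) (lift ord0 j) 0 =
      (B (shiftG k h G) - B G) (lift ord0 j) 0 + (B G - B (erase G)) (lift ord0 j) 0.
      by rewrite !mxE addrA subrK.
    set x := (B (shiftG k h G) - B G) _ _; set y' := (B G - _) _ _.
    have -> : rho G * k' * (x + y') - rho G * k0 * y' = rho G * (k' * x + (k' - k0) * y') by ring.
    rewrite exprMn ler_wpM2l ?sqr_ge0//.
    have := sqr_ge0 (k' * x - (k' - k0) * y'); nra.
  rewrite -mulr_sumr ler_wpM2l ?sqr_ge0// big_split/= -!mulr_sumr.
  apply: lerD.
    apply: (@le_trans _ _ (2 * kap (shiftG k h G) ^+ 2 * sq (B (shiftG k h G) - B G))).
      by rewrite ler_wpM2l ?sq_lift// mulr_ge0 ?sqr_ge0.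
    by rewrite ler_wpM2r ?dotv_ge0//; have := kp k; lra.
  by rewrite ler_wpM2l ?sq_lift// mulr_ge0 ?sqr_ge0.
have hw := wfull hZ; have hb := dB_erase hZ.
rewrite -/p2 in hw; rewrite -/b in hb.
set V := wrow G * (kap G * (1 + Z ^+ 2)) in hw hb.
have V0 : 0 <= V by rewrite !mulr_ge0//; lra.
have r0 : 0 <= rho G ^+ 2 by exact: sqr_ge0.
have d0 : 0 < delta^-1 by rewrite invr_gt0.
have t0 : 0 < tau^-1 by rewrite invr_gt0.
have s20 : 0 <= S2 by apply: sumr_ge0 => k _; exact: sqr_ge0.
have X1 : rho G ^+ 2 * kap G ^+ 2 * V <= X.
  have := @Xrow_ge G (rho G ^+ 2) r0 Z 3 1 isT isT; rewrite /V; lra.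
have b1 : b <= (1 + 1 / tau) / tau * V.
  by apply: le_trans hb; rewrite ler_peMl.
have bt0 : 0 <= (1 + 1 / tau) / tau by rewrite divr_ge0 ?ltW// addr_gt0// divr_gt0.
have kk : kap G <= kap G ^+ 2 by rewrite expr2 ler_peMr//; lra.
have m1 : N * (8 * kap G ^+ 2 * S1) <= h ^+ 2 * (8 * (1 + 1 / (delta * tau)) / tau * c3 * (kap G ^+ 2 * V)).
  have : 8 * kap G ^+ 2 * (N * S1) <= 8 * kap G ^+ 2 * (h ^+ 2 * ((1 + 1 / (delta * tau)) / tau * (c3 * V))).
    apply: ler_wpM2l; first by rewrite mulr_ge0// sqr_ge0.
    apply: le_trans hS1 _; apply: ler_wpM2l; first exact: sqr_ge0.
    apply: ler_wpM2l => //; apply: divr_ge0; last exact: ltW.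
    by rewrite addr_ge0// divr_ge0// mulr_ge0// ltW.
  lra.
have m2 : N * (2 * S2 * b) <= h ^+ 2 * (2 * (8 + 1 / delta) * ((1 + 1 / tau) / tau) * (kap G ^+ 2 * V)).
  apply: (@le_trans _ _ (2 * (h ^+ 2 * ((8 + 1 / delta) * kap G)) * ((1 + 1 / tau) / tau * V))).
    have -> : N * (2 * S2 * b) = 2 * (N * S2) * b by ring.
    apply: ler_pM => //; last by rewrite ler_pM2l.
    by rewrite mulr_ge0// mulr_ge0// ltW.
  have -> : 2 * (h ^+ 2 * ((8 + 1 / delta) * kap G)) * ((1 + 1 / tau) / tau * V) =
     h ^+ 2 * (2 * (8 + 1 / delta) * ((1 + 1 / tau) / tau) * (kap G * V)) by ring.
  apply: ler_wpM2l; first exact: sqr_ge0.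
  apply: ler_wpM2l; first by rewrite mulr_ge0// mulr_ge0// div1r; lra.
  by rewrite ler_wpM2r.
have c40 : 0 <= c4.
  rewrite /c4 addr_ge0// mulr_ge0//.
    by rewrite ltW// divr_gt0// mulr_gt0// addr_gt0// divr_gt0// mulr_gt0.
    by rewrite mulr_ge0 ?sqr_ge0.
  by rewrite mulr_ge0// div1r; lra.
rewrite [leRHS]mulrA ler_pdivlMr//.
apply: (@le_trans _ _ (h ^+ 2 * (c4 * (rho G ^+ 2 * kap G ^+ 2 * V)))); last first.
  by rewrite ler_wpM2l ?sqr_ge0// ler_wpM2l.
have : rho G ^+ 2 * (N * (8 * kap G ^+ 2 * S1) + N * (2 * S2 * b)) <=
   rho G ^+ 2 * (h ^+ 2 * (8 * (1 + 1 / (delta * tau)) / tau * c3 * (kap G ^+ 2 * V)) +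
     h ^+ 2 * (2 * (8 + 1 / delta) * ((1 + 1 / tau) / tau) * (kap G ^+ 2 * V))).
  by rewrite ler_wpM2l// lerD.
rewrite /c4; lra.
Qed.

Definition tailv (u : 'cV[R]_q.+1) : 'cV[R]_q.+1 := \col_j (if j == 0 then 0 else u j 0).

Lemma dotv_zrow_tail u : dotv (zrow G) (tailv u) = dotv (zrow G) u.
Proof.
by rewrite !dotvE; apply: eq_bigr => j _; rewrite !mxE; case: ifP => // _; rewrite !mul0r.
Qed.

Lemma tailvB u v : tailv (u - v) = tailv u - tailv v.
Proof. by apply/matrixP => j l; rewrite !mxE; case: ifP => // _; rewrite subrr. Qed.

Lemma tailv_le u : sq (tailv u) <= sq u.
Proof.
rewrite !dotv_sq; apply: ler_sum => j _; rewrite mxE; case: ifP => // _.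
by rewrite expr0n sqr_ge0.
Qed.

Lemma enorm_tail_diff u v : (enorm (tailv u) - enorm (tailv v)) ^+ 2 <= sq (u - v).
Proof.
apply: le_trans (tailv_le (u - v)); rewrite -enorm_sq tailvB.
have h a b : enorm a - enorm b <= enorm (a - b :> 'cV[R]_q.+1).
  by have := enormD (a - b) b; rewrite subrK; lra.
have h1 := h (tailv u) (tailv v); have h2 := h (tailv v) (tailv u).
rewrite -(opprB (tailv u)) enormN in h2.
have := enorm_ge0 (tailv u - tailv v); nra.
Qed.

(** [dv] stands for the divergence of [B] in the erased coordinates and [gam]
    for the trace of the matrix of the paper. *)
Lemma residual_bound (dv gam Y : R) :
  dotv (zrow G) (B (erase G)) = enorm (tailv (B (erase G))) * Z ->
  Y = \sum_j G i (lift ord0 j) * fld j G -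
      rho G * (kap G * dv + 2 / N * dotv (zrow G) (B G - B (erase G))) ->
  (dv - gam * psi G i 0) ^+ 2 <= 18 * psi G i 0 ^+ 2 / (N * tau) ^+ 2 + 2 * sq (B G) / (N * tau) ->
  N / sq (psi G) *
    (dotv (zrow G) (B G) - enorm (tailv (B G)) * Z - gam * psi G i 0) ^+ 2 <=
  6 * Y ^+ 2 + (24 * ((1 + 1 / tau) / tau) + 3 * (18 / tau ^+ 2 + 2 / tau) * c3
     + 3 * ((1 + 1 / tau) / tau)) * X / N.
Proof.
move=> hZ' hY hdv; have k1 := kap_ge1 G; have z0 := sqr_ge0 Z; have X0 := Xrow_ge0.
have N1 : 1 <= N by rewrite ler1n.
set dB := B G - B (erase G).
have YE : Y = rho G * (kap G * (dotv (zrow G) dB - dv) - 2 / N * dotv (zrow G) dB).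
  rewrite hY; have -> : \sum_j G i (lift ord0 j) * fld j G = rho G * kap G * dotv (zrow G) dB.
    rewrite dotvE big_ord_recl [zrow G ord0 0]mxE eqxx mul0r add0r mulr_sumr.
    by apply: eq_bigr => j _; rewrite zrow_lift /fld -/dB; ring.
  by ring.
have hr := hrho; set m := N / sq (psi G) in hr *.
have m0 : 0 <= m by rewrite divr_ge0 ?dotv_ge0// ltW.
have bt0 : 0 <= (1 + 1 / tau) / tau by rewrite divr_ge0 ?ltW// addr_gt0// divr_gt0.
(* The error is the sum of the Stein residual, of the gap between divergence and trace, and of the
   change of the norm of the tail between the erased and the full design. *)
set x1 := dotv (zrow G) dB - dv; set x2 := dv - gam * psi G i 0.
set x3 := (enorm (tailv (B (erase G))) - enorm (tailv (B G))) * Z.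
have -> : dotv (zrow G) (B G) - enorm (tailv (B G)) * Z - gam * psi G i 0 = x1 + x2 + x3.
  by rewrite /x1 /x2 /x3 /dB dotvBr hZ'; ring.
have s3 : (x1 + x2 + x3) ^+ 2 <= 3 * x1 ^+ 2 + 3 * x2 ^+ 2 + 3 * x3 ^+ 2.
  have := sqr_ge0 (x1 - x2); have := sqr_ge0 (x1 - x3); have := sqr_ge0 (x2 - x3); nra.
have hdB : m * sq dB * (1 + Z ^+ 2) <= (1 + 1 / tau) / tau * X / N.
  exact: dB_normalized hrho (sqr_ge0 _) _ hZ.
have hfull : m * (psi G i 0 ^+ 2 + sq (B G)) <= c3 * X.
  exact: wfull_normalized hrho (sqr_ge0 _) _ hZ.
have b0 : 0 <= sq dB by exact: dotv_ge0.
have t1 : m * x1 ^+ 2 <= 2 * Y ^+ 2 + 8 * ((1 + 1 / tau) / tau) * X / N.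
  pose y2 := rho G * (2 / N * dotv (zrow G) dB).
  have a1 : m * x1 ^+ 2 <= (Y + y2) ^+ 2.
    have -> : Y + y2 = rho G * kap G * x1 by rewrite YE /y2 /x1; ring.
    rewrite exprMn [X in _ <= X * _]exprMn; apply: ler_wpM2r => //; exact: sqr_ge0.
  have a2 : y2 ^+ 2 <= 4 * ((1 + 1 / tau) / tau) * X / N.
    have d1 : dotv (zrow G) dB ^+ 2 <= N * kap G * sq dB.
      apply: le_trans (dotv_CS2 _ _) _; apply: ler_wpM2r => //.
      by rewrite /kap mulrDr mulr1 mulrCA mulfV ?gt_eqF// mulr1 lerDr ltW.
    have d2 : N * sq dB <= (1 + 1 / tau) / tau * (wrow G * (kap G * (1 + Z ^+ 2))) by exact: dB_erase.
    have d3 : rho G ^+ 2 * kap G * (N * sq dB) <= (1 + 1 / tau) / tau * X.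
      apply: (@le_trans _ _ (rho G ^+ 2 * kap G * ((1 + 1 / tau) / tau * (wrow G * (kap G * (1 + Z ^+ 2)))))).
        by apply: ler_wpM2l => //; rewrite mulr_ge0 ?sqr_ge0//; lra.
      have := @Xrow_ge G (rho G ^+ 2) (sqr_ge0 _) Z 2 1 isT isT => d4.
      have := ler_wpM2l bt0 d4; lra.
    have -> : y2 ^+ 2 = 4 * rho G ^+ 2 / N ^+ 2 * dotv (zrow G) dB ^+ 2.
      by rewrite /y2; field; rewrite gt_eqF.
    apply: (@le_trans _ _ (4 * rho G ^+ 2 / N ^+ 2 * (N * kap G * sq dB))).
      by apply: ler_wpM2l => //; apply: divr_ge0; [rewrite mulr_ge0 ?sqr_ge0|exact: sqr_ge0].
    have -> : 4 * rho G ^+ 2 / N ^+ 2 * (N * kap G * sq dB) =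
      4 / N ^+ 2 * (rho G ^+ 2 * kap G * (N * sq dB)) by field; rewrite gt_eqF.
    apply: (@le_trans _ _ (4 / N ^+ 2 * ((1 + 1 / tau) / tau * X))).
      by apply: ler_wpM2l => //; apply: divr_ge0 => //; exact: sqr_ge0.
    have NN : (N ^+ 2)^-1 <= N^-1 by rewrite lef_pV2 ?posrE ?exprn_gt0// ler_eXnr.
    have bX : 0 <= (1 + 1 / tau) / tau * X by exact: mulr_ge0.
    have := ler_wpM2l bX NN; lra.
  apply: le_trans a1 _; have := sqr_ge0 (Y - y2); nra.
have t2 : m * x2 ^+ 2 <= (18 / tau ^+ 2 + 2 / tau) * c3 * X / N.
  set P := psi G i 0 ^+ 2 in hdv hfull; set b := sq (B G) in hdv hfull.
  have P0 : 0 <= P by exact: sqr_ge0.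
  have bb0 : 0 <= b by exact: dotv_ge0.
  have i0 : 0 < tau^-1 by rewrite invr_gt0.
  apply: (@le_trans _ _ (m * ((18 / tau ^+ 2 + 2 / tau) * (P + b) / N))).
    apply: ler_wpM2l => //; apply: le_trans hdv _.
    have -> : 18 * P / (N * tau) ^+ 2 + 2 * b / (N * tau) =
       (18 * P * tau^-1 ^+ 2 * N^-1 + 2 * b * tau^-1) * N^-1.
      by field; rewrite ?gt_eqF.
    apply: ler_wpM2r; first by rewrite invr_ge0 ltW.
    have NI : N^-1 <= 1 by rewrite invf_le1.
    have a1 : 18 * P * tau^-1 ^+ 2 * N^-1 <= 18 * P * tau^-1 ^+ 2.
      by rewrite ler_piMr// mulr_ge0 ?sqr_ge0// mulr_ge0.
    rewrite -exprVn; have := sqr_ge0 (tau^-1); nra.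
  have -> : m * ((18 / tau ^+ 2 + 2 / tau) * (P + b) / N) =
    (18 / tau ^+ 2 + 2 / tau) / N * (m * (P + b)) by field; rewrite ?gt_eqF.
  have -> : (18 / tau ^+ 2 + 2 / tau) * c3 * X / N = (18 / tau ^+ 2 + 2 / tau) / N * (c3 * X).
    by field; rewrite ?gt_eqF.
  apply: ler_wpM2l => //; rewrite -exprVn divr_ge0 ?(ltW N0)//.
  have := sqr_ge0 (tau^-1); lra.
have t3 : m * x3 ^+ 2 <= (1 + 1 / tau) / tau * X / N.
  apply: le_trans hdB; rewrite -mulrA; apply: ler_wpM2l => //.
  rewrite /x3 exprMn; apply: ler_pM; rewrite ?sqr_ge0//; last lra.
  by rewrite -[X in X <= _]sqrrN opprB; exact: enorm_tail_diff.
have := ler_wpM2l m0 s3; lra.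
Qed.

End Bounds.
End Field.
End Row.
End Deterministic.

(** * Moments *)

Section LatticeMax.
Context {R : realType}.

(** Comparable with [opnorm] up to a factor [2]; as a finite maximum it is measurable at once. *)
Definition latmax n p (G : 'M[R]_(n, p)) : R :=
  \big[Num.max/0]_(x : lat n * lat p | (enorm (latv x.1 : 'cV[R]_n) <= 1) && (enorm (latv x.2 : 'cV[R]_p) <= 1))
    dotv (latv x.1) (G *m latv x.2).

Lemma latmax_ge n p (G : 'M[R]_(n, p)) : (0 < n)%N -> (0 < p)%N ->
  opnorm G <= 2 * latmax G.
Proof.
move=> n0 p0; apply: opnorm_lattice => // f g f1 g1.
by apply: (@le_bigmax_cond _ _ _ _ (f, g)); rewrite /= f1 g1.
Qed.

Lemma latmax_le n p (G : 'M[R]_(n, p)) : latmax G <= opnorm G.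
Proof.
apply: bigmax_le => [|[f g] /= /andP[f1 g1]]; first exact: opnorm_ge0.
apply: le_trans (ler_norm _) _; apply: le_trans (dotv_CS _ _) _.
have := opnormP G (latv g); have := opnorm_ge0 G.
have := enorm_ge0 (latv f : 'cV[R]_n); have := enorm_ge0 (latv g : 'cV[R]_p).
have := enorm_ge0 (G *m latv g); nra.
Qed.

Lemma latmax_ge0 n p (G : 'M[R]_(n, p)) : 0 <= latmax G.
Proof. exact: bigmax_ge_id. Qed.

Lemma measurable_latmax dT (T : measurableType dT) n p (G : T -> 'M[R]_(n, p)) :
  (forall i j, measurable_fun setT (fun t => G t i j)) ->
  measurable_fun setT (fun t => latmax (G t)).
Proof.
move=> mG; rewrite /latmax; under eq_fun do rewrite -big_filter.
elim: [seq _ <- _ | _] => [|x s ih]; first by under eq_fun do rewrite big_nil; exact: measurable_cst.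
under eq_fun do rewrite big_cons; apply: measurable_maxr => //.
under eq_fun do rewrite dotvE; apply: measurable_sum => i; apply: measurable_funM => //.
under eq_fun do rewrite mxE; apply: measurable_sum => j; exact: measurable_funM.
Qed.

End LatticeMax.

Section Moments.
Context {R : realType}.
Notation Nrm := (normal_prob (0 : R) 1).

(** The polynomial is dominated by a multiple of [exp x + exp (- x)], whose mean is explicit. *)
Lemma gaussian_moment (a : R) (k : nat) : 0 <= a ->
  exists2 C : R, 1 <= C & (\int[Nrm]_x ((1 + a * x ^+ 2) ^+ k)%:E <= C%:E)%E.
Proof.
move=> a0; pose c : R := (1 + a) ^+ k * (2 * k.+1%:R) ^+ (2 * k).
have k0 : 0 < (k.+1%:R : R) by rewrite ltr0n.
have k1 : 1 <= (k.+1%:R : R) by rewrite ler1n.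
have c1 : 1 <= c by rewrite /c mulr_ege1// exprn_ege1//; lra.
have pw (x : R) : (1 + a * x ^+ 2) ^+ k <= c * (expR x + expR (- x)).
  have h1 : 1 + a * x ^+ 2 <= (1 + a) * (1 + `|x|) ^+ 2.
    by rewrite -(real_normK (num_real x)); have := normr_ge0 x; nra.
  have h2 : 1 + `|x| <= 2 * k.+1%:R * expR (`|x| / (2 * k.+1%:R)).
    have := expR_ge1Dx (`|x| / (2 * k.+1%:R)); set y := `|x| / _.
    have y0 : 0 <= y by rewrite divr_ge0// mulr_ge0// ltW.
    have -> : `|x| = 2 * k.+1%:R * y by rewrite /y; field; rewrite gt_eqF.
    by move: (k.+1%:R : R) k1 => m m1; nra.
  have h3 : expR `|x| <= expR x + expR (- x).
    case: (ger0P x) => _; first by rewrite lerDl expR_ge0.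
    by rewrite lerDr expR_ge0.
  apply: (@le_trans _ _ (((1 + a) * (1 + `|x|) ^+ 2) ^+ k)).
    apply: lerXn2r => //; rewrite nnegrE; first by rewrite addr_ge0// mulr_ge0// sqr_ge0.
    by rewrite mulr_ge0 ?sqr_ge0// addr_ge0.
  rewrite exprMn -exprM /c -mulrA; apply: ler_wpM2l; first by rewrite exprn_ge0// addr_ge0.
  apply: (@le_trans _ _ ((2 * k.+1%:R * expR (`|x| / (2 * k.+1%:R))) ^+ (2 * k))).
    apply: lerXn2r => //; rewrite nnegrE; first by rewrite addr_ge0.
    by rewrite mulr_ge0 ?expR_ge0// mulr_ge0// ltW.
  rewrite exprMn; apply: ler_wpM2l; first by rewrite exprn_ge0// mulr_ge0// ltW.
  apply: le_trans h3; rewrite -expRM_natl ler_expR natrM mulrCA -mulrA ler_piMr//.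
  have -> : 2 * (k%:R / (2 * k.+1%:R)) = k%:R / k.+1%:R :> R by field; rewrite gt_eqF.
  by rewrite ler_pdivrMr// mul1r ler_nat.
exists (c * (expR (1 ^+ 2 / 2) + expR ((-1) ^+ 2 / 2))).
  have := expR_ge1Dx (1 ^+ 2 / 2 : R); have := expR_gt0 ((-1) ^+ 2 / 2 : R).
  rewrite expr1n; nra.
have mE (s : R) : measurable_fun setT (fun x : R => (expR (s * x))%:E).
  by apply/measurable_EFinP; apply: measurableT_comp => //; exact: measurable_funM.
apply: (@le_trans _ _ (\int[Nrm]_x (c%:E * ((expR (1 * x))%:E + (expR (-1 * x))%:E))))%E.
  apply: ge0_le_integral => //.
  - by move=> x _; rewrite lee_fin exprn_ge0// addr_ge0// mulr_ge0// sqr_ge0.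
  - apply/measurable_EFinP; apply: measurable_funX; apply: measurable_funD => //.
    by apply: measurable_funM => //; exact: measurable_funX.
  - by apply: emeasurable_funM => //; apply: emeasurable_funD; exact: mE.
  - by move=> x _; rewrite -EFinD -EFinM lee_fin mul1r mulN1r.
have c0 : 0 <= c by lra.
rewrite ge0_integralZl_EFin//; last 2 first.
- by move=> x _; rewrite -EFinD lee_fin addr_ge0 ?expR_ge0.
- by apply: emeasurable_funD; exact: mE.
rewrite ge0_integralD//; try exact: mE; try by move=> x _; rewrite lee_fin expR_ge0.
by rewrite !normal_mgf -EFinD -EFinM.
Qed.

(** The inequality for squares is iterated, whence the restriction to powers of two. *)
Lemma jensen_pow2 (I : finType) (x : I -> R) (m : nat) : (0 < #|I|)%N ->
  (forall i, 0 <= x i) ->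
  (#|I|%:R^-1 * \sum_i x i) ^+ (2 ^ m) <= #|I|%:R^-1 * \sum_i x i ^+ (2 ^ m).
Proof.
move=> I0 x0; have c0 : 0 < (#|I|%:R : R) by rewrite ltr0n.
have sq (y : I -> R) : (#|I|%:R^-1 * \sum_i y i) ^+ 2 <= #|I|%:R^-1 * \sum_i y i ^+ 2.
  set a := _ * _.
  have : 0 <= \sum_i (y i - a) ^+ 2 by apply: sumr_ge0 => i _; exact: sqr_ge0.
  have -> : \sum_i (y i - a) ^+ 2 = \sum_i y i ^+ 2 + (- 2 * a) * (\sum_i y i) + #|I|%:R * a ^+ 2.
    rewrite mulr_sumr mulr_natl -sumr_const -!big_split/=; apply: eq_bigr => i _; ring.
  have -> : \sum_i y i = #|I|%:R * a by rewrite /a mulrA mulfV ?mul1r ?gt_eqF.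
  move=> h; rewrite mulrC ler_pdivlMr//; lra.
elim: m => [|m ih]; first by rewrite expn0.
rewrite expnS mulnC exprM; apply: (@le_trans _ _ ((#|I|%:R^-1 * \sum_i x i ^+ (2 ^ m)) ^+ 2)).
  have e0 : 0 <= #|I|%:R^-1 * \sum_i x i by rewrite mulr_ge0 ?invr_ge0 ?sumr_ge0.
  apply: lerXn2r => //; rewrite nnegrE ?exprn_ge0// mulr_ge0 ?invr_ge0// sumr_ge0// => i _.
  exact: exprn_ge0.
apply: le_trans (sq _) _; apply: ler_wpM2l; first by rewrite invr_ge0 ltW.
by apply: ler_sum => i _; rewrite -exprM mulnC.
Qed.

End Moments.

Section BlockIndependence.
Context dT (T : measurableType dT) (R : realType) (P : probability T R) (J : finType).
Variable D : T -> data R J.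
Hypothesis mD : measurable_fun setT D.
Hypothesis iD : forall A : J -> set R, (forall j, measurable (A j)) ->
  P (D @^-1` box A) = (\prod_j P ((fun t => crd j (D t)) @^-1` A j))%E.

Lemma block_indep (Q : pred J) (W V : data R J -> \bar R) :
  (forall d d', W (mix Q d d') = W d) -> (forall d d', V (mix Q d d') = V d') ->
  measurable_fun setT W -> measurable_fun setT V ->
  (forall d, 0 <= W d)%E -> (forall d, 0 <= V d)%E ->
  (\int[P]_t (W (D t) * V (D t)) = (\int[P]_t W (D t)) * (\int[P]_t V (D t)))%E.
Proof.
move=> hW hV mW mV W0 V0.
have mWV : measurable_fun setT (fun d => W d * V d)%E by exact: emeasurable_funM.
rewrite (resample mD iD Q (f := fun d => (W d * V d)%E))//; last first.
  by move=> d; rewrite mule_ge0.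
under eq_integral => t _.
  under eq_integral do rewrite hW hV.
  rewrite ge0_integralZl//; last exact: (measurableT_comp mV).
  over.
rewrite ge0_integralZr//; first exact: (measurableT_comp mW).
exact: integral_ge0.
Qed.

(** By convexity the power of the average of the [1 + a z_k^2] is at most the average of their
    powers, so the moment of a single variable bounds it in every dimension. *)
Lemma kappa_moment (K : finType) (c : K -> J) (a : R) : 0 <= a ->
  (forall k A, measurable A -> P ((fun t => crd (c k) (D t)) @^-1` A) = normal_prob 0 1 A) ->
  forall C, (\int[normal_prob (0 : R) 1]_x ((1 + a * x ^+ 2) ^+ 16)%:E <= C%:E)%E -> 1 <= C ->
  forall s, 0 <= s -> s * #|K|%:R <= a ->
  (\int[P]_t ((1 + s * \sum_k crd (c k) (D t) ^+ 2) ^+ 16)%:E <= C%:E)%E.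
Proof.
move=> a0 lc C hC C1 s s0 sK.
have [K0|K0] := posnP #|K|.
  rewrite (eq_integral (cst 1%E)); last first.
    move=> t _; rewrite big1 ?mulr0 ?addr0 ?expr1n// => k _.
    by have := card0_eq K0 k; rewrite inE.
  rewrite (integral_cst P measurableT 1%E) mul1e; apply: le_trans (probability_le1 _ _) _ => //.
have c0 : 0 < (#|K|%:R : R) by rewrite ltr0n.
have mz k : measurable_fun setT (fun t => (1 + a * crd (c k) (D t) ^+ 2) ^+ 16).
  apply: measurable_funX; apply: measurable_funD => //; apply: measurable_funM => //.
  by apply: measurable_funX; exact: (measurableT_comp (measurable_crd (c k))).
have p0 k t : 0 <= (1 + a * crd (c k) (D t) ^+ 2) ^+ 16.
  by rewrite exprn_ge0// addr_ge0// mulr_ge0// sqr_ge0.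
apply: (@le_trans _ _ (\int[P]_t ((#|K|%:R^-1)%:E * (\sum_k (1 + a * crd (c k) (D t) ^+ 2) ^+ 16)%:E))%E).
  apply: ge0_le_integral => //.
  - move=> t _; rewrite lee_fin exprn_ge0// addr_ge0// mulr_ge0// sumr_ge0// => k _; exact: sqr_ge0.
  - apply/measurable_EFinP; apply: measurable_funX; apply: measurable_funD => //.
    apply: measurable_funM => //; apply: measurable_sum => k; apply: measurable_funX.
    exact: (measurableT_comp (measurable_crd (c k))).
  - by apply: emeasurable_funM => //; apply/measurable_EFinP; exact: measurable_sum.
  - move=> t _; rewrite -EFinM lee_fin.
    apply: le_trans (@jensen_pow2 R K (fun k => 1 + a * crd (c k) (D t) ^+ 2) 4 K0 _); last first.
      by move=> k; rewrite addr_ge0// mulr_ge0// sqr_ge0.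
    have S0 : 0 <= \sum_k crd (c k) (D t) ^+ 2 by rewrite sumr_ge0// => k _; exact: sqr_ge0.
    apply: lerXn2r; rewrite ?nnegrE.
    + by rewrite addr_ge0// mulr_ge0.
    + by rewrite mulr_ge0 ?invr_ge0// sumr_ge0// => k _; rewrite addr_ge0// mulr_ge0// sqr_ge0.
    rewrite big_split/= sumr_const mulrDr -mulr_sumr -[1 *+ _]/(#|K|%:R) mulVf ?gt_eqF//.
    rewrite lerD2l mulrA; apply: ler_wpM2r => //.
    by rewrite mulrC ler_pdivlMr.
rewrite ge0_integralZl_EFin ?invr_ge0//; last 2 first.
- by move=> t _; rewrite lee_fin sumr_ge0.
- by apply/measurable_EFinP; exact: measurable_sum.
rewrite (ge0_Eint_sum P xpredT mz p0).
have e k : (\int[P]_t ((1 + a * crd (c k) (D t) ^+ 2) ^+ 16)%:E <= C%:E)%E.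
  apply: le_trans hC; rewrite -(@ge0_integral_law _ _ _ _ R P (normal_prob 0 1) (fun t => crd (c k) (D t))
      (fun x => ((1 + a * x ^+ 2) ^+ 16)%:E))//.
  - exact: (measurableT_comp (measurable_crd (c k))).
  - exact: lc.
  - apply/measurable_EFinP; apply: measurable_funX; apply: measurable_funD => //.
    by apply: measurable_funM => //; exact: measurable_funX.
  - by move=> x; rewrite lee_fin exprn_ge0// addr_ge0// mulr_ge0// sqr_ge0.
apply: (@le_trans _ _ ((#|K|%:R^-1)%:E * (\sum_(k : K) C%:E))%E).
  by rewrite lee_wpmul2l ?lee_fin ?invr_ge0// lee_sum.
by rewrite sumEFin sumr_const -EFinM lee_fin -[C *+ _]mulr_natl mulrA mulVf ?mul1r ?gt_eqF.
Qed.

End BlockIndependence.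

(** * The whitened model *)

Section Model.
Context {R : realType}.
Variables (n q : nat) (delta tau : R) (Sigma S : 'M[R]_q.+1).
Variables (loss : R -> R -> R) (g : 'cV[R]_q.+1 -> R) (F : R * R -> R).
Hypotheses (tau0 : 0 < tau) (delta0 : 0 < delta) (n0 : (0 < n)%N).
Hypothesis pn : q.+1%:R <= n%:R / delta.
Hypotheses (uH : sqrtmx Sigma \in unitmx).
Hypothesis Snorm : forall b, enorm (S^T *m b) = enorm (sqrtmx Sigma *m b).
Hypothesis cg : convexf g.
Hypothesis g0 : forall b, g 0 <= g b.
Hypothesis mg : strongly_monotone_subdifferential Sigma tau g.
Hypothesis gl : forall s, good_loss (loss (F s)).
Hypothesis l0 : forall s, derive1 (loss (F s)) 0 <> 0.
Hypothesis ml : forall u, measurable_fun setT (fun s => loss (F s) u).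
Notation N := (n%:R : R).
Notation sq u := (dotv u u).
Notation J := ('I_n * option 'I_q.+1)%type.

Let N0 : 0 < N. Proof. by rewrite ltr0n. Qed.

Section Estimators.
Variable y : 'I_n -> R * R.

(** The estimator in whitened coordinates. [y] lists the arguments of [F] and not the responses;
    being separate from [G], it stays fixed while the design varies. *)
Definition Bw (G : 'M[R]_(n, q.+1)) : 'cV[R]_q.+1 :=
  S^T *m bhat loss g (F \o y) (G *m S^T).

Definition psiw (G : 'M[R]_(n, q.+1)) : 'cV[R]_n := psihat loss g (F \o y) (G *m S^T).

Lemma BwE G : Bw G = S^T *m bhat loss g (F \o y) (G *m S^T).
Proof. by []. Qed.

Lemma psiwE G : psiw G = psihat loss g (F \o y) (G *m S^T).
Proof. by []. Qed.

Lemma Bw_perturb G G' : N * tau * sq (Bw G - Bw G') + sq (psiw G - psiw G') <=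
  dotv (Bw G - Bw G') ((G - G')^T *m psiw G') - dotv (psiw G - psiw G') ((G - G') *m Bw G').
Proof.
have := bhat_perturbation tau0 n0 uH cg g0 mg (y := F \o y) (fun k => gl (y k)) (G *m S^T) (G' *m S^T).
rewrite /= -Snorm enorm_sq -mulmxBl trmx_mul trmxK -!mulmxA.
by rewrite [dotv _ (S *m _)]dotv_mulmx /Bw mulmxBr.
Qed.

Lemma Bw_fit G : N * tau * sq (Bw G) <= dotv (G *m Bw G) (psiw G).
Proof.
have := bhat_kkt_ge0 tau0 n0 uH cg g0 mg (y := F \o y) (fun k => gl (y k)) (G *m S^T).
by rewrite -Snorm enorm_sq -mulmxA.
Qed.

Lemma psiw_gt0 G : 0 < sq (psiw G).
Proof.
have [k hk] := psihat_neq0 tau0 n0 uH cg g0 mg (y := F \o y) (fun k => gl (y k))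
  (G *m S^T) (Ordinal n0) (fun k => @l0 (y k)).
rewrite dotv_gt0; apply/eqP => /matrixP/(_ k 0); rewrite [RHS]mxE => e.
by rewrite /psiw in e; rewrite e eqxx in hk.
Qed.

End Estimators.

Section Permute.
Variable s : 'I_n -> 'I_n.
Hypothesis sK : involutive s.

Let permG (G : 'M[R]_(n, q.+1)) : 'M[R]_(n, q.+1) := \matrix_(k, j) G (s k) j.

Let permG_mul (G : 'M[R]_(n, q.+1)) (b : 'cV[R]_q.+1) k : (permG G *m b) k 0 = (G *m b) (s k) 0.
Proof. by rewrite !mxE; apply: eq_bigr => j _; rewrite mxE. Qed.

Lemma bhat_perm y G : bhat loss g (F \o (y \o s)) (permG G *m S^T) = bhat loss g (F \o y) (G *m S^T).
Proof.
rewrite /bhat; congr argmin; apply/funext => b; rewrite /objective; congr (_ * _ + _).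
rewrite [RHS](reindex_inj (inv_inj sK))/=; apply: eq_bigr => k _.
by rewrite -!mulmxA permG_mul.
Qed.

Lemma Bw_perm y G : Bw (y \o s) (permG G) = Bw y G.
Proof. by rewrite /Bw bhat_perm. Qed.

Lemma psiw_perm y G k : psiw (y \o s) (permG G) k 0 = psiw y G (s k) 0.
Proof.
rewrite /psiw [LHS]mxE [RHS]mxE bhat_perm/=.
by rewrite -!mulmxA permG_mul.
Qed.

End Permute.

Opaque Bw psiw.

(** The datum at [(k, Some l)] is the whitened coordinate [l] of row [k], and the one at [(k, None)]
    is its latent variable. [Gd] and [yd] share the coordinate [0], which is the index. *)
Definition Gd (d : data R J) : 'M[R]_(n, q.+1) := \matrix_(k, j) crd (k, Some j) d.

Definition yd (d : data R J) (k : 'I_n) : R * R := (crd (k, Some ord0) d, crd (k, None) d).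

Definition swapd (s : 'I_n -> 'I_n) (d : data R J) : data R J :=
  mkd (fun j : J => crd (s j.1, j.2) d).

Lemma Gd_swap s d : Gd (swapd s d) = \matrix_(k, j) Gd d (s k) j.
Proof. by apply/matrixP => k j; rewrite !mxE crd_mkd. Qed.

Lemma yd_swap s d : yd (swapd s d) = yd d \o s.
Proof. by apply/funext => k; rewrite /yd !crd_mkd. Qed.

Lemma measurable_Gd k j : measurable_fun setT (fun d => Gd d k j).
Proof. by under eq_fun do rewrite mxE; exact: measurable_crd. Qed.

Lemma measurable_yd k : measurable_fun setT (fun d => yd d k).
Proof. by apply: measurable_fun_pair; exact: measurable_crd. Qed.

Section Measurability.
Variable GG : data R J -> 'M[R]_(n, q.+1).
Hypothesis mGG : forall k j, measurable_fun setT (fun d => GG d k j).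

Let mX k j : measurable_fun setT (fun d => (GG d *m S^T) k j).
Proof.
under eq_fun do rewrite mxE; apply: measurable_sum => l.
by apply: measurable_funM => //; exact: measurable_cst.
Qed.

Let mloss k u : measurable_fun setT (fun d => loss ((F \o yd d) k) u).
Proof. exact: (measurableT_comp (ml u) (measurable_yd k)). Qed.

Lemma measurable_Bw j : measurable_fun setT (fun d => Bw (yd d) (GG d) j 0).
Proof.
under eq_fun do rewrite mxE; apply: measurable_sum => l.
apply: measurable_funM; first exact: measurable_cst.
have h := (measurable_bhat tau0 uH cg g0 mg (y := fun d => F \o yd d) (fun d k => gl (yd d k)) mloss mX l).
exact: h.
Qed.

Lemma measurable_psiw k : measurable_fun setT (fun d => psiw (yd d) (GG d) k 0).
Proof.
have h := (measurable_psihat tau0 uH cg g0 mg (y := fun d => F \o yd d) (fun d k => gl (yd d k)) mloss mX k).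
exact: h.
Qed.

End Measurability.

Lemma measurable_dotv k (u v : data R J -> 'cV[R]_k) :
  (forall j, measurable_fun setT (fun d => u d j 0)) ->
  (forall j, measurable_fun setT (fun d => v d j 0)) ->
  measurable_fun setT (fun d => dotv (u d) (v d)).
Proof.
move=> mu mv; under eq_fun do rewrite dotvE.
by apply: measurable_sum => j; exact: measurable_funM.
Qed.

Lemma measurable_inv_ge0 (f : data R J -> R) : measurable_fun setT f ->
  (forall d, 0 <= f d) -> measurable_fun setT (fun d => (f d)^-1).
Proof.
move=> mf f0; rewrite (_ : (fun d => _) = fun d => f d `^ (-1)).
  exact: (measurableT_comp (measurable_powR (-1)) mf).
by apply/funext => d; rewrite powR_inv1.
Qed.

Section Row.
Variable i : 'I_n.

Definition zblock : pred J := fun j => (j.1 == i) && (if j.2 is Some l then l != ord0 else false).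

Lemma yd_mix d d' : yd (mix zblock d d') = yd d.
Proof. by apply/funext => k; rewrite /yd !crd_mkd /zblock/= andbF. Qed.

Lemma erase_mix d d' : erase i (Gd (mix zblock d d')) = erase i (Gd d).
Proof.
apply/matrixP => k j; rewrite !mxE crd_mkd /zblock /=.
by case: (eqVneq k i) => //= _; case: (eqVneq j ord0).
Qed.

Lemma kap_mix d d' : kap i (Gd (mix zblock d d')) = kap i (Gd d').
Proof.
rewrite /kap; congr (1 + _ / _); rewrite !dotv_sq; apply: eq_bigr => j _; rewrite !mxE.
by case: ifPn => // j0; rewrite crd_mkd /zblock/= eqxx j0.
Qed.

Lemma Gd_shift (k : 'I_q) h d :
  Gd (shiftd (i, Some (lift ord0 k)) h d) = shiftG i k h (Gd d).
Proof.
apply/matrixP => l j; rewrite !mxE crd_mkd.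
case: eqP => [[-> ->]|hn]; first by rewrite !eqxx mulr1.
case: (eqVneq l i) => [li|_] /=; last by rewrite mulr0 addr0.
case: (eqVneq j (lift ord0 k)) => [jk|_] /=; last by rewrite mulr0 addr0.
by case: hn; rewrite li jk.
Qed.

Lemma yd_shift (k : 'I_q) h d : yd (shiftd (i, Some (lift ord0 k)) h d) = yd d.
Proof.
by apply/funext => l; rewrite /yd !crd_mkd; congr (_, _); case: eqP => // -[].
Qed.

(** A substitute for [1 / r] that does not depend on the erased row. *)
Definition rhod (d : data R J) : R := Num.sqrt (N * c2 tau / sq (psiw (yd d) (erase i (Gd d)))) *
  (1 + 2 * latmax (erase i (Gd d)) / Num.sqrt N).

Let sN : 0 < Num.sqrt N. Proof. by rewrite sqrtr_gt0. Qed.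

Lemma rhod_sq d : rhod d ^+ 2 = N * c2 tau / sq (psiw (yd d) (erase i (Gd d))) *
  (1 + 2 * latmax (erase i (Gd d)) / Num.sqrt N) ^+ 2.
Proof.
rewrite exprMn sqr_sqrtr// divr_ge0 ?dotv_ge0// mulr_ge0//.
by rewrite (le_trans ler01)// c2_ge1.
Qed.

Let rho_arith (c p pt K L kp : R) : 0 < p -> 0 < pt -> 1 + K <= L -> 0 <= K -> 1 <= c ->
  pt <= c * (1 + K) ^+ 2 * kp ^+ 2 * p -> N / p <= N * c / pt * L ^+ 2 * kp ^+ 2.
Proof.
move=> p0 pt0 KL K0 c1 h; rewrite ler_pdivrMr//.
have -> : N * c / pt * L ^+ 2 * kp ^+ 2 * p = N * (c * L ^+ 2 * kp ^+ 2 * p) / pt.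
  by field; rewrite gt_eqF.
rewrite ler_pdivlMr// ler_pM2l//; apply: le_trans h _.
apply: ler_wpM2r; first exact: ltW.
apply: ler_wpM2r; first exact: sqr_ge0.
apply: ler_wpM2l; first by rewrite (le_trans ler01).
by rewrite ler_sqr ?nnegrE ?(le_trans _ KL)// addr_ge0.
Qed.

Lemma rhod_lower d :
  N / sq (psiw (yd d) (Gd d)) <= rhod d ^+ 2 * kap i (Gd d) ^+ 2.
Proof.
have h : sq (psiw (yd d) (erase i (Gd d))) <=
    c2 tau * (1 + opnorm (erase i (Gd d)) / Num.sqrt N) ^+ 2 * kap i (Gd d) ^+ 2 *
    sq (psiw (yd d) (Gd d)).
  have h0 := psi_compare tau0 n0 (Bw_perturb (yd d)) (Bw_fit (yd d)) (eraseE i (Gd d)).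
  exact: h0.
have p0 := psiw_gt0 (yd d) (Gd d); have pt0 := psiw_gt0 (yd d) (erase i (Gd d)).
rewrite rhod_sq.
have KL : 1 + opnorm (erase i (Gd d)) / Num.sqrt N <= 1 + 2 * latmax (erase i (Gd d)) / Num.sqrt N.
  by rewrite lerD2l ler_pM2r ?invr_gt0// latmax_ge.
have K0 : 0 <= opnorm (erase i (Gd d)) / Num.sqrt N by rewrite divr_ge0 ?opnorm_ge0// ltW.
exact: (rho_arith p0 pt0 KL K0 (c2_ge1 tau0) h).
Qed.

Lemma rhod_upper d : rhod d ^+ 2 <= 4 * c2 tau * (1 + opnorm (erase i (Gd d)) / Num.sqrt N) ^+ 2 *
  (N / sq (psiw (yd d) (erase i (Gd d)))).
Proof.
have pt0 := psiw_gt0 (yd d) (erase i (Gd d)); rewrite rhod_sq.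
have KL' : latmax (erase i (Gd d)) / Num.sqrt N <= opnorm (erase i (Gd d)) / Num.sqrt N.
  by rewrite ler_pM2r ?invr_gt0// latmax_le.
have K0' : 0 <= opnorm (erase i (Gd d)) / Num.sqrt N by rewrite divr_ge0 ?opnorm_ge0// ltW.
have L0' : 0 <= latmax (erase i (Gd d)) / Num.sqrt N by rewrite divr_ge0 ?latmax_ge0// ltW.
rewrite -[2 * _ / _]mulrA; move: KL' K0' L0' pt0; move: (latmax _ / _) (opnorm _ / _) (sq _) => l K pt.
move=> KL' K0 ll0 pt0; set L := 1 + _.
have KL : L <= 2 * (1 + K) by rewrite /L; lra.
have L0 : 0 <= L by rewrite /L; lra.
have -> : 4 * c2 tau * (1 + K) ^+ 2 * (N / pt) = N * c2 tau / pt * (2 * (1 + K)) ^+ 2.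
  by field; rewrite gt_eqF.
apply: ler_wpM2l.
  by rewrite divr_ge0 ?(ltW pt0)// mulr_ge0 ?(ltW N0)// (le_trans ler01)// c2_ge1.
by rewrite ler_sqr ?nnegrE// (le_trans L0).
Qed.

Let mE k j : measurable_fun setT (fun d => erase i (Gd d) k j).
Proof.
under eq_fun do rewrite mxE.
by case: (_ && _); [exact: measurable_cst|exact: measurable_Gd].
Qed.

Lemma measurable_rhod : measurable_fun setT rhod.
Proof.
apply: measurable_funM.
  apply: (measurableT_comp (continuous_measurable_fun (@sqrt_continuous R))).
  apply: measurable_funM; first exact: measurable_cst.
  apply: measurable_inv_ge0 => [|d]; last exact: dotv_ge0.
  by apply: measurable_dotv => k; exact: measurable_psiw.
apply: measurable_funD; first exact: measurable_cst.
apply: measurable_funM; last exact: measurable_cst.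
by apply: measurable_funM; [exact: measurable_cst|exact: measurable_latmax].
Qed.

(** The factor of [Xrow] that does not see the erased entries. *)
Definition Wd d : R := rhod d ^+ 2 * wrow (Bw (yd d)) (psiw (yd d)) i (Gd d).

Lemma Wd_ge0 d : 0 <= Wd d.
Proof. by rewrite mulr_ge0 ?sqr_ge0// wrow_ge0. Qed.

Lemma rhod_mix d d' : rhod (mix zblock d d') = rhod d.
Proof. by rewrite /rhod yd_mix erase_mix. Qed.

Lemma Wd_mix d d' : Wd (mix zblock d d') = Wd d.
Proof. by rewrite /Wd rhod_mix /wrow yd_mix erase_mix. Qed.

Lemma measurable_Wd : measurable_fun setT Wd.
Proof.
apply: measurable_funM; first by apply: measurable_funX; exact: measurable_rhod.
apply: measurable_funD; first by apply: measurable_funX; exact: measurable_psiw.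
by apply: measurable_dotv => k; exact: measurable_Bw.
Qed.

Definition kapd d : R := kap i (Gd d).

Lemma kapd_ge1 d : 1 <= kapd d.
Proof. exact: kap_ge1. Qed.

Lemma kapdE d : kapd d = 1 + N^-1 * \sum_(k < q) crd (i, Some (lift ord0 k)) d ^+ 2.
Proof.
rewrite /kapd /kap mulrC; congr (1 + _ * _); rewrite dotv_sq big_ord_recl mxE eqxx expr0n add0r.
by apply: eq_bigr => k _; rewrite zrow_lift mxE.
Qed.

Lemma measurable_kapd : measurable_fun setT kapd.
Proof.
rewrite (_ : kapd = fun d => 1 + N^-1 * \sum_(k < q) crd (i, Some (lift ord0 k)) d ^+ 2); last first.
  by apply/funext => d; exact: kapdE.
apply: measurable_funD; first exact: measurable_cst.
apply: measurable_funM; first exact: measurable_cst.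
by apply: measurable_sum => k; apply: measurable_funX; exact: measurable_crd.
Qed.

Definition flddat (j : 'I_q) d : R := rhod d * kapd d *
  (Bw (yd d) (Gd d) - Bw (yd d) (erase i (Gd d))) (lift ord0 j) 0.

Lemma measurable_flddat j : measurable_fun setT (flddat j).
Proof.
apply: measurable_funM.
  by apply: measurable_funM; [exact: measurable_rhod|exact: measurable_kapd].
under eq_fun do rewrite mxE [X in _ + X]mxE.
apply: measurable_funB; apply: measurable_Bw => // k l; exact: measurable_Gd.
Qed.

End Row.
End Model.

(** * Limits of tilted difference quotients *)

Section Limits.
Context {R : realType}.

Lemma cvg_inv_shift2 : (m.+2%:R : R)^-1 @[m --> \oo] --> (0 : R).
Proof.
have h := @cvg_harmonic R; rewrite -(cvg_shiftn 1) in h.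
by apply: cvg_trans h; apply: near_eq_cvg; near=> m; rewrite /harmonic/= addn1.
Unshelve. all: by end_near. Qed.

(** [x <= expR x - 1 <= x * expR x]. *)
Lemma expR_sub1_quotient_cvg (z : R) (h : nat -> R) : (forall m, 0 < h m) -> h @ \oo --> (0 : R) ->
  ((expR (h m * z - h m ^+ 2 / 2) - 1) / h m) @[m --> \oo] --> z.
Proof.
move=> h0 ch.
have cu : (z - h m / 2) @[m --> \oo] --> z.
  rewrite -[X in _ --> X]subr0 -[X in _ --> _ - X](mul0r (2^-1 : R)).
  by apply: cvgB; [exact: cvg_cst|apply: cvgM => //; exact: cvg_cst].
have cv : (h m * z - h m ^+ 2 / 2) @[m --> \oo] --> (0 : R).
  rewrite (_ : (fun m => _) = (fun m => h m * (z - h m / 2))); last by apply/funext => m; ring.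
  by rewrite -[X in _ --> X](mul0r z); exact: cvgM.
apply: (@squeeze_cvgr _ _ _ _ (fun m => z - h m / 2) (fun m => (z - h m / 2) * expR (h m * z - h m ^+ 2 / 2))).
- near=> m; have hm := h0 m; apply/andP; split.
    rewrite ler_pdivlMr//; have := expR_ge1Dx (h m * z - h m ^+ 2 / 2).
    set e := expR _; have -> : (z - h m / 2) * h m = h m * z - h m ^+ 2 / 2 by ring.
    by lra.
  rewrite ler_pdivrMr//; set x := h m * z - h m ^+ 2 / 2.
  have -> : (z - h m / 2) * expR x * h m = x * expR x by rewrite /x; ring.
  have := expR_ge1Dx (- x); have e0 := expR_gt0 x; rewrite expRN => e1.
  have := ler_wpM2r (ltW e0) e1; rewrite mulVf ?gt_eqF// mulrDl mul1r mulNr; lra.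
- exact: cu.
- have e0 : z * expR 0 = z by rewrite expR0 mulr1.
  rewrite -[X in _ --> X]e0.
  by apply: cvgM => //; apply: (continuous_cvg _ (@continuous_expR R 0)).
Unshelve. all: by end_near. Qed.

(** The product rule: the three terms of the limit are the contributions of the exponential density,
    of [dB] and of [kap], whose derivative is [2 z / M]. [rho] is constant along the shift. *)
Lemma tilted_quotient_cvg (rho kap0 z M db dB : R) (h Bh : nat -> R) :
  (forall m, 0 < h m) -> h @ \oo --> (0 : R) ->
  (Bh m - dB) / h m @[m --> \oo] --> - db ->
  (rho * (kap0 + (2 * (- h m) * z + (- h m) ^+ 2) / M) * Bh m *
     expR (h m * z - h m ^+ 2 / 2) - rho * kap0 * dB) / h m @[m --> \oo] -->
  z * (rho * kap0 * dB) - rho * (kap0 * db + 2 / M * (z * dB)).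
Proof.
move=> h0 ch cB; have ce := expR_sub1_quotient_cvg (z := z) h0 ch.
pose k m := kap0 + (2 * (- h m) * z + (- h m) ^+ 2) / M.
have cBh : Bh @ \oo --> dB.
  rewrite (_ : Bh = fun m => (Bh m - dB) / h m * h m + dB); last first.
    by apply/funext => m; rewrite divfK ?subrK ?gt_eqF.
  rewrite -[X in _ --> X]add0r -[X in _ --> X + _](mulr0 (- db)).
  by apply: cvgD; [exact: cvgM|exact: cvg_cst].
have cq : (- (2 * z) + h m) / M @[m --> \oo] --> - (2 * z) / M.
  apply: cvgM; last exact: cvg_cst.
  by rewrite -[X in _ --> X]addr0; apply: cvgD => //; exact: cvg_cst.
have ck : k @ \oo --> kap0.
  rewrite (_ : k = fun m => kap0 + h m * ((- (2 * z) + h m) / M)); last first.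
    by apply/funext => m; rewrite /k; ring.
  rewrite -[X in _ --> X]addr0 -[X in _ --> _ + X](mul0r (- (2 * z) / M)).
  by apply: cvgD; [exact: cvg_cst|exact: cvgM].
rewrite (_ : (fun m => _) = fun m => rho * (k m * Bh m * ((expR (h m * z - h m ^+ 2 / 2) - 1) / h m)
   + k m * ((Bh m - dB) / h m) + (- (2 * z) + h m) / M * dB)); last first.
  apply/funext => m; have hm : h m != 0 by rewrite gt_eqF.
  rewrite -/(k m); apply: (mulIf hm); rewrite divfK//.
  move: (expR _) => e.
  have -> : rho * (k m * Bh m * ((e - 1) / h m) + k m * ((Bh m - dB) / h m) + (- (2 * z) + h m) / M * dB) * h m
    = rho * (k m * Bh m * ((e - 1) / h m * h m) + k m * ((Bh m - dB) / h m * h m) + h m * ((- (2 * z) + h m) / M) * dB) by ring.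
  by rewrite !divfK// /k; ring.
rewrite (_ : z * _ - _ = rho * (kap0 * dB * z + kap0 * (- db) + - (2 * z) / M * dB)); last by ring.
apply: cvgM; first exact: cvg_cst.
apply: cvgD; last by apply: cvgM => //; exact: cvg_cst.
apply: cvgD; first by apply: cvgM => //; exact: cvgM.
exact: cvgM.
Unshelve. all: by end_near. Qed.

Lemma cvg_sumr (I : finType) (u : I -> nat -> R) (l : I -> R) :
  (forall i, u i m @[m --> \oo] --> l i) -> \sum_i u i m @[m --> \oo] --> \sum_i l i.
Proof. by move=> h; apply: cvg_big => // -[x y]; exact: add_continuous. Qed.

End Limits.

(** * Expectation bounds *)

Section Core.
Context {R : realType}.
Variables (n q : nat) (delta tau : R) (Sigma S : 'M[R]_q.+1).
Variables (loss : R -> R -> R) (g : 'cV[R]_q.+1 -> R) (F : R * R -> R).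
Hypotheses (tau0 : 0 < tau) (delta0 : 0 < delta) (n0 : (0 < n)%N).
Hypothesis pn : q.+1%:R <= n%:R / delta.
Hypotheses (uH : sqrtmx Sigma \in unitmx).
Hypothesis Snorm : forall b, enorm (S^T *m b) = enorm (sqrtmx Sigma *m b).
Hypothesis cg : convexf g.
Hypothesis g0 : forall b, g 0 <= g b.
Hypothesis mg : strongly_monotone_subdifferential Sigma tau g.
Hypothesis gl : forall s, good_loss (loss (F s)).
Hypothesis l0 : forall s, derive1 (loss (F s)) 0 <> 0.
Hypothesis ml : forall u, measurable_fun setT (fun s => loss (F s) u).
Notation N := (n%:R : R).
Notation sq u := (dotv u u).
Notation J := ('I_n * option 'I_q.+1)%type.
Notation Bw := (Bw S loss g F).
Notation psiw := (psiw S loss g F).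
Notation Wd := (Wd tau S loss g F).
Notation rhod := (rhod tau S loss g F).

Context dT (T : measurableType dT) (P : probability T R).
Variable D : T -> data R J.
Hypothesis mD : measurable_fun setT D.
Hypothesis iD : forall A : J -> set R, (forall j, measurable (A j)) ->
  P (D @^-1` box A) = (\prod_j P ((fun t => crd j (D t)) @^-1` A j))%E.
Hypothesis lD : forall k l A, measurable A ->
  P ((fun t => crd (k, Some l) (D t)) @^-1` A) = normal_prob 0 1 A.
Hypothesis sD : forall k k' o A, measurable A ->
  P ((fun t => crd (k, o) (D t)) @^-1` A) = P ((fun t => crd (k', o) (D t)) @^-1` A).
Variables Cop C16 C4 : R.
Hypothesis Cop0 : 0 <= Cop.
Hypothesis hop : forall G : 'M[R]_(n, q.+1),
  (1 + opnorm G / Num.sqrt N) ^+ 8 <= Cop * (1 + lam G).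
Hypotheses (C161 : 1 <= C16) (C41 : 1 <= C4).
Hypothesis h16 : (\int[normal_prob (0 : R) 1]_x ((1 + delta^-1 * x ^+ 2) ^+ 16)%:E <= C16%:E)%E.
Hypothesis h4 : (\int[normal_prob (0 : R) 1]_x ((1 + 1 * x ^+ 2) ^+ 4)%:E <= C4%:E)%E.
Variable i : 'I_n.

Let N0 : 0 < N. Proof. by rewrite ltr0n. Qed.

Let mDc (f : data R J -> R) : measurable_fun setT f -> measurable_fun setT (fun t => (f (D t))%:E).
Proof. by move=> mf; apply/measurable_EFinP; exact: (measurableT_comp mf). Qed.

Let mEF (f : data R J -> R) : measurable_fun setT f -> measurable_fun setT (fun d => (f d)%:E).
Proof. by move=> mf; apply/measurable_EFinP. Qed.

Let mlam : measurable_fun setT (fun d : data R J => lam (Gd d : 'M[R]_(n, q.+1))).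
Proof. exact: (measurable_lam (fun k (j : 'I_q.+1) => (k, Some j) : J)). Qed.

Let E1lam : (\int[P]_t (1 + lam (Gd (D t) : 'M[R]_(n, q.+1)))%:E <= 2%:E)%E.
Proof.
under eq_integral do rewrite EFinD.
rewrite ge0_integralD//; last 2 first.
- by move=> t _; rewrite lee_fin lam_ge0.
- exact: (mDc mlam).
rewrite (integral_cst P measurableT 1%E) mul1e.
have -> : (2%:E = 1%:E + 1%:E :> \bar R)%E by rewrite -EFinD.
apply: leeD; first exact: probability_le1.
apply: (lam_expectation mD iD (c := fun k (j : 'I_q.+1) => (k, Some j) : J)).
- by move=> k j k' j' [-> ->].
- by move=> k j A mA; exact: lD.
Qed.

(** The [n] ratios sum to [n], and each has the same expectation, even against a
    weight symmetric in the rows. *)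
Lemma exchangeable_share (v : data R J -> 'cV[R]_n) :
  (forall k, measurable_fun setT (fun d => v d k 0)) ->
  (forall s d k, involutive s -> v (swapd s d) k 0 = v d (s k) 0) ->
  (\int[P]_t ((1 + lam (Gd (D t) : 'M[R]_(n, q.+1))) *
     (N * v (D t) i 0 ^+ 2 / sq (v (D t))))%:E <= 2%:E)%E.
Proof.
move=> mv sv; pose h k d := (1 + lam (Gd d : 'M[R]_(n, q.+1))) * (N * v d k 0 ^+ 2 / sq (v d)).
have h0 k d : 0 <= h k d.
  rewrite mulr_ge0 ?addr_ge0 ?lam_ge0// divr_ge0 ?dotv_ge0// mulr_ge0 ?sqr_ge0//.
have mh k : measurable_fun setT (h k).
  apply: measurable_funM; first by apply: measurable_funD => //.
  apply: measurable_funM; first by apply: measurable_funM => //; apply: measurable_funX; exact: mv.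
  apply: measurable_inv_ge0 => [|d]; last exact: dotv_ge0.
  exact: measurable_dotv.
have sq_swap s d : involutive s -> sq (v (swapd s d)) = sq (v d).
  move=> sK; rewrite !dotv_sq [RHS](reindex_inj (inv_inj sK))/=.
  by apply: eq_bigr => k _; rewrite sv.
have eqh k : (\int[P]_t (h i (D t))%:E = \int[P]_t (h k (D t))%:E)%E.
  pose s (j : J) : J := (tperm i k j.1, j.2).
  have sK : involutive s by move=> [a b]; rewrite /s/= tpermK.
  rewrite (law_involution mD iD sK (f := fun d => (h i d)%:E)).
  - apply: eq_integral => t _; rewrite -[mkd _]/(swapd (tperm i k) (D t)) /h.
    have tK : involutive (tperm i k) by exact: tpermK.
    by rewrite sq_swap// sv// tpermL Gd_swap lam_row_involution.
  - by move=> [a o] A mA; exact: sD.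
  - exact: mEF.
  - by move=> d; rewrite lee_fin.
have NI : (N%:E * \int[P]_t (h i (D t))%:E <= N%:E * 2%:E)%E.
  have -> : (N%:E * \int[P]_t (h i (D t))%:E = \sum_(k < n) \int[P]_t (h k (D t))%:E)%E.
    under [RHS]eq_bigr do rewrite -eqh.
    by rewrite sumr_const card_ord mule_natl.
  rewrite -(ge0_Eint_sum P xpredT (f := fun k t => h k (D t))); last 2 first.
  - by move=> k; exact: (measurableT_comp (mh k)).
  - by move=> k t; exact: h0.
  apply: (@le_trans _ _ (\int[P]_t (N%:E * (1 + lam (Gd (D t) : 'M[R]_(n, q.+1)))%:E))%E).
    apply: ge0_le_integral => //.
    - by move=> t _; rewrite lee_fin sumr_ge0.
    - by apply: (mDc (f := fun d => \sum_k h k d)); exact: measurable_sum.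
    - apply: emeasurable_funM => //; apply: (mDc (f := fun d => 1 + lam (Gd d : 'M[R]_(n, q.+1)))); exact: measurable_funD.
    - move=> t _; rewrite -EFinM lee_fin /h -mulr_sumr -mulr_suml -mulr_sumr -dotv_sq mulrC.
      apply: ler_wpM2r; first by rewrite addr_ge0// lam_ge0.
      have [->|s0] := eqVneq (sq (v (D t))) 0; first by rewrite mulr0 mul0r ltW.
      by rewrite mulfK.
  rewrite ge0_integralZl_EFin ?(ltW N0)//.
  - by apply: lee_wpmul2l => //; rewrite lee_fin ltW.
  - by move=> t _; rewrite lee_fin addr_ge0// lam_ge0.
  - by apply: (mDc (f := fun d => 1 + lam (Gd d : 'M[R]_(n, q.+1)))); exact: measurable_funD.
by rewrite lee_pmul2l// in NI.
Qed.

Let kap8 (d : data R J) : R := (kapd i d ^+ 8)^-1.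

Let k0 (d : data R J) : 0 < kapd i d.
Proof. by rewrite (lt_le_trans ltr01)// kapd_ge1. Qed.

Let mkapd : measurable_fun setT (fun d : data R J => kapd i d). Proof. exact: measurable_kapd. Qed.

Let mk8 : measurable_fun setT kap8.
Proof. by apply: measurable_inv_ge0 => [|d]; [exact: measurable_funX|rewrite exprn_ge0// ltW]. Qed.

Lemma kapd_moment : (\int[P]_t (kapd i (D t) ^+ 16)%:E <= C16%:E)%E.
Proof.
under eq_integral do rewrite kapdE.
have a0 : 0 <= delta^-1 by rewrite invr_ge0 ltW.
have lc (k : 'I_q) A : measurable A -> P ((fun t => crd ((i, Some (lift ord0 k)) : J) (D t)) @^-1` A) = normal_prob 0 1 A.
  by move=> mA; exact: lD.
have s0 : 0 <= N^-1 by rewrite invr_ge0 ltW.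
have sK : N^-1 * #|'I_q|%:R <= delta^-1.
  by rewrite card_ord ler_pdivrMl//; apply: le_trans pn; rewrite ler_nat.
have := kappa_moment mD (c := fun k : 'I_q => (i, Some (lift ord0 k)) : J) a0 lc h16 C161 s0 sK.
by [].
Qed.

(** Jensen's inequality for the inverse, in tangent form: [1 / a >= 2 c - c^2 a] with [c = 1 / C16]
    and [a = kap^8 <= kap^16]. *)
Let E8_lower : ((C16^-1)%:E <= \int[P]_t (kap8 (D t))%:E)%E.
Proof.
have C0 : 0 < C16 by rewrite (lt_le_trans ltr01).
have ci0 : 0 <= C16^-1 by rewrite invr_ge0 ltW.
have p8 t : (0 <= (kap8 (D t))%:E)%E by rewrite lee_fin invr_ge0 exprn_ge0// ltW.
have p16 t : (0 <= (kapd i (D t) ^+ 16)%:E)%E by rewrite lee_fin exprn_ge0// ltW.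
have m16 : measurable_fun setT (fun t => (kapd i (D t) ^+ 16)%:E) by apply: (mDc (f := fun d => kapd i d ^+ 16)); exact: measurable_funX.
have key : ((2 * C16^-1)%:E <= \int[P]_t (kap8 (D t))%:E + (C16^-1 ^+ 2)%:E * C16%:E)%E.
  apply: (@le_trans _ _ (\int[P]_t ((kap8 (D t))%:E + (C16^-1 ^+ 2)%:E * (kapd i (D t) ^+ 16)%:E))%E).
    rewrite -[leLHS]mule1 -(@probability_setT _ _ _ P) -(integral_cst P measurableT).
    apply: ge0_le_integral => //.
    - by move=> t _; rewrite lee_fin mulr_ge0.
    - by apply: emeasurable_funD; [exact: mDc|exact: emeasurable_funM].
    - move=> t _; rewrite -EFinM -EFinD lee_fin.
      set k := kapd i (D t); have k1 : 1 <= k by exact: kapd_ge1.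
      have kk : 0 < k ^+ 8 by rewrite exprn_gt0// (lt_le_trans ltr01).
      have -> : kap8 (D t) = (k ^+ 8)^-1 by [].
      have h : k ^+ 8 <= k ^+ 16 by rewrite ler_weXn2l.
      have h' : C16^-1 ^+ 2 * k ^+ 8 <= C16^-1 ^+ 2 * k ^+ 16 by rewrite ler_wpM2l// sqr_ge0.
      apply: le_trans (_ : (k ^+ 8)^-1 + C16^-1 ^+ 2 * k ^+ 8 <= _); last by rewrite lerD2l.
      have := mulr_ge0 (ltW kk) (sqr_ge0 ((k ^+ 8)^-1 - C16^-1)).
      have e : k ^+ 8 * (k ^+ 8)^-1 = 1 by rewrite mulfV ?gt_eqF.
      move: (k ^+ 8) (k ^+ 8)^-1 kk e => a b a0 e.
      have -> : a * (b - C16^-1) ^+ 2 = b * (a * b) - 2 * C16^-1 * (a * b) + C16^-1 ^+ 2 * a by ring.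
      by rewrite e !mulr1; lra.
  rewrite ge0_integralD//; last 3 first.
  - exact: mDc.
  - by move=> t _; rewrite mule_ge0// lee_fin sqr_ge0.
  - exact: emeasurable_funM.
  rewrite ge0_integralZl_EFin ?sqr_ge0//.
  by rewrite leeD2l// lee_wpmul2l ?lee_fin ?sqr_ge0//; exact: kapd_moment.
rewrite -EFinM in key.
have e : C16^-1 ^+ 2 * C16 = C16^-1 by rewrite expr2 -mulrA mulVf ?mulr1 ?gt_eqF.
rewrite e in key.
rewrite -(@leeD2rE _ (C16^-1)%:E)//.
by rewrite -EFinD -mulr2n -[_ *+ 2]mulr_natl.
Qed.

Lemma c5_ge0 : 0 <= c5 tau.
Proof.
have c21 := c2_ge1 tau0; rewrite /c5 addr_ge0//.
  by rewrite divr_ge0 ?sqr_ge0// mulr_ge0// (le_trans ler01).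
rewrite mulr_ge0//; first by rewrite mulr_ge0// sqr_ge0.
by rewrite !addr_ge0// divr_ge0 ?sqr_ge0// ltW.
Qed.

Definition CW : R := C16 * (c5 tau * Cop * 8).

(** [Wd] and [kapd] depend on complementary blocks, so the mean of [Wd / kapd^8] is a product of
    means. By [wrow_full] this quotient is at most a constant times [1 + lam] times the sum of [1]
    and three shares; each of the four products has mean at most [2], whence the [8]. *)
Lemma Wd_expectation : (\int[P]_t (Wd i (D t))%:E <= CW%:E)%E.
Proof.
have C0 : 0 < C16 by rewrite (lt_le_trans ltr01).
have mW := measurable_Wd S tau0 uH cg g0 mg gl ml i.
have W0 d : (0 <= (Wd i d)%:E)%E by rewrite lee_fin Wd_ge0.
have V0 d : (0 <= (kap8 d)%:E)%E by rewrite lee_fin invr_ge0 exprn_ge0// ltW.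
have Vm d d' : (kap8 (mix (zblock i) d d'))%:E = (kap8 d')%:E.
  by rewrite /kap8 /kapd kap_mix.
have Wm d d' : (Wd i (mix (zblock i) d d'))%:E = (Wd i d)%:E by rewrite Wd_mix.
have e := block_indep mD iD Wm Vm (mEF mW) (mEF mk8) W0 V0.
have step : ((\int[P]_t (Wd i (D t))%:E) * (C16^-1)%:E <= (c5 tau * Cop * 8)%:E)%E.
  apply: (@le_trans _ _ ((\int[P]_t (Wd i (D t))%:E) * \int[P]_t (kap8 (D t))%:E)%E).
    by apply: lee_wpmul2l; [exact: integral_ge0|exact: E8_lower].
  rewrite -e.
  pose v1 (d : data R J) : 'cV[R]_n := psiw (yd d) (Gd d).
  pose v2 (d : data R J) : 'cV[R]_n := Gd d *m Bw (yd d) (Gd d).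
  pose v3 (d : data R J) : 'cV[R]_n := col 0 (Gd d : 'M[R]_(n, q.+1)).
  have mG k j : measurable_fun setT (fun d : data R J => (Gd d : 'M[R]_(n, q.+1)) k j).
    exact: measurable_Gd.
  have mv1 k : measurable_fun setT (fun d => v1 d k 0) by exact: (measurable_psiw S tau0 uH cg g0 mg gl ml mG).
  have mB j : measurable_fun setT (fun d : data R J => Bw (yd d) (Gd d) j 0).
    exact: (measurable_Bw S tau0 uH cg g0 mg gl ml mG).
  have mv2 k : measurable_fun setT (fun d => v2 d k 0).
    under eq_fun do rewrite mxE; apply: measurable_sum => j.
    by apply: measurable_funM; [exact: mG|exact: mB].
  have mv3 k : measurable_fun setT (fun d => v3 d k 0).
    by under eq_fun do rewrite mxE; exact: mG.
  have {}e1 : (\int[P]_t ((1 + lam (Gd (D t) : 'M[R]_(n, q.+1))) * (N * v1 (D t) i 0 ^+ 2 / sq (v1 (D t))))%:E <= 2%:E)%E.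
    apply: (exchangeable_share mv1) => s d k sK; rewrite /v1 yd_swap Gd_swap.
    exact: psiw_perm.
  have e2 : (\int[P]_t ((1 + lam (Gd (D t) : 'M[R]_(n, q.+1))) * (N * v2 (D t) i 0 ^+ 2 / sq (v2 (D t))))%:E <= 2%:E)%E.
    apply: (exchangeable_share mv2) => s d k sK; rewrite /v2 yd_swap Gd_swap Bw_perm//.
    by rewrite !mxE; apply: eq_bigr => j _; rewrite mxE.
  have e3 : (\int[P]_t ((1 + lam (Gd (D t) : 'M[R]_(n, q.+1))) * (N * v3 (D t) i 0 ^+ 2 / sq (v3 (D t))))%:E <= 2%:E)%E.
    by apply: (exchangeable_share mv3) => s d k sK; rewrite /v3 Gd_swap !mxE.
  pose L t := 1 + lam (Gd (D t) : 'M[R]_(n, q.+1)).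
  pose h (v : data R J -> 'cV[R]_n) t := L t * (N * v (D t) i 0 ^+ 2 / sq (v (D t))).
  have L0 t : 0 <= L t by rewrite addr_ge0// lam_ge0.
  have h0 v t : 0 <= h v t by rewrite mulr_ge0// divr_ge0 ?dotv_ge0// mulr_ge0 ?sqr_ge0// ltW.
  have mL : measurable_fun setT (fun t => (L t)%:E).
    by apply: (mDc (f := fun d => 1 + lam (Gd d : 'M[R]_(n, q.+1)))); exact: measurable_funD.
  have mh (v : data R J -> 'cV[R]_n) : (forall k, measurable_fun setT (fun d => v d k 0)) -> measurable_fun setT (fun t => (h v t)%:E).
    move=> mv; apply: (mDc (f := fun d => (1 + lam (Gd d : 'M[R]_(n, q.+1))) * (N * v d i 0 ^+ 2 / sq (v d)))).
    apply: measurable_funM; first exact: measurable_funD.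
    apply: measurable_funM; first by apply: measurable_funM => //; apply: measurable_funX; exact: mv.
    apply: measurable_inv_ge0 => [|d]; last exact: dotv_ge0.
    exact: measurable_dotv.
  have c50 := c5_ge0.
  apply: (@le_trans _ _ (\int[P]_t ((c5 tau * Cop)%:E * ((L t)%:E + (h v1 t)%:E + (h v2 t)%:E + (h v3 t)%:E)))%E).
    apply: ge0_le_integral => //.
    - by move=> t _; rewrite mule_ge0.
    - by apply: emeasurable_funM; [exact: mDc|exact: mDc].
    - apply: emeasurable_funM => //; do 2 (apply: emeasurable_funD; last exact: mh).
      by apply: emeasurable_funD => //; exact: mh.
    - move=> t _; rewrite -!EFinD -!EFinM lee_fin.
      have hr := rhod_upper S tau0 n0 uH cg g0 mg gl l0 i (D t).
      have p0 := psiw_gt0 S tau0 n0 uH cg g0 mg gl l0 (yd (D t)) (Gd (D t)).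
      have pt0 := psiw_gt0 S tau0 n0 uH cg g0 mg gl l0 (yd (D t)) (erase i (Gd (D t))).
      have hw := wrow_full tau0 n0 (Bw_perturb tau0 n0 uH Snorm cg g0 mg gl (yd (D t)))
        (Bw_fit tau0 n0 uH Snorm cg g0 mg gl (yd (D t))) p0 pt0 (sqr_ge0 _) hr.
      have kk : 0 < kapd i (D t) ^+ 8 by rewrite exprn_gt0.
      rewrite -[kap8 _]/((kapd i (D t) ^+ 8)^-1) ler_pdivrMr//.
      apply: le_trans hw _.
      have hK := hop (Gd (D t)); rewrite -/(L t) in hK.
      set T1 := _ * psiw _ _ _ _ ^+ 2 / _; set T2 := _ * (_ *m _) _ _ ^+ 2 / _; set T3 := _ / sq (col 0 _).
      have h3E : h v3 t = L t * T3 by rewrite /h /v3 [col _ _ i 0]mxE.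
      rewrite h3E -[h v1 t]/(L t * T1) -[h v2 t]/(L t * T2) -/(kapd i (D t)).
      have T0 : 0 <= 1 + T1 + T2 + T3.
        by rewrite !addr_ge0// divr_ge0 ?dotv_ge0// mulr_ge0 ?sqr_ge0// ltW.
      have -> : c5 tau * Cop * (L t + L t * T1 + L t * T2 + L t * T3) * kapd i (D t) ^+ 8 =
        c5 tau * (kapd i (D t) ^+ 8 * (Cop * L t)) * (1 + T1 + T2 + T3) by ring.
      apply: ler_wpM2r => //; apply: ler_wpM2l => //; apply: ler_wpM2l => //; exact: ltW.
  rewrite ge0_integralZl_EFin ?mulr_ge0//; last 2 first.
  - by move=> t _; rewrite !adde_ge0// lee_fin.
  - do 2 (apply: emeasurable_funD; last exact: mh).
    by apply: emeasurable_funD => //; exact: mh.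
  rewrite [(_ * 8)%:E]EFinM; apply: lee_wpmul2l; first by rewrite lee_fin mulr_ge0.
  have hE0 v t : (0 <= (h v t)%:E)%E by rewrite lee_fin.
  have LE0 t : (0 <= (L t)%:E)%E by rewrite lee_fin.
  have m2 : measurable_fun setT (fun t => (L t)%:E + (h v1 t)%:E)%E by apply: emeasurable_funD => //; exact: mh.
  have m3 : measurable_fun setT (fun t => (L t)%:E + (h v1 t)%:E + (h v2 t)%:E)%E.
    by apply: emeasurable_funD => //; exact: mh.
  rewrite ge0_integralD//; [|by move=> t _; rewrite !adde_ge0//|exact: mh].
  rewrite ge0_integralD//; [|by move=> t _; rewrite !adde_ge0//|exact: mh].
  rewrite ge0_integralD//; last exact: mh.
  have -> : (8%:E = 2%:E + 2%:E + 2%:E + 2%:E :> \bar R)%E by rewrite -!EFinD; congr EFin; ring.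
  by apply: leeD => //; apply: leeD => //; apply: leeD.
rewrite /CW mulrC EFinM -lee_pdivrMr// invrK.
Qed.

(** * The residual of Stein's formula for one row *)

Section Residual.
Variable Z : T -> R.
Hypothesis mZ : measurable_fun setT Z.
Hypothesis Zlaw : forall (W : data R J -> \bar R) (phi : R -> \bar R),
  (forall d d', W (mix (zblock i) d d') = W d) ->
  measurable_fun setT W -> measurable_fun setT phi ->
  (forall d, 0 <= W d)%E -> (forall x, 0 <= phi x)%E ->
  (\int[P]_t (W (D t) * phi (Z t)) = (\int[P]_t W (D t)) * \int[normal_prob (0 : R) 1]_x phi x)%E.
Hypothesis hZ : forall t, dotv (zrow i (Gd (D t))) (Bw (yd (D t)) (erase i (Gd (D t)))) =
  enorm (tailv (Bw (yd (D t)) (erase i (Gd (D t))))) * Z t.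

Definition Xd t : R := Wd i (D t) * (kapd i (D t) ^+ 4 * (1 + Z t ^+ 2) ^+ 2).

Lemma Xd_ge0 t : 0 <= Xd t.
Proof.
rewrite /Xd mulr_ge0 ?Wd_ge0// mulr_ge0// exprn_ge0//; first exact: ltW (k0 _).
by rewrite addr_ge0// sqr_ge0.
Qed.

Let mW := measurable_Wd S tau0 uH cg g0 mg gl ml i.

Let W0 d : (0 <= (Wd i d)%:E)%E. Proof. by rewrite lee_fin Wd_ge0. Qed.

Let Wm d d' : (Wd i (mix (zblock i) d d'))%:E = (Wd i d)%:E. Proof. by rewrite Wd_mix. Qed.

Let Wkap_expectation : (\int[P]_t ((Wd i (D t))%:E * (kapd i (D t) ^+ 16)%:E) <= (CW * C16)%:E)%E.
Proof.
rewrite (block_indep mD iD (Q := zblock i) (W := fun d => (Wd i d)%:E) (V := fun d => (kapd i d ^+ 16)%:E)) //.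
- rewrite EFinM; apply: lee_pmul; [exact: integral_ge0| |exact: Wd_expectation|exact: kapd_moment].
  by apply: integral_ge0 => t _; rewrite lee_fin exprn_ge0// ltW.
- by move=> d d'; rewrite /kapd kap_mix.
- exact: mEF.
- by apply: mEF; apply: measurable_funX; exact: mkapd.
- by move=> d; rewrite lee_fin exprn_ge0// ltW.
Qed.

Let WZ_expectation : (\int[P]_t ((Wd i (D t))%:E * ((1 + 1 * Z t ^+ 2) ^+ 4)%:E) <= (CW * C4)%:E)%E.
Proof.
rewrite (Zlaw (W := fun d => (Wd i d)%:E) (phi := fun x => ((1 + 1 * x ^+ 2) ^+ 4)%:E)) //.
- rewrite EFinM; apply: lee_pmul; [exact: integral_ge0| |exact: Wd_expectation|exact: h4].
  by apply: integral_ge0 => x _; rewrite lee_fin exprn_ge0// addr_ge0// mulr_ge0// sqr_ge0.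
- exact: mEF.
- apply/measurable_EFinP; apply: measurable_funX; apply: measurable_funD => //.
  by apply: measurable_funM => //; exact: measurable_funX.
- by move=> x; rewrite lee_fin exprn_ge0// addr_ge0// mulr_ge0// sqr_ge0.
Qed.

Let Wexp_expectation h k : (\int[P]_t ((Wd i (D t))%:E *
  (expR (4 * h * crd (i, Some (lift ord0 k)) (D t)))%:E) <= (CW * expR (8 * h ^+ 2))%:E)%E.
Proof.
rewrite (block_indep mD iD (Q := zblock i) (W := fun d => (Wd i d)%:E)
  (V := fun d => (expR (4 * h * crd (i, Some (lift ord0 k)) d))%:E)) //.
- rewrite EFinM; apply: lee_pmul; [exact: integral_ge0|exact: integral_ge0|exact: Wd_expectation|].
  have mE : measurable_fun setT (fun x : R => (expR (4 * h * x))%:E).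
    apply/measurable_EFinP; apply: (measurableT_comp (@measurable_expR R)).
    exact: measurable_funM.
  have mc : measurable_fun setT (fun t => crd ((i, Some (lift ord0 k)) : J) (D t)).
    exact: (measurableT_comp (measurable_crd _) mD).
  rewrite -(ge0_integral_law (nu := normal_prob (0 : R) 1) (F := fun x => (expR (4 * h * x))%:E) mc)//.
    rewrite normal_mgf lee_fin ler_expR; rewrite le_eqVlt; apply/orP; left; apply/eqP; by field.
  by move=> A mA; exact: lD.
- by move=> d d'; rewrite crd_mkd /zblock/= eqxx.
- exact: mEF.
- apply: mEF; apply: (measurableT_comp (@measurable_expR R)).
  by apply: measurable_funM => //; exact: measurable_crd.
Qed.

Definition CX : R := (CW * C16 + CW * C4) / 2.

Let mWT : measurable_fun setT (fun t => (Wd i (D t))%:E). Proof. exact: mDc. Qed.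

Let mkT m : measurable_fun setT (fun t => (kapd i (D t) ^+ m)%:E).
Proof. by apply: (mDc (f := fun d => kapd i d ^+ m)); apply: measurable_funX; exact: mkapd. Qed.

Let mZT : measurable_fun setT (fun t => ((1 + 1 * Z t ^+ 2) ^+ 4)%:E).
Proof.
apply/measurable_EFinP; apply: measurable_funX; apply: measurable_funD => //.
by apply: measurable_funM => //; exact: measurable_funX.
Qed.

Let mXd : measurable_fun setT Xd.
Proof.
apply: measurable_funM; first exact: (measurableT_comp mW mD).
apply: measurable_funM; apply: measurable_funX; first exact: (measurableT_comp mkapd mD).
by apply: measurable_funD => //; exact: measurable_funX.
Qed.

(** [kapd] and [Z] are each independent of [Wd], but both depend on the erased entries. With
    [z = 1 + Z^2], the inequality [k^4 z^2 <= (k^8 + z^4) / 2] separates them. *)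
Lemma Xd_expectation : (\int[P]_t (Xd t)%:E <= CX%:E)%E.
Proof.
pose a t := ((Wd i (D t))%:E * (kapd i (D t) ^+ 16)%:E)%E.
pose b t := ((Wd i (D t))%:E * ((1 + 1 * Z t ^+ 2) ^+ 4)%:E)%E.
have ma : measurable_fun setT a by apply: emeasurable_funM => //; exact: mkT.
have mb : measurable_fun setT b by exact: emeasurable_funM.
have a0 t : (0 <= a t)%E by rewrite mule_ge0// lee_fin exprn_ge0// ltW.
have b0 t : (0 <= b t)%E by rewrite mule_ge0// lee_fin exprn_ge0// addr_ge0// mulr_ge0// sqr_ge0.
apply: (@le_trans _ _ (\int[P]_t ((2^-1)%:E * (a t + b t)))%E).
  apply: ge0_le_integral => //.
  - by move=> t _; rewrite lee_fin Xd_ge0.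
  - exact/measurable_EFinP.
  - by apply: emeasurable_funM => //; exact: emeasurable_funD.
  - move=> t _; rewrite [leRHS](_ : _ = (2^-1 * (Wd i (D t) * kapd i (D t) ^+ 16 + Wd i (D t) * (1 + Z t ^+ 2) ^+ 4))%:E);
      last by rewrite /a /b mul1r.
    rewrite lee_fin /Xd.
    have w0 := Wd_ge0 tau S loss g F i (D t); have k1 := kapd_ge1 i (D t).
    move: (Wd i (D t)) (kapd i (D t)) (1 + Z t ^+ 2) w0 k1 => W k z w0 k1.
    have k8 : k ^+ 8 <= k ^+ 16 by rewrite ler_weXn2l.
    have -> : 2^-1 * (W * k ^+ 16 + W * z ^+ 4) = W * (2^-1 * (k ^+ 16 + z ^+ 4)) by ring.
    apply: ler_wpM2l => //; have := sqr_ge0 (k ^+ 4 - z ^+ 2).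
    have -> : (k ^+ 4 - z ^+ 2) ^+ 2 = k ^+ 8 - 2 * (k ^+ 4 * z ^+ 2) + z ^+ 4 by ring.
    by lra.
rewrite ge0_integralZl_EFin//; last 2 first.
- by move=> t _; exact: adde_ge0.
- exact: emeasurable_funD.
rewrite ge0_integralD// /CX mulrC EFinM; apply: lee_wpmul2l; first by rewrite lee_fin.
by rewrite EFinD; apply: leeD; [exact: Wkap_expectation|exact: WZ_expectation].
Qed.

(** Integrability against the exponential tilts, where no uniform bound is required: Young's
    inequality leaves terms in which [Wd] meets one independent factor. *)
Lemma Xd_expR_finite h k : (\int[P]_t (Xd t * expR (h * crd (i, Some (lift ord0 k)) (D t)))%:E < +oo)%E.
Proof.
pose a t := ((Wd i (D t))%:E * (kapd i (D t) ^+ 16)%:E)%E.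
pose b t := ((Wd i (D t))%:E * ((1 + 1 * Z t ^+ 2) ^+ 4)%:E)%E.
pose c t := ((Wd i (D t))%:E * (expR (4 * h * crd (i, Some (lift ord0 k)) (D t)))%:E)%E.
have mcr : measurable_fun setT (fun t => crd ((i, Some (lift ord0 k)) : J) (D t)).
  exact: (measurableT_comp (measurable_crd _) mD).
have mex r : measurable_fun setT (fun t => expR (r * crd ((i, Some (lift ord0 k)) : J) (D t))).
  by apply: (measurableT_comp (@measurable_expR R)); exact: measurable_funM.
have ma : measurable_fun setT a by apply: emeasurable_funM => //; exact: mkT.
have mb : measurable_fun setT b by exact: emeasurable_funM.
have mc : measurable_fun setT c by apply: emeasurable_funM => //; apply/measurable_EFinP; exact: mex.
have a0 t : (0 <= a t)%E by rewrite mule_ge0// lee_fin exprn_ge0// ltW.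
have b0 t : (0 <= b t)%E by rewrite mule_ge0// lee_fin exprn_ge0// addr_ge0// mulr_ge0// sqr_ge0.
have c0 t : (0 <= c t)%E by rewrite mule_ge0// lee_fin expR_ge0.
have mab : measurable_fun setT (fun t => a t + b t)%E by exact: emeasurable_funD.
apply: (@le_lt_trans _ _ (\int[P]_t (a t + b t + c t))%E).
  apply: ge0_le_integral => //.
  - by move=> t _; rewrite lee_fin mulr_ge0 ?Xd_ge0 ?expR_ge0.
  - by apply/measurable_EFinP; apply: measurable_funM => //; exact: mex.
  - exact: emeasurable_funD.
  - move=> t _; rewrite /a /b /c -!EFinM -!EFinD lee_fin /Xd mul1r.
    have w0 := Wd_ge0 tau S loss g F i (D t); have k1 := kapd_ge1 i (D t).
    have -> : expR (4 * h * crd (i, Some (lift ord0 k)) (D t)) = expR (h * crd (i, Some (lift ord0 k)) (D t)) ^+ 4.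
      by rewrite -expRM_natl; congr expR; ring.
    have e0 := expR_ge0 (h * crd (i, Some (lift ord0 k)) (D t)).
    move: (Wd i (D t)) (kapd i (D t)) (1 + Z t ^+ 2) (expR _) w0 k1 e0 => W x z e w0 x1 e0.
    have -> : W * x ^+ 16 + W * z ^+ 4 + W * e ^+ 4 = W * (x ^+ 16 + z ^+ 4 + e ^+ 4) by ring.
    rewrite -mulrA; apply: ler_wpM2l => //.
    have := sqr_ge0 (x ^+ 4 * e - z ^+ 2); have := sqr_ge0 (x ^+ 8 - e ^+ 2).
    have -> : (x ^+ 4 * e - z ^+ 2) ^+ 2 = x ^+ 8 * e ^+ 2 - 2 * (x ^+ 4 * z ^+ 2 * e) + z ^+ 4 by ring.
    have -> : (x ^+ 8 - e ^+ 2) ^+ 2 = x ^+ 16 - 2 * (x ^+ 8 * e ^+ 2) + e ^+ 4 by ring.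
    have p1 : 0 <= x ^+ 16 by rewrite exprn_ge0// (le_trans ler01).
    have p2 : 0 <= z ^+ 4 by rewrite (exprM z 2 2) sqr_ge0.
    have p3 : 0 <= e ^+ 4 by rewrite exprn_ge0.
    by lra.
rewrite ge0_integralD//; last by move=> t _; exact: adde_ge0.
rewrite ge0_integralD//.
apply: (le_lt_trans (leeD (leeD Wkap_expectation WZ_expectation) (Wexp_expectation h k))).
by rewrite -!EFinD ltry.
Qed.

(** [rhod] with frozen responses, the form used by the deterministic bounds, where the design alone
    varies. *)
Definition rhoy (y : 'I_n -> R * R) (G : 'M[R]_(n, q.+1)) : R :=
  Num.sqrt (N * c2 tau / sq (psiw y (erase i G))) * (1 + 2 * latmax (erase i G) / Num.sqrt N).

Lemma rhoy_erase y G G' : erase i G = erase i G' -> rhoy y G = rhoy y G'.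
Proof. by rewrite /rhoy => ->. Qed.

Lemma score_dotv_sq (u b : 'cV[R]_q.+1) z : dotv u b = enorm (tailv b) * z ->
  dotv u b ^+ 2 <= sq b * z ^+ 2.
Proof.
move=> ->; rewrite exprMn enorm_sq; apply: ler_wpM2r; first exact: sqr_ge0.
exact: tailv_le.
Qed.

Let zc (k : 'I_q) : J := (i, Some (lift ord0 k)).

Notation fd := (flddat tau S loss g F i).

Let flddat_shift j k h d : fd j (shiftd (zc k) h d) =
  fld (Bw (yd d)) i (rhoy (yd d)) j (shiftG i k h (Gd d)).
Proof. by rewrite -Gd_shift /flddat /rhod /fld -/(zc k) yd_shift. Qed.

Lemma flddat_sq t : \sum_j fd j (D t) ^+ 2 <= (1 + 1 / tau) / tau * Xd t / N.
Proof.
have h := fld_sq tau0 n0 (Bw_perturb tau0 n0 uH Snorm cg g0 mg gl (yd (D t))) (rhoy (yd (D t))) (score_dotv_sq (hZ t)).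
exact: h.
Qed.

Lemma flddat_increment h t : 0 <= h <= 1 / 2 ->
  \sum_j \sum_k (fd j (shiftd (zc k) h (D t)) - fd j (D t)) ^+ 2 <= h ^+ 2 * (c4 tau delta * Xd t / N).
Proof.
move=> hh; have qN : q%:R <= N / delta by apply: le_trans pn; rewrite ler_nat.
have key := fld_increment tau0 n0 (Bw_perturb tau0 n0 uH Snorm cg g0 mg gl (yd (D t)))
  (@rhoy_erase (yd (D t))) (score_dotv_sq (hZ t)) delta0 qN hh.
apply: le_trans key; apply: ler_sum => j _; apply: ler_sum => k _.
by rewrite flddat_shift.
Qed.

Variables (b : 'I_q -> T -> R).
Hypothesis mb : measurable_fun setT (fun t => \sum_j b j t).
Hypothesis hb : {ae P, forall t, forall j,
  (Bw (yd (D t)) (shiftG i j (- m.+2%:R^-1) (Gd (D t))) - Bw (yd (D t)) (Gd (D t))) (lift ord0 j) 0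
    / m.+2%:R^-1 @[m --> \oo] --> - b j t}.

Definition Yd t : R := \sum_j Gd (D t) i (lift ord0 j) * fd j (D t) -
  rhod i (D t) * (kapd i (D t) * (\sum_j b j t) + 2 / N *
    dotv (zrow i (Gd (D t))) (Bw (yd (D t)) (Gd (D t)) - Bw (yd (D t)) (erase i (Gd (D t))))).

Lemma measurable_Yd : measurable_fun setT Yd.
Proof.
have mfD j : measurable_fun setT (fun t => fd j (D t)).
  exact: (measurableT_comp (measurable_flddat S tau0 uH cg g0 mg gl ml i j) mD).
have mGD k j : measurable_fun setT (fun t => Gd (D t) k j : R).
  exact: (measurableT_comp (measurable_Gd k j) mD).
apply: measurable_funB; first by apply: measurable_sum => j; exact: measurable_funM.
apply: measurable_funM; first exact: (measurableT_comp (measurable_rhod S tau0 uH cg g0 mg gl ml i) mD).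
apply: measurable_funD.
  by apply: measurable_funM => //; exact: (measurableT_comp mkapd mD).
apply: measurable_funM => //.
apply: (measurableT_comp (f := fun d : data R J => dotv (zrow i (Gd d)) (Bw (yd d) (Gd d) - Bw (yd d) (erase i (Gd d)))) _ mD).
apply: measurable_dotv => j.
  under eq_fun do rewrite mxE; case: (_ == _); first exact: measurable_cst.
  exact: measurable_Gd.
under eq_fun do rewrite mxE [X in _ + X]mxE.
apply: measurable_funB; apply: (measurable_Bw S tau0 uH cg g0 mg gl ml) => k l; first exact: measurable_Gd.
under eq_fun do rewrite mxE; case: (_ && _); first exact: measurable_cst.
exact: measurable_Gd.
Qed.

(** The field and its increments are both bounded by multiples of [Xd / N], so [stein_fatou] gives
    the rate [1 / N]. *)
Lemma Yd_expectation : (\int[P]_t (Yd t ^+ 2)%:E <=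
  (5 * (c4 tau delta * CX / N) + 4 * ((1 + 1 / tau) / tau * CX / N))%:E)%E.
Proof.
have mf j : measurable_fun setT (fd j) by exact: (measurable_flddat S tau0 uH cg g0 mg gl ml i).
have mfD j : measurable_fun setT (fun t => fd j (D t)) by exact: (measurableT_comp (mf j) mD).
have c40 : 0 <= c4 tau delta.
  have p1 : 0 <= 1 / tau by rewrite divr_ge0// ltW.
  have p2 : 0 <= 1 / (delta * tau) by rewrite divr_ge0// ltW// mulr_gt0.
  have p3 : 0 <= 1 / delta by rewrite divr_ge0// ltW.
  have p4 := ltW tau0.
  rewrite /c4 /c3 addr_ge0//; apply: mulr_ge0.
  - by rewrite divr_ge0// mulr_ge0// addr_ge0.
  - by rewrite mulr_ge0// sqr_ge0.
  - by rewrite mulr_ge0// addr_ge0.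
  - by rewrite divr_ge0// addr_ge0.
have a0 : 0 <= (1 + 1 / tau) / tau by rewrite divr_ge0 ?(ltW tau0)// addr_ge0// divr_ge0// ltW.
have int_X (a : R) : 0 <= a -> (\int[P]_t (a * Xd t / N)%:E <= (a * CX / N)%:E)%E.
  move=> aa; under eq_integral do rewrite mulrAC EFinM.
  rewrite ge0_integralZl_EFin//; last 3 first.
  - by move=> t _; rewrite lee_fin Xd_ge0.
  - exact/measurable_EFinP.
  - by rewrite divr_ge0// ltW.
  rewrite [(a * CX / N)%:E](_ : _ = (a / N)%:E * CX%:E)%E; last by rewrite -EFinM mulrAC.
  apply: lee_wpmul2l; last exact: Xd_expectation.
  by rewrite lee_fin divr_ge0// ltW.
have mX' (a : R) : measurable_fun setT (fun t => (a * Xd t / N)%:E).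
  by apply/measurable_EFinP; apply: measurable_funM => //; exact: measurable_funM.
have zi : injective zc
  by move=> j k e; apply: (@lift_inj q.+1 ord0); exact: (congr1 (fun x : J => odflt ord0 x.2) e).
have zl k A : measurable A -> P ((fun t => crd (zc k) (D t)) @^-1` A) = normal_prob 0 1 A.
  by move=> mA; exact: lD.
apply: (stein_fatou mD iD zi zl (f := fd) mf).
- move=> h j k _; apply: (@le_lt_trans _ _ (\int[P]_t (((1 + 1 / tau) / tau / N)%:E * (Xd t * expR (h * crd (zc k) (D t)))%:E))%E).
    have mex : measurable_fun setT (fun t => expR (h * crd (zc k) (D t))).
      apply: (measurableT_comp (@measurable_expR R)); apply: measurable_funM => //.
      exact: (measurableT_comp (measurable_crd _) mD).
    apply: ge0_le_integral => //.
    + by move=> t _; rewrite lee_fin mulr_ge0 ?sqr_ge0 ?expR_ge0.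
    + by apply/measurable_EFinP; apply: measurable_funM => //; exact: measurable_funX.
    + by apply: emeasurable_funM => //; apply/measurable_EFinP; exact: measurable_funM.
    + move=> t _; rewrite -EFinM lee_fin mulrA; apply: ler_wpM2r; first exact: expR_ge0.
      rewrite mulrAC; apply: le_trans (flddat_sq t).
      by rewrite (bigD1 j)//= lerDl sumr_ge0// => l _; exact: sqr_ge0.
  rewrite ge0_integralZl_EFin//; last 3 first.
  + by move=> t _; rewrite lee_fin mulr_ge0 ?Xd_ge0 ?expR_ge0.
  + apply/measurable_EFinP; apply: measurable_funM => //.
    apply: (measurableT_comp (@measurable_expR R)); apply: measurable_funM => //.
    exact: (measurableT_comp (measurable_crd _) mD).
  + by rewrite divr_ge0// ltW.
  by rewrite lte_mul_pinfty// ?Xd_expR_finite// lee_fin divr_ge0// ltW.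
- move=> h /andP[hp h12].
  apply: (@le_trans _ _ (\int[P]_t ((h ^+ 2)%:E * (c4 tau delta * Xd t / N)%:E))%E).
    apply: ge0_le_integral => //.
    + by move=> t _; rewrite lee_fin; do 2 apply: sumr_ge0 => ? _; exact: sqr_ge0.
    + apply/measurable_EFinP; do 2 apply: measurable_sum => ?.
      apply: measurable_funX; apply: measurable_funB => //.
      by apply: (measurableT_comp (mf _)); exact: (measurableT_comp (measurable_shiftd _ _) mD).
    + exact: emeasurable_funM.
    + by move=> t _; rewrite -EFinM lee_fin flddat_increment// (ltW hp).
  rewrite ge0_integralZl_EFin ?sqr_ge0//; last first.
    by move=> t _; rewrite lee_fin divr_ge0 ?(ltW N0)// mulr_ge0// Xd_ge0.
  rewrite [X in (_ <= X)%E]EFinM.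
  by apply: lee_wpmul2l; [rewrite lee_fin sqr_ge0|exact: int_X].
- apply: le_trans (int_X _ a0); apply: ge0_le_integral => //.
  + by move=> t _; rewrite lee_fin sumr_ge0// => j _; exact: sqr_ge0.
  + by apply/measurable_EFinP; apply: measurable_sum => j; exact: measurable_funX.
  + by move=> t _; rewrite lee_fin flddat_sq.
- exact: measurable_Yd.
- apply: filterS hb => t ht.
  set G := Gd (D t); set y := yd (D t).
  have -> : Yd t = \sum_j (G i (lift ord0 j) * fd j (D t) - rhod i (D t) * (kapd i (D t) * b j t +
      2 / N * (G i (lift ord0 j) * (Bw y G - Bw y (erase i G)) (lift ord0 j) 0))).
    rewrite sumrB /Yd -/G -/y -mulr_sumr big_split/= -mulr_sumr -mulr_sumr; congr (_ - _ * (_ + _ * _)).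
    rewrite dotvE big_ord_recl [zrow _ _ ord0 0]mxE eqxx mul0r add0r.
    by apply: eq_bigr => j _; rewrite zrow_lift.
  apply: cvg_sumr => j.
  have hm0 m : 0 < (m.+2%:R : R)^-1 by rewrite invr_gt0 ltr0n.
  pose Bh m : R := (Bw y (shiftG i j (- m.+2%:R^-1) G) - Bw y (erase i G)) (lift ord0 j) 0.
  pose dB : R := (Bw y G - Bw y (erase i G)) (lift ord0 j) 0.
  have cB : (Bh m - dB) / m.+2%:R^-1 @[m --> \oo] --> - b j t.
    have {}ht := ht j; apply: cvg_trans ht; apply: near_eq_cvg; near=> m.
    by congr (_ / _); rewrite /Bh /dB !mxE; ring.
  have := @tilted_quotient_cvg R (rhod i (D t)) (kapd i (D t)) (G i (lift ord0 j)) N (b j t) dB _ Bh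
    hm0 cvg_inv_shift2 cB.
  apply: cvg_trans; apply: near_eq_cvg; near=> m.
  rewrite flddat_shift /fld -/G -/y erase_shiftG.
  have -> : kap i (shiftG i j (- m.+2%:R^-1) G) = kapd i (D t) +
      (2 * - m.+2%:R^-1 * G i (lift ord0 j) + (- m.+2%:R^-1) ^+ 2) / N.
    by rewrite -(kap_shiftG n0 i j) /kapd -/G; ring.
  rewrite (rhoy_erase y (erase_shiftG i j (- m.+2%:R^-1) G)) -/(Bh m) /flddat -/G -/y -/dB.
  by rewrite -[crd _ _]/(crd (zc j) (D t)) /G mxE.
Unshelve. all: by end_near. Qed.

End Residual.
End Core.

(** * Directional derivatives of the estimator *)

Section Units.
Context {R : realType}.

Lemma delta_mx_mulcol k l i j (u : 'cV[R]_l) :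
  (delta_mx i j : 'M[R]_(k, l)) *m u = u j 0 *: delta_mx i 0.
Proof. by rewrite -(mul_delta_mx (0 : 'I_1)) -mulmxA -rowE [row _ _]mx11_scalar mxE mul_mx_scalar. Qed.

Lemma row_form_mul k l (i : 'I_k) (v : 'cV[R]_l) (u : 'cV[R]_k) :
  (delta_mx i 0 *m v^T)^T *m u = u i 0 *: v.
Proof.
rewrite trmx_mul trmxK trmx_delta -mulmxA -rowE [row _ _]mx11_scalar mxE.
by rewrite mul_mx_scalar.
Qed.

Lemma cvg_ge0 (u : nat -> R) (l : R) : u @ \oo --> l -> (forall m, 0 <= u m) -> 0 <= l.
Proof.
move=> cu h; rewrite -(cvg_lim (@Rhausdorff R) cu); apply: limr_ge; last exact: nearW.
by apply/cvg_ex; exists l.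
Qed.

End Units.

Section Derivative.
Context {R : realType}.
Variables (n q : nat) (delta tau : R) (Sigma S : 'M[R]_q.+1).
Variables (loss : R -> R -> R) (g : 'cV[R]_q.+1 -> R) (F : R * R -> R).
Hypotheses (tau0 : 0 < tau) (n0 : (0 < n)%N).
Hypotheses (uH : sqrtmx Sigma \in unitmx).
Hypothesis SS : S *m S^T = Sigma.
Hypothesis Snorm : forall b, enorm (S^T *m b) = enorm (sqrtmx Sigma *m b).
Hypothesis Sop : forall (A : 'M[R]_q.+1) u, enorm (S^T *m A *m S *m u) <=
  opnorm (sqrtmx Sigma *m A *m sqrtmx Sigma) * enorm u.
Hypothesis cg : convexf g.
Hypothesis g0 : forall b, g 0 <= g b.
Hypothesis mg : strongly_monotone_subdifferential Sigma tau g.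
Hypothesis gl : forall s, good_loss (loss (F s)).
Hypothesis l0 : forall s, derive1 (loss (F s)) 0 <> 0.
Notation N := (n%:R : R).
Notation sq u := (dotv u u).
Notation Bw := (Bw S loss g F).
Notation psiw := (psiw S loss g F).
Variables (y : 'I_n -> R * R) (G : 'M[R]_(n, q.+1)) (A : 'M[R]_q.+1).
Notation X := (G *m S^T).
Hypothesis hA : is_Ahat loss g Sigma tau (F \o y) X A.

Let N0 : 0 < N. Proof. by rewrite ltr0n. Qed.

Let Nt0 : 0 < N * tau. Proof. exact: mulr_gt0. Qed.

Notation bh := (bhat loss g (F \o y)).
Notation Dm := (Dmx loss g (F \o y) X).
Notation At := (S^T *m A *m S).

(** The differential is linear, hence determined by its values at the unit matrices, and the
    right-hand side is linear in [W] too. *)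
Lemma bhat_derive W : 'D_W bh X = A *m (W^T *m psihat loss g (F \o y) X - X^T *m Dm *m W *m bh X).
Proof.
have [df dE _ _ _] := hA.
pose L (V : 'M[R]_(n, q.+1)) : 'cV[R]_q.+1 := A *m (V^T *m psihat loss g (F \o y) X - X^T *m Dm *m V *m bh X).
have LD : {morph L : U V / U + V}.
  move=> U V; rewrite /L [(U + V)^T]linearD/= [X^T *m Dm *m (U + V)]mulmxDr !mulmxDl opprD -mulmxDr; congr (_ *m _).
  by rewrite addrACA.
have LZ a V : L (a *: V) = a *: L V.
  by rewrite /L linearZ/= -scalemxAl -scalemxAr -scalemxAl -scalerBr scalemxAr.
have L0 : L 0 = 0 by rewrite -(scale0r (0 : 'M[R]_(n, q.+1))) LZ scale0r.
rewrite -/(L W) deriveE// [in LHS](matrix_sum_delta W) [in RHS](matrix_sum_delta W).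
rewrite linear_sum (big_morph L LD L0); apply: eq_bigr => i _.
rewrite linear_sum (big_morph L LD L0); apply: eq_bigr => j _.
rewrite linearZ LZ; congr (_ *: _).
rewrite -deriveE// dE /L; congr (_ *m (_ - _)).
  by rewrite trmx_delta delta_mx_mulcol.
by rewrite -[_ *m delta_mx i j *m _]mulmxA delta_mx_mulcol scalemxAr.
Qed.

Definition dirB (V : 'M[R]_(n, q.+1)) : 'cV[R]_q.+1 :=
  At *m (V^T *m psiw y G - G^T *m Dm *m V *m Bw y G).

Lemma Bw_derive V (h : nat -> R) j : (forall m, h m != 0) -> h @ \oo --> (0 : R) ->
  (Bw y (G + h m *: V) - Bw y G) j 0 / h m @[m --> \oo] --> dirB V j 0.
Proof.
move=> h0 ch; have [df _ _ _ _] := hA.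
have [W WE] : exists W, W = V *m S^T by exists (V *m S^T).
have dE : dirB V = S^T *m 'D_W bh X.
  rewrite bhat_derive WE /dirB -!mulmxA; congr (_ *m (_ *m _)).
  by rewrite mulmxBr !trmx_mul trmxK BwE psiwE !mulmxA.
have hd : h @ \oo --> (0 : R)^'.
  move=> P hP; have h' : \forall m \near \oo, h m != 0 -> P (h m) by exact: (ch _ hP).
  by apply: filterS h' => m; exact.
have cW : (h m)^-1 *: (bh (h m *: W + X) - bh X) @[m --> \oo] --> 'D_W bh X.
  have dW : derivable bh X W by exact: diff_derivable.
  exact: (cvg_comp h (fun x : R => x^-1 *: (bh (x *: W + X) - bh X)) hd dW).
have cc : continuous (fun b : 'cV[R]_q.+1 => (S^T *m b) j 0) by exact: mulmx_coord_continuous.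
rewrite dE; apply: cvg_trans (cvg_comp _ _ cW (cc _)); apply: near_eq_cvg; near=> m.
have eX : (G + h m *: V) *m S^T = h m *: W + X by rewrite mulmxDl addrC -scalemxAl WE.
rewrite /= !BwE eX -mulmxBr -scalemxAr [LHS]mxE; exact: mulrC.
Unshelve. all: by end_near. Qed.

Let h2 (m : nat) : R := m.+2%:R^-1.

Let h20 m : 0 < h2 m. Proof. by rewrite invr_gt0 ltr0n. Qed.

Let Bw_derive2 V j : (Bw y (G + h2 m *: V) - Bw y G) j 0 / h2 m @[m --> \oo] --> dirB V j 0.
Proof. by apply: Bw_derive; [move=> m; rewrite gt_eqF|exact: cvg_inv_shift2]. Qed.

Let dotv_derive V u : dotv (Bw y (G + h2 m *: V) - Bw y G) u / h2 m @[m --> \oo] --> dotv (dirB V) u.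
Proof.
rewrite dotvE (_ : (fun m => _) = fun m => \sum_j (Bw y (G + h2 m *: V) - Bw y G) j 0 / h2 m * u j 0).
  by apply: cvg_sumr => j; apply: cvgM; [exact: Bw_derive2|exact: cvg_cst].
by apply/funext => m; rewrite dotvE mulr_suml; apply: eq_bigr => j _; rewrite mulrAC.
Qed.

Let pert := Bw_perturb tau0 n0 uH Snorm cg g0 mg gl y.

(** The limit of [rank1_perturb] along [G + h V], divided by [h^2]. *)
Lemma dirB_row_bound i v : N * tau * sq (dirB (delta_mx i 0 *m v^T)) <=
  sq v * psiw y G i 0 ^+ 2 / (N * tau) + dotv v (Bw y G) ^+ 2.
Proof.
set V := _ *m _; set c := leRHS.
pose dq m := Bw y (G + h2 m *: V) - Bw y G.
have cs : N * tau * (sq (dq m) / h2 m ^+ 2) @[m --> \oo] --> N * tau * sq (dirB V).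
  apply: cvgM; first exact: cvg_cst.
  rewrite dotvE (_ : (fun m => _) = fun m => \sum_j (dq m j 0 / h2 m) * (dq m j 0 / h2 m)).
    by apply: cvg_sumr => j; apply: cvgM; exact: Bw_derive2.
  apply/funext => m; rewrite dotvE mulr_suml; apply: eq_bigr => j _.
  by rewrite expr2 invfM; ring.
apply: (ler_cvg_to cs (@cvg_cst _ c _ _ _)); near=> m.
have e : G + h2 m *: V - G = delta_mx i 0 *m (h2 m *: v)^T.
  by rewrite addrC addKr linearZ/= -scalemxAr.
have := rank1_perturb tau0 n0 pert e; rewrite -/(dq m) dotvZl dotvZr dotvZl.
have d0 := dotv_ge0 (psiw y (G + h2 m *: V) - psiw y G).
have -> : h2 m * (h2 m * sq v) * psiw y G i 0 ^+ 2 / (N * tau) + (h2 m * dotv v (Bw y G)) ^+ 2 = c * h2 m ^+ 2.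
  by rewrite /c; ring.
by rewrite mulrA ler_pdivrMr ?exprn_gt0//; lra.
Unshelve. all: by end_near. Qed.

(** For [u] orthogonal to [B], the direction [V = psi u^T] satisfies [V B = 0]. The derivative of
    the estimator is then [|psi|^2 At u], and the perturbation inequality keeps a single term on the
    right, whose sign passes to the limit. *)
Lemma At_monotone u : dotv u (Bw y G) = 0 -> 0 <= dotv u (At *m u).
Proof.
move=> uB; pose V : 'M[R]_(n, q.+1) := psiw y G *m u^T.
have p0 := psiw_gt0 S tau0 n0 uH cg g0 mg gl l0 y G.
have VE : dirB V = sq (psiw y G) *: (At *m u).
  have VB : V *m Bw y G = 0.
    by rewrite /V -mulmxA [u^T *m _]mx11_scalar -/(dotv _ _) uB raddf0 mulmx0.
  rewrite /dirB -[_ *m V *m _]mulmxA VB mulmx0 subr0 /V trmx_mul trmxK -[u *m _ *m _]mulmxA.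
  rewrite [_^T *m psiw y G]mx11_scalar -/(dotv _ _) mul_mx_scalar.
  by rewrite -scalemxAr.
have : 0 <= dotv (dirB V) u.
  refine (cvg_ge0 (@dotv_derive V u) _) => m.
  have := pert (G + h2 m *: V) G.
  have -> : G + h2 m *: V - G = h2 m *: V by rewrite addrC addKr.
  set dB := Bw _ _ - _; set dp := psiw _ _ - _.
  have -> : dotv dp (h2 m *: V *m Bw y G) = 0.
    by rewrite -scalemxAl /V -mulmxA [u^T *m _]mx11_scalar -/(dotv _ _) uB raddf0 mulmx0 scaler0 dotv0r.
  have -> : dotv dB ((h2 m *: V)^T *m psiw y G) = h2 m * sq (psiw y G) * dotv dB u.
    rewrite linearZ/= -scalemxAl /V trmx_mul trmxK -mulmxA [_^T *m psiw y G]mx11_scalar -/(dotv _ _).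
    by rewrite mul_mx_scalar !dotvZr mulrA.
  have := dotv_ge0 dB; have := dotv_ge0 dp; rewrite subr0 => a1 a2 a3.
  have b1 : 0 <= N * tau * sq dB by rewrite mulr_ge0// ltW.
  have b2 : 0 <= h2 m * sq (psiw y G) * dotv dB u by lra.
  rewrite divr_ge0//; last exact: ltW (h20 m).
  by rewrite pmulr_rge0 ?mulr_gt0// in b2.
by rewrite VE dotvZl pmulr_rge0// dotvC.
Qed.

Let At_bound u : enorm (At *m u) <= (N * tau)^-1 * enorm u.
Proof.
have [_ _ hop _ _] := hA; apply: le_trans (Sop A u) _.
by rewrite ler_wpM2r// enorm_ge0.
Qed.

Lemma trace_At : \tr (Sigma *m A) = \tr At.
Proof. by rewrite -SS -mulmxA mxtrace_mulC. Qed.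

(** [At] has norm at most [1 / (N tau)] and a nonnegative form on the orthogonal complement of [B]:
    the situation of [trace_ge_compl]. *)
Lemma gamma_lower : - (N * tau)^-1 <= \tr (Sigma *m A).
Proof.
rewrite trace_At; apply: (trace_ge_compl At_bound (b := Bw y G)).
by move=> u; exact: At_monotone.
Qed.

Let form_bound u v : `|dotv u (At *m v)| <= (N * tau)^-1 * (enorm u * enorm v).
Proof.
apply: le_trans (dotv_CS _ _) _; rewrite mulrCA; apply: ler_wpM2l; first exact: enorm_ge0.
exact: At_bound.
Qed.

(** The derivative along [e_i v^T] is [psi_i At v - (v . B) c]. So the divergence is [psi_i] times
    the trace without its first entry, minus [v . c] with [v = tailv B]. The vector [c] contains
    second derivatives of the loss; [v . c] is bounded by reading the same formula backwards, with
    [dirB_row_bound] for the derivative along [e_i v^T]. *)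
Lemma divergence_bound i :
  ((\sum_(j < q) dirB (delta_mx i (lift ord0 j)) (lift ord0 j) 0) - \tr (Sigma *m A) * psiw y G i 0) ^+ 2 <=
  18 * psiw y G i 0 ^+ 2 / (N * tau) ^+ 2 + 2 * sq (Bw y G) / (N * tau).
Proof.
pose c : 'cV[R]_q.+1 := At *m (G^T *m Dm *m delta_mx i 0).
have dirE v : dirB (delta_mx i 0 *m v^T) = psiw y G i 0 *: (At *m v) - dotv v (Bw y G) *: c.
  rewrite /dirB -[_ *m (_ *m v^T) *m _]mulmxA rank1_mul row_form_mul mulmxBr.
  by rewrite -[At *m (_ *: v)]scalemxAr -[G^T *m Dm *m _]scalemxAr -scalemxAr.
set ps := psiw y G i 0 in dirE *; set B := Bw y G in dirE *; set v := tailv B.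
have sumE : \sum_(j < q) dirB (delta_mx i (lift ord0 j)) (lift ord0 j) 0 =
    ps * (\tr At - At 0 0) - dotv v c.
  have -> : \tr At - At 0 0 = \sum_(j < q) At (lift ord0 j) (lift ord0 j).
    rewrite /mxtrace big_ord_recl; set s := \sum_i _; rewrite -[At ord0 ord0]/(At 0 0).
    by move: (At 0 0) s => a s; rewrite addrAC subrr add0r.
  have -> : dotv v c = \sum_(j < q) B (lift ord0 j) 0 * c (lift ord0 j) 0.
    rewrite dotvE big_ord_recl mxE eqxx mul0r add0r; apply: eq_bigr => j _.
    by rewrite mxE eq_sym (negbTE (neq_lift _ _)).
  rewrite mulr_sumr -sumrB; apply: eq_bigr => j _.
  rewrite -(mul_delta_mx (0 : 'I_1)) -[delta_mx 0 _]trmx_delta dirE dotv_delta.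
  rewrite mxE [in X in X + _]mxE [in X in _ + X]mxE [in X in _ + X]mxE -colE.
  by rewrite [col _ _ _ _]mxE.
have a0 : 0 < (N * tau)^-1 by rewrite invr_gt0.
have vc : `|dotv v c| <= 2 * (N * tau)^-1 * `|ps| + Num.sqrt (N * tau)^-1 * enorm v.
  have [v0|v0] := eqVneq v 0.
    by rewrite v0 dotv0l normr0 addr_ge0// mulr_ge0 ?sqrtr_ge0 ?enorm_ge0// mulr_ge0// ltW.
  have s0 : 0 < sq v by rewrite dotv_gt0.
  have vB : dotv v B = sq v.
    rewrite !dotvE; apply: eq_bigr => j _.
    have -> : v j 0 = if j == 0 then 0 else B j 0 by rewrite /v /tailv mxE.
    by case: eqP => _ //; rewrite !mul0r.
  have hd := dirB_row_bound i v; rewrite -/ps -/B vB in hd.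
  have dE := dirE v; rewrite vB in dE.
  set w := dirB _ in hd dE.
  have vcE : sq v * dotv v c = ps * dotv v (At *m v) - dotv v w.
    by rewrite dE dotvBr !dotvZr; ring.
  have wle : enorm w <= enorm v * ((N * tau)^-1 * `|ps| + Num.sqrt (N * tau)^-1 * enorm v).
    have r0 : 0 <= (N * tau)^-1 * `|ps| + Num.sqrt (N * tau)^-1 * enorm v.
      by rewrite addr_ge0// mulr_ge0 ?sqrtr_ge0 ?enorm_ge0// ltW.
    apply: ler_enorm; first by rewrite mulr_ge0// enorm_ge0.
    have e1 : sq w <= (N * tau)^-1 * (sq v * (ps ^+ 2 * (N * tau)^-1 + sq v)).
      by rewrite ler_pdivlMl//; apply: le_trans hd _; rewrite le_eqVlt; apply/orP; left; apply/eqP; ring.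
    apply: le_trans e1 _.
    have s1 : Num.sqrt (N * tau)^-1 ^+ 2 = (N * tau)^-1 by rewrite sqr_sqrtr// ltW.
    rewrite exprMn enorm_sq -[in leLHS]s1.
    have -> : Num.sqrt (N * tau)^-1 ^+ 2 * (sq v * (ps ^+ 2 * Num.sqrt (N * tau)^-1 ^+ 2 + sq v)) =
      sq v * ((N * tau)^-1 ^+ 2 * `|ps| ^+ 2 + (N * tau)^-1 * enorm v ^+ 2).
      by rewrite s1 real_normK ?num_real// enorm_sq; ring.
    apply: ler_wpM2l; first exact: ltW.
    have p1 : 0 <= (N * tau)^-1 * `|ps| * (Num.sqrt (N * tau)^-1 * enorm v).
      by rewrite !mulr_ge0 ?sqrtr_ge0 ?enorm_ge0// ltW.
    have -> : ((N * tau)^-1 * `|ps| + Num.sqrt (N * tau)^-1 * enorm v) ^+ 2 =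
      (N * tau)^-1 ^+ 2 * `|ps| ^+ 2 + Num.sqrt (N * tau)^-1 ^+ 2 * enorm v ^+ 2 +
      2 * ((N * tau)^-1 * `|ps| * (Num.sqrt (N * tau)^-1 * enorm v)) by ring.
    by rewrite s1; lra.
  have h1 : `|ps * dotv v (At *m v)| <= `|ps| * ((N * tau)^-1 * sq v).
    by rewrite normrM ler_wpM2l// -enorm_sq expr2 form_bound.
  have h2' : `|dotv v w| <= sq v * ((N * tau)^-1 * `|ps| + Num.sqrt (N * tau)^-1 * enorm v).
    apply: le_trans (dotv_CS _ _) _; rewrite -enorm_sq expr2 -mulrA.
    by apply: ler_wpM2l => //; exact: enorm_ge0.
  rewrite -(ler_pM2l s0) -[X in X * `|_|](gtr0_norm s0) -normrM vcE.
  apply: le_trans (ler_normB _ _) _; apply: le_trans (lerD h1 h2') _.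
  by rewrite le_eqVlt; apply/orP; left; apply/eqP; ring.
have h00 : `|ps * At 0 0| <= (N * tau)^-1 * `|ps|.
  rewrite normrM mulrC; apply: ler_wpM2r => //.
  have := form_bound (delta_mx 0 0) (delta_mx 0 0).
  by rewrite !enorm_delta !mulr1 dotv_delta -colE mxE.
rewrite sumE trace_At.
have -> : ps * (\tr At - At 0 0) - dotv v c - \tr At * ps = - (ps * At 0 0 + dotv v c) by ring.
rewrite sqrrN -real_normK ?num_real//.
have tot : `|ps * At 0 0 + dotv v c| <= 3 * ((N * tau)^-1 * `|ps|) + Num.sqrt (N * tau)^-1 * enorm v.
  by apply: le_trans (ler_normD _ _) _; lra.
have tv := tailv_le B; rewrite -/v in tv.
have s1 : Num.sqrt (N * tau)^-1 ^+ 2 = (N * tau)^-1 by rewrite sqr_sqrtr// ltW.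
apply: (@le_trans _ _ ((3 * ((N * tau)^-1 * `|ps|) + Num.sqrt (N * tau)^-1 * enorm v) ^+ 2)).
  by rewrite lerXn2r ?nnegrE// (le_trans _ tot).
set al := (N * tau)^-1 * `|ps|; set be := Num.sqrt _ * _.
apply: (@le_trans _ _ (18 * al ^+ 2 + 2 * be ^+ 2)).
  by have := sqr_ge0 (3 * al - be); nra.
rewrite /al /be [(_ * `|ps|) ^+ 2]exprMn [(Num.sqrt _ * _) ^+ 2]exprMn s1 enorm_sq real_normK ?num_real//.
have -> : 18 * ps ^+ 2 / (N * tau) ^+ 2 = 18 * ((N * tau)^-1 ^+ 2 * ps ^+ 2) by rewrite -exprVn; ring.
have := ler_wpM2l (ltW a0) tv; lra.
Qed.

Lemma shiftG_derive i j : (Bw y (shiftG i j (- h2 m) G) - Bw y G) (lift ord0 j) 0 / h2 m @[m --> \oo]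
  --> - dirB (delta_mx i (lift ord0 j)) (lift ord0 j) 0.
Proof.
have h0 m : - h2 m != 0 by rewrite oppr_eq0 gt_eqF.
have ch : (fun m => - h2 m) @ \oo --> (0 : R).
  by rewrite -[X in _ --> X]oppr0; apply: cvgN; exact: cvg_inv_shift2.
rewrite (_ : (fun m => _) = fun m =>
  - ((Bw y (G + - h2 m *: delta_mx i (lift ord0 j)) - Bw y G) (lift ord0 j) 0 / - h2 m)).
  by apply: cvgN; exact: Bw_derive.
by apply/funext => m; rewrite invrN mulrN opprK.
Qed.

End Derivative.

(** * The proximal operator and the error of one row *)

Section Prox.
Context {R : realType}.

(** The proximal point [p] solves [p + f' p = u], which the intermediate value theorem provides, and
    the map [v + f' v] does not contract distances. *)
Lemma prox_residual (f : R -> R) (x u : R) : convexf (V := R^o) f ->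
  (forall v, derivable f v 1) -> continuous (derive1 f) ->
  (x - prox f u) ^+ 2 <= (x + derive1 f x - u) ^+ 2.
Proof.
move=> cf df ccf; pose h v := v + derive1 f v.
have [p hp] : exists p, h p = u.
  pose b := `|u - h 0|.
  have b0 : 0 <= b by exact: normr_ge0.
  have chh : {within `[- b, b], continuous h}.
    apply: continuous_subspaceT => v; apply: (@continuousD _ _ _ (fun v : R => v)); [exact: cvg_id|exact: ccf].
  have m1 := derive1_convex_mono cf df b 0; have m2 := derive1_convex_mono cf df (- b) 0.
  have hb : u <= h b.
    have := ler_norm (u - h 0); rewrite -/b /h; move: m1; rewrite subr0.
    have [->|bn] := eqVneq b 0; first by rewrite !add0r; lra.
    have bp : 0 < b by rewrite lt_def bn.
    by rewrite pmulr_rge0//; lra.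
  have hmb : h (- b) <= u.
    have := ler_norm (- (u - h 0)); rewrite normrN -/b /h; move: m2; rewrite subr0.
    have [->|bn] := eqVneq b 0; first by rewrite oppr0 !add0r; lra.
    have bp : 0 < b by rewrite lt_def bn.
    by rewrite mulNr oppr_ge0 pmulr_rle0//; lra.
  have bb : - b <= b by lra.
  have [|c _ hc] := IVT bb chh (v := u); last by exists c.
  by rewrite ge_min le_max hmb hb orbT.
have growth v : (u - p) ^+ 2 / 2 + f p + (v - p) ^+ 2 / 2 <= (u - v) ^+ 2 / 2 + f v.
  have := convexf_tangent cf df p v; rewrite -hp /h; nra.
have pE : prox f u = p.
  rewrite /prox asboolT//.
  have h2 := growth (argmin (fun v : R => (u - v) ^+ 2 / 2 + f v)).
  have h3 : (u - argmin (fun v : R => (u - v) ^+ 2 / 2 + f v)) ^+ 2 / 2 +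
    f (argmin (fun v : R => (u - v) ^+ 2 / 2 + f v)) <= (u - p) ^+ 2 / 2 + f p.
    have ex : exists b : R, forall b' : R, (u - b) ^+ 2 / 2 + f b <= (u - b') ^+ 2 / 2 + f b'.
      by exists p => v; have := growth v; have := sqr_ge0 (v - p); lra.
    by have := argminP ex p.
  move: h2 h3; set a := argmin _ => h2 h3.
  have : (a - p) ^+ 2 <= 0 by lra.
  by rewrite -[_ <= 0]orbF le_eqVlt ltNge sqr_ge0 orbF orbF sqrf_eq0 subr_eq0 => /eqP.
rewrite pE -hp /h; have := derive1_convex_mono cf df x p.
have := sqr_ge0 (derive1 f x - derive1 f p); nra.
Qed.

(** [ga] may be slightly negative. When [ga l] fails to be convex, [prox] takes its conventional
    value [u], and dropping the term [ga l' x] costs at most [c |l' x|]. *)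
Lemma prox_scaled_residual (l : R -> R) (ga c u x : R) : good_loss l -> 0 <= c -> - c <= ga ->
  (x - prox (fun v => ga * l v) u) ^+ 2 <=
  2 * (x - ga * - derive1 l x - u) ^+ 2 + 2 * (c ^+ 2 * derive1 l x ^+ 2).
Proof.
move=> [cl dl ll] c0 cga.
have d1 v : derive1 (fun v => ga * l v) v = ga * derive1 l v by rewrite derive1Ml.
case: (pselect (convexf (V := R^o) (fun v : R => ga * l v))) => cf.
  have df v : derivable (fun v : R => ga * l v) v 1 by exact: derivableM.
  have ccl : continuous (derive1 l).
    move=> v; apply/cvgrPdist_le => e e0; near=> w.
    apply: le_trans (ll v w) _; near: w.
    by apply/nbhs_ballP; exists e => //= w; rewrite /ball/=; exact: ltW.
  have cdf : continuous (derive1 (fun v : R => ga * l v)).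
    rewrite (_ : derive1 _ = fun v => ga * derive1 l v); last by apply/funext.
    by move=> v; apply: cvgM; [exact: cvg_cst|exact: ccl].
  have := prox_residual x u cf df cdf; rewrite d1.
  have -> : x + ga * derive1 l x - u = x - ga * - derive1 l x - u by ring.
  have := sqr_ge0 (x - ga * - derive1 l x - u); have := mulr_ge0 (sqr_ge0 c) (sqr_ge0 (derive1 l x)); lra.
have ga0 : ga < 0.
  rewrite ltNge; apply/negP => ga0; apply: cf; apply/convexfP => t a b t01.
  have /convexfP/(_ t a b t01) h := cl.
  have := ler_wpM2l ga0 h; lra.
rewrite /prox asboolF//.
have e : (ga * derive1 l x) ^+ 2 <= c ^+ 2 * derive1 l x ^+ 2.
  rewrite exprMn; apply: ler_wpM2r; first exact: sqr_ge0.
  by rewrite -sqrrN ler_sqr ?nnegrE//; lra.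
have := sqr_ge0 (x - u + 2 * (ga * derive1 l x)).
move: e; set d := ga * derive1 l x; have -> : x - ga * - derive1 l x - u = x - u + d by rewrite /d; ring.
by nra.
Unshelve. all: by end_near. Qed.

End Prox.

(** * Integrals of functions not known to be measurable *)

Section Upper.
Context dT (T : measurableType dT) (R : realType) (P : probability T R).

Import HBNNSimple.

(** [f] need not be measurable. *)
Lemma ae_le_integral_nonmeasurable (f : T -> R) (h : T -> R) : (forall t, 0 <= f t) ->
  (forall t, 0 <= h t) -> measurable_fun setT h ->
  {ae P, forall t, f t <= h t} ->
  (\int[P]_t (f t)%:E <= \int[P]_t (h t)%:E)%E.
Proof.
move=> f0 h0 mh fh.
rewrite ge0_integralTE//; apply: ge_ereal_sup => _ [s sf <-].
rewrite -[sintegral _ _](_ : (\int[P]_t (s t)%:E)%E = _).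
  apply: ae_ge0_le_integral => //.
  - by move=> t _; rewrite lee_fin.
  - by apply/measurable_EFinP.
  - by move=> t _; rewrite lee_fin.
  - by apply/measurable_EFinP.
  - apply: filterS fh => t ht _; rewrite lee_fin; apply: le_trans ht.
    by have := sf t; rewrite lee_fin.
by rewrite integral_nnsfun// patch_setT.
Qed.

(** The upper limit is measurable, and it agrees with the limit wherever the latter exists. *)
Lemma measurable_sequence_limit (u : nat -> T -> R) : (forall m, measurable_fun setT (u m)) ->
  exists2 v : T -> R, measurable_fun setT v & forall t l, u m t @[m --> \oo] --> l -> v t = l.
Proof.
move=> mu; exists (fun t => fine (limn_esup (fun m => (u m t)%:E))).
  apply: (measurableT_comp (fine_measurable measurableT)).
  by apply: measurable_fun_limn_esup => m; exact/measurable_EFinP.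
by move=> t l ul; have [_ ->] := cvg_limn_einf_sup (cvg_EFinT ul).
Qed.

End Upper.

(** * The expected error of one row *)

Section RowBound.
Context {R : realType}.
Variables (n q : nat) (delta tau : R) (Sigma S : 'M[R]_q.+1).
Variables (loss : R -> R -> R) (g : 'cV[R]_q.+1 -> R) (F : R * R -> R).
Hypotheses (tau0 : 0 < tau) (delta0 : 0 < delta) (n0 : (0 < n)%N).
Hypothesis pn : q.+1%:R <= n%:R / delta.
Hypotheses (uH : sqrtmx Sigma \in unitmx).
Hypothesis Snorm : forall b, enorm (S^T *m b) = enorm (sqrtmx Sigma *m b).
Hypothesis SS : S *m S^T = Sigma.
Hypothesis Sop : forall (A : 'M[R]_q.+1) u, enorm (S^T *m A *m S *m u) <=
  opnorm (sqrtmx Sigma *m A *m sqrtmx Sigma) * enorm u.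
Hypothesis cg : convexf g.
Hypothesis g0 : forall b, g 0 <= g b.
Hypothesis mg : strongly_monotone_subdifferential Sigma tau g.
Hypothesis gl : forall s, good_loss (loss (F s)).
Hypothesis l0 : forall s, derive1 (loss (F s)) 0 <> 0.
Hypothesis ml : forall u, measurable_fun setT (fun s => loss (F s) u).
Notation N := (n%:R : R).
Notation sq u := (dotv u u).
Notation J := ('I_n * option 'I_q.+1)%type.
Notation Bw := (Bw S loss g F).
Notation psiw := (psiw S loss g F).
Notation Wd := (Wd tau S loss g F).
Notation rhod := (rhod tau S loss g F).

Context dT (T : measurableType dT) (P : probability T R).
Variable D : T -> data R J.
Hypothesis mD : measurable_fun setT D.
Hypothesis iD : forall A : J -> set R, (forall j, measurable (A j)) ->
  P (D @^-1` box A) = (\prod_j P ((fun t => crd j (D t)) @^-1` A j))%E.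
Hypothesis lD : forall k l A, measurable A ->
  P ((fun t => crd (k, Some l) (D t)) @^-1` A) = normal_prob 0 1 A.
Hypothesis sD : forall k k' o A, measurable A ->
  P ((fun t => crd (k, o) (D t)) @^-1` A) = P ((fun t => crd (k', o) (D t)) @^-1` A).
Variables Cop C16 C4 : R.
Hypothesis Cop0 : 0 <= Cop.
Hypothesis hop : forall G : 'M[R]_(n, q.+1),
  (1 + opnorm G / Num.sqrt N) ^+ 8 <= Cop * (1 + lam G).
Hypotheses (C161 : 1 <= C16) (C41 : 1 <= C4).
Hypothesis h16 : (\int[normal_prob (0 : R) 1]_x ((1 + delta^-1 * x ^+ 2) ^+ 16)%:E <= C16%:E)%E.
Hypothesis h4 : (\int[normal_prob (0 : R) 1]_x ((1 + 1 * x ^+ 2) ^+ 4)%:E <= C4%:E)%E.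
Variable i : 'I_n.

Let N0 : 0 < N. Proof. by rewrite ltr0n. Qed.

Variables (Z : T -> R) (A : T -> 'M[R]_q.+1).
Hypothesis mZ : measurable_fun setT Z.
Hypothesis Zlaw : forall (W : data R J -> \bar R) (phi : R -> \bar R),
  (forall d d', W (mix (zblock i) d d') = W d) ->
  measurable_fun setT W -> measurable_fun setT phi ->
  (forall d, 0 <= W d)%E -> (forall x, 0 <= phi x)%E ->
  (\int[P]_t (W (D t) * phi (Z t)) = (\int[P]_t W (D t)) * \int[normal_prob (0 : R) 1]_x phi x)%E.
Hypothesis hZ : forall t, dotv (zrow i (Gd (D t))) (Bw (yd (D t)) (erase i (Gd (D t)))) =
  enorm (tailv (Bw (yd (D t)) (erase i (Gd (D t))))) * Z t.
Hypothesis hA : {ae P, forall t,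
  is_Ahat loss g Sigma tau (F \o yd (D t)) (Gd (D t) *m S^T) (A t)}.

Definition row_error t : R :=
  N / sq (psiw (yd (D t)) (Gd (D t))) *
  ((Gd (D t) *m Bw (yd (D t)) (Gd (D t))) i 0 -
   prox (fun v => \tr (Sigma *m A t) * loss (F (yd (D t) i)) v)
     (Bw (yd (D t)) (Gd (D t)) 0 0 * Gd (D t) i 0 +
      enorm (tailv (Bw (yd (D t)) (Gd (D t)))) * Z t)) ^+ 2.

Definition cR : R := 24 * ((1 + 1 / tau) / tau) + 3 * (18 / tau ^+ 2 + 2 / tau) * c3 tau
  + 3 * ((1 + 1 / tau) / tau).

(** Twice the constants of [residual_bound], with the bounds on the means of [Yd ^ 2] and [Xd]
    inserted; the last summand pays for a negative [gamma]. *)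
Definition rate_const : R :=
  12 * (5 * (c4 tau delta * CX tau Cop C16 C4) + 4 * ((1 + 1 / tau) / tau * CX tau Cop C16 C4))
  + 2 * cR * CX tau Cop C16 C4 + 2 / tau ^+ 2.

Let score_row y G : psiw y G i 0 = - derive1 (loss (F (y i))) ((G *m Bw y G) i 0).
Proof. by rewrite psiwE /psihat mxE BwE mulmxA. Qed.

Let linear_row (G : 'M[R]_(n, q.+1)) b :
  (G *m b) i 0 = b 0 0 * G i 0 + dotv (zrow i G) b.
Proof.
rewrite mxE dotvE !big_ord_recl mulrC; congr (_ + _).
rewrite [zrow i G ord0 0]mxE eqxx mul0r add0r.
by apply: eq_bigr => j _; rewrite zrow_lift.
Qed.

Let prox_arith (L e ps p : R) : 0 < p -> ps ^+ 2 <= p ->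
  L <= 2 * e ^+ 2 + 2 * ((N * tau)^-1 ^+ 2 * ps ^+ 2) ->
  N / p * L <= 2 * (N / p * e ^+ 2) + 2 / tau ^+ 2 / N.
Proof.
move=> p0 pi2 h; have m0 : 0 <= N / p by rewrite divr_ge0// ltW.
apply: le_trans (ler_wpM2l m0 h) _.
rewrite mulrDr mulrCA lerD2l mulrCA -!mulrA ler_pM2l//.
have -> : N * (p^-1 * ((N * tau)^-1 * ((N * tau)^-1 * ps ^+ 2))) = (tau ^- 2 / N) * (ps ^+ 2 / p).
  by field; rewrite ?gt_eqF.
rewrite -[leRHS]mulr1; apply: ler_wpM2l; last by rewrite ler_pdivrMr ?mul1r.
by rewrite divr_ge0 ?invr_ge0 ?sqr_ge0// ltW.
Qed.

Lemma row_error_bound t : is_Ahat loss g Sigma tau (F \o yd (D t)) (Gd (D t) *m S^T) (A t) ->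
  row_error t <= 2 * (N / sq (psiw (yd (D t)) (Gd (D t))) *
    (dotv (zrow i (Gd (D t))) (Bw (yd (D t)) (Gd (D t))) - enorm (tailv (Bw (yd (D t)) (Gd (D t)))) * Z t -
     \tr (Sigma *m A t) * psiw (yd (D t)) (Gd (D t)) i 0) ^+ 2) + 2 / tau ^+ 2 / N.
Proof.
move=> At; rewrite /row_error.
have gam := gamma_lower tau0 n0 uH SS Snorm Sop cg g0 mg gl l0 At.
have c0 : 0 <= (N * tau)^-1 by rewrite invr_ge0 mulr_ge0// ltW.
have p0 := psiw_gt0 S tau0 n0 uH cg g0 mg gl l0 (yd (D t)) (Gd (D t)).
have pi2 := coord_le_sq (psiw (yd (D t)) (Gd (D t))) i.
set x := (_ *m _) i 0; set u := _ * Gd (D t) i 0 + _.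
have := prox_scaled_residual (l := loss (F (yd (D t) i))) u x (gl _) c0 gam.
have e1 : derive1 (loss (F (yd (D t) i))) x = - psiw (yd (D t)) (Gd (D t)) i 0.
  by rewrite score_row opprK.
rewrite e1 opprK sqrrN.
have -> : x - \tr (Sigma *m A t) * psiw (yd (D t)) (Gd (D t)) i 0 - u =
  dotv (zrow i (Gd (D t))) (Bw (yd (D t)) (Gd (D t))) - enorm (tailv (Bw (yd (D t)) (Gd (D t)))) * Z t -
     \tr (Sigma *m A t) * psiw (yd (D t)) (Gd (D t)) i 0.
  by rewrite /x linear_row /u; ring.
exact: prox_arith.
Qed.

Lemma row_expectation (L : T -> R) : (forall t, 0 <= L t) -> {ae P, forall t, L t <= row_error t} ->
  (\int[P]_t (L t)%:E <= (rate_const / N)%:E)%E.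
Proof.
move=> L0 hL.
have mGD k j : measurable_fun setT (fun t => Gd (D t) k j : R).
  exact: (measurableT_comp (measurable_Gd k j) mD).
pose quot (j : 'I_q) m t := (Bw (yd (D t)) (shiftG i j (- m.+2%:R^-1) (Gd (D t))) -
  Bw (yd (D t)) (Gd (D t))) (lift ord0 j) 0 / m.+2%:R^-1.
have mquot j m : measurable_fun setT (quot j m).
  apply: measurable_funM => //.
  apply: (measurableT_comp (f := fun d : data R J => (Bw (yd d) (shiftG i j (- m.+2%:R^-1) (Gd d)) -
    Bw (yd d) (Gd d)) (lift ord0 j) 0) _ mD).
  under eq_fun do rewrite mxE [X in _ + X]mxE.
  apply: measurable_funB; apply: (measurable_Bw S tau0 uH cg g0 mg gl ml) => k l; last exact: measurable_Gd.
  under eq_fun do rewrite mxE; apply: measurable_funD; first exact: measurable_Gd.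
  exact: measurable_cst.
have lims j := measurable_sequence_limit (mquot j).
have {}lims j := cid2 (lims j).
(* The partial derivatives exist only almost everywhere, so a measurable version is taken. The sign
   undoes the shift by a negative step. *)
pose b j t := - s2val (lims j) t.
have mb : measurable_fun setT (fun t => \sum_j b j t).
  by apply: measurable_sum => j; apply: measurable_funN; exact: (s2valP (lims j)).
have bE t : is_Ahat loss g Sigma tau (F \o yd (D t)) (Gd (D t) *m S^T) (A t) ->
    forall j, b j t = dirB S loss g F (yd (D t)) (Gd (D t)) (A t)
      (delta_mx i (lift ord0 j)) (lift ord0 j) 0.
  move=> At j; rewrite /b (s2valP' (lims j) _ _ (shiftG_derive At (i := i) (j := j))).
  by rewrite opprK.
have hb : {ae P, forall t, forall j, quot j m t @[m --> \oo] --> - b j t}.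
  by apply: filterS hA => t At j; rewrite (bE t At); exact: (shiftG_derive At).
have IY := Yd_expectation tau0 delta0 n0 pn uH Snorm cg g0 mg gl l0 ml mD iD lD sD Cop0 hop C161 h16 h4 mZ Zlaw hZ mb hb.
have IX := Xd_expectation tau0 delta0 n0 pn uH Snorm cg g0 mg gl l0 ml mD iD lD sD Cop0 hop C161 h16 h4 mZ Zlaw.
pose X t := Xd tau S loss g F D i Z t.
pose Y t := Yd tau S loss g F D i b t.
have X0 t : 0 <= X t by exact: Xd_ge0.
have mX : measurable_fun setT X.
  apply: measurable_funM; first exact: (measurableT_comp (measurable_Wd S tau0 uH cg g0 mg gl ml i) mD).
  apply: measurable_funM; apply: measurable_funX; first exact: (measurableT_comp (measurable_kapd i) mD).
  by apply: measurable_funD => //; exact: measurable_funX.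
have mY : measurable_fun setT Y by exact: (measurable_Yd S tau0 uH cg g0 mg gl ml mD i mb).
have bt0 : 0 <= (1 + 1 / tau) / tau by rewrite divr_ge0 ?(ltW tau0)// addr_ge0// divr_ge0// ltW.
have cR0 : 0 <= cR.
  have c30 : 0 <= c3 tau by rewrite /c3 mulr_ge0// sqr_ge0.
  have t2 : 0 <= 18 / tau ^+ 2 + 2 / tau by rewrite addr_ge0// divr_ge0 ?sqr_ge0// ltW.
  have m1 := mulr_ge0 (ler0n R 24) bt0; have m2 := mulr_ge0 (mulr_ge0 (ler0n R 3) t2) c30.
  exact: addr_ge0 (addr_ge0 m1 m2) (mulr_ge0 (ler0n R 3) bt0).
pose H t := 12 * Y t ^+ 2 + 2 * cR / N * X t + 2 / tau ^+ 2 / N.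
have h2 : 0 <= 2 / tau ^+ 2 / N by rewrite !divr_ge0 ?sqr_ge0// ltW.
have h1 : 0 <= 2 * cR / N by rewrite divr_ge0 ?mulr_ge0// ltW.
apply: (@le_trans _ _ (\int[P]_t (H t)%:E)%E).
  apply: ae_le_integral_nonmeasurable; first exact: L0.
  - by move=> t; rewrite !addr_ge0// mulr_ge0 ?sqr_ge0.
  - apply: measurable_funD => //; apply: measurable_funD; apply: measurable_funM => //.
    exact: measurable_funX.
  - apply: filterS2 hA hL => t At Lt; apply: le_trans Lt _.
    apply: le_trans (row_error_bound At) _; rewrite lerD2r.
    have key : N / sq (psiw (yd (D t)) (Gd (D t))) *
        (dotv (zrow i (Gd (D t))) (Bw (yd (D t)) (Gd (D t))) - enorm (tailv (Bw (yd (D t)) (Gd (D t)))) * Z t -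
        \tr (Sigma *m A t) * psiw (yd (D t)) (Gd (D t)) i 0) ^+ 2 <= 6 * Y t ^+ 2 + cR * X t / N.
      have hr := rhod_lower tau0 n0 uH Snorm cg g0 mg gl l0 i (D t).
      have hdv := divergence_bound tau0 n0 uH SS Snorm Sop cg g0 mg gl At i.
      have eb : \sum_(j < q) dirB S loss g F (yd (D t)) (Gd (D t)) (A t) (delta_mx i (lift ord0 j)) (lift ord0 j) 0 =
        \sum_j b j t by apply: eq_bigr => j _; rewrite (bE t At).
      rewrite eb in hdv.
      exact: (residual_bound tau0 n0 (Bw_perturb tau0 n0 uH Snorm cg g0 mg gl (yd (D t)))
        (rho := rhoy tau S loss g F i (yd (D t))) hr (score_dotv_sq (hZ t)) (hZ t) erefl hdv).
    have := ler_wpM2l (ler0n R 2) key.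
    have e2 (a a' : R) : 2 * (6 * a + cR * a' / N) = 12 * a + 2 * cR / N * a' by ring.
    by rewrite e2.
pose y2 t := (12%:E * (Y t ^+ 2)%:E)%E; pose x1 t := ((2 * cR / N)%:E * (X t)%:E)%E.
have my2 : measurable_fun setT y2.
  by apply: emeasurable_funM => //; apply/measurable_EFinP; exact: measurable_funX.
have mx1 : measurable_fun setT x1 by apply: emeasurable_funM => //; exact/measurable_EFinP.
have y20 t : (0 <= y2 t)%E by rewrite mule_ge0// lee_fin sqr_ge0.
have x10 t : (0 <= x1 t)%E by rewrite mule_ge0// lee_fin.
rewrite (_ : \int[P]_t (H t)%:E = \int[P]_t (y2 t + x1 t + (2 / tau ^+ 2 / N)%:E))%E; last first.
  by apply: eq_integral => t _; rewrite /y2 /x1 -!EFinM -!EFinD.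
rewrite ge0_integralD//; last 2 first.
- by move=> t _; rewrite adde_ge0.
- exact: emeasurable_funD.
have ec : (\int[P]__ (2 / tau ^+ 2 / N)%:E <= (2 / tau ^+ 2 / N)%:E)%E.
  rewrite (integral_cst P measurableT (2 / tau ^+ 2 / N)%:E) -[leRHS]mule1.
  by apply: lee_wpmul2l; [rewrite lee_fin|exact: probability_le1].
rewrite ge0_integralD//.
rewrite ge0_integralZl_EFin//; last 2 first.
- by move=> t _; rewrite lee_fin sqr_ge0.
- by apply/measurable_EFinP; exact: measurable_funX.
rewrite ge0_integralZl_EFin//; last 2 first.
- by move=> t _; rewrite lee_fin.
- exact/measurable_EFinP.
have a12 : (0%:E <= 12%:E :> \bar R)%E by rewrite lee_fin.
have acr : (0%:E <= (2 * cR / N)%:E :> \bar R)%E by rewrite lee_fin.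
apply: le_trans (leeD (leeD (lee_wpmul2l a12 IY) (lee_wpmul2l acr IX)) ec) _.
rewrite -!EFinM -!EFinD lee_fin /rate_const le_eqVlt; apply/orP; left; apply/eqP; ring.
Qed.

End RowBound.

(** * The auxiliary Gaussian variables *)

Section Extension.
Context {R : realType}.
Variables (n q : nat) (tau : R) (Sigma S : 'M[R]_q.+1).
Variables (loss : R -> R -> R) (g : 'cV[R]_q.+1 -> R) (F : R * R -> R).
Hypotheses (tau0 : 0 < tau).
Hypotheses (uH : sqrtmx Sigma \in unitmx).
Hypothesis cg : convexf g.
Hypothesis g0 : forall b, g 0 <= g b.
Hypothesis mg : strongly_monotone_subdifferential Sigma tau g.
Hypothesis gl : forall s, good_loss (loss (F s)).
Hypothesis ml : forall u, measurable_fun setT (fun s => loss (F s) u).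
Notation sq u := (dotv u u).
Notation J := ('I_n * option 'I_q.+1)%type.
Notation Bw := (Bw S loss g F).
Context dT (T : measurableType dT) (P : probability T R).
Variable D : T -> data R J.
Hypothesis mD : measurable_fun setT D.
Hypothesis iD : forall A : J -> set R, (forall j, measurable (A j)) ->
  P (D @^-1` box A) = (\prod_j P ((fun t => crd j (D t)) @^-1` A j))%E.
Variable i : 'I_n.
Hypothesis hform : forall a : 'cV[R]_q.+1, sq a = 1 -> forall A, measurable A ->
  P ((fun t => \sum_l a l 0 * crd (i, Some l) (D t)) @^-1` A) = normal_prob 0 1 A.

Let sum_zblock (f : J -> R) :
  \sum_(j | zblock i j) f j = \sum_(l < q.+1 | l != 0) f (i, Some l).
Proof.
rewrite (reindex_onto (fun l : 'I_q.+1 => (i, Some l) : J) (fun j => odflt ord0 j.2))/=.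
  by apply: eq_bigl => l; rewrite /zblock/= !eqxx andbT.
by move=> [k [l|]]; rewrite /zblock/= ?andbF// => /andP[/eqP ->].
Qed.

(** The direction of the tail of the erased estimator. Since the inverse of [0] is [0], it is the
    zero vector when the tail vanishes. *)
Definition zweight (d : data R J) (j : J) : R :=
  if j.2 is Some l then
    tailv (Bw (yd d) (erase i (Gd d))) l 0 / enorm (tailv (Bw (yd d) (erase i (Gd d))))
  else 0.

(** The second coordinate of [z] is only used when the direction vanishes. *)
Definition zscore (z : T * R) : R :=
  if \sum_(j | zblock i j) zweight (D z.1) j ^+ 2 == 0 then z.2
  else \sum_(j | zblock i j) zweight (D z.1) j * crd j (D z.1).

Let tail_lift (u : 'cV[R]_q.+1) l : tailv u l 0 = if l == 0 then 0 else u l 0.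
Proof. by rewrite mxE. Qed.

Let zweight_sq d : let v := tailv (Bw (yd d) (erase i (Gd d))) in
  \sum_(j | zblock i j) zweight d j ^+ 2 = sq v / enorm v ^+ 2.
Proof.
move=> v; rewrite sum_zblock dotv_sq [in RHS](bigD1 ord0)//= {1}/v tail_lift eqxx expr0n add0r.
by rewrite mulr_suml; apply: eq_bigr => l _; rewrite exprMn exprVn.
Qed.

Let zweight_unit d : \sum_(j | zblock i j) zweight d j ^+ 2 = 0 \/ \sum_(j | zblock i j) zweight d j ^+ 2 = 1.
Proof.
rewrite zweight_sq enorm_sq; have [->|h] := eqVneq (sq (tailv (Bw (yd d) (erase i (Gd d))))) 0.
  by left; rewrite mul0r.
by right; rewrite mulfV.
Qed.

Let mzweight j : measurable_fun setT (fun d => zweight d j).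
Proof.
case: j => k [l|]; last exact: measurable_cst.
have mB m : measurable_fun setT (fun d : data R J => tailv (Bw (yd d) (erase i (Gd d))) m 0).
  under eq_fun do rewrite mxE; case: (m == 0); first exact: measurable_cst.
  apply: (measurable_Bw S tau0 uH cg g0 mg gl ml) => a b.
  under eq_fun do rewrite mxE; case: (_ && _); first exact: measurable_cst.
  exact: measurable_Gd.
apply: measurable_funM; first exact: mB.
apply: measurable_inv_ge0 => [|d]; last exact: enorm_ge0.
apply: (measurableT_comp (continuous_measurable_fun (@sqrt_continuous R))).
exact: measurable_dotv.
Qed.

Let mcrdD j : measurable_fun setT (fun z : T * R => crd j (D z.1)).
Proof. exact: (measurableT_comp (measurableT_comp (measurable_crd j) mD) measurable_fst). Qed.

Let mzwD j : measurable_fun setT (fun z : T * R => zweight (D z.1) j).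
Proof. exact: (measurableT_comp (measurableT_comp (mzweight j) mD) measurable_fst). Qed.

Lemma measurable_zscore : measurable_fun setT zscore.
Proof.
apply: measurable_fun_ifT; last 2 first.
- exact: measurable_snd.
- by apply: measurable_sum_cond => j; exact: measurable_funM.
apply: measurable_fun_eqr; last exact: measurable_cst.
by apply: measurable_sum_cond => j; exact: measurable_funX.
Qed.

Lemma zscoreE z : dotv (zrow i (Gd (D z.1))) (Bw (yd (D z.1)) (erase i (Gd (D z.1)))) =
  enorm (tailv (Bw (yd (D z.1)) (erase i (Gd (D z.1))))) * zscore z.
Proof.
set v := tailv _; rewrite -dotv_zrow_tail -/v /zscore.
have [v0|v0] := eqVneq v 0; first by rewrite v0 dotv0r enorm0 mul0r.
have s0 : enorm v != 0 by rewrite enorm_eq0.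
have -> : \sum_(j | zblock i j) zweight (D z.1) j ^+ 2 = 1.
  by rewrite zweight_sq -/v -enorm_sq mulfV// sqrf_eq0.
rewrite oner_eq0 sum_zblock mulr_sumr dotvE [in LHS](bigD1 ord0)//= [zrow _ _ ord0 0]mxE eqxx mul0r add0r.
apply: eq_bigr => l l0; rewrite [zrow _ _ l 0]mxE (negbTE l0) [Gd _ _ _]mxE /zweight/= -/v.
by rewrite mulrC mulrA mulrCA mulfV// mulr1.
Qed.

Lemma product_fst A : measurable A -> (P \x normal_prob (0 : R) 1)%E (fst @^-1` A) = P A.
Proof.
move=> mA; have -> : fst @^-1` A = A `*` (setT : set R) by apply/seteqP; split => -[a b]//= [].
rewrite product_measure1E// [X in (_ * X)%E](_ : _ = 1%E) ?mule1//; exact: probability_setT.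
Qed.

(** Fubini integrates out the extra Gaussian variable, which leaves exactly [block_gaussian]. *)
Lemma zscore_law (W : data R J -> \bar R) (phi : R -> \bar R) :
  (forall d d', W (mix (zblock i) d d') = W d) ->
  measurable_fun setT W -> measurable_fun setT phi ->
  (forall d, 0 <= W d)%E -> (forall x, 0 <= phi x)%E ->
  (\int[P \x normal_prob (0 : R) 1]_z (W (D z.1) * phi (zscore z)) =
   (\int[P \x normal_prob (0 : R) 1]_z W (D z.1)) * \int[normal_prob (0 : R) 1]_x phi x)%E.
Proof.
move=> hW mW mphi W0 phi0.
have mWD : measurable_fun setT (fun z : T * R => W (D z.1)).
  exact: (measurableT_comp (measurableT_comp mW mD) measurable_fst).
have mWT : measurable_fun setT (fun t => W (D t)) by exact: (measurableT_comp mW mD).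
rewrite fubini_tonelli1//; last 2 first.
- by apply: emeasurable_funM => //; exact: (measurableT_comp mphi measurable_zscore).
- by move=> z; rewrite mule_ge0.
rewrite [X in _ = (X * _)%E]fubini_tonelli1//.
set c := (\int[normal_prob (0 : R) 1]_x phi x)%E.
have c0 : (0 <= c)%E by exact: integral_ge0.
have hQ (a : J -> R) : \sum_(j | zblock i j) a j ^+ 2 = 1 -> forall A, measurable A ->
    P ((fun t => \sum_(j | zblock i j) a j * crd j (D t)) @^-1` A) = normal_prob 0 1 A.
  move=> a1 A mA; rewrite -(hform (a := \col_l (if l == 0 then 0 else a (i, Some l))))//.
    suff -> : (fun t => \sum_(j | zblock i j) a j * crd j (D t)) = fun t =>
      \sum_l (\col_l (if l == 0 then 0 else a (i, Some l)) : 'cV[R]_q.+1) l 0 * crd (i, Some l) (D t) by [].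
    apply/funext => t; rewrite sum_zblock [in RHS](bigD1 ord0)//= mxE eqxx mul0r add0r.
    by apply: eq_bigr => l l0; rewrite mxE (negbTE l0).
  rewrite dotv_sq (bigD1 ord0)//= mxE eqxx expr0n add0r -[RHS]a1 sum_zblock.
  by apply: eq_bigr => l l0; rewrite mxE (negbTE l0).
have key := block_gaussian mD iD (Q := zblock i) (m := zweight) (W := W) (phi := phi) hQ _ hW mzweight mW mphi W0 phi0 zweight_unit.
have hm d d' : zweight (mix (zblock i) d d') = zweight d.
  by apply/funext => j; rewrite /zweight yd_mix erase_mix.
have {}key := key hm.
rewrite /= -/c in key.
have eW t : (\int[normal_prob (0 : R) 1]__ W (D t) = W (D t))%E.
  rewrite (integral_cst (normal_prob (0 : R) 1) measurableT (W (D t))).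
  by rewrite [X in (_ * X)%E](_ : _ = 1%E) ?mule1//; exact: probability_setT.
rewrite /fubini_F /=; under [X in _ = (X * _)%E]eq_integral do rewrite eW.
rewrite -key; apply: eq_integral => t _.
rewrite ge0_integralZl//; last first.
  exact: (measurableT_comp mphi (measurableT_comp measurable_zscore (measurable_fun_pair (measurable_cst t) (@measurable_id _ _ setT)))).
congr (_ * _)%E; rewrite /zscore/=; case: ifP => _ //.
rewrite (integral_cst (normal_prob (0 : R) 1) measurableT (phi _)).
by rewrite [X in (_ * X)%E](_ : _ = 1%E) ?mule1//; exact: probability_setT.
Qed.

End Extension.

(** * From the single index model to independent whitened data *)

Section ModelData.
Context {R : realType} {dT : measure_display} {T : measurableType dT}.
Variables (P : probability T R) (n q : nat).
Variables (Sigma S : 'M[R]_q.+1) (w : 'cV[R]_q.+1) (F : R * R -> R).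
Variables (x : 'I_n -> {RV P >-> q.+1.-tuple R}) (xi : 'I_n -> {RV P >-> R}) (y : 'I_n -> T -> R).
Hypothesis model : single_index_model Sigma w F x xi y.
Hypothesis uS : S \in unitmx.
Hypothesis SS : S *m S^T = Sigma.
Hypothesis Sw : S^T *m w = delta_mx 0 0.
Notation J := ('I_n * option 'I_q.+1)%type.

Definition white (v : q.+1.-tuple R) : 'cV[R]_q.+1 := invmx S *m col_of_tuple v.

Definition model_data (t : T) : data R J :=
  mkd (fun j : J => if j.2 is Some l then white (x j.1 t) l 0 else xi j.1 t).

Let measurable_white l : measurable_fun setT (fun v => white v l 0).
Proof.
under eq_fun do rewrite mxE; apply: measurable_sum => j.
under eq_fun do rewrite mxE; apply: measurable_funM; first exact: measurable_cst.
exact: measurable_tnth.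
Qed.

Lemma measurable_model_data : measurable_fun setT model_data.
Proof.
apply: measurable_mkd => -[k [l|]] /=; last exact: measurable_funPT.
exact: (measurableT_comp (measurable_white l) (measurable_funPT (x k))).
Qed.

Lemma white_row t k : col_of_tuple (x k t) = S *m white (x k t).
Proof. by rewrite /white mulKVmx. Qed.

Lemma Gd_model_data t : Gd (model_data t) *m S^T = design x t.
Proof.
apply/matrixP => k j; rewrite !mxE.
have := congr1 (fun v : 'cV_q.+1 => v j 0) (white_row t k); rewrite [LHS]mxE => ->.
rewrite [RHS]mxE; apply: eq_bigr => l _.
by rewrite mxE crd_mkd [S^T _ _]mxE mulrC.
Qed.

Lemma Gd_index t k : Gd (model_data t) k 0 = dotv (col_of_tuple (x k t)) w.
Proof. by rewrite mxE crd_mkd/= white_row dotv_mulmxl Sw dotvC dotv_delta. Qed.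

Lemma model_response t k : y k t = F (yd (model_data t) k).
Proof.
have [_ _ _ _ ->] := model; rewrite /yd -Gd_index mxE; congr F; congr pair.
by rewrite crd_mkd.
Qed.

(** A form with coefficients [a] in the whitened coordinates is a form in [x] with coefficients
    [S^-T a], of variance [|a|^2]. *)
Lemma model_form k (a : 'cV[R]_q.+1) : dotv a a = 1 -> forall A, measurable A ->
  P ((fun t => \sum_l a l 0 * crd (k, Some l) (model_data t)) @^-1` A) = normal_prob 0 1 A.
Proof.
move=> a1 A mA; have [_ gx _ _ _] := model.
have := gx k ((invmx S)^T *m a) A mA.
have -> : dotv ((invmx S)^T *m a) (Sigma *m ((invmx S)^T *m a)) = 1.
  rewrite dotv_mulmxl trmxK -SS -[S *m _ *m _]mulmxA mulKmx// mulmxA -trmx_mul.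
  by rewrite mulVmx// trmx1 mul1mx.
rewrite /centered_normal oner_eq0 sqrtr1 => <-; congr (P _); congr (_ @^-1` A).
apply/funext => t; rewrite dotv_mulmxl trmxK -/(white _) dotvE.
by apply: eq_bigr => l _; rewrite crd_mkd.
Qed.

Lemma model_marginal k l A : measurable A ->
  P ((fun t => crd (k, Some l) (model_data t)) @^-1` A) = normal_prob 0 1 A.
Proof.
move=> mA; rewrite -(model_form k (a := delta_mx l 0))//; last by rewrite dotv_delta mxE !eqxx.
congr (P _); congr (_ @^-1` A); apply/funext => t; rewrite (bigD1 l)//= mxE !eqxx mul1r big1 ?addr0// => m ml.
by rewrite mxE (negbTE ml) mul0r.
Qed.

Lemma model_exchangeable k k' o A : measurable A ->
  P ((fun t => crd (k, o) (model_data t)) @^-1` A) = P ((fun t => crd (k', o) (model_data t)) @^-1` A).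
Proof.
case: o => [l|] mA; first by rewrite !model_marginal.
have [[_ same] _ _ _ _] := model.
have mB : measurable ((fun z : q.+1.-tuple R * R * R => z.1.2) @^-1` A).
  by rewrite -[X in measurable X]setTI; apply: (measurableT_comp measurable_snd measurable_fst).
have e m : (fun t => crd (m, None) (model_data t)) @^-1` A =
    (fun t => (x m t, xi m t, y m t)) @^-1` ((fun z : q.+1.-tuple R * R * R => z.1.2) @^-1` A).
  by apply/seteqP; split => t /=; rewrite crd_mkd.
by rewrite !e; exact: same.
Qed.

(** Three sources are combined: independence of the rows, independence of [x] and [xi] within a row,
    and [gaussian_forms_independent] for the whitened coordinates of [x]. *)
Lemma model_independent (A : J -> set R) : (forall j, measurable (A j)) ->
  P (model_data @^-1` box A) = (\prod_j P ((fun t => crd j (model_data t)) @^-1` A j))%E.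
Proof.
move=> mA; have [[ind _] _ ix _ _] := model.
pose E k : set (q.+1.-tuple R) := \bigcap_l ((fun v => white v l 0) @^-1` A (k, Some l)).
have mE k : measurable (E k).
  apply: fin_bigcap_measurable => [|l _]; first exact: finite_finset.
  by rewrite -[X in measurable X]setTI; exact: measurable_white.
pose C k : set (q.+1.-tuple R * R * R) := [set z | E k z.1.1 /\ A (k, None) z.1.2].
have mC k : measurable (C k).
  apply: measurableI; rewrite -[X in measurable X]setTI.
    exact: (measurableT_comp measurable_fst measurable_fst).
  exact: (measurableT_comp measurable_snd measurable_fst).
have -> : model_data @^-1` box A = \bigcap_k ((fun t => (x k t, xi k t, y k t)) @^-1` C k).
  apply/seteqP; split => t /=.
    move=> h k _; split => /= [l _|]; first by have := h (k, Some l); rewrite crd_mkd.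
    by have := h (k, None); rewrite crd_mkd.
  by move=> h [k [l|]]; rewrite crd_mkd /=; have [h1 h2] := h k I; [exact: h1|].
rewrite ind//.
have -> : (\prod_j P ((fun t => crd j (model_data t)) @^-1` A j) =
    \prod_k \prod_o P ((fun t => crd (k, o) (model_data t)) @^-1` A (k, o)))%E.
  by rewrite pair_bigA; apply: eq_bigr => -[k o].
apply: eq_bigr => k _.
have -> : (fun t => (x k t, xi k t, y k t)) @^-1` C k = x k @^-1` E k `&` xi k @^-1` A (k, None) by [].
rewrite (ix k)//.
rewrite (bigD1 (None : option 'I_q.+1))//= muleC; congr (_ * _)%E.
  by congr (P _); apply/seteqP; split => t /=; rewrite crd_mkd.
rewrite (reindex_omap (fun l : 'I_q.+1 => Some l) id)/=; last by case.
rewrite (eq_bigl xpredT); last by move=> l; rewrite eqxx.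
have mw l : measurable_fun setT (fun t => white (x k t) l 0).
  exact: (measurableT_comp (measurable_white l) (measurable_funPT (x k))).
have lw (a : 'I_q.+1 -> R) : \sum_l a l ^+ 2 = 1 -> forall B, measurable B ->
    P ((fun t => \sum_l a l * white (x k t) l 0) @^-1` B) = normal_prob 0 1 B.
  move=> a1 B mB; rewrite -(model_form k (a := \col_l a l))//.
    congr (P _); congr (_ @^-1` B); apply/funext => t.
    by apply: eq_bigr => l _; rewrite mxE crd_mkd.
  by rewrite dotv_sq -[RHS]a1; apply: eq_bigr => l _; rewrite mxE.
have h := gaussian_forms_independent mw lw (A := fun l => A (k, Some l)) (fun l => mA _).
transitivity (P (\bigcap_l ((fun t => white (x k t) l 0) @^-1` A (k, Some l)))); first by [].
rewrite h; apply: eq_bigr => l _; congr (P _).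
by apply/seteqP; split => t /=; rewrite crd_mkd.
Qed.

End ModelData.

(** * Responses with a regular loss *)

Section Responses.
Context {R : realType}.
Variables (Y : set R) (loss : R -> R -> R).
Hypothesis mY : measurable Y.
Hypothesis rl : regular_loss Y loss.

Definition good_response : set R := [set y0 | Y y0 /\ derive1 (loss y0) 0 <> 0].

Lemma regular_good_loss y0 : Y y0 -> good_loss (loss y0).
Proof. by move=> /rl.1[h1 h2 _ h4]. Qed.

Let measurable_derive : measurable_fun Y (fun y0 => derive1 (loss y0) 0).
Proof.
pose h (m : nat) : R := m.+2%:R^-1.
have h0 m : h m != 0 by rewrite invr_neq0// pnatr_eq0.
apply: (@measurable_fun_cvg _ _ _ _ (fun m y0 => (h m)^-1 * (loss y0 (h m) - loss y0 0))) => [m|y0 Yy].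
  by apply: measurable_funM => //; apply: measurable_funB; exact: rl.2.
have [_ /(_ 0) d0 _ _] := rl.1 _ Yy.
have hd : h @ \oo --> (0 : R)^'.
  move=> P hP; have h' : \forall m \near \oo, h m != 0 -> P (h m) by exact: (cvg_inv_shift2 hP).
  by apply: filterS h' => m; exact.
rewrite derive1E; have := cvg_comp h _ hd d0; apply: cvg_trans; apply: near_eq_cvg; near=> m.
by rewrite /= -[_ *: 1]/(h m * 1) mulr1 addr0.
Unshelve. all: by end_near. Qed.

Lemma measurable_good_response : measurable good_response.
Proof.
have -> : good_response = Y `&` (fun y0 => derive1 (loss y0) 0) @^-1` (~` [set 0]).
  by apply/seteqP; split => y0 [].
by apply: measurable_derive => //; apply: measurableC.
Qed.

Variable y1 : R.
Hypothesis gy1 : good_response y1.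

(** Replaces the responses outside [good_response], which have probability
    zero but for which nothing is known about [loss]. *)
Definition repair (y0 : R) : R := if `[< good_response y0 >] then y0 else y1.

Lemma repair_good y0 : good_response (repair y0).
Proof. by rewrite /repair; case: ifP => // /asboolP. Qed.

Lemma repairE y0 : good_response y0 -> repair y0 = y0.
Proof. by move=> h; rewrite /repair asboolT. Qed.

Lemma measurable_repair_loss u : measurable_fun setT (fun y0 => loss (repair y0) u).
Proof.
rewrite (_ : (fun _ => _) = fun y0 => if `[< good_response y0 >] then loss y0 u else loss y1 u); last first.
  by apply/funext => y0; rewrite /repair; case: ifP.
have mb : measurable_fun setT (fun y0 => `[< good_response y0 >]).
  apply: (measurable_fun_bool true); rewrite setTI.
  rewrite (_ : _ @^-1` _ = good_response); first exact: measurable_good_response.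
  by apply/seteqP; split => y0 /=; [move/asboolP|move=> h; exact/asboolP].
apply: measurable_fun_if => //.
apply: measurable_funS (rl.2 u) => //.
by move=> y0 [_ /= /asboolP[]].
Qed.

End Responses.

Lemma measure_indic d (T : measurableType d) (R : realType) (mu : {measure set T -> \bar R}) (A : set T) :
  measurable A -> mu A = (\int[mu]_t (\1_A t)%:E)%E.
Proof. by move=> mA; rewrite integral_indic// setIT. Qed.

Lemma rms_inv_sq (R : realType) n (u : 'cV[R]_n) :
  (Num.sqrt (n%:R^-1 * enorm u ^+ 2) ^+ 2)^-1 = n%:R / dotv u u.
Proof.
rewrite sqr_sqrtr; first by rewrite enorm_sq invfM invrK.
by rewrite mulr_ge0 ?invr_ge0 ?sqr_ge0.
Qed.

Lemma enorm_tail_sqrt (R : realType) q (u : 'cV[R]_q.+1) :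
  Num.sqrt (enorm u ^+ 2 - u 0 0 ^+ 2) = enorm (tailv u).
Proof.
rewrite enorm_sq /enorm; congr Num.sqrt.
rewrite !dotv_sq [in LHS]big_ord_recl [in RHS]big_ord_recl [tailv _ ord0 0]mxE eqxx expr0n add0r.
rewrite addrAC subrr add0r; apply: eq_bigr => j _.
by rewrite [tailv _ _ _]mxE.
Qed.

Section Product.
Context {R : realType} {dT : measure_display} {T : measurableType dT}.
Variable P : probability T R.

Lemma ae_product_fst (Q : T -> Prop) : {ae P, forall t, Q t} ->
  {ae (P \x normal_prob (0 : R) 1)%E, forall z, Q z.1}.
Proof.
move=> [N [mN N0 QN]]; exists (fst @^-1` N); split.
- by rewrite -[X in measurable X]setTI; exact: measurable_fst.
- by rewrite product_fst.
- by move=> z hz; exact: QN.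
Qed.

Lemma ae_probability_one (A : set T) : measurable A -> P A = 1%E -> {ae P, forall t, A t}.
Proof.
move=> mA PA; exists (~` A); split => //; first exact: measurableC.
by rewrite probability_setC// PA subee.
Qed.

Lemma ae_inhabited (Q : T -> Prop) : {ae P, forall t, Q t} -> exists t, Q t.
Proof.
move=> [N [mN N0 QN]]; apply: contrapT => nQ.
have : P setT = 0%E.
  by apply: (subset_measure0 _ mN _ N0) => // t _; apply: QN => Qt; apply: nQ; exists t.
have -> : P setT = 1%E by exact: probability_setT.
by move=> /eqP; rewrite onee_eq0.
Qed.

End Product.

(** * The law of the score and its independence of the index *)

Section Scores.
Context {R : realType}.
Variables (n q : nat) (tau : R) (Sigma S : 'M[R]_q.+1).
Variables (loss : R -> R -> R) (g : 'cV[R]_q.+1 -> R) (F : R * R -> R).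
Hypotheses (tau0 : 0 < tau).
Hypotheses (uH : sqrtmx Sigma \in unitmx).
Hypothesis cg : convexf g.
Hypothesis g0 : forall b, g 0 <= g b.
Hypothesis mg : strongly_monotone_subdifferential Sigma tau g.
Hypothesis gl : forall s, good_loss (loss (F s)).
Hypothesis ml : forall u, measurable_fun setT (fun s => loss (F s) u).
Notation J := ('I_n * option 'I_q.+1)%type.
Context dT (T : measurableType dT) (P : probability T R).
Variable D : T -> data R J.
Hypothesis mD : measurable_fun setT D.
Hypothesis iD : forall A : J -> set R, (forall j, measurable (A j)) ->
  P (D @^-1` box A) = (\prod_j P ((fun t => crd j (D t)) @^-1` A j))%E.
Variable i : 'I_n.
Hypothesis hform : forall a : 'cV[R]_q.+1, dotv a a = 1 -> forall A, measurable A ->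
  P ((fun t => \sum_l a l 0 * crd (i, Some l) (D t)) @^-1` A) = normal_prob 0 1 A.
Notation P' := (P \x normal_prob (0 : R) 1)%E.
Notation Z := (zscore S loss g F D i).

Let mZ : measurable_fun setT Z.
Proof. exact: (measurable_zscore S tau0 uH cg g0 mg gl ml mD i). Qed.

Let zlaw := zscore_law S tau0 uH cg g0 mg gl ml mD iD hform.

Let mphi (B : set R) : measurable B -> measurable_fun setT (fun x : R => (\1_B x)%:E : \bar R).
Proof. by move=> mB; apply/measurable_EFinP; exact: measurable_indic. Qed.

Let phi_int (B : set R) : measurable B ->
  (\int[normal_prob (0 : R) 1]_x (\1_B x)%:E = normal_prob (0 : R) 1 B)%E.
Proof. by move=> mB; rewrite integral_indic// setIT. Qed.

Let mZB (B : set R) : measurable B -> measurable (Z @^-1` B).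
Proof. by move=> mB; rewrite -[X in measurable X]setTI; exact: mZ. Qed.

Let phi_ge0 (B : set R) (x : R) : (0 <= (\1_B x)%:E :> \bar R)%E. Proof. by rewrite lee_fin. Qed.

Lemma zscore_normal : has_law P' Z (normal_prob 0 1).
Proof.
move=> B mB; have := zlaw (W := fun=> 1%E) (phi := fun x => (\1_B x)%:E) (fun _ _ => erefl)
  (measurable_cst _) (mphi mB) (fun=> lee01) (phi_ge0 B).
rewrite phi_int// (integral_cst P' measurableT 1%E) mul1e [X in (X * _)%E](_ : _ = 1%E); last exact: probability_setT.
rewrite mul1e => <-; under eq_integral do rewrite mul1e.
have -> : (fun z => (\1_B (Z z))%:E) = (fun z => (\1_(Z @^-1` B) z)%:E) :> (_ -> \bar R).
  by apply/funext => z; rewrite !indicE.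
by rewrite integral_indic ?setIT//; exact: mZB.
Qed.

(** The index lies outside the erased block, so indicators of events of the index are admissible
    weights in [zscore_law]. *)
Lemma index_zscore_independent :
  independent2 P' (fun z => crd (i, Some ord0) (D z.1)) Z.
Proof.
move=> A B mA mB; set U := fun z : T * R => crd (i, Some ord0) (D z.1).
have mU : measurable_fun setT U.
  exact: (measurableT_comp (measurableT_comp (measurable_crd _) mD) measurable_fst).
have mUA : measurable (U @^-1` A) by rewrite -[X in measurable X]setTI; exact: mU.
have mW : measurable_fun setT (fun d : data R J => (\1_A (crd (i, Some ord0) d))%:E : \bar R).
  exact: (measurableT_comp (mphi mA) (measurable_crd _)).
have hW d d' : (\1_A (crd ((i, Some ord0) : J) (mix (zblock i) d d')))%:E = (\1_A (crd ((i, Some ord0) : J) d))%:E :> \bar R.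
  by rewrite crd_mkd /zblock/= eqxx andbF.
have := zlaw (W := fun d => (\1_A (crd (i, Some ord0) d))%:E) (phi := fun x => (\1_B x)%:E) hW mW (mphi mB)
  (fun d => phi_ge0 A _) (phi_ge0 B).
rewrite phi_int// -(zscore_normal mB).
have -> : (\int[P']_z (\1_A (crd (i, Some ord0) (D z.1)))%:E = P' (U @^-1` A))%E.
  rewrite (measure_indic P' mUA).
  by apply: eq_integral => z _; rewrite !indicE.
have mI : measurable (U @^-1` A `&` Z @^-1` B) by apply: measurableI => //; exact: mZB.
move=> <-.
rewrite (measure_indic P' mI).
by apply: eq_integral => z _; rewrite -EFinM !indicE in_setI -natrM mulnb.
Qed.

End Scores.

(** * Assembly on the product with a Gaussian space *)

Theorem theorem4p3 (R : realType) (delta tau : R)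
    (delta_gt0 : 0 < delta) (tau_gt0 : 0 < tau) :
  exists C : R,
  forall (kappa : R) (n p : nat)
    (d : measure_display) (T : measurableType d) (P : probability T R)
    (Sigma : 'M[R]_p) (w : 'cV[R]_p) (F : R * R -> R)
    (x : 'I_n -> {RV P >-> p.-tuple R}) (xi : 'I_n -> {RV P >-> R})
    (y : 'I_n -> T -> R)
    (Y : set R) (loss : R -> R -> R) (g : 'cV[R]_p -> R)
    (Ahat : T -> 'M[R]_p),
  1 <= kappa ->
  single_index_model Sigma w F x xi y ->
  measurable Y ->
  (forall i, P (y i @^-1` Y) = 1%E) ->
  (2 * delta)^-1 <= p%:R / n%:R <= delta^-1 ->
  psdmx Sigma -> Sigma \in unitmx ->
  opnorm Sigma * opnorm (invmx Sigma) <= kappa ->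
  dotv w (Sigma *m w) = 1 ->
  convexf g ->
  regular_loss Y loss ->
  (forall b, g 0 <= g b) ->
  strongly_monotone_subdifferential Sigma tau g ->
  (forall i, {ae P, forall t, derive1 (loss (y i t)) 0 <> 0}) ->
  (forall j k, measurable_fun setT (fun t => Ahat t j k)) ->
  {ae P, forall t,
     is_Ahat loss g Sigma tau (fun i => y i t) (design x t) (Ahat t)} ->
  let beta t := bhat loss g (fun i => y i t) (design x t) in
  let r t := rhat loss g (fun i => y i t) (design x t) in
  let a t := dotv w (Sigma *m beta t) in
  let sigma t : R := Num.sqrt (enorm (sqrtmx Sigma *m beta t) ^+ 2 - a t ^+ 2) in
  let gamma t := \tr (Sigma *m Ahat t) in
  let U i t := dotv (col_of_tuple (x i t)) w in
  (* the Z_i live on an extension (T', P') of (T, P) *)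
  exists (d' : measure_display) (T' : measurableType d')
    (P' : probability T' R) (ext : {RV P' >-> T})
    (Z : 'I_n -> {RV P' >-> R}),
    [/\ has_law P' ext P,
        forall i,
          [/\ has_law P' (U i \o ext) (normal_prob 0 1),
              has_law P' (Z i) (normal_prob 0 1) &
              independent2 P' (U i \o ext) (Z i)] &
        (\big[maxe/-oo]_(i < n)
           'E_P'[fun t' => let t := ext t' in
              ((r t ^+ 2)^-1
              * `|dotv (col_of_tuple (x i t)) (beta t)
                  - prox (fun v => gamma t * loss (y i t) v)
                      (a t * U i t + sigma t * Z i t')| ^+ 2)%R]
         <= (C / n%:R)%:E)%E].
Proof.
(* [8] is the power of the operator norm in [wrow_full]; [16] and [4] are the powers of [kapd] and
   of [1 + Z^2] in [Xd_expectation]. *)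
have [Cop Cop0 hop] := opnorm_moment 8 delta_gt0.
have di0 : 0 <= delta^-1 by rewrite invr_ge0 ltW.
have [C16 C161 h16] := gaussian_moment 16 di0.
have [C4 C41 h4] := gaussian_moment 4 (@ler01 R).
exists (rate_const delta tau Cop C16 C4).
move=> kappa n [|q] d T P Sigma w F x xi y Y loss g Ahat _ model mY PY /andP[pn1 pn2] psd uSig _ ww cg rl g0 mg l0 _ hA.
  (* In dimension [0] the normalization of [w] is impossible. *)
  by exfalso; move: ww; rewrite dotvE big_ord0 => /esym/eqP; rewrite oner_eq0.
move=> beta r a sigma gamma U.
have n0 : (0 < n)%N.
  (* For [n = 0] the quotient [p / n] is [0] by convention, against its positive lower bound. *)
  rewrite lt0n; apply/eqP => n0; move: pn1; rewrite n0 invr0 mulr0 invr_le0.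
  by rewrite leNgt mulr_gt0.
have N0 : 0 < (n%:R : R) by rewrite ltr0n.
have pn : q.+1%:R <= n%:R / delta :> R by rewrite mulrC -ler_pdivrMr.
have [S [uS SS Sw Snorm Sop]] := whitening psd uSig ww.
have uH := sqrtmx_unit psd uSig.
have [_ _ _ mF yE] := model.
pose D := model_data S x xi.
have mD : measurable_fun setT D by exact: measurable_model_data.
have iD := model_independent model uS SS.
have lD := model_marginal model uS SS.
have sD := model_exchangeable model uS SS.
have Dy t k : y k t = F (yd (D t) k) by exact: (model_response model uS Sw).
have hG : {ae P, forall t, forall k, good_response Y loss (y k t)}.
  apply: filter_forall => k; apply: filterS2 (l0 k) _ => [t h1 h2|]; first by split; [exact: h2|exact: h1].
  apply: (ae_probability_one (A := y k @^-1` Y)) => //.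
  rewrite (_ : y k = fun t => F (yd (D t) k)); last by apply/funext => t; exact: Dy.
  rewrite -[X in measurable X]setTI.
  by apply: (measurableT_comp mF (measurableT_comp (measurable_yd k) mD)).
have [y1 gy1] : exists y1, good_response Y loss y1.
  by have [t ht] := ae_inhabited hG; exists (y (Ordinal n0) t).
(* The deterministic bounds require a regular loss at every response, so the responses are altered
   on a null event; [F'] and [F] agree almost surely on the data. *)
pose F' := repair Y loss y1 \o F.
have gl s : good_loss (loss (F' s)) by exact: (regular_good_loss rl (repair_good gy1 (F s)).1).
have l0' s : derive1 (loss (F' s)) 0 <> 0 by exact: (repair_good gy1 (F s)).2.
have ml u : measurable_fun setT (fun s => loss (F' s) u).
  exact: (measurableT_comp (measurable_repair_loss mY rl y1 u) mF).
have hE : {ae P, forall t, F' \o yd (D t) = (fun k => y k t)}.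
  by apply: filterS hG => t ht; apply/funext => k; rewrite /F'/= -Dy repairE.
have GX t : Gd (D t) *m S^T = design x t by exact: Gd_model_data.
have hA' : {ae P, forall t, is_Ahat loss g Sigma tau (F' \o yd (D t)) (Gd (D t) *m S^T) (Ahat t)}.
  by apply: filterS2 hA hE => t h ->; rewrite GX.
have form i := model_form model uS SS i.
have mZ i := measurable_zscore S tau_gt0 uH cg g0 mg gl ml mD i.
(* One extra Gaussian variable serves all rows, since nothing is claimed about the joint law of the
   [Z i]. *)
pose P' := Probability.clone _ _ _ (P \x normal_prob (0 : R) 1)%E _.
have mD' : measurable_fun setT (fun z : T * measurableTypeR R => D z.1) by exact: (measurableT_comp mD measurable_fst).
have pD j B : measurable B ->
    P' ((fun z => crd j (D z.1)) @^-1` B) = P ((fun t => crd j (D t)) @^-1` B).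
  move=> mB; rewrite -(product_fst P)//.
  rewrite -[X in measurable X]setTI; apply: (measurableT_comp (measurable_crd j) mD) => //.
have iD' B : (forall j, measurable (B j)) -> P' ((fun z => D z.1) @^-1` box B) =
    (\prod_j P' ((fun z => crd j (D z.1)) @^-1` B j))%E.
  move=> mB; transitivity (P (D @^-1` box B)).
    rewrite -(product_fst P)//; rewrite -[X in measurable X]setTI.
    by apply: mD => //; exact: measurable_box.
  by rewrite iD//; apply: eq_bigr => j _; rewrite pD.
have lD' k l B : measurable B -> P' ((fun z => crd (k, Some l) (D z.1)) @^-1` B) = normal_prob 0 1 B.
  by move=> mB; rewrite pD// lD.
have sD' k k' o B : measurable B -> P' ((fun z => crd (k, o) (D z.1)) @^-1` B) =
    P' ((fun z => crd (k', o) (D z.1)) @^-1` B).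
  by move=> mB; rewrite !pD//; exact: sD.
have hA2 := ae_product_fst hA'; have hE2 := ae_product_fst hE.
pose ext : {RV P' >-> T} := HB.pack (fst : T * measurableTypeR R -> T)
  (isMeasurableFun.Build _ _ _ _ (fst : T * measurableTypeR R -> T) measurable_fst).
have mZ' i : measurable_fun (setT : set (T * measurableTypeR R))
  (zscore S loss g F' D i : T * measurableTypeR R -> R) by exact: mZ.
pose Z i : {RV P' >-> R} := HB.pack (zscore S loss g F' D i : T * measurableTypeR R -> R)
  (isMeasurableFun.Build _ _ _ _ (zscore S loss g F' D i : T * measurableTypeR R -> R) (mZ' i)).
have UE i t : U i t = crd (i, Some ord0) (D t).
  by rewrite /U -(Gd_index x xi uS Sw) mxE.
have UF i : U i \o ext = (fun z => crd (i, Some ord0) (D z.1)) by apply/funext => z; exact: UE.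
exists _, (T * measurableTypeR R)%type, P', ext, Z; split.
- by move=> B mB; exact: product_fst.
- move=> i; rewrite UF; split.
  + by move=> B mB; exact: lD'.
  + exact: (zscore_normal S tau_gt0 uH cg g0 mg gl ml mD iD (form i)).
  + exact: (index_zscore_independent S tau_gt0 uH cg g0 mg gl ml mD iD (form i)).
- apply: bigmax_le => [|i _]; first by rewrite leNye.
  rewrite unlock.
  have hop' (G : 'M[R]_(n, q.+1)) := hop n q.+1 G n0 isT pn.
  have Zl := zscore_law S tau_gt0 uH cg g0 mg gl ml mD iD (form i).
  have Zs := zscoreE S loss g F' D i.
  apply: (row_expectation tau_gt0 delta_gt0 n0 pn uH Snorm SS Sop cg g0 mg gl l0' ml mD' iD' lD' sD'
    Cop0 hop' C161 h16 h4 (mZ' i) Zl Zs hA2) => [z|].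
    by rewrite mulr_ge0// ?exprn_ge0// invr_ge0 sqr_ge0.
  apply: filterS hE2 => z hz; rewrite le_eqVlt; apply/orP; left; apply/eqP.
  rewrite -[ext z]/(z.1) -[Z i z]/(zscore S loss g F' D i z) /= /row_error.
  set t := z.1 in hz *.
  have eB : Bw S loss g F' (yd (D t)) (Gd (D t)) = S^T *m beta t by rewrite BwE hz GX.
  have ep : psiw S loss g F' (yd (D t)) (Gd (D t)) = psihat loss g (fun k => y k t) (design x t).
    by rewrite psiwE hz GX.
  have er : (r t ^+ 2)^-1 = n%:R / dotv (psihat loss g (fun k => y k t) (design x t)) (psihat loss g (fun k => y k t) (design x t)).
    exact: rms_inv_sq.
  have ex : dotv (col_of_tuple (x i t)) (beta t) = (Gd (D t) *m (S^T *m beta t)) i 0.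
    by rewrite mulmxA GX dotvE mxE; apply: eq_bigr => j _; rewrite !mxE.
  have ea : a t = (S^T *m beta t) 0 0 by rewrite /a -SS -mulmxA dotv_mulmx Sw dotv_delta.
  have es : sigma t = enorm (tailv (S^T *m beta t)).
    rewrite /sigma -Snorm ea; exact: enorm_tail_sqrt.
  have eU : U i t = Gd (D t) i 0 by rewrite UE mxE.
  have ey : F' (yd (D t) i) = y i t by exact: (congr1 (fun f => f i) hz).
  by rewrite ep eB er ex ea es eU ey -normrX ger0_norm ?sqr_ge0.
Qed.
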